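(* Let $d=1$ and $\omega>0$. Let $\alpha,\beta\in W^{1,\infty}(\mathbb{R})$ be real-valued functions such that, for some constants $\alpha_{\min},\beta_{\min},\alpha_0,\beta_0>0$ and some open bounded interval $\Omega_{in}\subset\mathbb{R}$, one has $\alpha(x)\ge\alpha_{\min}$ and $\beta(x)\ge\beta_{\min}$ for all $x\in\mathbb{R}$, and $\alpha(x)=\alpha_0$, $\beta(x)=\beta_0$ for all $x\in\mathbb{R}\setminus\Omega_{in}$. Let $F\in L^2(\mathbb{R})$ be complex-valued with $\operatorname{supp}F\subset\Omega_{in}$. Let $U$ be the solution of $$-\omega^2U(x)-\beta^{-1}(x)\,\partial_x(\alpha(x)\,\partial_xU(x))=F(x),\quad x\in\mathbb{R},\qquad \lim_{|x|\to\infty}\left[\partial_{|x|}U(x)-i\omega\sqrt{\beta_0/\alpha_0}\,U(x)\right]=0,$$ and let $u$ be the solution of $$\partial_t^2u(x,t)-\beta^{-1}(x)\,\partial_x(\alpha(x)\,\partial_xu(x,t))=e^{-i\omega t}F(x),\quad x\in\mathbb{R},\ t>0,\qquad u(x,0)=0,\ \partial_tu(x,0)=0,\quad x\in\mathbb{R}.$$ Define the constant $$U_\infty:=\frac{1}{2i\omega\sqrt{\alpha_0\beta_0}}\int_{\Omega_{in}}F(x)\beta(x)\,dx.$$ Then there exists a constant $\Lambda>0$ depending on $\alpha,\beta$ and, for every bounded domain $\Omega\subset\mathbb{R}$, a constant $C>0$ depending on $F,\alpha,\beta,\omega$ and $\Omega$, such that $$\|u(\cdot,t)-e^{-i\omega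 t}U-U_\infty\|_{H^1(\Omega)}+\|\partial_tu(\cdot,t)+i\omega e^{-i\omega t}U\|_{L^2(\Omega)}\le Ce^{-\Lambda t},\qquad t\ge0.$$
   Context: In one dimension $\partial_{|x|}=(\operatorname{sgn}x)\,\partial_x$. Solutions are understood in the standard sense: $U\in H^2_{\mathrm{loc}}(\mathbb{R})$ satisfies its equation almost everywhere (it is smooth outside $\overline{\Omega_{in}}$, so the radiation condition is meaningful pointwise); $u\in C([0,\infty),H^1(\mathbb{R}))\cap C^1([0,\infty),L^2(\mathbb{R}))$ is the finite-energy (weak) solution. *)

(* Defs.v *)
From HB Require Import structures.
From mathcomp Require Import all_boot all_order all_algebra.
From mathcomp Require Import all_classical all_reals all_analysis.
From mathcomp.real_closed Require Export complex.
Set Implicit Arguments.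
Unset Strict Implicit.
Unset Printing Implicit Defensive.
Import Order.TTheory GRing.Theory Num.Theory.
Import numFieldNormedType.Exports.
Local Open Scope classical_set_scope.
Local Open Scope ring_scope.
Local Open Scope complex_scope.

(* Complex-valued functions have type R -> R[i]; integrals, derivatives and
   measurability are taken on the real and imaginary parts. Elements of
   Lebesgue and Sobolev spaces are functions; the notions below are invariant
   under almost-everywhere equality. *)

Section Defs.
Context {R : realType}.
Local Notation mu := (@lebesgue_measure R).
Implicit Types (D : set R) (f g U F : R -> R[i]) (u ut : R -> R -> R[i]).

Definition re f : R -> R := fun x => complex.Re (f x).
Definition im f : R -> R := fun x => complex.Im (f x).

Definition cintegral D f : R[i] :=
  (\int[mu]_(x in D) re f x)%R +i* (\int[mu]_(x in D) im f x)%R.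

Definition cis (theta : R) : R[i] := cos theta +i* sin theta.

(* phi \in C_c^oo(D) *)
Definition test_function D (phi : R -> R) : Prop :=
  (forall n x, derivable (derive1n n phi) x 1) /\
  exists K : set R,
    [/\ compact K, K `<=` D & forall x, ~ K x -> phi x = 0].

(* g is the derivative of f in the sense of distributions on the open set D *)
Definition is_wderivR D (f g : R -> R) : Prop :=
  [/\ locally_integrable D f, locally_integrable D g &
      forall phi, test_function D phi ->
        (\int[mu]_(x in D) (f x * derive1 phi x))%R =
        - (\int[mu]_(x in D) (g x * phi x))%R].

Definition is_wderiv D f g : Prop :=
  is_wderivR D (re f) (re g) /\ is_wderivR D (im f) (im g).

Definition has_wderiv D f : Prop := exists g, is_wderiv D f g.

(* junk value 0 when f has no weak derivative on D; every use below is guarded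
   by has_wderiv or by membership in a Sobolev space *)
Definition wderiv D f : R -> R[i] := xget (cst 0) [set g | is_wderiv D f g].

Definition L2norm D f : \bar R :=
  ('N[mu]_2%:E [ (fun x => ((fun y => Normc.normc (f y)) \_ D x)%:E) ])%E.

Definition L2 D f : Prop :=
  [/\ measurable_fun D (re f), measurable_fun D (im f) &
      (L2norm D f < +oo)%E].

Definition H1 D f : Prop := [/\ L2 D f, has_wderiv D f & L2 D (wderiv D f)].

(* +oo outside the functions having a weak derivative on D *)
Definition H1norm D f : \bar R :=
  if `[< has_wderiv D f >] then
    ((L2norm D f ^+ 2 + L2norm D (wderiv D f) ^+ 2) `^ 2^-1)%E
  else +oo%E.

Definition L2loc f : Prop := forall a b : R, L2 `]a, b[ f.

Definition H2loc f : Prop :=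
  [/\ L2loc f,
      has_wderiv setT f, L2loc (wderiv setT f),
      has_wderiv setT (wderiv setT f) &
      L2loc (wderiv setT (wderiv setT f))].

Definition W1oo (f : R -> R) : Prop :=
  f \in Lfun mu +oo%E /\
  exists2 g, is_wderivR setT f g & g \in Lfun mu +oo%E.

(* supp F for a class of functions: complement of the largest open set on which
   F vanishes almost everywhere *)
Definition esupport F : set R :=
  [set x | forall V, nbhs x V -> ~ mu.-negligible (V `&` [set y | F y != 0])].

Definition medium (alpha beta : R -> R) (alpha_min beta_min alpha0 beta0 : R)
    (Omega_in : set R) : Prop :=
  [/\ [/\ 0 < alpha_min, 0 < beta_min, 0 < alpha0 & 0 < beta0],
      forall x, alpha_min <= alpha x,
      forall x, beta_min <= beta x &
      forall x, ~ Omega_in x -> alpha x = alpha0 /\ beta x = beta0].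

Definition cderivable f (x : R) : Prop :=
  derivable (re f) x 1 /\ derivable (im f) x 1.

Definition cderiv f (x : R) : R[i] := derive1 (re f) x +i* derive1 (im f) x.

(* d_{|x|} U - i k U at x *)
Definition radiation_defect (k : R) U (x : R) : R[i] :=
  (Num.sg x)%:C * cderiv U x - 'i%C * k%:C * U x.

(* U is only defined up to a null set: its pointwise derivative is that of the
   representative which is differentiable outside the closure of Omega_in *)
Definition radiating (Omega_in : set R) (k : R) U : Prop :=
  exists V : R -> R[i],
    [/\ \forall x \ae mu, U x = V x,
        forall x, ~ closure Omega_in x -> cderivable V x,
        Normc.normc (radiation_defect k V x) @[x --> +oo] --> (0 : R) &
        Normc.normc (radiation_defect k V x) @[x --> -oo] --> (0 : R)].

(* d_x (alpha d_x f) *)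
Definition flux_wderiv (alpha : R -> R) f : R -> R[i] :=
  wderiv setT (fun x => (alpha x)%:C * wderiv setT f x).

Definition helmholtz_solution (alpha beta : R -> R) (alpha0 beta0 : R)
    (Omega_in : set R) (omega : R) F U : Prop :=
  [/\ H2loc U,
      has_wderiv setT (fun x => (alpha x)%:C * wderiv setT U x),
      \forall x \ae mu,
        - (omega ^+ 2)%:C * U x - ((beta x)^-1)%:C * flux_wderiv alpha U x
        = F x &
      radiating Omega_in (omega * Num.sqrt (beta0 / alpha0)) U].

(* u \in C([0, oo), H^1) *)
Definition continuous_in_H1 u : Prop :=
  (forall t, 0 <= t -> H1 setT (u t)) /\
  forall t, 0 <= t ->
    H1norm setT (fun x => u s x - u t x)
      @[s --> within `[0, +oo[ (nbhs t)] --> 0%E.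

(* u \in C([0, oo), L^2) *)
Definition continuous_in_L2 u : Prop :=
  (forall t, 0 <= t -> L2 setT (u t)) /\
  forall t, 0 <= t ->
    L2norm setT (fun x => u s x - u t x)
      @[s --> within `[0, +oo[ (nbhs t)] --> 0%E.

(* u \in C^1([0, oo), L^2) with time derivative ut *)
Definition C1_in_L2 u ut : Prop :=
  [/\ continuous_in_L2 u, continuous_in_L2 ut &
      forall t, 0 <= t ->
        L2norm setT (fun x => ((s - t)^-1)%:C * (u s x - u t x) - ut t x)
          @[s --> within `[0, +oo[ (dnbhs t)] --> 0%E].

(* Finite-energy solution of
     d_t^2 u - beta^-1 d_x (alpha d_x u) = e^{-i omega t} F
   with zero initial data, ut being its time derivative: for every phi in
   C_c^oo(R),
     d/dt (beta ut, phi) = - (alpha d_x u, phi') + e^{-i omega t} (beta F, phi)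
   in the sense of distributions on (0, oo). *)
Definition wave_solution (alpha beta : R -> R) (omega : R) F u ut : Prop :=
  [/\ continuous_in_H1 u,
      C1_in_L2 u ut,
      \forall x \ae mu, u 0 x = 0,
      \forall x \ae mu, ut 0 x = 0 &
      forall phi, test_function setT phi ->
        is_wderiv `]0, +oo[
          (fun t => cintegral setT (fun x => (beta x * phi x)%:C * ut t x))
          (fun t =>
             - cintegral setT
                 (fun x => (alpha x * derive1 phi x)%:C * wderiv setT (u t) x)
             + cis (- (omega * t)) *
               cintegral setT (fun x => (beta x * phi x)%:C * F x))].

Definition Uinfty (alpha0 beta0 omega : R) (Omega_in : set R)
    (beta : R -> R) F : R[i] :=
  (2 * 'i%C * (omega * Num.sqrt (alpha0 * beta0))%:C)^-1 *
  cintegral Omega_in (fun x => F x * (beta x)%:C).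

End Defs.

(* Main.v *)
(** The imaginary part of a solution is the real part of the solution with data [-iF],
    so both equations may be treated as real. Integrating the wave equation once in [x]
    gives a potential [z] of the flux, [z_t = alpha u_x] and [z_x = beta u_t] minus the
    source. As source and initial data vanish outside [Omega_in], the characteristics show
    that [z = - sgn(x) Z u] there, with [Z = sqrt (alpha0 beta0)]; the radiation
    condition says the same of the time-harmonic solution. Their difference [(w, z)]
    thus solves, on a bounded interval, the source-free system [w_x = P / alpha],
    [z_x = beta Q], [z_t = P], [w_t = Q] with absorbing boundary conditions.

    If this solution is smooth in time, a Lyapunov functional (the energy plus a small
    multiple of a cross term whose weight grows exponentially in [x]) decays
    exponentially; on the homogeneous part of the medium the weights can be chosen so
    that enlarging the interval does not change the rate. Difference quotients in time
    and weak lower semicontinuity give the same decay of [P] and [Q] in general.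
    Finally [z(b) - z(a) = int beta Q] and the boundary conditions determine the limit
    of [w(a) + w(b)], which is [2 U_infty]. The constant depends on [U] only through its
    data because two time-harmonic solutions would both be limits of the same [u]. *)
Require Import Defs.
From HB Require Import structures.
From mathcomp Require Import all_boot all_order all_algebra.
From mathcomp Require Import all_classical all_reals all_analysis.
From mathcomp Require Import measurable_realfun ring lra.
Set Implicit Arguments.
Unset Strict Implicit.
Unset Printing Implicit Defensive.
Import Order.TTheory GRing.Theory Num.Theory.
Import numFieldNormedType.Exports.
Local Open Scope classical_set_scope.
Local Open Scope ring_scope.

(** * Integrals over compact intervals *)

Section Integrals.
Context {R : realType}.
Local Notation mu := (@lebesgue_measure R).
Implicit Types (f g k : R -> R) (a b x y : R).

Lemma aeS (P Q : R -> Prop) : {ae mu, forall x, P x} -> (forall x, P x -> Q x) ->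
  {ae mu, forall x, Q x}.
Proof.
by move=> aeP PQ; apply: (@filterS _ _ (ae_filter_ringOfSetsType mu) _ _ _ aeP).
Qed.

Lemma ae_and (P Q : R -> Prop) : {ae mu, forall x, P x} ->
  {ae mu, forall x, Q x} -> {ae mu, forall x, P x /\ Q x}.
Proof.
move=> aeP aeQ; exact: (@filterI _ _ (ae_filter_ringOfSetsType mu) _ _ aeP aeQ).
Qed.

Definition locint f := measurable_fun setT f /\
  forall x y, mu.-integrable `[x, y] (EFin \o f).

Definition Int f x y : R := \int[mu]_(s in `[x, y]) f s.

Lemma IntE f x y : Int f x y = \int[mu]_(s in `[x, y]) f s.
Proof. by []. Qed.

Lemma locint_int f x y : locint f -> mu.-integrable `[x, y] (EFin \o f).
Proof. by case. Qed.

Lemma locint_cont f : continuous f -> locint f.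
Proof.
move=> cf; split; first exact: continuous_measurable_fun.
move=> x y; apply: continuous_compact_integrable; first exact: segment_compact.
exact: continuous_subspaceT.
Qed.

Lemma locintD f g : locint f -> locint g -> locint (fun x => f x + g x).
Proof.
move=> [mf If] [mg Ig]; split; first exact: measurable_funD.
by move=> x y; apply: (integrableD _ (If x y) (Ig x y)).
Qed.

Lemma locintZ f c : locint f -> locint (fun x => c * f x).
Proof.
move=> [mf If]; split; first exact: measurable_funM.
by move=> x y; apply: (integrableZl _ c (If x y)).
Qed.

Lemma locintN f : locint f -> locint (fun x => - f x).
Proof.
move=> lf; have := locintZ (-1) lf.
by rewrite (_ : (fun x => -1 * f x) = (fun x => - f x))//; apply/funext => x; rewrite mulN1r.
Qed.

Lemma locintB f g : locint f -> locint g -> locint (fun x => f x - g x).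
Proof. by move=> lf lg; apply: locintD => //; exact: locintN. Qed.

Lemma locint_norm f : locint f -> locint (fun x => `|f x|).
Proof.
move=> [mf If]; split; first exact: measurableT_comp.
by move=> x y; apply: (integrable_norm (If x y)).
Qed.

Lemma locintMl k f : measurable_fun setT k ->
  (forall x y, exists M : R, forall s, x <= s <= y -> `|k s| <= M) ->
  locint f -> locint (fun x => k x * f x).
Proof.
move=> mk kb [mf If]; split; first exact: measurable_funM.
move=> x y.
have kb' : [bounded k s | s in `[x, y]].
  have [M hM] := kb x y.
  exists M; split; first exact: num_real.
  by move=> N MN s /=; rewrite in_itv/= => /hM /le_trans -> //; exact: ltW.
rewrite (_ : EFin \o _ = ((EFin \o k) \* (EFin \o f))%E); last by apply/funext => s.
apply: (@integrableMr _ _ _ mu) => //; first exact: measurable_funTS.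
Qed.

Lemma cont_bounded k : continuous k ->
  forall x y, exists M : R, forall s, x <= s <= y -> `|k s| <= M.
Proof.
move=> ck x y; have [xy|yx] := leP x y; last first.
  by exists 0 => s /andP[xs sy]; move: yx; rewrite ltNge (le_trans xs sy).
have ckn : {within `[x, y], continuous (fun s => `|k s|)}.
  apply: continuous_subspaceT => s.
  by apply: continuous_comp; [exact: ck|exact: norm_continuous].
have [c _ cM] := EVT_max xy ckn.
by exists `|k c| => s sxy; apply: cM; rewrite in_itv.
Qed.

Lemma locintM k f : continuous k -> locint f -> locint (fun x => k x * f x).
Proof.
by move=> ck; apply: locintMl; [exact: continuous_measurable_fun|exact: cont_bounded].
Qed.

Lemma locint_cst c : locint (fun=> c).
Proof. by apply: locint_cont => x; exact: cvg_cst. Qed.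

Lemma IntD f g x y : locint f -> locint g ->
  Int (fun s => f s + g s) x y = Int f x y + Int g x y.
Proof. by move=> [_ fi] [_ gi]; rewrite /Int RintegralD. Qed.

Lemma IntZ f c x y : locint f -> Int (fun s => c * f s) x y = c * Int f x y.
Proof. by move=> [_ fi]; rewrite /Int RintegralZl. Qed.

Lemma IntN f x y : locint f -> Int (fun s => - f s) x y = - Int f x y.
Proof.
move=> lf; rewrite -mulN1r -IntZ//; congr Int.
by apply/funext => s; rewrite mulN1r.
Qed.

Lemma IntB f g x y : locint f -> locint g ->
  Int (fun s => f s - g s) x y = Int f x y - Int g x y.
Proof. by move=> [_ fi] [_ gi]; rewrite /Int RintegralB. Qed.

Lemma eq_Int f g x y : (forall s, x <= s <= y -> f s = g s) ->
  Int f x y = Int g x y.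
Proof.
move=> fg; apply: eq_Rintegral => s; rewrite inE/= in_itv/=; exact: fg.
Qed.

Lemma Int_ge f x y : y <= x -> Int f x y = 0.
Proof.
rewrite le_eqVlt => /predU1P[->|yx]; first by rewrite /Int set_itv1 Rintegral_set1.
by rewrite /Int set_itv_ge ?Rintegral_set0// bnd_simp -ltNge.
Qed.

Lemma Int_cst c x y : x <= y -> Int (fun=> c) x y = c * (y - x).
Proof.
move=> xy; rewrite /Int Rintegral_cst//= lebesgue_measure_itv/= lte_fin.
by case: ltgtP xy => // ->; rewrite subrr.
Qed.

Lemma le_Int f g x y : locint f -> locint g ->
  (forall s, x <= s <= y -> f s <= g s) -> Int f x y <= Int g x y.
Proof.
move=> [_ fi] [_ gi] fg; exact: le_Rintegral.
Qed.

Lemma Int_ge0 f x y : (forall s, x <= s <= y -> 0 <= f s) -> 0 <= Int f x y.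
Proof. by move=> f0; apply: Rintegral_ge0 => s /=; rewrite in_itv/=; exact: f0. Qed.

Lemma Int_norm f x y : locint f -> `|Int f x y| <= Int (fun s => `|f s|) x y.
Proof. by move=> [_ fi]; apply: le_normr_Rintegral. Qed.

Lemma Int_cat f x y z : locint f -> x <= y -> y <= z ->
  Int f x z = Int f x y + Int f y z.
Proof.
move=> lf xy yz; rewrite /Int.
have := @Rintegral_itvB _ f (BLeft x) (BRight z) y (locint_int x z lf).
rewrite !bnd_simp => /(_ xy yz) /eqP; rewrite subr_eq => /eqP ->.
rewrite addrC; congr (_ + _); apply: Rintegral_itv_obnd_cbnd.
by apply: integrableS (locint_int y z lf) => //; exact: subset_itv_oc_cc.
Qed.

Lemma Int_ae f g x y : locint f -> locint g ->
  {ae mu, forall s, f s = g s} -> Int f x y = Int g x y.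
Proof.
move=> [mf fi] [mg gi] fg; congr fine; apply: ae_eq_integral => //.
- by case/integrableP: (fi x y).
- by case/integrableP: (gi x y).
- exact: (aeS fg (fun s E _ => congr1 EFin E)).
Qed.

Lemma Int_ae_meas f g x y : measurable_fun setT f -> measurable_fun setT g ->
  {ae mu, forall s, x <= s <= y -> f s = g s} -> Int f x y = Int g x y.
Proof.
move=> mf mg fg; congr fine; apply: ae_eq_integral => //.
- by apply/measurable_EFinP; exact: measurable_funTS.
- by apply/measurable_EFinP; exact: measurable_funTS.
- by apply: (aeS fg) => s E; rewrite /= in_itv/= => /E ->.
Qed.

Lemma locint_ae f g : measurable_fun setT f -> locint g ->
  {ae mu, forall s, f s = g s} -> locint f.
Proof.
move=> mf [mg lg] fg; split=> // x y; apply/integrableP; split.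
  by apply/measurable_EFinP; exact: measurable_funTS.
have /integrableP[_] := lg x y; congr (_ < _)%E; apply: ae_eq_integral => //.
- by apply/measurable_EFinP; apply: measurableT_comp => //; exact: measurable_funTS.
- by apply/measurable_EFinP; apply: measurableT_comp => //; exact: measurable_funTS.
- exact: (aeS fg (fun s E _ => congr1 (fun r => `|r%:E|%E) (esym E))).
Qed.

Lemma Int_norm_le f x y M : locint f -> x <= y ->
  (forall s, x <= s <= y -> `|f s| <= M) -> `|Int f x y| <= M * (y - x).
Proof.
move=> lf xy fM; apply: (le_trans (Int_norm x y lf)).
by rewrite -Int_cst//; apply: le_Int => //; [exact: locint_norm|exact: locint_cst].
Qed.

Definition prim f x : R := Int f 0 x - Int f x 0.

Lemma primB f x y : locint f -> x <= y -> prim f y - prim f x = Int f x y.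
Proof.
move=> lf xy; rewrite /prim.
have [x0|x0] := leP 0 x.
  have y0 := le_trans x0 xy.
  by rewrite (Int_ge f y0) (Int_ge f x0) (Int_cat lf x0 xy); ring.
have [y0|y0] := leP 0 y.
  rewrite (Int_ge f y0) (Int_ge f (ltW x0)) (Int_cat lf (ltW x0) y0); ring.
by rewrite (Int_ge f (ltW y0)) (Int_ge f (ltW x0)) (Int_cat lf xy (ltW y0)); ring.
Qed.

Lemma prim0 f : prim f 0 = 0.
Proof. by rewrite /prim subrr. Qed.

Lemma primE f x : 0 <= x -> prim f x = Int f 0 x.
Proof. by move=> x0; rewrite /prim (Int_ge f x0) subr0. Qed.

(* Telescoping over a fine partition. *)
Lemma mono_local f (m : R -> R) a b : a <= b ->
  (forall e : R, 0 < e -> exists2 d : R, 0 < d & forall x y, a <= x -> x <= y -> y <= b ->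
     y - x < d -> f y - f x <= e * (m y - m x)) -> f b <= f a.
Proof.
move=> ab H; rewrite leNgt; apply/negP => fab.
have H1 e : 0 < e -> f b - f a <= e * (m b - m a).
  move=> e0; have [d d0 Hd] := H e e0.
  pose n := (Num.truncn ((b - a) / d)).+1.
  have n0 : (0 : R) < n%:R by rewrite ltr0n.
  have nd : (b - a) / n%:R < d.
    by rewrite ltr_pdivrMr// mulrC -ltr_pdivrMr//; exact: truncnS_gt.
  pose p (i : nat) : R := a + i%:R * ((b - a) / n%:R).
  have st0 : 0 <= (b - a) / n%:R by rewrite divr_ge0 ?subr_ge0// ltW.
  have Hp (i : nat) : (i <= n)%N -> f (p i) - f a <= e * (m (p i) - m a).
    elim: i => [|i IH] ile; first by rewrite /p mul0r addr0 !subrr mulr0.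
    have step : f (p i.+1) - f (p i) <= e * (m (p i.+1) - m (p i)).
      have pE : p i.+1 = p i + (b - a) / n%:R by rewrite /p -natr1; ring.
      apply: Hd.
      - by rewrite /p lerDl mulr_ge0.
      - by rewrite pE lerDl.
      - rewrite /p -lerBrDl mulrCA ler_piMr ?subr_ge0//.
        by rewrite ler_pdivrMr// mul1r ler_nat.
      - by rewrite pE addrC addKr.
    have := IH (ltnW ile); rewrite !mulrBr in step *; lra.
  have := Hp n (leqnn n); rewrite (_ : p n = b)// /p.
  by field; rewrite gt_eqF.
have [mm|mm] := leP (m b - m a) 0.
  have := H1 1 ltr01; lra.
have := H1 ((f b - f a) / (2 * (m b - m a))).
have fab' : 0 < f b - f a by lra.
rewrite divr_gt0// ?mulr_gt0// => /(_ erefl).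
rewrite (_ : _ / _ * _ = (f b - f a) / 2); last by field; rewrite gt_eqF.
lra.
Qed.

Lemma eq_local f (m : R -> R) a b : a <= b ->
  (forall e : R, 0 < e -> exists2 d : R, 0 < d & forall x y, a <= x -> x <= y -> y <= b ->
     y - x < d -> `|f y - f x| <= e * (m y - m x)) -> f b = f a.
Proof.
move=> ab H; apply/eqP; rewrite eq_le; apply/andP; split.
  apply: (mono_local (m := m) ab) => e /H[d d0 Hd]; exists d => // x y ax xy yb yx.
  by apply: le_trans (Hd x y ax xy yb yx); exact: ler_norm.
rewrite -lerN2; apply: (mono_local (f := fun x => - f x) (m := m) ab) => e /H[d d0 Hd].
exists d => // x y ax xy yb yx.
apply: le_trans (Hd x y ax xy yb yx).
by rewrite -opprD -normrN; exact: ler_norm.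
Qed.

Lemma heine (N : R -> R -> R) a b :
  (forall s t, N s t = N t s) -> (forall r s t, N r t <= N r s + N s t) ->
  (forall t, a <= t <= b -> forall e : R, 0 < e -> exists2 d : R, 0 < d &
     forall s, a <= s <= b -> `|s - t| < d -> N s t <= e) ->
  forall e : R, 0 < e -> exists2 d : R, 0 < d &
    forall s t, a <= s <= b -> a <= t <= b -> `|s - t| < d -> N s t <= e.
Proof.
move=> Nsym Ntri Nc e e0.
have /compact_near_coveringP/near_covering_withinP := @segment_compact R a b.
move=> /(_ _ (0 : R)^'+ (fun d t => forall s, a <= s <= b -> `|s - t| < d -> N s t <= e)).
case.
  move=> t /= tab; rewrite in_itv/= in tab.
  have [d d0 Hd] := Nc t tab _ (divr_gt0 e0 (@ltr0Sn R 1)).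
  exists (ball t (d / 2), [set d' | d' < d / 2]) => /=.
    split; first by apply: nbhsx_ballx; rewrite divr_gt0.
    by apply: nbhs_right_lt; rewrite divr_gt0.
  move=> [t' d'] /= [tt' dd'] t'ab s sab sd.
  rewrite in_itv/= in t'ab.
  rewrite /ball/= in tt'.
  apply: le_trans (Ntri s t t') _; rewrite (Nsym t t').
  rewrite (splitr e); apply: lerD; apply: Hd => //.
    rewrite (_ : s - t = (s - t') + (t' - t)); last by ring.
    by apply: le_lt_trans (ler_normD _ _) _; move: tt'; rewrite distrC; lra.
  by move: tt'; rewrite distrC; lra.
move=> d /= d0 Hd; exists (d / 2); first by rewrite divr_gt0.
move=> s t sab tab st.
apply: (Hd (d / 2)) => //.
- by rewrite /ball_/= sub0r normrN gtr0_norm ?divr_gt0//; lra.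
- by rewrite divr_gt0.
Qed.

Lemma cont_unif f a b : continuous f -> forall e : R, 0 < e -> exists2 d : R, 0 < d &
    forall s t, a <= s <= b -> a <= t <= b -> `|s - t| < d -> `|f s - f t| <= e.
Proof.
move=> cf; apply: heine.
- by move=> s t; rewrite distrC.
- by move=> r s t; exact: ler_distD.
move=> t _ e e0; have /cvgrPdist_le/(_ e e0) := cf t.
move=> [d /= d0 Hd]; exists d => // s _ st; rewrite distrC; apply: Hd.
by rewrite /ball/= distrC.
Qed.

Lemma cont_ed f : (forall t e : R, 0 < e -> exists2 d : R, 0 < d &
     forall s, `|s - t| < d -> `|f s - f t| <= e) -> continuous f.
Proof.
move=> H t; apply/cvgrPdist_le => e e0; have [d d0 Hd] := H t e e0.
by exists d => //= s st; rewrite distrC; apply: Hd; rewrite distrC.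
Qed.

Lemma le_Int_itv f x y x' y' : locint f -> (forall s, 0 <= f s) ->
  x' <= x -> x <= y -> y <= y' -> Int f x y <= Int f x' y'.
Proof.
move=> lf f0 xx xy yy.
rewrite (Int_cat lf xx (le_trans xy yy)) (Int_cat lf xy yy).
have := Int_ge0 (x := x') (y := x) (fun s _ => f0 s).
have := Int_ge0 (x := y) (y := y') (fun s _ => f0 s).
lra.
Qed.

Lemma Int_oo f x y : locint f ->
  \int[mu]_(s in `]x, y[) f s = Int f x y.
Proof.
move=> lf; have H (b1 b2 : bool) : mu.-integrable [set` Interval (BSide b1 x) (BSide b2 y)] (EFin \o f).
  apply: integrableS (locint_int x y lf) => // u; rewrite /= !in_itv/=.
  by case: b1; case: b2 => /= /andP[h1 h2]; apply/andP; lra.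
rewrite (Rintegral_itv_bndo_bndc (H false true)).
exact: (Rintegral_itv_obnd_cbnd (H false false)).
Qed.

End Integrals.

(** * Smooth functions *)

Section Smooth.
Context {R : realType}.
Implicit Types (f g : R -> R) (x y : R).

Definition dat f x (l : R) := forall e : R, 0 < e -> exists2 d : R, 0 < d &
  forall h, `|h| < d -> `|f (x + h) - f x - h * l| <= e * `|h|.

Lemma is_derive_dat f x (l : R) : is_derive x (1 : R) f l <-> dat f x l.
Proof.
split=> [fl e e0|H].
  have /cvgrPdist_le : (fun h => h^-1 *: (f (h *: (1 : R) + x) - f x)) @ 0^' --> l.
    by case: fl => df <-; exact: df.
  move=> /(_ e e0)[d /= d0 Hd]; exists d => // h hd.
  have [->|h0] := eqVneq h 0; first by rewrite addr0 subrr mul0r subrr normr0 mulr0.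
  have := Hd h _ h0; rewrite /ball_/= sub0r normrN => /(_ hd).
  rewrite /GRing.scale/= mulr1 addrC => {}Hd.
  have -> : f (x + h) - f x - h * l = - (h * (l - h^-1 * (f (h + x) - f x))).
    by rewrite (addrC h x) mulrBr mulVKf//; ring.
  rewrite normrN normrM mulrC; apply: ler_wpM2r => //.
  by rewrite addrC.
suff cv : (fun h => h^-1 *: (f (h *: (1 : R) + x) - f x)) @ 0^' --> l.
  by split; [apply/cvg_ex; exists l|exact/cvg_lim].
apply/cvgrPdist_le => e e0; have [d d0 Hd] := H e e0.
exists d => //= h; rewrite /ball_/= sub0r normrN => hd h0.
have := Hd h hd; rewrite /GRing.scale/= mulr1 (addrC h x).
have -> : l - h^-1 * (f (x + h) - f x) = - (h^-1 * (f (x + h) - f x - h * l)).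
  by rewrite [in RHS]mulrBr mulKf//; ring.
by rewrite normrN normrM normfV ler_pdivrMl ?normr_gt0// (mulrC `|h|).
Qed.

Lemma dat_derive f x l : dat f x l -> derivable f x 1 /\ derive1 f x = l.
Proof.
move=> /is_derive_dat fl; split; first exact: ex_derive.
by rewrite derive1E; exact: derive_val.
Qed.

Lemma derive_dat f x : derivable f x 1 -> dat f x (derive1 f x).
Proof. by move=> df; apply/is_derive_dat; rewrite derive1E; exact: derivableP. Qed.

Lemma dat_near f g x l (d : R) : 0 < d -> (forall y, `|y - x| < d -> f y = g y) ->
  dat f x l -> dat g x l.
Proof.
move=> d0 fg fl e e0; have [d' d'0 H] := fl e e0.
exists (Num.min d d'); first by rewrite lt_min d0.
move=> h; rewrite lt_min => /andP[hd hd'].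
have := H h hd'; rewrite fg; last by rewrite addrC addKr.
by rewrite fg// subrr normr0.
Qed.

Lemma datD f g x l m : dat f x l -> dat g x m -> dat (fun y => f y + g y) x (l + m).
Proof. by move=> /is_derive_dat fl /is_derive_dat gm; apply/is_derive_dat; exact: is_deriveD. Qed.

Lemma datM f g x l m : dat f x l -> dat g x m ->
  dat (fun y => f y * g y) x (f x * m + g x * l).
Proof. by move=> /is_derive_dat fl /is_derive_dat gm; apply/is_derive_dat; exact: is_deriveM. Qed.

Lemma dat_cst c x : dat (fun=> c) x 0.
Proof. by apply/is_derive_dat; exact: is_derive_cst. Qed.

Lemma datZ f x l c : dat f x l -> dat (fun y => c * f y) x (c * l).
Proof.
move=> fl; have := datM (dat_cst c x) fl.
by rewrite mulr0 addr0.
Qed.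

Lemma dat_aff (a b x : R) : dat (fun y => a * y + b) x a.
Proof.
move=> e e0; exists 1 => // h _.
have -> : a * (x + h) + b - (a * x + b) - h * a = 0 by ring.
by rewrite normr0 mulr_ge0// ltW.
Qed.

Lemma dat_comp f g x a b : dat f (g x) a -> dat g x b ->
  dat (fun y => f (g y)) x (a * b).
Proof.
move=> /is_derive_dat fa /is_derive_dat gb; apply/is_derive_dat; exact: is_derive1_comp.
Qed.

Lemma dat_cont f x l : dat f x l -> forall e : R, 0 < e -> exists2 d : R, 0 < d &
  forall y, `|y - x| < d -> `|f y - f x| <= e.
Proof.
move=> fl e e0; have [d d0 H] := fl 1 ltr01.
have l1 : 0 < 1 + `|l| by rewrite ltr_pwDl.
exists (Num.min d (e / (1 + `|l|))); first by rewrite lt_min d0 divr_gt0.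
move=> y; rewrite lt_min => /andP[yd]; rewrite ltr_pdivlMr// => ye.
have := H (y - x) yd; rewrite (addrC x) subrK mul1r => {}H.
have -> : f y - f x = (f y - f x - (y - x) * l) + (y - x) * l by ring.
apply: le_trans (ler_normD _ _) _; rewrite normrM.
by apply: le_trans (lerD H (lexx _)) _; move: ye; rewrite mulrDr mulr1 => /ltW.
Qed.

Definition smooth f := forall n x, derivable (derive1n n f) x 1.

Lemma smooth_family (S : (R -> R) -> Prop) :
  (forall f, S f -> exists2 g, S g & forall x, dat f x (g x)) ->
  forall f, S f -> smooth f.
Proof.
move=> HS f Sf n x.
have {Sf} : S (derive1n n f).
  elim: n f Sf => [//|n IH] f Sf; rewrite derive1Sn; apply: IH.
  have [g Sg fg] := HS f Sf.
  by rewrite (_ : derive1 f = g)//; apply/funext => y; have [_] := dat_derive (fg y).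
by move=> /HS[g _ /(_ x)/dat_derive[]].
Qed.

Lemma smooth_dat f : smooth f -> forall x, dat f x (derive1 f x).
Proof. by move=> sf x; apply: derive_dat; exact: (sf 0%N x). Qed.

Lemma smooth_derive f : smooth f -> smooth (derive1 f).
Proof. by move=> sf n x; rewrite -derive1Sn; exact: sf. Qed.

Lemma smooth_cont f : smooth f -> continuous f.
Proof. by move=> sf; apply: cont_ed => x; exact: dat_cont (smooth_dat sf x). Qed.

Lemma smooth_prim f g : smooth g -> (forall x, dat f x (g x)) -> smooth f.
Proof.
move=> sg fg; apply: (@smooth_family (fun h => h = f \/ smooth h)); last by left.
move=> h [->|sh]; first by exists g => //; right.
by exists (derive1 h); [right; exact: smooth_derive|exact: smooth_dat].
Qed.

Lemma smooth_aff f a b c : smooth f -> smooth (fun x => c * f (a * x + b)).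
Proof.
move=> sf; apply: (@smooth_family
  (fun h => exists g c, smooth g /\ h = fun x => c * g (a * x + b))); last by exists f, c.
move=> h [g [k [sg ->]]]; exists (fun x => (k * a) * derive1 g (a * x + b)).
  by exists (derive1 g), (k * a); split => //; exact: smooth_derive.
move=> x; rewrite -mulrA; apply: datZ; rewrite [a * _]mulrC.
apply: (dat_comp (g := fun y => a * y + b)); last exact: dat_aff.
exact: smooth_dat.
Qed.

Lemma smoothD f g : smooth f -> smooth g -> smooth (fun x => f x + g x).
Proof.
move=> sf sg; apply: (@smooth_family
  (fun h => exists f g, [/\ smooth f, smooth g & h = fun x => f x + g x])); last by exists f, g.
move=> h [f' [g' [sf' sg' ->]]]; exists (fun x => derive1 f' x + derive1 g' x).
  by exists (derive1 f'), (derive1 g'); split; [exact: smooth_derive|exact: smooth_derive|].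
by move=> x; apply: datD; exact: smooth_dat.
Qed.

Lemma smoothZ f c : smooth f -> smooth (fun x => c * f x).
Proof.
move=> sf; have := @smooth_aff f 1 0 c sf.
by rewrite (_ : (fun x => _) = (fun x => c * f x))//; apply/funext => x; rewrite mul1r addr0.
Qed.

Lemma prim_dat f : continuous f -> forall x, dat (prim f) x (f x).
Proof.
move=> cf x e e0.
have /cvgrPdist_le/(_ e e0)[d /= d0 Hd] := cf x.
exists d => // h hd; have lf := locint_cont cf.
have key a b : a <= b -> (forall s, a <= s <= b -> `|f s - f x| <= e) ->
   `|prim f b - prim f a - (b - a) * f x| <= e * (b - a).
  move=> ab fe; rewrite primB//.
  have -> : Int f a b - (b - a) * f x = Int (fun s => f s - f x) a b.
    by rewrite IntB//; [rewrite Int_cst// mulrC|exact: locint_cst].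
  apply: Int_norm_le => //; apply: locintB => //; exact: locint_cst.
have [h0|h0] := leP 0 h.
  have := key x (x + h); rewrite lerDl h0 => /(_ erefl).
  rewrite (_ : x + h - x = h); last by ring.
  move: hd; rewrite (ger0_norm h0) => hd; apply => s /andP[xs sx].
  rewrite distrC; apply: Hd; rewrite /ball/= distrC ger0_norm ?subr_ge0//; lra.
have := key (x + h) x; rewrite gerDl (ltW h0) => /(_ erefl).
have -> : x - (x + h) = - h by ring.
move: hd; rewrite (ltr0_norm h0) => hd H.
have -> : prim f (x + h) - prim f x - h * f x =
  - (prim f x - prim f (x + h) - - h * f x) by ring.
rewrite normrN; apply: H => s /andP[xs sx].
rewrite distrC; apply: Hd; rewrite /ball/= ger0_norm ?subr_ge0//; lra.
Qed.

Lemma poly_expR_bound (p : {poly R}) (e : R) : 0 < e ->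
  exists C : R, forall y, 0 <= y -> `|p.[y]| <= C * expR (e * y).
Proof.
elim/poly_ind: p e => [|p c IH] e e0.
  by exists 0 => y _; rewrite horner0 normr0 mul0r.
have e20 : 0 < e / 2 by rewrite divr_gt0.
have [C HC] := IH _ e20.
exists (C * (2 / e) + `|c|) => y y0.
rewrite hornerMXaddC mulrDl; apply: le_trans (ler_normD _ _) _.
apply: lerD; last first.
  rewrite ler_peMr//; rewrite -expR0 ler_expR mulr_ge0// ltW//.
have -> : expR (e * y) = expR (e / 2 * y) * expR (e / 2 * y).
  by rewrite -expRD; congr expR; field.
rewrite normrM (ger0_norm y0).
have yb : y <= 2 / e * expR (e / 2 * y).
  rewrite mulrC -ler_pdivrMr ?divr_gt0// invf_div (mulrC y).
  by apply: le_trans (expR_ge1Dx _); rewrite lerDr.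
have C0 : 0 <= C.
  have := HC 0 (lexx 0); rewrite mulr0 expR0 mulr1; apply: le_trans; exact: normr_ge0.
apply: le_trans (ler_pM _ _ (HC y y0) yb) _ => //.
by rewrite le_eqVlt; apply/orP; left; apply/eqP; ring.
Qed.

Definition flat (p : {poly R}) (x : R) : R :=
  if 0 < x then p.[x^-1] * expR (- x^-1) else 0.

Definition flat' (p : {poly R}) : {poly R} := 'X^2 * (p - p^`()).

Lemma flat_dat p x : dat (flat p) x (flat (flat' p) x).
Proof.
case: (ltgtP x 0) => [x0|x0|->].
- apply: (@dat_near (fun=> 0) _ _ _ (- x)); first by rewrite oppr_gt0.
    move=> y yx; rewrite /flat ltNge (_ : y <= 0)//.
    by move: yx; rewrite ltr_norml => /andP[_]; lra.
  by rewrite /flat ltNge (ltW x0)/=; exact: dat_cst.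
- apply: (@dat_near (fun y => p.[y^-1] * expR (- y^-1)) _ _ _ x) => //.
    move=> y yx; rewrite /flat (_ : 0 < y)//.
    by move: yx; rewrite ltr_norml => /andP[+ _]; lra.
  have xn0 : x != 0 by rewrite gt_eqF.
  have dV : dat (fun y => y^-1) x (- x ^- 2).
    apply/is_derive_dat.
    have := @is_deriveV R id x 1 1 xn0 (is_derive_id _ _).
    by rewrite /GRing.scale/= mulr1.
  have dp : dat (fun y => p.[y^-1]) x (p^`().[x^-1] * - x ^- 2).
    apply: (dat_comp (f := horner p)) => //.
    by apply/is_derive_dat; exact: is_derive_poly.
  have de : dat (fun y => expR (- y^-1)) x (expR (- x^-1) * (x ^- 2)).
    apply: (dat_comp (f := expR) (g := fun y => - y^-1)).
      by apply/is_derive_dat; exact: is_derive_expR.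
    have := datZ (-1) dV; rewrite mulrN mulN1r opprK.
    by apply: dat_near ltr01 _ => y _; rewrite mulN1r.
  have := datM dp de; rewrite /flat x0.
  have -> : (flat' p).[x^-1] = x^-1 ^+ 2 * (p.[x^-1] - p^`().[x^-1]).
    by rewrite /flat' hornerM hornerXn hornerD hornerN.
  suff -> : p.[x^-1] * (expR (- x^-1) * x ^- 2) + expR (- x^-1) * (p^`().[x^-1] * - x ^- 2) = (x^-1 ^+ 2) * (p.[x^-1] - p^`().[x^-1]) * expR (- x^-1) by [].
  by rewrite exprVn; ring.
- rewrite {2}/flat ltxx => e e0.
  have [C HC] := @poly_expR_bound p (1 / 2) (ltac:(by rewrite divr_gt0)).
  have C0 : 0 <= C.
    have := HC 0 (lexx 0); rewrite mulr0 expR0 mulr1; apply: le_trans; exact: normr_ge0.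
  exists (e / (16 * C + 1)); first by rewrite divr_gt0//; lra.
  move=> h; rewrite ltr_pdivlMr; last by lra.
  move=> he; rewrite add0r /flat ltxx subr0 mulr0 subr0.
  case: ifPn => [h0|_]; last by rewrite normr0 mulr_ge0// ltW.
  rewrite (ger0_norm (ltW h0)) in he *.
  have hV0 : 0 < h^-1 by rewrite invr_gt0.
  rewrite normrM (ger0_norm (expR_ge0 _)).
  apply: le_trans (ler_wpM2r (expR_ge0 _) (HC _ (ltW hV0))) _.
  rewrite -mulrA -expRD.
  have -> : 1 / 2 * h^-1 + - h^-1 = - (1 / 2 * h^-1) by field; rewrite gt_eqF.
  rewrite expRN.
  have eb : (h^-1) ^+ 2 / 16 <= expR (1 / 2 * h^-1).
    have -> : expR (1 / 2 * h^-1) = expR (1 / 4 * h^-1) ^+ 2.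
      by rewrite -expRM_natl; congr expR; field; rewrite gt_eqF.
    have : 1 / 4 * h^-1 <= expR (1 / 4 * h^-1).
      by apply: le_trans (expR_ge1Dx _); rewrite lerDr.
    have := ltW hV0; nra.
  have : (expR (1 / 2 * h^-1))^-1 <= 16 * h ^+ 2.
    rewrite -[leRHS]invrK lef_pV2 ?posrE ?expR_gt0//; last by rewrite invr_gt0 mulr_gt0// exprn_gt0.
    by apply: le_trans eb; rewrite exprVn invfM mulrC.
  move=> /(ler_wpM2l C0) /le_trans; apply.
  by nra.
Qed.

Inductive bumps : (R -> R) -> Prop :=
| bumps_base p q : bumps (fun x => flat p x * flat q (1 - x))
| bumps_add f g : bumps f -> bumps g -> bumps (fun x => f x + g x)
| bumps_opp f : bumps f -> bumps (fun x => -1 * f x).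

Lemma bumps_dat f : bumps f -> exists2 g, bumps g & forall x, dat f x (g x).
Proof.
elim=> [p q|{}f g _ [f' Bf' ff'] _ [g' Bg' gg']|{}f _ [f' Bf' ff']].
- exists (fun x => flat (flat' p) x * flat q (1 - x)
          + -1 * (flat p x * flat (flat' q) (1 - x))).
    by apply: bumps_add; [|apply: bumps_opp]; exact: bumps_base.
  move=> x.
  have dq : dat (fun y => flat q (1 - y)) x (flat (flat' q) (1 - x) * -1).
    apply: (dat_comp (f := flat q) (g := fun y => 1 - y)); first exact: flat_dat.
    have := dat_aff (-1) 1 x; apply: (dat_near ltr01) => y _; ring.
  have := datM (flat_dat p x) dq.
  by rewrite (_ : _ + _ = flat (flat' p) x * flat q (1 - x)
          + -1 * (flat p x * flat (flat' q) (1 - x)))//; ring.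
- exists (fun x => f' x + g' x); first exact: bumps_add.
  by move=> x; exact: datD.
- exists (fun x => -1 * f' x); first exact: bumps_opp.
  by move=> x; exact: datZ.
Qed.

Lemma exists_bump : exists psi : R -> R, [/\ smooth psi, forall x, 0 <= psi x,
  forall x, ~ (0 < x < 1) -> psi x = 0 & Int psi 0 1 = 1].
Proof.
pose b x := flat 1 x * flat 1 (1 - x).
have sb : smooth b by apply: (smooth_family bumps_dat); exact: bumps_base.
have f0 x : 0 <= flat 1 x.
  by rewrite /flat; case: ifP => // _; rewrite hornerC mul1r expR_ge0.
have b0 x : 0 <= b x by rewrite mulr_ge0.
have bout x : ~ (0 < x < 1) -> b x = 0.
  move=> /negP; rewrite negb_and -!leNgt /b /flat subr_gt0.
  case/orP => h; first by rewrite [0 < x]ltNge h/= mul0r.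
  by rewrite [x < 1]ltNge h/= mulr0.
have cb := smooth_cont sb.
have c0 : 0 < Int b 0 1.
  have f4 x : 1 / 4 <= x -> expR (- 4) <= flat 1 x.
    move=> x4; have x0 : 0 < x by lra.
    rewrite /flat x0 hornerC mul1r ler_expR lerN2.
    by rewrite -[leRHS]invrK lef_pV2 ?posrE ?invr_gt0//; lra.
  apply: (@lt_le_trans _ _ (Int b (1/4) (3/4))); last first.
    by apply: le_Int_itv => //; [exact: locint_cont|lra..].
  apply: (@lt_le_trans _ _ (Int (fun=> expR (- 4) * expR (- 4)) (1/4) (3/4))).
    by rewrite Int_cst; [rewrite !mulr_gt0 ?expR_gt0//; lra|lra].
  apply: le_Int; [exact: locint_cst|exact: locint_cont|].
  move=> s /andP[s1 s2]; apply: ler_pM; rewrite ?expR_ge0//; apply: f4; lra.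
exists (fun x => (Int b 0 1)^-1 * b x); split.
- exact: smoothZ.
- by move=> x; rewrite mulr_ge0// invr_ge0 ltW.
- by move=> x /bout ->; rewrite mulr0.
- by rewrite IntZ ?mulVf ?gt_eqF//; exact: locint_cont.
Qed.

End Smooth.

(** * Lebesgue points *)

Section Lebesgue.
Context {R : realType}.
Local Notation mu := (@lebesgue_measure R).
Implicit Types (f g h k : R -> R) (a b x y : R).

Lemma ae_ex (P : R -> Prop) a b : {ae mu, forall x, P x} -> a < b ->
  exists2 x, a < x < b & P x.
Proof.
move=> aeP ab; apply: contrapT => H.
have : mu.-negligible `]a, b[.
  apply: negligibleS aeP => x /=; rewrite in_itv/= => xab Px; apply: H.
  by exists x.
move=> /measure_negligible => /(_ (measurable_itv _)) /=.
rewrite lebesgue_measure_itv/= lte_fin ab => /eqP.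
by rewrite -EFinB eqe subr_eq0 gt_eqF.
Qed.

Lemma ae_cont_eq f g : continuous f -> continuous g ->
  {ae mu, forall x, f x = g x} -> f = g.
Proof.
move=> cf cg fg; apply/funext => x; apply/eqP; rewrite -subr_eq0 -normr_le0.
apply/ler_addgt0Pl => e e0; rewrite addr0.
have e2 : 0 < e / 2 by rewrite divr_gt0.
have /cvgrPdist_le/(_ _ e2)[d1 /= d10 H1] := cf x.
have /cvgrPdist_le/(_ _ e2)[d2 /= d20 H2] := cg x.
have [|y /andP[xy yd] E] := @ae_ex _ x (x + Num.min d1 d2) fg.
  by rewrite ltrDl lt_min d10.
have yx : `|x - y| < Num.min d1 d2 by rewrite distrC gtr0_norm ?subr_gt0//; lra.
move: yx; rewrite lt_min => /andP[/H1 {}H1 /H2 {}H2].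
have -> : f x - g x = (f x - f y) - (g x - g y) by rewrite E; ring.
by apply: le_trans (ler_normB _ _) _; rewrite (splitr e); exact: lerD.
Qed.

(* Countably many rational intervals cover an open set. *)
Lemma ae_local (D : set R) (P : R -> Prop) : open D ->
  (forall x, D x -> exists e : R, 0 < e /\
     (forall r s, x - e < r -> r < x -> x < s -> s < x + e ->
        {ae mu, forall y, r < y < s -> P y})) ->
  {ae mu, forall y, D y -> P y}.
Proof.
move=> oD H.
pose F (i : nat) : set R := if unpickle i is Some (p, q)
  then if `[< {ae mu, forall y, ratr p < y < ratr q -> P y} >]
       then [set y | ratr p < y < ratr q /\ ~ P y] else set0 else set0.
have : mu.-negligible (\bigcup_k F k).
  apply: negligible_bigcup => i; rewrite /F.
  case: (unpickle i) => [[p q]|]; last exact: negligible_set0.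
  case: asboolP => [ae|_]; last exact: negligible_set0.
  by apply: negligibleS ae => y /= [pq nP] /(_ pq).
apply: negligibleS => y /= /not_implyP[Dy nP].
have [e [e0 He]] := H y Dy.
have [|p] := @rat_in_itvoo R (y - e) y; first by rewrite ltrBlDr ltrDl.
rewrite in_itv/= => /andP[p1 p2].
have [|q] := @rat_in_itvoo R y (y + e); first by rewrite ltrDl.
rewrite in_itv/= => /andP[q1 q2].
have [i Hi] : exists i, unpickle i = Some (p, q).
  by exists (pickle (p, q)); exact: pickleK.
exists i => //; rewrite /F Hi.
by case: asboolP => [_|]; [split => //; rewrite p2 q1|case; exact: He].
Qed.

Lemma param_cont f a b x : locint f -> a <= x <= b -> forall e : R, 0 < e ->
  exists2 d : R, 0 < d & forall y, a <= y <= b -> `|x - y| < d ->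
    `|Int f a x - Int f a y| <= e.
Proof.
move=> lf xab e e0; have ab : a <= b by case/andP: xab => /le_trans; exact.
have /subspace_continuousP := parameterized_integral_continuous ab (locint_int a b lf).
move=> /(_ x); rewrite /= in_itv/= => /(_ xab).
move=> /cvgrPdist_le/(_ e e0)[d /= d0 Hd]; exists d => // y yab xy.
by apply: Hd => //=; rewrite in_itv.
Qed.

Lemma prim_continuous f : locint f -> continuous (prim f).
Proof.
move=> lf; apply: cont_ed => x e e0.
have [|d d0 Hd] := @param_cont f (x - 1) (x + 1) x lf _ e e0; first by apply/andP; lra.
exists (Num.min 1 d); first by rewrite lt_min ltr01.
move=> y; rewrite lt_min => /andP[y1 yd].
have y1' : x - 1 <= y <= x + 1 by move: y1; rewrite ltr_norml; lra.
have := Hd y y1'; rewrite distrC => /(_ yd).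
rewrite -!primB//; [|lra|lra].
by rewrite distrC; congr (`|_| <= _); ring.
Qed.

Lemma small_Int f x : locint f -> forall e : R, 0 < e ->
  exists2 d : R, 0 < d & forall r, 0 <= r -> r < d -> Int (fun s => `|f s|) x (x + r) <= e.
Proof.
move=> lf e e0; have lnf := locint_norm lf.
have /cvgrPdist_le/(_ e e0)[d /= d0 Hd] := @prim_continuous _ lnf x.
exists d => // r r0 rd; rewrite -primB//; last by rewrite lerDl.
have := Hd (x + r); rewrite /ball/= opprD addNKr normrN ger0_norm// => /(_ rd).
by rewrite distrC; apply: le_trans; exact: ler_norm.
Qed.

Definition Lpt f x := forall e : R, 0 < e -> exists2 d : R, 0 < d &
  forall r, 0 < r -> r < d -> Int (fun s => `|f s - f x|) x (x + r) <= e * r.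

Lemma locint_locally f : locint f -> locally_integrable setT f.
Proof.
move=> [mf If]; split => //; first exact: openT.
move=> K _ cK; have /compact_bounded[M [_ HM]] := cK.
have KM : K `<=` `[- (M + 1), M + 1].
  move=> x Kx /=; rewrite in_itv/= -ler_norml; apply: HM => //; by rewrite ltrDl.
have /integrableP[_] := If (- (M + 1)) (M + 1).
apply: le_lt_trans; apply: ge0_subset_integral => //=.
- exact: compact_measurable.
- by apply/measurable_EFinP; apply: measurableT_comp => //; exact: measurable_funTS.
Qed.

Lemma locally_locint f : locally_integrable setT f -> locint f.
Proof.
move=> [mf _ If]; split => // x y; apply/integrableP; split.
  by apply/measurable_EFinP; exact: measurable_funTS.
by apply: If => //; exact: segment_compact.
Qed.

Lemma cvge0_lt (T : Type) (F : set_system T) (h : T -> \bar R) : Filter F ->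
  h x @[x --> F] --> 0%E -> forall e : R, 0 < e -> \forall x \near F, (h x < e%:E)%E.
Proof.
move=> FF /fine_cvgP[hf /cvgrPdist_lt hc] e e0; have := hc e e0.
apply: filterS2 hf => x hx; rewrite sub0r normrN => /ltr_normlW.
by rewrite -lte_fin fineK.
Qed.

Lemma Lpt_ae f : locint f -> {ae mu, forall x, Lpt f x}.
Proof.
move=> lf; have H := lebesgue_differentiation (locint_locally lf).
apply: (aeS H) => {H} x.
move=> /cvge0_lt fx e e0.
have [d /= d0 Hd] := fx _ (divr_gt0 e0 (ltr0Sn R 1)).
exists d => // r r0 rd.
have := Hd r; rewrite /ball_/= sub0r normrN gtr0_norm// => /(_ rd r0).
rewrite /davg /iavg (lebesgue_measure_ball _ (ltW r0)).
rewrite inver mulrn_eq0/= (gt_eqF r0) => H.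
rewrite -lee_fin /Int /Rintegral.
have lg : locint (fun s => `|f s - f x|).
  by apply: locint_norm; apply: locintB => //; exact: locint_cst.
rewrite fineK; last exact: integrable_fin_num (locint_int _ _ lg).
have r20 : (0 < r *+ 2)%R by rewrite pmulrn_lgt0.
move: H; rewrite lte_pdivrMl// => H.
have -> : e * r = r *+ 2 * (e / 2) by field.
apply: le_trans (ltW H).
rewrite -integral_itv_bndo_bndc; last first.
  by apply/measurable_EFinP; apply: measurable_funTS; case: lg.
apply: ge0_subset_integral => //=.
- exact: measurable_ball.
- apply/measurable_EFinP; apply: measurable_funTS; exact: (lg.1).
- rewrite ball_itv => y /=; rewrite !in_itv/= => /andP[xy ->].
  by rewrite andbT; apply: lt_le_trans xy; rewrite ltrBlDr ltrDl.
Qed.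

Lemma Lpt_cont f x : continuous f -> Lpt f x.
Proof.
move=> cf e e0; have /cvgrPdist_le/(_ e e0)[d /= d0 Hd] := cf x.
exists d => // r r0 rd.
have lg : locint (fun s => `|f s - f x|).
  by apply: locint_norm; apply: locintB; [exact: locint_cont|exact: locint_cst].
apply: (@le_trans _ _ (Int (fun=> e) x (x + r))); last first.
  by rewrite Int_cst ?lerDl ?(ltW r0)// [x + r]addrC addrK.
apply: le_Int => //; first exact: locint_cst.
move=> s /andP[xs sr]; rewrite distrC; apply: Hd.
by rewrite /ball/= distrC ger0_norm ?subr_ge0//; lra.
Qed.

Lemma integral_supp (D : set R) h a b : measurable D -> `[a, b] `<=` D ->
  (forall x, ~ (a <= x <= b) -> h x = 0) -> \int[mu]_(x in D) h x = Int h a b.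
Proof.
move=> mD abD h0; rewrite /Int [LHS]Rintegral_mkcond [RHS]Rintegral_mkcond.
apply: eq_Rintegral => x _; rewrite !patchE.
case: ifPn => xD; case: ifPn => xab //.
- by apply: h0 => xab'; move: xab; rewrite notin_setE/= in_itv.
- by move: xD; rewrite notin_setE => /(_ (abD _ (set_mem xab))).
Qed.

End Lebesgue.

Section Kernel.
Context {R : realType}.
Local Notation mu := (@lebesgue_measure R).
Implicit Types (f g h k : R -> R) (a b x y n : R).

Definition bump : R -> R := sval (cid (@exists_bump R)).
Definition step : R -> R := prim bump.
(* approximate unit mass at x+, and the smoothed indicator of [x, +oo[ *)
Definition dlt n x (s : R) : R := n * bump (n * s + - (n * x)).
Definition stp n x (s : R) : R := 1 * step (n * s + - (n * x)).

Lemma bumpP : [/\ smooth bump, forall x, 0 <= bump x,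
  forall x, ~ (0 < x < 1) -> bump x = 0 & Int bump 0 1 = 1].
Proof. by rewrite /bump; case: cid. Qed.

Lemma bump_cont : continuous bump.
Proof. by apply: smooth_cont; case: bumpP. Qed.

Lemma smooth_step : smooth step.
Proof. by apply: (@smooth_prim _ _ bump); [case: bumpP|apply: prim_dat bump_cont]. Qed.

Lemma smooth_dlt n x : smooth (dlt n x).
Proof. by apply: smooth_aff; case: bumpP. Qed.

Lemma smooth_stp n x : smooth (stp n x).
Proof. by apply: smooth_aff; exact: smooth_step. Qed.

Lemma stp_dat n x s : dat (stp n x) s (dlt n x s).
Proof.
rewrite /dlt mulrC -[_ * n]mul1r; apply: datZ.
apply: (dat_comp (f := step)); first exact: (prim_dat bump_cont).
exact: dat_aff.
Qed.

Lemma dlt_out n x s : 0 < n -> ~ (x <= s <= x + n^-1) -> dlt n x s = 0.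
Proof.
move=> n0 H; rewrite /dlt; case: bumpP => _ _ -> //; rewrite ?mulr0//.
move=> /andP[h1 h2]; apply: H.
have h1' : 0 < n * (s - x) by lra.
rewrite pmulr_rgt0// in h1'.
have h2' : n * (s - x) < 1 by lra.
move: h2'; rewrite -ltr_pdivlMl// mulr1 => h2'; apply/andP; lra.
Qed.

Lemma step_le0 x : x <= 0 -> step x = 0.
Proof.
move=> x0; rewrite /step /prim (Int_ge _ x0) sub0r.
have [_ _ b0 _] := bumpP.
rewrite (@eq_Int _ _ (fun=> 0)) ?Int_cst ?mul0r ?oppr0// => s /andP[_ s0].
by apply: b0; rewrite ltNge s0.
Qed.

Lemma step_ge1 x : 1 <= x -> step x = 1.
Proof.
move=> x1; rewrite /step primE; last by lra.
have lb := locint_cont bump_cont.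
have [_ _ b0 b1] := bumpP.
rewrite (Int_cat lb ler01 x1) b1 (@eq_Int _ _ (fun=> 0) 1) ?Int_cst ?mul0r ?addr0// => s /andP[s1 _].
by apply: b0; rewrite [s < 1]ltNge s1 andbF.
Qed.

Lemma step01 x : 0 <= step x <= 1.
Proof.
have lb := locint_cont bump_cont.
have [_ bb b0 b1] := bumpP.
have [x0|x0] := leP x 0; first by rewrite step_le0// lexx ler01.
have [x1|x1] := leP 1 x; first by rewrite step_ge1// lexx ler01.
rewrite /step primE ?(ltW x0)//; apply/andP; split; first exact: Int_ge0.
by rewrite -b1; apply: le_Int_itv => //; exact: ltW.
Qed.

Lemma stp_l n x s : 0 < n -> s <= x -> stp n x s = 0.
Proof.
by move=> n0 sx; rewrite /stp step_le0 ?mulr0// -mulrBr pmulr_rle0// subr_le0.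
Qed.

Lemma stp_r n x s : 0 < n -> x + n^-1 <= s -> stp n x s = 1.
Proof.
move=> n0 sx; rewrite /stp step_ge1 ?mulr1// -mulrBr -ler_pdivrMl// mulr1; lra.
Qed.

Lemma stp01 n x s : 0 <= stp n x s <= 1.
Proof. by rewrite /stp mul1r; exact: step01. Qed.

Lemma dlt_cont n x : continuous (dlt n x).
Proof. exact: (smooth_cont (@smooth_dlt n x)). Qed.

Lemma stp_cont n x : continuous (stp n x).
Proof. exact: (smooth_cont (@smooth_stp n x)). Qed.

Lemma prim_unique f g : continuous g -> (forall x, dat f x (g x)) ->
  forall x y, x <= y -> f y - f x = Int g x y.
Proof.
move=> cg fg x y xy; rewrite -(primB (locint_cont cg) xy).
suff : f y - prim g y = f x - prim g x by lra.
have d0 z : is_derive z (1 : R) (fun z => f z - prim g z) 0.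
  apply/is_derive_dat.
  have := datD (fg z) (datZ (-1) (prim_dat cg z)).
  rewrite mulN1r subrr; apply: (dat_near ltr01) => t _; by rewrite mulN1r.
exact: (is_derive_0_is_cst _ _ d0).
Qed.

Lemma Int_dlt n x y : 0 < n -> x + n^-1 <= y -> Int (dlt n x) x y = 1.
Proof.
move=> n0 xy; have nV : 0 < n^-1 by rewrite invr_gt0.
rewrite -(prim_unique (@dlt_cont n x) (stp_dat n x)); last by lra.
by rewrite stp_r// stp_l// subr0.
Qed.

Lemma kernel f x : locint f -> Lpt f x -> forall e : R, 0 < e ->
  exists2 N : R, 0 < N & forall n, N < n -> forall y, x + n^-1 <= y ->
   `|Int (fun s => f s * dlt n x s) x y - f x| <= e.
Proof.
move=> lf Lf e e0.
have [M HM] := cont_bounded bump_cont 0 1.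
have M0 : 0 <= M by apply: le_trans (HM 0 _) => //; rewrite lexx ler01.
have [d d0 Hd] := Lf (e / (M + 1)) (ltac:(by rewrite divr_gt0//; lra)).
exists d^-1; first by rewrite invr_gt0.
move=> n nd y xy; have n0 : 0 < n by apply: lt_trans nd; rewrite invr_gt0.
have nV0 : 0 < n^-1 by rewrite invr_gt0.
have nVd : n^-1 < d by rewrite -[d]invrK ltf_pV2// posrE invr_gt0.
have ld : locint (dlt n x) by exact: locint_cont (@dlt_cont n x).
have lfd h : locint h -> locint (fun s => h s * dlt n x s).
  move=> lh; have := locintM (@dlt_cont n x) lh.
  by rewrite (_ : (fun s => dlt n x s * h s) = (fun s => h s * dlt n x s))//; apply/funext => s; rewrite mulrC.
have lc : locint (fun s => f s - f x) by apply: locintB => //; exact: locint_cst.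
have -> : Int (fun s => f s * dlt n x s) x y - f x =
   Int (fun s => (f s - f x) * dlt n x s) x y.
  rewrite -[X in _ - X]mulr1 -(Int_dlt n0 xy) -IntZ// -IntB//; last 2 first.
  - exact: lfd.
  - exact: locintZ.
  by apply: eq_Int => s _; ring.
have xn : x <= x + n^-1 by lra.
rewrite (Int_cat (lfd _ lc) xn xy).
rewrite [X in _ + X](_ : _ = 0) ?addr0; last first.
  rewrite (@eq_Int _ _ (fun=> 0)) ?Int_cst ?mul0r// => s /andP[s1 s2].
  have [->|sn] := eqVneq s (x + n^-1); last first.
    rewrite dlt_out ?mulr0// => /andP[_ s3]; move/eqP: sn; apply; apply/eqP.
    by rewrite eq_le s3 s1.
  rewrite /dlt; case: bumpP => _ _ -> //; rewrite ?mulr0//.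
  by rewrite mulrDr mulfV ?gt_eqF// addrAC addrN add0r ltxx andbF.
apply: le_trans (Int_norm _ _ (lfd _ lc)) _.
apply: (@le_trans _ _ (Int (fun s => (n * M) * `|f s - f x|) x (x + n^-1))).
  apply: le_Int; [exact: locint_norm (lfd _ lc)|exact: locintZ (locint_norm lc)|].
  move=> s /andP[s1 s2]; rewrite normrM mulrC; apply: ler_wpM2r => //.
  rewrite normrM gtr0_norm//; apply: ler_wpM2l; first exact: ltW.
  apply: HM; rewrite -mulrBr mulr_ge0 ?subr_ge0 ?(ltW n0)//=.
  by rewrite -ler_pdivlMl// mulr1; lra.
rewrite IntZ; last exact: locint_norm.
apply: le_trans (ler_wpM2l (mulr_ge0 (ltW n0) M0) (Hd _ nV0 nVd)) _.
have -> : n * M * (e / (M + 1) / n) = e * (M / (M + 1)) by field; rewrite !gt_eqF//; lra.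
by rewrite ler_piMr ?(ltW e0)// ler_pdivrMr ?mul1r; lra.
Qed.

End Kernel.

(** * Weak derivatives *)

Section Weak.
Context {R : realType}.
Local Notation mu := (@lebesgue_measure R).
Implicit Types (f g h k phi : R -> R) (a b x y n : R) (D : set R).

Lemma test_itv D phi a b : smooth phi -> `[a, b] `<=` D ->
  (forall x, ~ (a <= x <= b) -> phi x = 0) -> test_function D phi.
Proof.
move=> sp abD p0; split => //; exists `[a, b]%classic; split => //.
  exact: segment_compact.
Qed.

Lemma test_dlt D n x a b : 0 < n -> `[a, b] `<=` D -> a <= x -> x + n^-1 <= b ->
  test_function D (dlt n x).
Proof.
move=> n0 abD ax xb; apply: (test_itv (@smooth_dlt _ n x) abD) => y yab.
by apply: dlt_out => // /andP[h1 h2]; apply: yab; apply/andP; lra.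
Qed.

Definition cutoff n x y s := stp n x s + -1 * stp n y s.

Lemma smooth_cutoff n x y : smooth (cutoff n x y).
Proof. by apply: smoothD; [|apply: smoothZ]; exact: smooth_stp. Qed.

Lemma cutoff_dat n x y s : dat (cutoff n x y) s (dlt n x s - dlt n y s).
Proof. by rewrite -mulN1r; apply: datD; [|apply: datZ]; exact: stp_dat. Qed.

Lemma cutoff_out n x y s : 0 < n -> x <= y -> ~ (x <= s <= y + n^-1) ->
  cutoff n x y s = 0.
Proof.
move=> n0 xy H; have nV0 : 0 < n^-1 by rewrite invr_gt0.
have [sx|sx] := leP s x.
  by rewrite /cutoff !stp_l//; [ring|lra].
have [sy|sy] := leP (y + n^-1) s.
  by rewrite /cutoff !stp_r//; [ring|lra].
by exfalso; apply: H; apply/andP; lra.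
Qed.

Lemma test_cutoff D n x y a b : 0 < n -> `[a, b] `<=` D -> a <= x -> x <= y ->
  y + n^-1 <= b -> test_function D (cutoff n x y).
Proof.
move=> n0 abD ax xy xb; apply: (test_itv (@smooth_cutoff n x y) abD) => s sab.
by apply: cutoff_out => // /andP[h1 h2]; apply: sab; apply/andP; lra.
Qed.

Lemma derive1_cutoff n x y : derive1 (cutoff n x y) = fun s => dlt n x s - dlt n y s.
Proof. by apply/funext => s; have [_ ->] := dat_derive (cutoff_dat n x y s). Qed.

Lemma Int_cutoff g x y b : locint g -> x <= y -> y < b -> forall e : R, 0 < e ->
  exists2 N : R, 0 < N & forall n, N < n ->
   `|Int (fun s => g s * cutoff n x y s) x b - Int g x y| <= e.
Proof.
move=> lg xy yb e e0; have e2 : 0 < e / 2 by rewrite divr_gt0.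
have [d1 d10 H1] := small_Int x lg e2.
have [d2 d20 H2] := small_Int y lg e2.
pose d := Num.min (Num.min d1 d2) (b - y).
have d0 : 0 < d by rewrite !lt_min d10 d20 subr_gt0.
exists d^-1; first by rewrite invr_gt0.
move=> n nd; have n0 : 0 < n by apply: lt_trans nd; rewrite invr_gt0.
have nV0 : 0 < n^-1 by rewrite invr_gt0.
have : n^-1 < d by rewrite -[d]invrK ltf_pV2// posrE invr_gt0.
rewrite !lt_min => /andP[/andP[nd1 nd2] nb].
have cc z : continuous (stp n z) by exact: stp_cont.
have lgs z : locint (fun s => stp n z s * g s) by exact: locintM.
have lgs' z : locint (fun s => (1 - stp n z s) * g s).
  apply: locintM => // s; apply: cvgB; [exact: cvg_cst|exact: cc].
have -> : Int (fun s => g s * cutoff n x y s) x b =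
  Int (fun s => stp n x s * g s) x b - Int (fun s => stp n y s * g s) x b.
  by rewrite -IntB//; apply: eq_Int => s _; rewrite /cutoff; ring.
have xb : x <= b by lra.
have E1 : Int (fun s => stp n x s * g s) x b = Int g x b - Int (fun s => (1 - stp n x s) * g s) x (x + n^-1).
  have -> : Int (fun s => (1 - stp n x s) * g s) x (x + n^-1) = Int (fun s => (1 - stp n x s) * g s) x b.
    rewrite [RHS](@Int_cat _ _ x (x + n^-1) b)//; [|lra|lra].
    rewrite [X in _ = _ + X](@eq_Int _ _ (fun=> 0)).
      by rewrite Int_cst ?mul0r ?addr0//; lra.
    by move=> s /andP[s1 _]; rewrite stp_r// subrr mul0r.
  by rewrite -IntB//; apply: eq_Int => s _; ring.
have E2 : Int (fun s => stp n y s * g s) x b = Int g y b - Int (fun s => (1 - stp n y s) * g s) y (y + n^-1).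
  have -> : Int (fun s => stp n y s * g s) x b = Int (fun s => stp n y s * g s) y b.
    rewrite (@Int_cat _ _ x y b)//; last lra.
    rewrite [X in X + _](@eq_Int _ _ (fun=> 0)); first by rewrite Int_cst ?mul0r ?add0r.
    by move=> s /andP[_ s1]; rewrite stp_l// mul0r.
  have -> : Int (fun s => (1 - stp n y s) * g s) y (y + n^-1) = Int (fun s => (1 - stp n y s) * g s) y b.
    rewrite [RHS](@Int_cat _ _ y (y + n^-1) b)//; [|lra|lra].
    rewrite [X in _ = _ + X](@eq_Int _ _ (fun=> 0)).
      by rewrite Int_cst ?mul0r ?addr0//; lra.
    by move=> s /andP[s1 _]; rewrite stp_r// subrr mul0r.
  by rewrite -IntB//; apply: eq_Int => s _; ring.
rewrite E1 E2 (Int_cat lg xy (ltW yb)).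
have -> : forall p q r t : R, p + q - r - (q - t) - p = t - r by move=> *; ring.
apply: le_trans (ler_normB _ _) _; rewrite (splitr e).
have B z r : 0 <= r -> `|Int (fun s => (1 - stp n z s) * g s) z (z + r)| <= Int (fun s => `|g s|) z (z + r).
  move=> r0; apply: le_trans (Int_norm _ _ (lgs' z)) _.
  apply: le_Int; [exact: locint_norm|exact: locint_norm|].
  move=> s _; rewrite normrM ler_piMl//.
  by have /andP[h1 h2] := stp01 n z s; rewrite ger0_norm ?subr_ge0// lerBlDr lerDl.
apply: lerD; apply: le_trans (B _ _ (ltW nV0)) _; [apply: H2|apply: H1] => //; exact: ltW.
Qed.

Definition weak_on D f g := forall phi, test_function D phi ->
  \int[mu]_(x in D) (f x * derive1 phi x) = - \int[mu]_(x in D) (g x * phi x).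

Lemma weak_Int D f g x y b : measurable D -> locint f -> locint g -> weak_on D f g ->
  x <= y -> y < b -> `[x, b] `<=` D -> Lpt f x -> Lpt f y -> f y - f x = Int g x y.
Proof.
move=> mD lf lg W xy yb xbD Lx Ly.
apply/eqP; rewrite -subr_eq0 -normr_le0; apply/ler_addgt0Pl => e e0; rewrite addr0.
have e3 : 0 < e / 3 by rewrite divr_gt0.
have [N1 N10 H1] := kernel lf Lx e3.
have [N2 N20 H2] := kernel lf Ly e3.
have [N3 N30 H3] := Int_cutoff lg xy yb e3.
pose n := N1 + N2 + N3 + (b - y)^-1.
have by0 : 0 < (b - y)^-1 by rewrite invr_gt0; lra.
have n0 : 0 < n by rewrite /n; lra.
have nV0 : 0 < n^-1 by rewrite invr_gt0.
have nV : n^-1 < b - y by rewrite -[b - y]invrK ltf_pV2 ?posrE// /n; lra.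
have yn : y + n^-1 <= b by lra.
have := W (cutoff n x y) (test_cutoff n0 xbD (lexx _) xy yn).
rewrite derive1_cutoff.
rewrite (@integral_supp _ D _ x b)//; last first.
  by move=> s sxb; rewrite !dlt_out ?subrr ?mulr0// => /andP[h1 h2]; apply: sxb; apply/andP; lra.
rewrite (@integral_supp _ D _ x b)//; last first.
  by move=> s sxb; rewrite cutoff_out ?mulr0// => /andP[h1 h2]; apply: sxb; apply/andP; lra.
have lfd z : locint (fun s => f s * dlt n z s).
  have := locintM (@dlt_cont _ n z) lf.
  by rewrite (_ : (fun s => dlt n z s * f s) = (fun s => f s * dlt n z s))//; apply/funext => s; rewrite mulrC.
have -> : Int (fun s => f s * (dlt n x s - dlt n y s)) x b =
   Int (fun s => f s * dlt n x s) x b - Int (fun s => f s * dlt n y s) y b.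
  have -> : Int (fun s => f s * dlt n y s) y b = Int (fun s => f s * dlt n y s) x b.
    rewrite [RHS](@Int_cat _ _ x y b)//; last lra.
    rewrite [X in _ = X + _](@eq_Int _ _ (fun=> 0)); first by rewrite Int_cst ?mul0r ?add0r.
    move=> s /andP[_]; rewrite le_eqVlt => /predU1P[->|sy].
      by rewrite /dlt addrN; have [_ _ -> //] := bumpP (R := R); [rewrite !mulr0|rewrite ltxx].
    by rewrite dlt_out ?mulr0// => /andP[]; lra.
  by rewrite -IntB//; apply: eq_Int => s _; ring.
move=> E.
have := H1 n _ b; have := H2 n _ b; have := H3 n.
have -> : N1 < n by rewrite /n; lra.
have -> : N2 < n by rewrite /n; lra.
have -> : N3 < n by rewrite /n; lra.
have -> : y + n^-1 <= b by lra.
have -> : x + n^-1 <= b by lra.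
move=> /(_ erefl) A3 /(_ erefl erefl) A2 /(_ erefl erefl) A1.
move: A1 A2 A3 E.
set p := Int (fun s => f s * dlt n x s) x b.
set q := Int (fun s => f s * dlt n y s) y b.
set r := Int (fun s => g s * cutoff n x y s) x b.
move=> A1 A2 A3 E.
have -> : f y - f x - Int g x y = (p - f x) - (q - f y) + (r - Int g x y) by lra.
apply: le_trans (ler_normD _ _) _; apply: le_trans (lerD (ler_normB _ _) A3) _; lra.
Qed.

Lemma weak_zero D h : open D -> measurable_fun D h ->
  (forall a b, `[a, b] `<=` D -> mu.-integrable `[a, b] (EFin \o h)) ->
  (forall phi, test_function D phi -> \int[mu]_(x in D) (h x * phi x) = 0) ->
  {ae mu, forall x, D x -> h x = 0}.
Proof.
move=> oD mh ih H; have mD := open_measurable oD.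
apply: (ae_local oD) => x Dx.
have [e /= e0 He] := oD x Dx.
exists e; split => // r s er rx xs se.
have rsD : `[r, s] `<=` D.
  move=> y /=; rewrite in_itv/= => /andP[ry ys]; apply: He; rewrite /ball_/=.
  by rewrite ltr_norml; apply/andP; lra.
pose h1 := h \_ `[r, s].
have lh1 : locint h1.
  apply/locally_locint/integrable_locally_restrict => //; exact: ih.
apply: (aeS (Lpt_ae lh1)) => y Ly /andP[ry ys].
suff : h1 y = 0 by rewrite /h1 patchE mem_set//= in_itv/= !ltW.
apply/eqP; rewrite -normr_le0; apply/ler_addgt0Pl => {er e0 He se}e e0; rewrite addr0.
have [N N0 HN] := kernel lh1 Ly e0.
pose n := N + (s - y)^-1.
have by0 : 0 < (s - y)^-1 by rewrite invr_gt0; lra.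
have n0 : 0 < n by rewrite /n; lra.
have nV0 : 0 < n^-1 by rewrite invr_gt0.
have nV : n^-1 < s - y by rewrite -[s - y]invrK ltf_pV2 ?posrE// /n; lra.
have yn : y + n^-1 <= s by lra.
have := HN n _ s; have -> : N < n by rewrite /n; lra.
rewrite yn => /(_ erefl erefl).
rewrite (@eq_Int _ _ (fun z => h z * dlt n y z)); last first.
  by move=> z /andP[z1 z2]; rewrite /h1 patchE mem_set//= in_itv/= z2 andbT; lra.
have := H (dlt n y) (test_dlt n0 rsD (ltW ry) yn).
rewrite (@integral_supp _ D _ y s) => [->|//||]; first by rewrite sub0r normrN.
  by move=> z; rewrite /= in_itv/= => /andP[z1 z2]; apply: rsD; rewrite /= in_itv/= z2 andbT; lra.
by move=> z zys; rewrite dlt_out ?mulr0// => /andP[z1 z2]; apply: zys; apply/andP; lra.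
Qed.

Lemma locally_itv D f a b : locally_integrable D f -> `[a, b] `<=` D ->
  mu.-integrable `[a, b] (EFin \o f).
Proof.
move=> [mf oD If] abD; apply/integrableP; split.
  by apply/measurable_EFinP; apply: measurable_funS mf => //; exact: open_measurable.
have cab : compact (`[a, b] : set R) by exact: segment_compact.
exact: (If _ abD cab).
Qed.

Lemma derive1_supp (K : set R) phi : compact K -> (forall x, ~ K x -> phi x = 0) ->
  forall x, ~ K x -> derive1 phi x = 0.
Proof.
move=> cK phi0 x nKx; have cl : open (~` K).
  by apply: closed_openC; apply: compact_closed => //; exact: Rhausdorff.
have [d /= d0 Hd] := cl x nKx.
have Hd' y : `|y - x| < d -> 0 = phi y.
  by move=> yx; rewrite phi0//; apply: Hd; rewrite /ball_/= distrC.
by have [_] := dat_derive (dat_near d0 Hd' (dat_cst 0 x)).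
Qed.

Lemma weak_integrable D f phi : locally_integrable D f -> test_function D phi ->
  mu.-integrable D (EFin \o (fun x => f x * phi x)) /\
  mu.-integrable D (EFin \o (fun x => f x * derive1 phi x)).
Proof.
move=> lf [sp [K [cK KD phi0]]].
have [mf oD If] := lf.
have mD := open_measurable oD.
have mK : measurable K by exact: compact_measurable.
have iK : mu.-integrable K (EFin \o f).
  apply/integrableP; split; last exact: If.
  by apply/measurable_EFinP; exact: measurable_funS mf.
have dphi0 := derive1_supp cK phi0.
have gen k : continuous k -> (forall x, ~ K x -> k x = 0) ->
    mu.-integrable D (EFin \o (fun x => f x * k x)).
  move=> ck k0.
  have iK' : mu.-integrable K (EFin \o (fun x => f x * k x)).
    rewrite (_ : EFin \o _ = ((EFin \o f) \* (EFin \o k))%E); last by apply/funext => s.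
    apply: (@integrableMl _ _ _ mu) => //.
      by apply: measurable_funTS; exact: continuous_measurable_fun.
    have := @continuous_compact R R k K (continuous_subspaceT ck) cK.
    move=> /compact_bounded[M [rM HM]]; exists M; split => // N MN x Kx /=.
    by apply: HM => //; exists x.
  have : mu.-integrable D ((EFin \o (fun x => f x * k x)) \_ K).
    by apply/integrable_restrict => //; rewrite setIidr.
  apply: eq_integrable => // x _; rewrite patchE; case: ifPn => //.
  by rewrite notin_setE => /k0; rewrite /= => ->; rewrite mulr0.
split; apply: gen => //; first exact: smooth_cont.
exact: smooth_cont (smooth_derive sp).
Qed.

Lemma wderivR_unique D f g1 g2 : is_wderivR D f g1 -> is_wderivR D f g2 ->
  {ae mu, forall x, D x -> g1 x = g2 x}.
Proof.
move=> [lf lg1 W1] [_ lg2 W2].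
have [mg1 oD Ig1] := lg1; have [mg2 _ Ig2] := lg2.
suff : {ae mu, forall x, D x -> g1 x - g2 x = 0}.
  by move=> H; apply: (aeS H) => x Hx Dx; apply/eqP; rewrite -subr_eq0 Hx.
have mD := open_measurable oD.
apply: weak_zero => //.
- exact: measurable_funB.
- move=> a b abD.
  exact: (integrableB _ (locally_itv lg1 abD) (locally_itv lg2 abD)).
- move=> phi tphi.
  have [I1 _] := weak_integrable lg1 tphi; have [I2 _] := weak_integrable lg2 tphi.
  have := W1 phi tphi; rewrite W2// => /oppr_inj E.
  rewrite (@eq_Rintegral _ _ _ mu D (fun x => g1 x * phi x - g2 x * phi x)); last first.
    by move=> x _; rewrite mulrBl.
  by rewrite RintegralB// E subrr.
Qed.

Lemma wderivR_rep f g : is_wderivR setT f g ->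
  exists c, {ae mu, forall x, f x = c + prim g x}.
Proof.
move=> [/locally_locint lf /locally_locint lg W].
have Lf := Lpt_ae lf.
have [x0 _ L0] := ae_ex Lf ltr01.
exists (f x0 - prim g x0); apply: (aeS Lf) => x Lx.
have key y z : y <= z -> Lpt f y -> Lpt f z -> f z - f y = prim g z - prim g y.
  move=> yz Ly Lz; rewrite primB//.
  by apply: (@weak_Int setT _ _ _ _ (z + 1)) => //; rewrite ltrDl.
have [h|h] := leP x0 x; first by have := key _ _ h L0 Lx; lra.
by have := key _ _ (ltW h) Lx L0; lra.
Qed.

Lemma wderivR_sub (D : set R) f g : open D -> is_wderivR setT f g -> is_wderivR D f g.
Proof.
move=> oD [[mf _ If] [mg _ Ig] W].
have mD := open_measurable oD.
split.
- by split => //; [exact: measurable_funTS|move=> K _; exact: If].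
- by split => //; [exact: measurable_funTS|move=> K _; exact: Ig].
move=> phi tphi.
have [sp [K [cK KD phi0]]] := tphi.
have tphi' : test_function setT phi by split => //; exists K; split.
have := W phi tphi'.
have dphi0 x : ~ D x -> derive1 phi x = 0.
  by move=> nDx; apply: (derive1_supp cK phi0) => /KD.
have E k : (forall x, ~ D x -> k x = 0) -> \int[mu]_x k x = \int[mu]_(x in D) k x.
  move=> k0; rewrite [RHS]Rintegral_mkcond; apply: eq_Rintegral => x _.
  by rewrite patchE; case: ifPn => //; rewrite notin_setE => /k0.
by rewrite !E// => x nDx; rewrite ?dphi0 ?mulr0// phi0 ?mulr0// => /KD.
Qed.

End Weak.

(** * Differentiation under the integral sign *)

Section Calculus.
Context {R : realType}.
Implicit Types (f g k phi : R -> R) (a b x y t : R).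

Lemma normM_le (p q P Q : R) : `|p| <= P -> `|q| <= Q -> `|p * q| <= P * Q.
Proof. by move=> pP qQ; rewrite normrM; apply: ler_pM. Qed.

Lemma dat_le0_decr f l a b : 0 < a -> a <= b -> (forall t, 0 < t -> dat f t (l t)) ->
  (forall t, 0 < t -> l t <= 0) -> f b <= f a.
Proof.
move=> a0 ab fl l0.
apply: (@ler0_derive1_nincr _ f a b) => //.
- by move=> x /[!in_itv]/= /andP[ax _]; have [] := dat_derive (fl x (lt_trans a0 ax)).
- move=> x /[!in_itv]/= /andP[ax _]; have x0 := lt_trans a0 ax.
  by have [_ ->] := dat_derive (fl x x0); exact: l0.
- apply: derivable_within_continuous => x /[!in_itv]/= /andP[ax _].
  by have [] := dat_derive (fl x (lt_le_trans a0 ax)).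
Qed.

Lemma gronwall (L l : R -> R) (c T1 T : R) : (forall t, 0 < t -> dat L t (l t)) ->
  (forall t, 0 < t -> l t <= - c * L t) -> 0 < T1 -> T1 <= T ->
  L T <= expR (- (c * (T - T1))) * L T1.
Proof.
move=> dL lL T10 T0.
have dE t : dat (fun t => expR (c * t)) t (expR (c * t) * c).
  apply: (dat_comp (f := expR) (g := fun t => c * t)).
    by apply/is_derive_dat; exact: is_derive_expR.
  by apply: (@dat_near _ (fun y => c * y + 0) _ _ _ 1) => // [y _|]; [rewrite addr0|exact: dat_aff].
have H : expR (c * T) * L T <= expR (c * T1) * L T1.
  have D t : 0 < t -> dat (fun t => expR (c * t) * L t) t (expR (c * t) * l t + L t * (expR (c * t) * c)).
    by move=> t0; exact: (datM (dE t) (dL t t0)).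
  apply: (dat_le0_decr T10 T0 D).
  by move=> t t0; have := lL t t0; have := expR_gt0 (c * t); nra.
have -> : expR (- (c * (T - T1))) = (expR (c * T))^-1 * expR (c * T1).
  by rewrite -expRN -expRD; congr expR; ring.
by rewrite -mulrA ler_pdivlMl ?expR_gt0.
Qed.

Definition udat a b (F : R -> R -> R) t (F' : R -> R) :=
  forall e : R, 0 < e -> exists2 d : R, 0 < d & forall h, `|h| < d ->
  forall x, a <= x <= b -> `|F (t + h) x - F t x - h * F' x| <= e * `|h|.

Definition bnd a b f := exists M : R, forall x, a <= x <= b -> `|f x| <= M.

Lemma udatD a b F G t F' G' : udat a b F t F' -> udat a b G t G' ->
  udat a b (fun t x => F t x + G t x) t (fun x => F' x + G' x).
Proof.
move=> HF HG e e0; have e2 : 0 < e / 2 by rewrite divr_gt0.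
have [d1 d10 H1] := HF _ e2; have [d2 d20 H2] := HG _ e2.
exists (Num.min d1 d2); first by rewrite lt_min d10.
move=> h; rewrite lt_min => /andP[h1 h2] x xab.
have := lerD (H1 h h1 x xab) (H2 h h2 x xab).
rewrite -mulrDl -splitr; apply: le_trans; apply: le_trans (ler_normD _ _).
by rewrite le_eqVlt; apply/orP; left; apply/eqP; congr `|_|; ring.
Qed.

Lemma udatZ a b F t F' c : bnd a b c -> udat a b F t F' ->
  udat a b (fun t x => c x * F t x) t (fun x => c x * F' x).
Proof.
move=> [M HM] HF e e0.
have M1 : 0 < `|M| + 1 by rewrite ltr_pwDr.
have [d d0 H] := HF _ (divr_gt0 e0 M1).
exists d => // h hd x xab; have := H h hd x xab => {}H.
have -> : c x * F (t + h) x - c x * F t x - h * (c x * F' x) =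
  c x * (F (t + h) x - F t x - h * F' x) by ring.
have cM : `|c x| <= `|M| + 1.
  by apply: le_trans (HM x xab) _; apply: le_trans (ler_norm _) _; rewrite lerDl.
apply: le_trans (normM_le cM H) _.
by rewrite mulrA mulrCA divff ?gt_eqF// mulr1.
Qed.

Lemma udatM a b F G t F' G' : bnd a b (F t) -> bnd a b (G t) -> bnd a b F' ->
  bnd a b G' -> udat a b F t F' -> udat a b G t G' ->
  udat a b (fun t x => F t x * G t x) t (fun x => F t x * G' x + G t x * F' x).
Proof.
move=> [M1 B1] [M2 B2] [M3 B3] [M4 B4] HF HG e e0.
pose M := `|M1| + `|M2| + `|M3| + `|M4|.
have BB f N : (forall x, a <= x <= b -> `|f x| <= N) -> `|N| <= M ->
    forall x, a <= x <= b -> `|f x| <= M.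
  by move=> H NM x /H /le_trans; apply; apply: le_trans (ler_norm _) NM.
have n1 := normr_ge0 M1; have n2 := normr_ge0 M2.
have n3 := normr_ge0 M3; have n4 := normr_ge0 M4.
have {}B1 := BB _ _ B1 (ltac:(rewrite /M; lra)).
have {}B2 := BB _ _ B2 (ltac:(rewrite /M; lra)).
have {}B3 := BB _ _ B3 (ltac:(rewrite /M; lra)).
have {}B4 := BB _ _ B4 (ltac:(rewrite /M; lra)).
have M0 : 0 <= M by rewrite /M; lra.
clear BB n1 n2 n3 n4.
pose K := 4 * M + M * M + 1.
have K0 : 0 < K by rewrite /K; nra.
pose e' := Num.min 1 (e / K).
have e'0 : 0 < e' by rewrite lt_min ltr01 divr_gt0.
have e'1 : e' <= 1 by rewrite ge_min lexx.
have e'K : e' * K <= e by rewrite -ler_pdivlMr// ge_min lexx orbT.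
clearbody e'.
have [d1 d10 H1] := HF _ e'0; have [d2 d20 H2] := HG _ e'0.
exists (Num.min e' (Num.min d1 d2)); first by rewrite !lt_min e'0 d10.
move=> h; rewrite !lt_min => /andP[he /andP[h1 h2]] x xab.
have {}H1 := H1 h h1 x xab; have {}H2 := H2 h h2 x xab.
set r := F (t + h) x - F t x - h * F' x in H1.
set q := G (t + h) x - G t x - h * G' x in H2.
have -> : F (t + h) x * G (t + h) x - F t x * G t x - h * (F t x * G' x + G t x * F' x)
  = F t x * q + r * G t x + (h * F' x) * (h * G' x) + (h * F' x) * q + r * (h * G' x) + r * q.
  by rewrite /r /q; ring.
have h0 := normr_ge0 h.
have hF : `|h * F' x| <= `|h| * M by apply: normM_le => //; exact: B3.
have hG : `|h * G' x| <= `|h| * M by apply: normM_le => //; exact: B4.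
have A1 := normM_le (B1 x xab) H2.
have A2 := normM_le H1 (B2 x xab).
have A3 := normM_le hF hG.
have A4 := normM_le hF H2.
have A5 := normM_le H1 hG.
have A6 := normM_le H1 H2.
apply: le_trans (ler_wpM2r h0 e'K).
set H := `|h| in h0 he hF hG A1 A2 A3 A4 A5 A6 *.
have tri (p1 p2 p3 p4 p5 p6 : R) : `|p1 + p2 + p3 + p4 + p5 + p6| <=
   `|p1| + `|p2| + `|p3| + `|p4| + `|p5| + `|p6|.
  do 4 (apply: le_trans (ler_normD _ _) _; rewrite lerD2r).
  exact: ler_normD.
apply: le_trans (tri _ _ _ _ _ _) _.
apply: (@le_trans _ _ (M * (e' * H) + e' * H * M + H * M * (H * M) + H * M * (e' * H)
   + e' * H * (H * M) + e' * H * (e' * H))).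
  by do 5 (apply: lerD => //).
have -> : M * (e' * H) + e' * H * M + H * M * (H * M) + H * M * (e' * H)
   + e' * H * (H * M) + e' * H * (e' * H) =
   H * (e' * (2 * M) + H * (M * M) + H * (2 * M * e') + H * (e' * e')) by ring.
have -> : e' * K * H = H * (e' * (2 * M) + e' * (M * M) + e' * (2 * M * 1) + e' * 1).
  by rewrite /K; ring.
apply: ler_wpM2l => //.
have MM : 0 <= M * M by rewrite mulr_ge0.
have hle : H <= e' by exact: ltW.
rewrite !lerD ?ler_wpM2r ?ler_wpM2l ?mulr_ge0//.
  by apply: ler_pM => //; [rewrite !mulr_ge0// ltW|apply: ler_wpM2l => //; rewrite mulr_ge0].
by apply: ler_pM => //; [rewrite mulr_ge0// ltW|rewrite mulr_ile1// ltW].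
Qed.

Lemma dat_Int a b F t F' : a <= b -> (forall s, locint (F s)) -> locint F' ->
  udat a b F t F' -> dat (fun s => Int (F s) a b) t (Int F' a b).
Proof.
move=> ab lF lF' H e e0.
have K0 : 0 < b - a + 1 by lra.
have [d d0 Hd] := H _ (divr_gt0 e0 K0).
exists d => // h hd.
rewrite -IntB// -IntZ// -IntB//; [|exact: locintB|exact: locintZ].
apply: le_trans (Int_norm_le _ ab (Hd h hd)) _; first by apply: locintB; [exact: locintB|exact: locintZ].
have -> : e / (b - a + 1) * `|h| * (b - a) = e * `|h| * ((b - a) / (b - a + 1)) by field; rewrite gt_eqF.
by rewrite ler_piMr ?mulr_ge0 ?(ltW e0)// ler_pdivrMr// mul1r; lra.
Qed.

Lemma cont_bnd a b f : continuous f -> bnd a b f.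
Proof. by move=> cf; exact: cont_bounded. Qed.

(* [int k g' + d g <= [k g]] for a weight [k] that need not be differentiable: only
   the lower bound [d] for its growth rate enters. *)
Lemma growth_parts k d g g' a b : a <= b -> continuous k -> continuous d ->
  continuous g' -> (forall x, dat g x (g' x)) -> (forall x, 0 <= g x) ->
  (forall e : R, 0 < e -> exists2 r : R, 0 < r & forall x y, a <= x -> x <= y -> y <= b ->
     y - x < r -> (y - x) * (d x - e) <= k y - k x) ->
  Int (fun x => k x * g' x) a b + Int (fun x => d x * g x) a b <= k b * g b - k a * g a.
Proof.
move=> ab ck cd cg' dg g0 H.
have cg : continuous g by apply: cont_ed => t; exact: dat_cont (dg t).
have lkg : locint (fun x => k x * g' x) by apply: locintM => //; exact: locint_cont.
have ldg : locint (fun x => d x * g x) by apply: locintM => //; exact: locint_cont.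
have lg' : locint g' by exact: locint_cont.
pose f y := Int (fun x => k x * g' x) a y + Int (fun x => d x * g x) a y - k y * g y.
suff : f b <= f a by rewrite /f !(Int_ge _ (lexx a)); lra.
have [M1 B1] := cont_bounded cg' a b.
have [M2 B2] := cont_bounded cg a b.
have M10 : 0 <= M1 by apply: le_trans (B1 a _); rewrite // lexx.
have M20 : 0 <= M2 by apply: le_trans (B2 a _); rewrite // lexx.
pose K := M1 + M2 + 1.
have K0 : 0 < K by rewrite /K; lra.
apply: (mono_local (m := id) ab) => e e0.
have e'0 : 0 < e / K by rewrite divr_gt0.
have [r1 r10 H1] := H _ e'0.
have [r2 r20 H2] := cont_unif a b ck e'0.
have cdg : continuous (fun x => d x * g x) by move=> x; apply: cvgM; [exact: cd|exact: cg].
have [r3 r30 H3] := cont_unif a b cdg e'0.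
exists (Num.min r1 (Num.min r2 r3)); first by rewrite !lt_min r10 r20.
move=> x y ax xy yb; rewrite !lt_min => /andP[yx1 /andP[yx2 yx3]].
have ay : a <= y by lra. have xb : x <= b by lra.
have yx0 : 0 <= y - x by lra.
have E : f y - f x = Int (fun s => (k s - k y) * g' s) x y
   + Int (fun s => d s * g s - d x * g x) x y + (y - x) * (d x * g x) - (k y - k x) * g x.
  rewrite /f (Int_cat lkg ax xy) (Int_cat ldg ax xy).
  rewrite [X in _ = _ + X + _ - _]IntB//; last exact: locint_cst.
  rewrite (Int_cst _ xy).
  have -> : Int (fun s => (k s - k y) * g' s) x y = Int (fun x => k x * g' x) x y - k y * Int g' x y.
    by rewrite -IntZ// -IntB//; [apply: eq_Int => s _; ring|exact: locintZ].
  by rewrite -(prim_unique cg' dg xy); ring.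
rewrite E.
have lk' : locint (fun s => (k s - k y) * g' s).
  by apply: locintM => // s; apply: cvgB; [exact: ck|exact: cvg_cst].
have T1 : `|Int (fun s => (k s - k y) * g' s) x y| <= e / K * M1 * (y - x).
  apply: Int_norm_le => // s /andP[xs sy]; apply: normM_le.
    by apply: H2; [apply/andP; lra|apply/andP; lra|rewrite distrC ger0_norm; lra].
  by apply: B1; apply/andP; lra.
have T2 : `|Int (fun s => d s * g s - d x * g x) x y| <= e / K * (y - x).
  apply: Int_norm_le => //; first by apply: locintB => //; exact: locint_cst.
  move=> s /andP[xs sy].
  by apply: H3; [apply/andP; lra|apply/andP; lra|rewrite ger0_norm; lra].
have T3 := H1 x y ax xy yb yx1.
have gM : g x <= M2 by apply: le_trans (ler_norm _) (B2 x _); apply/andP.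
have T4 : (y - x) * (d x * g x) - (k y - k x) * g x <= e / K * (y - x) * M2.
  have := ler_wpM2r (g0 x) T3.
  have : e / K * (y - x) * g x <= e / K * (y - x) * M2.
    by apply: ler_wpM2l => //; rewrite mulr_ge0// ltW.
  move: (e / K) => c; move: (y - x) => u; move: (k y - k x) (d x) (g x) => v w z; lra.
have -> : e * (y - x) = e / K * M1 * (y - x) + e / K * (y - x) + e / K * (y - x) * M2.
  have -> : e * (y - x) = e / K * K * (y - x) by rewrite divfK ?gt_eqF.
  by rewrite {2}/K; ring.
have := ler_norm (Int (fun s => (k s - k y) * g' s) x y).
have := ler_norm (Int (fun s => d s * g s - d x * g x) x y).
move: T1 T2 T4.
move: (Int _ x y) (Int _ x y) => I1 I2.
move: (e / K * M1 * (y - x)) (e / K * (y - x)) (e / K * (y - x) * M2) => p q r.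
move: ((y - x) * (d x * g x)) ((k y - k x) * g x) => v w.
lra.
Qed.

Lemma Int_dat f g : continuous g -> (forall x y : R, x <= y -> f y - f x = Int g x y) ->
  forall x : R, dat f x (g x).
Proof.
move=> cg fg x; have lg := locint_cont cg.
have E y : prim g y + f 0 = f y.
  have [y0|y0] := leP 0 y; first by rewrite primE// -fg//; ring.
  have := fg _ _ (ltW y0); have := primB lg (ltW y0); rewrite prim0; lra.
have := datD (prim_dat cg x) (dat_cst (f 0) x); rewrite addr0.
by apply: (dat_near ltr01).
Qed.

Lemma udat_sub (a b a' b' : R) (F : R -> R -> R) t (F' : R -> R) : a <= a' -> b' <= b -> udat a b F t F' -> udat a' b' F t F'.
Proof.
move=> aa bb H e e0; have [d d0 Hd] := H e e0; exists d => // h hd x /andP[x1 x2].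
by apply: Hd => //; apply/andP; split; [exact: le_trans x1|exact: le_trans bb].
Qed.

Lemma udat_ext a b (F G : R -> R -> R) t (F' G' : R -> R) : (forall t x, F t x = G t x) -> (forall x, F' x = G' x) ->
  udat a b F t F' -> udat a b G t G'.
Proof.
move=> FG FG' H e e0; have [d d0 Hd] := H e e0; exists d => // h hd x xab.
by rewrite -!FG -FG'; exact: Hd.
Qed.

End Calculus.

Section Energy.
Context {R : realType}.
Variables (al be : R -> R).
Hypotheses (cal : continuous al) (cbe : continuous be).
Hypotheses (al0 : forall x, 0 < al x) (be0 : forall x, 0 < be x).
Implicit Types (f g v s phi mu : R -> R) (a b x : R).

(* With [v] and [s] the time derivatives of the two unknowns: [phi] times the energy
   density plus [mu] times a cross term. *)
Definition rho phi mu v s x :=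
  1 / 2 * (phi x * (s x ^+ 2 / al x + be x * v x ^+ 2)) + be x * mu x * (v x * s x).

Definition rho' phi mu v s v' s' x :=
  phi x * (s x * s' x / al x + be x * (v x * v' x)) + be x * mu x * (v' x * s x + v x * s' x).

Definition flux phi mu v s x :=
  phi x * (v x * s x) + 1 / 2 * (mu x * s x ^+ 2) + 1 / 2 * (mu x * al x * be x * v x ^+ 2).

Lemma contM f g : continuous f -> continuous g -> continuous (fun x : R => f x * g x : R).
Proof. by move=> cf cg x; apply: cvgM; [exact: cf|exact: cg]. Qed.

Lemma contD f g : continuous f -> continuous g -> continuous (fun x : R => f x + g x : R).
Proof. by move=> cf cg x; apply: cvgD; [exact: cf|exact: cg]. Qed.

Lemma contZ (c : R) f : continuous f -> continuous (fun x : R => c * f x : R).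
Proof. by move=> cf; apply: contM => // x; exact: cvg_cst. Qed.

Lemma contV f : continuous f -> (forall x : R, 0 < f x) -> continuous (fun x : R => (f x)^-1 : R).
Proof. by move=> cf f0 x; apply: cvgV; [rewrite gt_eqF|exact: cf]. Qed.

Lemma contX2 f : continuous f -> continuous (fun x : R => f x ^+ 2 : R).
Proof. by move=> cf; rewrite (_ : (fun x => _) = (fun x => f x * f x)) //; exact: contM. Qed.

Lemma rho_cont phi mu v s : continuous phi -> continuous mu -> continuous v ->
  continuous s -> continuous (rho phi mu v s).
Proof.
move=> *; apply: contD; first apply: contZ; repeat (first [apply: contM|apply: contD|apply: contX2|apply: contV|by []]).
Qed.

Lemma rho'_cont phi mu v s v' s' : continuous phi -> continuous mu -> continuous v ->
  continuous s -> continuous v' -> continuous s' -> continuous (rho' phi mu v s v' s').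
Proof.
move=> *; repeat (first [apply: contM|apply: contD|apply: contX2|apply: contV|by []]).
Qed.

Lemma flux_ineq phi mu phi' mu' d v s v' s' (La a b : R) : a <= b ->
  continuous phi' -> continuous mu' -> continuous d -> continuous v' -> continuous s' ->
  (forall x, dat phi x (phi' x)) -> (forall x, dat mu x (mu' x)) ->
  (forall x, dat v x (s' x / al x)) -> (forall x, dat s x (be x * v' x)) ->
  (forall e : R, 0 < e -> exists2 r : R, 0 < r & forall x y, a <= x -> x <= y -> y <= b ->
     y - x < r -> (y - x) * (d x - e) <= mu y * al y * be y - mu x * al x * be x) ->
  (forall x, a <= x <= b -> forall v s,
     La * rho phi mu v s x <= phi' x * (v x * s x) + 1 / 2 * (mu' x * s x ^+ 2)
       + 1 / 2 * (d x * v x ^+ 2)) ->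
  Int (rho' phi mu v s v' s') a b + La * Int (rho phi mu v s) a b <=
  flux phi mu v s b - flux phi mu v s a.
Proof.
move=> ab cp' cm' cd cv' cs' dp dm dv ds grow quad.
have cont f l : (forall x : R, dat f x (l x)) -> continuous f.
  by move=> fl; apply: cont_ed => t; exact: dat_cont (fl t).
have cp := cont _ _ dp; have cm := cont _ _ dm.
have cv := cont _ _ dv; have cs := cont _ _ ds.
pose vx x := s' x / al x; pose sx x := be x * v' x.
have cvx : continuous vx by apply: contM => //; exact: contV.
have csx : continuous sx by exact: contM.
pose G x := phi x * (v x * s x) + 1 / 2 * (mu x * (s x * s x)).
pose G' x := phi x * (v x * sx x + s x * vx x) + v x * s x * phi' x
  + 1 / 2 * (mu x * (s x * sx x + s x * sx x) + s x * s x * mu' x).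
have dG x : dat G x (G' x).
  apply: datD.
    apply: datM => //; exact: datM.
  apply: datZ; apply: datM => //; exact: datM.
have cG' : continuous G'.
  by rewrite /G' /sx /vx; repeat (first [apply: contZ|apply: contM|apply: contD|apply: contV|by []]).
have EG := prim_unique cG' dG ab.
pose k x := mu x * al x * be x.
have ck : continuous k by apply: contM => //; exact: contM.
pose g x := v x * v x; pose g' x := v x * vx x + v x * vx x.
have dg x : dat g x (g' x) by exact: datM.
have cg' : continuous g' by apply: contD; exact: contM.
have cg : continuous g by exact: contM.
have g0 x : 0 <= g x by rewrite /g -expr2 sqr_ge0.
have H := growth_parts ab ck cd cg' dg g0 grow.
have cr := rho_cont cp cm cv cs.
have cr' := rho'_cont cp cm cv cs cv' cs'.
have lkg : locint (fun x => k x * g' x) by apply: locint_cont; exact: contM.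
have ldg : locint (fun x => d x * g x) by apply: locint_cont; exact: contM.
have lG' := locint_cont cG'.
have : Int (rho' phi mu v s v' s') a b + La * Int (rho phi mu v s) a b <=
  Int G' a b + 1 / 2 * (Int (fun x => k x * g' x) a b + Int (fun x => d x * g x) a b).
  have lr := locint_cont cr; have lr' := locint_cont cr'.
  rewrite -(IntZ La a b lr) -(IntD a b lr' (locintZ La lr)).
  rewrite -(IntD a b lkg ldg) -(IntZ (1 / 2) a b (locintD lkg ldg)).
  rewrite -(IntD a b lG' (locintZ (1 / 2) (locintD lkg ldg))).
  apply: le_Int.
  - by apply: locintD => //; exact: locintZ.
  - by apply: locintD => //; apply: locintZ; exact: locintD.
  move=> x xab; have Q := quad x xab v s.
  apply: (@le_trans _ _ (rho' phi mu v s v' s' x + (phi' x * (v x * s x) + 1 / 2 * (mu' x * s x ^+ 2)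
       + 1 / 2 * (d x * v x ^+ 2)))); first by rewrite lerD2l.
  rewrite le_eqVlt; apply/orP; left; apply/eqP.
  by rewrite /rho' /G' /k /g' /g /vx /sx; field; rewrite gt_eqF.
move=> /le_trans; apply.
rewrite -EG /flux /G; move: H; rewrite /k /g; lra.
Qed.

Lemma rho_bounds phi mu v s (Phi : R) x : phi x <= Phi -> 1 / 2 <= phi x ->
  al x * be x * mu x ^+ 2 <= phi x ^+ 2 - 1 / 4 ->
  1 / (16 * Phi) * (s x ^+ 2 / al x + be x * v x ^+ 2) <= rho phi mu v s x /\
  rho phi mu v s x <= Phi * (s x ^+ 2 / al x + be x * v x ^+ 2).
Proof.
move=> pP p0 H; rewrite /rho.
have A := al0 x; have B := be0 x.
set q := s x ^+ 2 / al x + be x * v x ^+ 2.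
set r := Num.sqrt (al x * be x * mu x ^+ 2).
have r0 : 0 <= r by exact: sqrtr_ge0.
have r2 : r ^+ 2 = al x * be x * mu x ^+ 2.
  by rewrite sqr_sqrtr// mulr_ge0 ?sqr_ge0// ltW// mulr_gt0.
have q0 : 0 <= q.
  by apply: addr_ge0; [apply: divr_ge0|apply: mulr_ge0]; rewrite ?sqr_ge0//; exact: ltW.
have cross : `|be x * mu x * (v x * s x)| <= r * (q / 2).
  rewrite -(@ler_pXn2r _ 2)// ?nnegrE ?mulr_ge0 ?divr_ge0// -normrX ger0_norm ?sqr_ge0//.
  rewrite exprMn [leRHS]exprMn r2.
  have -> : (be x * mu x) ^+ 2 * (v x * s x) ^+ 2 =
     al x * be x * mu x ^+ 2 * ((be x * v x ^+ 2) * (s x ^+ 2 / al x)).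
    by field; rewrite gt_eqF.
  apply: ler_wpM2l; first by rewrite mulr_ge0 ?sqr_ge0// ltW// mulr_gt0.
  rewrite /q; set p1 := be x * _; set p2 := s x ^+ 2 / _.
  have := sqr_ge0 (p1 - p2); lra.
have rp : r <= phi x - 1 / (8 * Phi).
  have P0 : 0 < Phi by lra.
  have H1 : (phi x - r) * (phi x + r) >= 1 / 4.
    by rewrite -subr_sqr r2; lra.
  have rp : r < phi x by nra.
  have H2 : (phi x - r) * (2 * Phi) >= 1 / 4 by nra.
  have : 1 / (8 * Phi) = (1 / 4) / (2 * Phi) by field; rewrite gt_eqF.
  have : (1 / 4) / (2 * Phi) <= phi x - r by rewrite ler_pdivrMr ?mulr_gt0.
  lra.
have /ler_normlP[c1 c2] := cross.
have E : 1 / (16 * Phi) * q = 1 / (8 * Phi) * (q / 2) by field; rewrite gt_eqF//; lra.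
have iP : 0 < 1 / (8 * Phi) by rewrite divr_gt0// mulr_gt0//; lra.
have rq : r * (q / 2) <= (phi x - 1 / (8 * Phi)) * (q / 2) by apply: ler_wpM2r => //; rewrite divr_ge0.
split; first by rewrite E; lra.
have : phi x * q <= Phi * q by exact: ler_wpM2r.
have : 0 <= 1 / (8 * Phi) * (q / 2) by apply: mulr_ge0; [exact: ltW|exact: divr_ge0].
lra.
Qed.

End Energy.

(** * Lyapunov functional for smooth-in-time solutions *)

Section Lyapunov.
Context {R : realType}.
Variables (al be : R -> R) (m M Lp a0 b0 A0 B0 : R).
Implicit Types (F G V S : R -> R -> R) (phi mu f g : R -> R) (a b t : R).
Hypotheses (m0 : 0 < m) (M1 : 1 <= M) (Lp0 : 0 <= Lp) (ab0 : a0 <= b0).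
Hypotheses (cal : continuous al) (cbe : continuous be).
Hypotheses (al_lo : forall x, m <= al x) (be_lo : forall x, m <= be x).
Hypotheses (al_up : forall x, al x <= M) (be_up : forall x, be x <= M).
Hypotheses (al_lip : forall x y, x <= y -> `|al y - al x| <= Lp * (y - x)).
Hypotheses (be_lip : forall x y, x <= y -> `|be y - be x| <= Lp * (y - x)).
Hypotheses (al_out : forall x, ~ (a0 < x < b0) -> al x = A0).
Hypotheses (be_out : forall x, ~ (a0 < x < b0) -> be x = B0).

Let al0 x : 0 < al x. Proof. exact: lt_le_trans m0 (al_lo x). Qed.
Let be0 x : 0 < be x. Proof. exact: lt_le_trans m0 (be_lo x). Qed.
Let M0 : 0 < M. Proof. exact: lt_le_trans M1. Qed.
Let A00 : 0 < A0. Proof. by rewrite -(al_out (x := a0)) ?al0// => /andP[]; rewrite ltxx. Qed.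
Let B00 : 0 < B0. Proof. by rewrite -(be_out (x := a0)) ?be0// => /andP[]; rewrite ltxx. Qed.

Definition impedance := Num.sqrt (A0 * B0).
Local Notation Z0 := impedance.

Let Z00 : 0 < Z0. Proof. by rewrite sqrtr_gt0 mulr_gt0. Qed.
Let Z02 : Z0 ^+ 2 = A0 * B0. Proof. by rewrite sqr_sqrtr// ltW// mulr_gt0. Qed.
Let Z0M : Z0 <= M.
Proof.
rewrite -(@ler_pXn2r _ 2)// ?nnegrE ?(ltW Z00) ?(ltW M0)// Z02 expr2.
have hA : A0 <= M by rewrite -(al_out (x := a0)) ?al_up// => /andP[]; rewrite ltxx.
have hB : B0 <= M by rewrite -(be_out (x := a0)) ?be_up// => /andP[]; rewrite ltxx.
by apply: ler_pM => //; exact: ltW.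
Qed.

Let del := 1 / (2 * M).
Let K1 := 2 * Lp * M / m ^+ 2.
Let K := K1 + 2.
Let mumin := del * expR (- (K * (b0 - a0))).

Definition decay_rate := mumin * (Num.min 1 (m ^+ 2) / (1 / m + M + 1)).
Local Notation La := decay_rate.

Let del0 : 0 < del. Proof. by rewrite divr_gt0// mulr_gt0. Qed.
Let K10 : 0 <= K1. Proof. by rewrite divr_ge0 ?sqr_ge0// mulr_ge0 ?(ltW M0)// mulr_ge0. Qed.
Let K0 : 0 <= K. Proof. by rewrite /K addr_ge0. Qed.
Let K1K : 1 <= K. Proof. by rewrite /K -lerBlDr; apply: le_trans K10; rewrite subr_le0 ler1n. Qed.
Let mumin0 : 0 < mumin. Proof. by rewrite mulr_gt0// expR_gt0. Qed.
Let muminle : mumin <= del.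
Proof.
rewrite ler_piMr ?(ltW del0)// -expR0 ler_expR oppr_le0 mulr_ge0 ?subr_ge0//.
Qed.
Let delM : del * M = 1 / 2. Proof. by rewrite /del; field; rewrite gt_eqF. Qed.

Lemma decay_rate_gt0 : 0 < La.
Proof.
rewrite mulr_gt0// divr_gt0// ?lt_min ?ltr01 ?exprn_gt0//.
have : 0 < 1 / m by rewrite divr_gt0.
by have := M0; lra.
Qed.

Let kap := La * B0 / Z0.

(* Outside [[a0, b0]] the weights are hyperbolic functions; there they satisfy the
   growth conditions with equality, so that the decay rate does not depend on the
   size of the interval. *)
Definition oweight (c1 c2 x0 B x : R) : R :=
  c1 * expR (kap * (x - x0)) * (1 + B * Z0) + c2 * expR (- kap * (x - x0)) * (1 - B * Z0).
Definition phiO := oweight (1 / 2) (1 / 2).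
Definition muO := oweight (1 / (2 * Z0)) (- (1 / (2 * Z0))).

Let expdat (k x0 x : R) : dat (fun x => expR (k * (x - x0))) x (k * expR (k * (x - x0))).
Proof.
rewrite mulrC; apply: (dat_comp (f := expR) (g := fun x => k * (x - x0))).
  by apply/is_derive_dat; exact: is_derive_expR.
by apply: (@dat_near _ (fun y => k * y + - (k * x0)) _ _ _ 1) => // [y _|]; [ring|exact: dat_aff].
Qed.

Let odat c1 c2 x0 B x : dat (oweight c1 c2 x0 B) x (oweight (kap * c1) (- kap * c2) x0 B x).
Proof.
have := datD (datZ (c1 * (1 + B * Z0)) (expdat kap x0 x)) (datZ (c2 * (1 - B * Z0)) (expdat (- kap) x0 x)).
rewrite (_ : _ + _ = oweight (kap * c1) (- kap * c2) x0 B x); last by rewrite /oweight; ring.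
by apply: dat_near ltr01 _ => y _; rewrite /oweight; ring.
Qed.

Let kapZ : kap * Z0 = La * B0. Proof. by rewrite /kap divfK// gt_eqF. Qed.

Lemma phiO_dat x0 B x : dat (phiO x0 B) x (La * B0 * muO x0 B x).
Proof.
have := odat (1 / 2) (1 / 2) x0 B x; rewrite (_ : oweight _ _ _ _ _ = La * B0 * muO x0 B x)//.
by rewrite -kapZ /muO /oweight; field; rewrite gt_eqF.
Qed.

Lemma muO_dat x0 B x : dat (muO x0 B) x (La / A0 * phiO x0 B x).
Proof.
have := odat (1 / (2 * Z0)) (- (1 / (2 * Z0))) x0 B x.
rewrite (_ : oweight _ _ _ _ _ = La / A0 * phiO x0 B x)//.
have -> : La / A0 = kap / Z0.
  rewrite /kap -mulrA -invfM -expr2 Z02; field; rewrite !gt_eqF//.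
by rewrite /phiO /oweight; field; rewrite gt_eqF.
Qed.

Let contO f l : (forall x : R, dat f x (l x)) -> continuous f.
Proof. by move=> fl; apply: cont_ed => t; exact: dat_cont (fl t). Qed.

Lemma phiO_cont x0 B : continuous (phiO x0 B).
Proof. exact: contO (phiO_dat x0 B). Qed.
Lemma muO_cont x0 B : continuous (muO x0 B).
Proof. exact: contO (muO_dat x0 B). Qed.

Lemma phimuO x0 B x : phiO x0 B x ^+ 2 - A0 * B0 * muO x0 B x ^+ 2 = 1 - B ^+ 2 * A0 * B0.
Proof.
rewrite -[B ^+ 2 * A0 * B0]mulrA -!Z02 /phiO /muO /oweight mulNr expRN.
have := expR_gt0 (kap * (x - x0)); set E := expR _ => E0.
by field; rewrite !gt_eqF.
Qed.

Lemma phimuO_pm x0 B x : 0 <= B -> B <= del ->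
  0 <= phiO x0 B x - muO x0 B x * Z0 /\ 0 <= phiO x0 B x + muO x0 B x * Z0.
Proof.
move=> B0' Bd.
have BZ : B * Z0 <= 1 / 2 by rewrite -delM; apply: ler_pM => //; exact: ltW.
have BZ0 : 0 <= B * Z0 by rewrite mulr_ge0// ltW.
have -> : phiO x0 B x - muO x0 B x * Z0 = expR (- kap * (x - x0)) * (1 - B * Z0).
  by rewrite /phiO /muO /oweight; field; rewrite gt_eqF.
have -> : phiO x0 B x + muO x0 B x * Z0 = expR (kap * (x - x0)) * (1 + B * Z0).
  by rewrite /phiO /muO /oweight; field; rewrite gt_eqF.
by split; rewrite mulr_ge0 ?expR_ge0//; lra.
Qed.

Lemma weightO_ok x0 B x : 0 <= B -> B <= del ->
  1 / 2 <= phiO x0 B x /\ A0 * B0 * muO x0 B x ^+ 2 <= phiO x0 B x ^+ 2 - 1 / 4.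
Proof.
move=> B0' Bd.
have [p1 p2] := phimuO_pm x0 x B0' Bd.
have H := phimuO x0 B x.
have B2 : B ^+ 2 * A0 * B0 <= 1 / 4.
  rewrite -mulrA -Z02 -exprMn.
  have BZ : B * Z0 <= 1 / 2 by rewrite -delM; apply: ler_pM => //; exact: ltW.
  have BZ0 : 0 <= B * Z0 by rewrite mulr_ge0// ltW.
  by nra.
have q0 : 0 <= A0 * B0 * muO x0 B x ^+ 2 by rewrite mulr_ge0 ?sqr_ge0// mulr_ge0// ltW.
have pp : 0 <= phiO x0 B x by lra.
split; last by lra.
by move: (phiO x0 B x) H pp => p H pp; nra.
Qed.

(* Inside, [phi = 1] and [mu] grows fast enough to beat the oscillation of [al * be]. *)
Definition muI x := del * expR (K * (x - b0)).

Let muI_dat x : dat muI x (K * muI x).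
Proof. by rewrite mulrCA; apply: datZ; exact: expdat. Qed.

Let muI_range x : a0 <= x <= b0 -> mumin <= muI x <= del.
Proof.
move=> /andP[ax xb]; 
apply/andP; split.
  rewrite /muI /mumin ler_pM2l// ler_expR -mulrN ler_wpM2l//; lra.
by rewrite /muI ler_piMr ?(ltW del0)// -expR0 ler_expR mulr_ge0_le0//; lra.
Qed.

Lemma quad_inner x : a0 <= x <= b0 -> forall v s : R -> R,
  La * rho al be (fun=> 1) muI v s x <= 0 * (v x * s x)
    + 1 / 2 * (K * muI x * s x ^+ 2)
    + 1 / 2 * (muI x * al x * be x * v x ^+ 2).
Proof.
move=> xab v s; have /andP[m1 m2] := muI_range xab.
have A1 := al_lo x; have A2 := al_up x; have B1 := be_lo x; have B2 := be_up x.
have Am := al0 x; have Bm := be0 x.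
have La0 := decay_rate_gt0.
rewrite /rho mul0r add0r [1 * (_ + _)]mul1r.
set S := s x ^+ 2; set V := v x ^+ 2.
have S0 : 0 <= S by exact: sqr_ge0.
have V0 : 0 <= V by exact: sqr_ge0.
have mu0 : 0 < muI x by exact: lt_le_trans mumin0 m1.
have Mmu : be x * muI x <= 1 / 2.
  by rewrite -delM mulrC; apply: ler_pM => //; exact: ltW.
have cross : be x * muI x * (v x * s x) <= 1 / 2 * (1 / 2 * (S + V)).
  have h1 : v x * s x <= 1 / 2 * (S + V) by have := sqr_ge0 (v x - s x); rewrite /S /V sqrrB; lra.
  apply: le_trans (ler_wpM2l _ h1) _; first by rewrite mulr_ge0// ltW.
  by apply: ler_wpM2r => //; rewrite mulr_ge0// addr_ge0.
have iA : S / al x <= S * (1 / m).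
  by rewrite ler_wpM2l// mul1r lef_pV2 ?posrE.
have iB : be x * V <= M * V by exact: ler_wpM2r.
have im : 0 < 1 / m by rewrite divr_gt0.
have up : 1 / 2 * (S / al x + be x * V) + be x * muI x * (v x * s x) <=
   1 / 2 * (1 / m + M + 1) * (S + V).
  have : 0 <= 1 / m * V by rewrite mulr_ge0// ltW.
  have : 0 <= M * S by rewrite mulr_ge0// ltW.
  move: cross iA iB; rewrite mulrDr; move: (S / al x) (be x * V) (be x * muI x * _) => p q r.
  lra.
apply: le_trans (ler_wpM2l (ltW La0) up) _.
have N0 : 0 < 1 / m + M + 1 by have := M0; lra.
have -> : La * (1 / 2 * (1 / m + M + 1) * (S + V)) =
    1 / 2 * (mumin * Num.min 1 (m ^+ 2) * (S + V)).
  by rewrite /decay_rate; move: N0; set N := 1 / m + M + 1 => N0; field; rewrite gt_eqF.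
have mn1 : Num.min 1 (m ^+ 2) <= 1 by rewrite ge_min lexx.
have mn2 : Num.min 1 (m ^+ 2) <= m ^+ 2 by rewrite ge_min lexx orbT.
have mn0 : 0 <= Num.min 1 (m ^+ 2) by rewrite le_min ler01 sqr_ge0.
rewrite -mulrDr ler_pM2l// mulrDr; apply: lerD; apply: ler_wpM2r => //.
  rewrite mulrC; apply: ler_pM => //; first exact: ltW.
  exact: le_trans mn1 _.
rewrite -mulrA; apply: ler_pM => //; first exact: ltW.
apply: le_trans mn2 _; rewrite expr2; apply: ler_pM => //; exact: ltW.
Qed.

Lemma growth_inner (e : R) : 0 < e -> exists2 r : R, 0 < r & forall x y : R,
  a0 <= x -> x <= y -> y <= b0 -> y - x < r ->
  (y - x) * (muI x * al x * be x - e) <= muI y * al y * be y - muI x * al x * be x.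
Proof.
move=> e0; have KK : 0 < K * K1 + 1 by have : 0 <= K * K1 by [exact: mulr_ge0]; lra.
exists (1 / (K * K1 + 1)); first by rewrite divr_gt0.
move=> x y ax xy yb; rewrite ltr_pdivlMr// => yx.
set h := y - x in yx *.
have h0 : 0 <= h by rewrite subr_ge0.
have A1 := al_lo x; have A2 := al_up x; have B1 := be_lo x; have B2 := be_up x.
have A3 := al_up y; have B3 := be_up y; have A4 := al_lo y; have B4 := be_lo y.
have m2 : 0 < m ^+ 2 by rewrite exprn_gt0.
have abm : m ^+ 2 <= al x * be x by rewrite expr2; apply: ler_pM => //; exact: ltW.
have mu0 : 0 < muI x by rewrite mulr_gt0// expR_gt0.
have ab1 : al x * be x * (1 - K1 * h) <= al y * be y.
  have := al_lip xy; have := be_lip xy; rewrite -/h => /ler_normlP[l1 _] /ler_normlP[l2 _].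
  have d1 : al x * be x - al y * be y <= 2 * Lp * M * h.
    have -> : al x * be x - al y * be y = al x * (be x - be y) + (al x - al y) * be y by ring.
    have Lh : 0 <= Lp * h by rewrite mulr_ge0.
    have t1 : al x * (be x - be y) <= M * (Lp * h).
      apply: le_trans (ler_wpM2l (ltW (al0 x)) (_ : be x - be y <= Lp * h)) _; first by move: l1; rewrite opprB.
      exact: ler_wpM2r.
    have t2 : (al x - al y) * be y <= Lp * h * M.
      apply: le_trans (ler_wpM2r (ltW (be0 y)) (_ : al x - al y <= Lp * h)) _; first by move: l2; rewrite opprB.
      exact: ler_wpM2l.
    by apply: le_trans (lerD t1 t2) _; rewrite le_eqVlt; apply/orP; left; apply/eqP; ring.
  have : 2 * Lp * M * h <= al x * be x * (K1 * h).
    have -> : 2 * Lp * M * h = m ^+ 2 * (K1 * h) by rewrite /K1; field; rewrite gt_eqF.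
    by apply: ler_wpM2r => //; rewrite mulr_ge0.
  have -> : al x * be x * (1 - K1 * h) = al x * be x - al x * be x * (K1 * h) by ring.
  lra.
have mu1 : muI x * (1 + K * h) <= muI y.
  have -> : muI y = muI x * expR (K * h).
    by rewrite /muI -mulrA -expRD; congr (_ * expR _); rewrite /h; ring.
  by apply: ler_wpM2l; [exact: ltW|exact: expR_ge1Dx].
have K10h : 0 <= 1 - K1 * h.
  have : K1 * h <= (K * K1 + 1) * h by apply: ler_wpM2r => //; have := mulr_ge0 K10 K10; rewrite /K; nra.
  by move: yx; rewrite mulrC; lra.
have step : muI x * (al x * be x) * (1 + h) <= muI y * (al y * be y).
  have ab0' : 0 <= al x * be x by rewrite mulr_ge0// ltW.
  apply: (@le_trans _ _ ((muI x * (1 + K * h)) * (al x * be x * (1 - K1 * h)))).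
    have -> : (muI x * (1 + K * h)) * (al x * be x * (1 - K1 * h)) =
       muI x * (al x * be x) * ((1 + K * h) * (1 - K1 * h)) by ring.
    apply: ler_wpM2l; first by rewrite mulr_ge0// ltW.
    have hh : K * K1 * h <= 1.
      have -> : K * K1 * h = h * (K * K1 + 1) - h by ring.
      by rewrite lerBlDr; apply: le_trans (ltW yx) _; rewrite lerDl.
    have -> : (1 + K * h) * (1 - K1 * h) = 1 + h + (h - (K * K1 * h) * h) by rewrite /K; ring.
    by rewrite lerDl subr_ge0; exact: ler_piMl.
  apply: ler_pM => //; rewrite mulr_ge0//; first exact: ltW.
  by rewrite addr_ge0// mulr_ge0.
have he : 0 <= h * e by rewrite mulr_ge0// ltW.
have -> : h * (muI x * al x * be x - e) = muI x * (al x * be x) * (1 + h) - muI x * (al x * be x) - h * e by ring.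
have -> : muI y * al y * be y - muI x * al x * be x = muI y * (al y * be y) - muI x * (al x * be x) by ring.
apply: (@le_trans _ _ (muI x * (al x * be x) * (1 + h) - muI x * (al x * be x))).
  by rewrite lerBlDr lerDl.
by rewrite lerD2r.
Qed.

Lemma growth_smooth k d a b : continuous d -> (forall x : R, dat k x (d x)) ->
  forall e : R, 0 < e -> exists2 r : R, 0 < r & forall x y : R,
  a <= x -> x <= y -> y <= b -> y - x < r -> (y - x) * (d x - e) <= k y - k x.
Proof.
move=> cd dk e e0; have [r r0 H] := cont_unif a b cd e0.
exists r => // x y ax xy yb yx.
rewrite (prim_unique cd dk xy) mulrC -Int_cst//.
apply: le_Int; [exact: locint_cst|exact: locint_cont|].
move=> s /andP[xs sy].
have := H x s; have -> : a <= x <= b by apply/andP; lra.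
have -> : a <= s <= b by apply/andP; lra.
by rewrite distrC ger0_norm ?subr_ge0// => /(_ erefl erefl); 
  have -> : s - x < r by [lra]; move=> /(_ erefl) /ler_normlP[]; lra.
Qed.

Lemma rho_udat a b phi mu V S (V' S' : R -> R) t : continuous phi -> continuous mu ->
  continuous (V t) -> continuous (S t) -> continuous V' -> continuous S' ->
  udat a b V t V' -> udat a b S t S' ->
  udat a b (fun t => rho al be phi mu (V t) (S t)) t (rho' al be phi mu (V t) (S t) V' S').
Proof.
move=> cp cm cV cS cV' cS' uV uS.
have bV := @cont_bnd _ a b _ cV; have bS := @cont_bnd _ a b _ cS.
have bV' := @cont_bnd _ a b _ cV'; have bS' := @cont_bnd _ a b _ cS'.
have u1 := udatM bS bS bS' bS' uS uS.
have u2 := udatM bV bV bV' bV' uV uV.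
have u3 := udatM bV bS bV' bS' uV uS.
have c1 : continuous (fun x => 1 / 2 * phi x * (al x)^-1).
  by apply: contM; [exact: contZ|exact: contV].
have c2 : continuous (fun x => 1 / 2 * phi x * be x) by apply: contM => //; exact: contZ.
have c3 : continuous (fun x => be x * mu x) by exact: contM.
have := udatD (udatD (udatZ (@cont_bnd _ a b _ c1) u1) (udatZ (@cont_bnd _ a b _ c2) u2))
  (udatZ (@cont_bnd _ a b _ c3) u3).
apply: udat_ext => [s x|x]; rewrite /rho /rho'; field; by rewrite gt_eqF.
Qed.

Theorem decay_C1 a b : a <= a0 -> b0 <= b -> exists2 C : R, 0 < C &
  forall V S V' S' : R -> R -> R,
  (forall t, continuous (V t)) -> (forall t, continuous (S t)) ->
  (forall t, continuous (V' t)) -> (forall t, continuous (S' t)) ->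
  (forall t, 0 < t -> forall x y, x <= y -> V t y - V t x = Int (fun s => S' t s / al s) x y) ->
  (forall t, 0 < t -> forall x y, x <= y -> S t y - S t x = Int (fun s => be s * V' t s) x y) ->
  (forall t, 0 < t -> udat a b V t (V' t)) -> (forall t, 0 < t -> udat a b S t (S' t)) ->
  (forall t, 0 < t -> S t b = - (Z0 * V t b)) ->
  (forall t, 0 < t -> S t a = Z0 * V t a) ->
  forall T1 T, 0 < T1 -> T1 <= T ->
    Int (fun x => V T x ^+ 2 + S T x ^+ 2) a b <=
    C * expR (- (La * (T - T1))) * Int (fun x => V T1 x ^+ 2 + S T1 x ^+ 2) a b.
Proof.
move=> aa bb.
have d0 := ltW mumin0; have d1 := ltW del0.
have [P1 HP1] := cont_bounded (@phiO_cont a0 mumin) a b.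
have [P2 HP2] := cont_bounded (@phiO_cont b0 del) a b.
pose Phi := `|P1| + `|P2| + 1.
have Phi1 : 1 <= Phi by rewrite /Phi lerDr addr_ge0.
have Phi0 : 0 < Phi by exact: lt_le_trans Phi1.
have PL x : a <= x <= b -> phiO a0 mumin x <= Phi.
  move=> /HP1 h; apply: le_trans (ler_norm _) _; apply: le_trans h _.
  by apply: le_trans (ler_norm _) _; rewrite /Phi -addrA lerDl addr_ge0.
have PR x : a <= x <= b -> phiO b0 del x <= Phi.
  move=> /HP2 h; apply: le_trans (ler_norm _) _; apply: le_trans h _.
  by apply: le_trans (ler_norm _) _; rewrite /Phi addrAC lerDr addr_ge0.
pose cl := Num.min m (1 / M).
have cl0 : 0 < cl by rewrite lt_min m0 divr_gt0.
pose cu := M + 1 / m.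
have im : 0 < 1 / m by rewrite divr_gt0.
have cu0 : 0 < cu by rewrite addr_gt0.
pose lo := 1 / (16 * Phi) * cl.
have lo0 : 0 < lo by rewrite mulr_gt0// divr_gt0// mulr_gt0.
pose up := Phi * cu.
have up0 : 0 < up by rewrite mulr_gt0.
have bounds phi mu v s x : phi x <= Phi -> 1 / 2 <= phi x ->
  al x * be x * mu x ^+ 2 <= phi x ^+ 2 - 1 / 4 ->
  lo * (v x ^+ 2 + s x ^+ 2) <= rho al be phi mu v s x /\ rho al be phi mu v s x <= up * (v x ^+ 2 + s x ^+ 2).
  move=> h1 h2 h3; have [r1 r2] := rho_bounds al0 be0 v s h1 h2 h3.
  have A1 := al_lo x; have A2 := al_up x; have B1 := be_lo x; have B2 := be_up x.
  have s2 := sqr_ge0 (s x); have v2 := sqr_ge0 (v x).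
  have cl1 : cl <= m by rewrite ge_min lexx.
  have cl2 : cl <= 1 / M by rewrite ge_min lexx orbT.
  have i1 : cl * s x ^+ 2 <= s x ^+ 2 / al x.
    rewrite mulrC; apply: ler_wpM2l => //; apply: le_trans cl2 _.
    by rewrite mul1r lef_pV2 ?posrE.
  have i2 : cl * v x ^+ 2 <= be x * v x ^+ 2 by apply: ler_wpM2r => //; exact: le_trans cl1 _.
  have i3 : s x ^+ 2 / al x <= 1 / m * s x ^+ 2.
    by rewrite mulrC; apply: ler_wpM2r => //; rewrite mul1r lef_pV2 ?posrE.
  have i4 : be x * v x ^+ 2 <= M * v x ^+ 2 by exact: ler_wpM2r.
  split.
    apply: le_trans r1; rewrite /lo -mulrA; apply: ler_wpM2l.
      by rewrite divr_ge0// mulr_ge0// ltW.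
    by rewrite mulrDr addrC; exact: lerD.
  apply: le_trans r2 _; rewrite /up -mulrA; apply: ler_wpM2l; first exact: ltW.
  rewrite addrC; apply: le_trans (lerD i4 i3) _.
  have e1 : 0 <= 1 / m * v x ^+ 2 by rewrite mulr_ge0// ltW.
  have e2 : 0 <= M * s x ^+ 2 by rewrite mulr_ge0// ltW.
  by rewrite /cu mulrDl !mulrDr; move: e1 e2; move: (M * _) (M * _) (1 / m * _) (1 / m * _) => p1 p2 p3 p4; lra.
have outL x : x <= a0 -> al x = A0 /\ be x = B0.
  by move=> h; split; [apply: al_out|apply: be_out]; rewrite ltNge h.
have outR x : b0 <= x -> al x = A0 /\ be x = B0.
  by move=> h; split; [apply: al_out|apply: be_out]; rewrite [x < b0]ltNge h andbF.
exists (lo^-1 * up); first by rewrite mulr_gt0// invr_gt0.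
move=> V S V' S' cVt cSt cV' cS' Vx Sx uV uS bdb bda T1 T T10 T0.
have iac t : continuous (fun s => S' t s / al s) by apply: contM; [exact: cS'|exact: contV].
have ibc t : continuous (fun s => be s * V' t s) by exact: contM.
have dV t : 0 < t -> forall x, dat (V t) x (S' t x / al x).
  by move=> t0 x; exact: (@Int_dat _ (V t) (fun s => S' t s / al s) (iac t) (Vx t t0) x).
have dS t : 0 < t -> forall x, dat (S t) x (be x * V' t x).
  by move=> t0 x; exact: (@Int_dat _ (S t) (fun s => be s * V' t s) (ibc t) (Sx t t0) x).
have muIc : continuous muI by exact: (@contO muI (fun x => K * muI x) muI_dat).
have c1 : continuous ((fun=> 1) : R -> R) by move=> x; exact: cvg_cst.
pose rL t := rho al be (phiO a0 mumin) (muO a0 mumin) (V t) (S t).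
pose rI t := rho al be (fun=> 1) muI (V t) (S t).
pose rR t := rho al be (phiO b0 del) (muO b0 del) (V t) (S t).
pose rL' t := rho' al be (phiO a0 mumin) (muO a0 mumin) (V t) (S t) (V' t) (S' t).
pose rI' t := rho' al be (fun=> 1) muI (V t) (S t) (V' t) (S' t).
pose rR' t := rho' al be (phiO b0 del) (muO b0 del) (V t) (S t) (V' t) (S' t).
have pc := phiO_cont; have mc := muO_cont.
have crho phi mu t : continuous phi -> continuous mu -> locint (rho al be phi mu (V t) (S t)).
  by move=> cp cm; apply: locint_cont; exact: rho_cont.
have crho' phi mu t : continuous phi -> continuous mu ->
   locint (rho' al be phi mu (V t) (S t) (V' t) (S' t)).
  by move=> cp cm; apply: locint_cont; exact: rho'_cont.
pose L t := Int (rL t) a a0 + Int (rI t) a0 b0 + Int (rR t) b0 b.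
pose L' t := Int (rL' t) a a0 + Int (rI' t) a0 b0 + Int (rR' t) b0 b.
have ru phi mu t : 0 < t -> continuous phi -> continuous mu ->
   udat a b (fun t => rho al be phi mu (V t) (S t)) t (rho' al be phi mu (V t) (S t) (V' t) (S' t)).
  by move=> t0 cp cm; apply: rho_udat => //; [exact: uV|exact: uS].
have dL t : 0 < t -> dat L t (L' t).
  move=> t0; apply: datD; [apply: datD|].
  - apply: dat_Int => // [s||]; [exact: crho|exact: crho'|].
    by apply: (udat_sub (lexx a) (le_trans ab0 bb)); exact: ru.
  - apply: dat_Int => // [s||]; [exact: crho|exact: crho'|].
    by apply: (udat_sub aa bb); exact: ru.
  - apply: dat_Int => // [s||]; [exact: crho|exact: crho'|].
    by apply: (udat_sub (le_trans aa ab0) (lexx b)); exact: ru.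
have quadO x0 B x : al x = A0 -> be x = B0 -> forall v s : R -> R,
  La * rho al be (phiO x0 B) (muO x0 B) v s x <=
    La * B0 * muO x0 B x * (v x * s x) + 1 / 2 * (La / A0 * phiO x0 B x * s x ^+ 2)
    + 1 / 2 * (La * B0 * phiO x0 B x * v x ^+ 2).
  move=> E1 E2 v s; rewrite /rho E1 E2 le_eqVlt; apply/orP; left; apply/eqP.
  by field; rewrite gt_eqF.
have growO x0 B a' b' : (forall x, a' <= x <= b' -> al x = A0 /\ be x = B0) ->
  forall e : R, 0 < e -> exists2 r : R, 0 < r & forall x y : R,
  a' <= x -> x <= y -> y <= b' -> y - x < r ->
  (y - x) * (La * B0 * phiO x0 B x - e) <= muO x0 B y * al y * be y - muO x0 B x * al x * be x.
  move=> out e e0.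
  have dk x : dat (fun x => muO x0 B x * A0 * B0) x (La * B0 * phiO x0 B x).
    have := datZ (A0 * B0) (muO_dat x0 B x).
    rewrite (_ : A0 * B0 * (La / A0 * phiO x0 B x) = La * B0 * phiO x0 B x); last by field; rewrite gt_eqF.
    by apply: (dat_near ltr01) => y _; ring.
  have cd : continuous (fun x => La * B0 * phiO x0 B x) by apply: contZ; exact: pc.
  have [r r0 H] := growth_smooth a' b' cd dk e0.
  exists r => // x y ax xy yb yx.
  have [-> ->] := out x (ltac:(by rewrite ax (le_trans xy yb))).
  have [-> ->] := out y (ltac:(by rewrite (le_trans ax xy) yb)).
  exact: H.
have fluxO x0 B a' b' t : 0 < t -> a' <= b' -> (forall x, a' <= x <= b' -> al x = A0 /\ be x = B0) ->
  Int (rho' al be (phiO x0 B) (muO x0 B) (V t) (S t) (V' t) (S' t)) a' b' +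
  La * Int (rho al be (phiO x0 B) (muO x0 B) (V t) (S t)) a' b' <=
  flux al be (phiO x0 B) (muO x0 B) (V t) (S t) b' - flux al be (phiO x0 B) (muO x0 B) (V t) (S t) a'.
  move=> t0 ab' out.
  apply: (@flux_ineq _ al be cal cbe al0 (phiO x0 B) (muO x0 B)
    (fun x => La * B0 * muO x0 B x) (fun x => La / A0 * phiO x0 B x) (fun x => La * B0 * phiO x0 B x)) => //.
  - by apply: contZ; exact: mc.
  - by apply: contZ; exact: pc.
  - by apply: contZ; exact: pc.
  - exact: phiO_dat.
  - exact: muO_dat.
  - exact: dV.
  - exact: dS.
  - exact: growO.
  - by move=> x xab v s; have [h1 h2] := out x xab; exact: quadO.
have lL t : 0 < t -> L' t <= - La * L t.
  move=> t0.
  have FL := @fluxO a0 mumin a a0 t t0 aa (fun x h => outL x (proj2 (andP h))).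
  have FR := @fluxO b0 del b0 b t t0 bb (fun x h => outR x (proj1 (andP h))).
  have FI : Int (rI' t) a0 b0 + La * Int (rI t) a0 b0 <=
     flux al be (fun=> 1) muI (V t) (S t) b0 - flux al be (fun=> 1) muI (V t) (S t) a0.
    apply: (@flux_ineq _ al be cal cbe al0 (fun=> 1) muI (fun=> 0) (fun x => K * muI x)
      (fun x => muI x * al x * be x)) => //.
    - by move=> x; exact: cvg_cst.
    - by apply: contZ.
    - by apply: contM => //; exact: contM.
    - by move=> x; exact: dat_cst.
    - exact: dV.
    - exact: dS.
    - exact: growth_inner.
    - by move=> x xab v s; exact: quad_inner.
  have jb : flux al be (fun=> 1) muI (V t) (S t) b0 = flux al be (phiO b0 del) (muO b0 del) (V t) (S t) b0.
    rewrite /flux /muI /phiO /muO /oweight !subrr !mulr0 expR0.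
    by field; rewrite gt_eqF.
  have ja : flux al be (fun=> 1) muI (V t) (S t) a0 = flux al be (phiO a0 mumin) (muO a0 mumin) (V t) (S t) a0.
    have E : muI a0 = mumin by rewrite /muI /mumin; congr (_ * expR _); ring.
    rewrite /flux E /phiO /muO /oweight !subrr !mulr0 expR0.
    by field; rewrite gt_eqF.
  have [_ p2] := phimuO_pm a0 a d0 muminle.
  have [p3 _] := phimuO_pm b0 b d1 (lexx del).
  have fb : flux al be (phiO b0 del) (muO b0 del) (V t) (S t) b <= 0.
    have [Eb Fb] := outR b bb.
    rewrite /flux Eb Fb (bdb t t0).
    have -> : phiO b0 del b * (V t b * - (Z0 * V t b)) + 1 / 2 * (muO b0 del b * (- (Z0 * V t b)) ^+ 2) +
      1 / 2 * (muO b0 del b * A0 * B0 * V t b ^+ 2) =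
      - (Z0 * V t b ^+ 2 * (phiO b0 del b - muO b0 del b * Z0)).
      by rewrite -[muO b0 del b * A0 * B0]mulrA -Z02; field.
    by rewrite oppr_le0 mulr_ge0// mulr_ge0 ?sqr_ge0// ltW.
  have fa : 0 <= flux al be (phiO a0 mumin) (muO a0 mumin) (V t) (S t) a.
    have [Ea Fa] := outL a aa.
    rewrite /flux Ea Fa (bda t t0).
    have -> : phiO a0 mumin a * (V t a * (Z0 * V t a)) + 1 / 2 * (muO a0 mumin a * (Z0 * V t a) ^+ 2) +
      1 / 2 * (muO a0 mumin a * A0 * B0 * V t a ^+ 2) =
      Z0 * V t a ^+ 2 * (phiO a0 mumin a + muO a0 mumin a * Z0).
      by rewrite -[muO a0 mumin a * A0 * B0]mulrA -Z02; field.
    by rewrite mulr_ge0// mulr_ge0 ?sqr_ge0// ltW.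
  rewrite jb ja in FI.
  have arith (l x1 x2 x3 y1 y2 y3 f1 f2 f3 f4 : R) : x1 + l * y1 <= f2 - f1 ->
    x2 + l * y2 <= f3 - f2 -> x3 + l * y3 <= f4 - f3 -> 0 <= f1 -> f4 <= 0 ->
    x1 + x2 + x3 <= - l * (y1 + y2 + y3).
    by move=> *; rewrite mulNr !mulrDr; lra.
  exact: arith FL FI FR fa fb.
pose E t := Int (fun x => V t x ^+ 2 + S t x ^+ 2) a b.
have lE t : locint (fun x => V t x ^+ 2 + S t x ^+ 2).
  by apply: locint_cont; apply: contD; exact: contX2.
have Esplit t : E t = Int (fun x => V t x ^+ 2 + S t x ^+ 2) a a0
   + Int (fun x => V t x ^+ 2 + S t x ^+ 2) a0 b0 + Int (fun x => V t x ^+ 2 + S t x ^+ 2) b0 b.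
  by rewrite /E (Int_cat (lE t) aa (le_trans ab0 bb)) (Int_cat (lE t) ab0 bb) addrA.
have bL t x : a <= x <= a0 -> lo * (V t x ^+ 2 + S t x ^+ 2) <= rL t x /\ rL t x <= up * (V t x ^+ 2 + S t x ^+ 2).
  move=> /andP[x1 x2]; have [h1 h2] := @weightO_ok a0 mumin x d0 muminle.
  have [Ea Eb] := outL x x2.
  apply: bounds => //; last by rewrite Ea Eb.
  by apply: PL; rewrite x1 (le_trans x2 (le_trans ab0 bb)).
have bR t x : b0 <= x <= b -> lo * (V t x ^+ 2 + S t x ^+ 2) <= rR t x /\ rR t x <= up * (V t x ^+ 2 + S t x ^+ 2).
  move=> /andP[x1 x2]; have [h1 h2] := @weightO_ok b0 del x d1 (lexx del).
  have [Ea Eb] := outR x x1.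
  apply: bounds => //; last by rewrite Ea Eb.
  by apply: PR; rewrite x2 andbT (le_trans (le_trans aa ab0) x1).
have bI t x : a0 <= x <= b0 -> lo * (V t x ^+ 2 + S t x ^+ 2) <= rI t x /\ rI t x <= up * (V t x ^+ 2 + S t x ^+ 2).
  move=> xab; have /andP[m1 m2] := muI_range xab.
  apply: bounds => //.
    by rewrite ler_pdivrMr// mul1r ler1n.
  have mM : muI x * M <= 1 / 2 by rewrite -delM; apply: ler_wpM2r => //; exact: ltW.
  have mu0 : 0 <= muI x by exact: le_trans m1.
  have : al x * be x * muI x ^+ 2 <= (muI x * M) ^+ 2.
    rewrite [leRHS]exprMn [leLHS]mulrC; apply: ler_wpM2l; first exact: sqr_ge0.
    rewrite expr2.
    by apply: ler_pM => //; exact: ltW.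
  have : (muI x * M) ^+ 2 <= (1 / 2) ^+ 2.
    by rewrite ler_pXn2r// nnegrE ?divr_ge0// mulr_ge0// ltW.
  lra.
have lower t : lo * E t <= L t.
  rewrite Esplit !mulrDr -!IntZ//.
  apply: lerD; [apply: lerD|]; (apply: le_Int; [exact: locintZ|exact: crho|]) => x xab.
  - by have [] := bL t x xab.
  - by have [] := bI t x xab.
  - by have [] := bR t x xab.
have upper t : L t <= up * E t.
  rewrite Esplit !mulrDr -!IntZ//.
  apply: lerD; [apply: lerD|]; (apply: le_Int; [exact: crho|exact: locintZ|]) => x xab.
  - by have [] := bL t x xab.
  - by have [] := bI t x xab.
  - by have [] := bR t x xab.
have G := gronwall dL lL T10 T0.
rewrite -/(E T) -/(E T1) -2!mulrA ler_pdivlMl// mulrCA.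
apply: le_trans (lower T) _; apply: le_trans G _.
by apply: ler_wpM2l; [exact: expR_ge0|exact: upper].
Qed.

End Lyapunov.

(** * Averages *)

Section Averages.
Context {R : realType}.
Local Notation mu := (@lebesgue_measure R).
Implicit Types (f g k : R -> R) (a b x y t r : R).

Lemma Int_sqr_le f x y : locint f -> locint (fun s => f s ^+ 2) -> x <= y ->
  Int f x y ^+ 2 <= (y - x) * Int (fun s => f s ^+ 2) x y.
Proof.
move=> lf lf2 xy; have [E|xy'] := eqVneq x y.
  by rewrite E !(Int_ge _ (lexx y)) expr0n mulr0.
have d0 : 0 < y - x by rewrite subr_gt0 lt_neqAle xy'.
pose c := Int f x y / (y - x).
have : 0 <= Int (fun s => (f s - c) ^+ 2) x y by apply: Int_ge0 => s _; exact: sqr_ge0.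
have -> : Int (fun s => (f s - c) ^+ 2) x y =
  Int (fun s => f s ^+ 2) x y - 2 * c * Int f x y + c ^+ 2 * (y - x).
  rewrite -IntZ// -(Int_cst _ xy) -IntB//; last exact: locintZ.
  rewrite -IntD//; [|by apply: locintB => //; exact: locintZ|exact: locint_cst].
  by apply: eq_Int => s _; ring.
rewrite /c => H.
have -> : (y - x) * Int (fun s => f s ^+ 2) x y =
   (y - x) * (Int (fun s => f s ^+ 2) x y - 2 * (Int f x y / (y - x)) * Int f x y
     + (Int f x y / (y - x)) ^+ 2 * (y - x)) + Int f x y ^+ 2.
  by field; rewrite gt_eqF.
by rewrite lerDr mulr_ge0// ltW.
Qed.

Lemma Int_mul_le f g x y : locint (fun s => f s ^+ 2) -> locint (fun s => g s ^+ 2) ->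
  locint (fun s => f s * g s) ->
  Int (fun s => f s * g s) x y <=
  1 / 2 * Int (fun s => f s ^+ 2) x y + 1 / 2 * Int (fun s => g s ^+ 2) x y.
Proof.
move=> lf lg lfg; rewrite -!IntZ// -IntD//; [|exact: locintZ..].
apply: le_Int => //; first by apply: locintD; exact: locintZ.
by move=> s _; have := sqr_ge0 (f s - g s); rewrite sqrrB; lra.
Qed.

Lemma Int_sqr_close f g a b (M e : R) : a <= b -> continuous f -> continuous g ->
  0 <= e -> (forall x, a <= x <= b -> `|g x| <= M) ->
  (forall x, a <= x <= b -> `|f x - g x| <= e) ->
  `|Int (fun x => f x ^+ 2) a b - Int (fun x => g x ^+ 2) a b| <= e * (2 * M + e) * (b - a).
Proof.
move=> ab cf cg e0 gM fg.
have lf := locint_cont (contX2 cf); have lg := locint_cont (contX2 cg).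
rewrite -IntB//; apply: Int_norm_le => //; first exact: locintB.
move=> s sab; have -> : f s ^+ 2 - g s ^+ 2 = (f s - g s) * (2 * g s + (f s - g s)) by ring.
apply: normM_le; first exact: fg.
apply: le_trans (ler_normD _ _) _; apply: lerD; last exact: fg.
by rewrite normrM ger0_norm// ler_pM2l//; exact: gM.
Qed.

Definition avg r f x := Int f x (x + r) / r.

Lemma avg_prim r f x : locint f -> 0 < r -> avg r f x = (prim f (x + r) - prim f x) / r.
Proof. by move=> lf r0; rewrite /avg primB// lerDl ltW. Qed.

Lemma shift_cont r f : continuous f -> continuous (fun x => f (x + r)).
Proof.
move=> cf x; apply: (@continuous_comp _ _ _ (fun x => x + r) f); last exact: cf.
by apply: cvgD; [exact: cvg_id|exact: cvg_cst].
Qed.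

Lemma avg_cont r f : locint f -> 0 < r -> continuous (avg r f).
Proof.
move=> lf r0; have cp := prim_continuous lf.
have -> : avg r f = fun x => r^-1 * (prim f (x + r) + (-1) * prim f x).
  by apply/funext => x; rewrite avg_prim// mulN1r mulrC.
by apply: contZ; apply: contD; [exact: shift_cont|exact: contZ].
Qed.

Lemma avg_contraction r f a b : 0 < r -> a <= b -> continuous f ->
  Int (fun x => avg r f x ^+ 2) a b <= Int (fun x => f x ^+ 2) a (b + r).
Proof.
move=> r0 ab cf; have lf := locint_cont cf.
have cf2 := contX2 cf; have lf2 := locint_cont cf2.
pose Q := prim (fun x => f x ^+ 2).
have cQ : continuous Q by exact: prim_continuous.
have lQ := locint_cont cQ.
have Qmono x y : x <= y -> Q x <= Q y.
  by move=> xy; rewrite -subr_ge0 primB//; apply: Int_ge0 => s _; exact: sqr_ge0.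
pose g x := r^-1 * (Q (x + r) + (-1) * Q x).
have cg : continuous g.
  by apply: contZ; apply: contD; [exact: shift_cont|exact: contZ].
apply: (@le_trans _ _ (Int g a b)).
  apply: le_Int; [exact: locint_cont (contX2 (avg_cont lf r0))|exact: locint_cont|].
  move=> x _; rewrite /avg /g mulN1r primB//; last by rewrite lerDl ltW.
  have xr : x <= x + r by rewrite lerDl ltW.
  have := Int_sqr_le lf lf2 xr; rewrite (_ : x + r - x = r); last by ring.
  rewrite exprMn => H.
  have -> : r^-1 * Int (fun s => f s ^+ 2) x (x + r) =
    (r * Int (fun s => f s ^+ 2) x (x + r)) * r^-1 ^+ 2 by field; rewrite gt_eqF.
  by apply: ler_wpM2r => //; exact: sqr_ge0.
pose H x := r^-1 * (prim Q (x + r) + (-1) * prim Q x).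
have dH x : dat H x (g x).
  apply: datZ; apply: datD; last by apply: datZ; exact: prim_dat.
  rewrite -[Q (x + r)]mulr1.
  apply: (dat_comp (f := prim Q) (g := fun x => x + r)); first exact: prim_dat.
  have := dat_aff 1 r x; apply: (dat_near ltr01) => y _; ring.
rewrite -(prim_unique cg dH ab) /H !mulN1r !primB ?lerDl ?(ltW r0)//.
rewrite -mulrBr ler_pdivrMl//.
have h1 : Int Q b (b + r) <= r * Q (b + r).
  have br : b <= b + r by rewrite lerDl ltW.
  have -> : r * Q (b + r) = Int (fun=> Q (b + r)) b (b + r) by rewrite Int_cst//; ring.
  by apply: le_Int; [|exact: locint_cst|move=> s /andP[_ sb]; exact: Qmono].
have h2 : r * Q a <= Int Q a (a + r).
  have ar : a <= a + r by rewrite lerDl ltW.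
  have -> : r * Q a = Int (fun=> Q a) a (a + r) by rewrite Int_cst//; ring.
  by apply: le_Int; [exact: locint_cst| |move=> s /andP[sa _]; exact: Qmono].
have -> : Int (fun x => f x ^+ 2) a (b + r) = Q (b + r) - Q a.
  by rewrite primB// (le_trans ab)// lerDl ltW.
by rewrite mulrBr; exact: lerB.
Qed.

Lemma avg_cvg f x : Lpt f x -> locint f -> forall e : R, 0 < e -> exists2 d : R, 0 < d &
  forall r, 0 < r -> r < d -> `|avg r f x - f x| <= e.
Proof.
move=> Lf lf e e0; have [d d0 H] := Lf e e0; exists d => // r r0 rd.
have xr : x <= x + r by rewrite lerDl ltW.
have -> : avg r f x - f x = Int (fun s => f s - f x) x (x + r) / r.
  rewrite IntB//; last exact: locint_cst.
  by rewrite Int_cst// /avg; field; rewrite gt_eqF.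
rewrite normrM normfV (gtr0_norm r0) ler_pdivrMr//.
apply: le_trans (H r r0 rd); apply: Int_norm.
by apply: locintB => //; exact: locint_cst.
Qed.

(* Weak lower semicontinuity of the L2 norm: means over short intervals turn weak
   convergence into pointwise convergence, to which Fatou's lemma applies. *)
Lemma sqr_lsc f a b c (B : R) : a <= b -> b < c -> locint f -> 0 <= B ->
  (forall e : R, 0 < e -> exists g, [/\ continuous g,
     Int (fun x => g x ^+ 2) a c <= B + e &
     forall x y, a <= x -> x <= y -> y <= c -> `|Int g x y - Int f x y| <= e]) ->
  (\int[mu]_(x in `[a, b]) (f x ^+ 2)%:E <= B%:E)%E.
Proof.
move=> ab bc lf B0 H.
have avgB r : 0 < r -> b + r <= c -> Int (fun x => avg r f x ^+ 2) a b <= B.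
  move=> r0 brc; apply/ler_addgt0Pl => e e0.
  have cA := avg_cont lf r0.
  have [M HM] := cont_bounded cA a b.
  have M0 : 0 <= M by apply: le_trans (HM a _); rewrite // lexx.
  pose K := (2 * (2 * M + 1) + r ^+ 2 + 2 * r) * (b - a) / r + 2.
  have d0 : 0 <= b - a by rewrite subr_ge0.
  have K0 : 0 < K.
    rewrite ltr_pwDr// divr_ge0 ?(ltW r0)// mulr_ge0//.
    apply: addr_ge0; first by apply: addr_ge0; rewrite ?sqr_ge0// mulr_ge0// addr_ge0// mulr_ge0.
    by rewrite mulr_ge0// ltW.
  pose e' := Num.min r (e / K).
  have e'0 : 0 < e' by rewrite lt_min r0 divr_gt0.
  have e'r : e' <= r by rewrite ge_min lexx.
  have e'K : e' * K <= e by rewrite -ler_pdivlMr// ge_min lexx orbT.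
  clearbody e'.
  have [g [cg gB gf]] := H e' e'0.
  have lg := locint_cont cg.
  have cl x : a <= x <= b -> `|avg r g x - avg r f x| <= e' / r.
    move=> /andP[ax xb]; rewrite /avg -mulrBl normrM normfV (gtr0_norm r0) ler_pM2r ?invr_gt0//.
    apply: gf => //; first by rewrite lerDl ltW.
    by apply: le_trans brc; rewrite lerD2r.
  have er0 : 0 <= e' / r by rewrite divr_ge0 ?(ltW r0)// ltW.
  have := Int_sqr_close ab (avg_cont lg r0) cA er0 HM cl.
  move=> /ler_normlP[h _].
  have h2 := avg_contraction r0 ab cg.
  have h3 : Int (fun x => g x ^+ 2) a (b + r) <= B + e'.
    apply: le_trans gB; apply: le_Int_itv => //; first exact: locint_cont (contX2 cg).
      by move=> s; exact: sqr_ge0.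
    by apply: le_trans ab _; rewrite lerDl ltW.
  have er1 : e' / r <= 1 by rewrite ler_pdivrMr// mul1r.
  have h4 : e' / r * (2 * M + e' / r) * (b - a) <= e' / r * (2 * M + 1) * (b - a).
    by apply: ler_wpM2r => //; apply: ler_wpM2l => //; rewrite lerD2l.
  have h5 : e' / r * (2 * M + 1) * (b - a) + e' <= e' * K.
    have -> : e' * K = e' / r * (2 * M + 1) * (b - a) + e' +
      (e' / r * (2 * M + 1) * (b - a) + e' / r * (r ^+ 2 + 2 * r) * (b - a) + e').
      by rewrite /K; field; rewrite gt_eqF.
    rewrite lerDl; apply: addr_ge0; last exact: ltW.
    apply: addr_ge0; apply: mulr_ge0 => //; apply: mulr_ge0 => //.
      by rewrite addr_ge0// mulr_ge0.
    by rewrite addr_ge0 ?sqr_ge0// mulr_ge0// ltW.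
  move: h h2 h3 h4 h5 e'K.
  move: (e' / r * (2 * M + 1) * (b - a)) (e' / r * (2 * M + e' / r) * (b - a)) (e' * K) => p q s.
  move: (Int _ a b) (Int _ a b) (Int _ a (b + r)) => i1 i2 i3; lra.
pose r0 n : R := (c - b) / n.+1%:R.
have r00 n : 0 < r0 n by rewrite divr_gt0// subr_gt0.
have r0c n : b + r0 n <= c.
  rewrite -lerBrDl ler_pdivrMr// ler_peMr ?ler1n// subr_ge0 ltW//.
pose F n x := ((avg (r0 n) f x) ^+ 2)%:E.
have lF n : locint (fun x => avg (r0 n) f x ^+ 2).
  by apply: locint_cont; apply: contX2; exact: avg_cont.
have FB n : (\int[mu]_(x in `[a, b]) F n x <= B%:E)%E.
  have := avgB _ (r00 n) (r0c n).
  rewrite -lee_fin /Int /Rintegral fineK//.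
  exact: integrable_fin_num (locint_int a b (lF n)).
have mF n : measurable_fun `[a, b] (F n).
  by apply/measurable_EFinP; apply: measurable_funTS; case: (lF n).
have [mf _] := lf.
have Fc : {ae mu, forall x, `[a, b]%classic x -> (f x ^+ 2)%:E = limn_einf (F^~ x)}.
  apply: (aeS (Lpt_ae lf)) => x Lx _.
  have cv : F n x @[n --> \oo] --> (f x ^+ 2)%:E.
    apply: cvg_EFin; first by apply: nearW.
    apply: (@cvg_comp _ _ _ (fun n => avg (r0 n) f x) (fun y => y ^+ 2) _ (nbhs (f x))); last exact: exprn_continuous.
    apply/cvgrPdist_le => e e0.
    have [d d0 Hd] := avg_cvg Lx lf e0.
    have r0c0 : r0 n @[n --> \oo] --> 0.
      rewrite -(mulr0 (c - b)); apply: cvgM; first exact: cvg_cst.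
      exact: cvg_harmonic.
    move/cvgrPdist_lt : r0c0 => /(_ _ d0); apply: filterS => n.
    by rewrite sub0r normrN gtr0_norm// distrC; exact: Hd.
  by have [-> _] := cvg_limn_einf_sup cv.
have mli : measurable_fun `[a, b] (fun x => limn_einf (F^~ x)).
  rewrite /limn_einf; apply: measurableT_comp => //.
  apply: (@measurable_fun_limn_esup _ _ _ _ (fun n x => - F n x)%E) => n.
  exact: measurableT_comp.
have mf2 : measurable_fun `[a, b] (fun x => (f x ^+ 2)%:E).
  by apply/measurable_EFinP; apply: measurable_funTS; exact: measurable_funX.
rewrite (@ae_eq_integral _ _ _ mu `[a, b]%classic (fun x => limn_einf (F^~ x)) (fun x => (f x ^+ 2)%:E) _ mf2 mli Fc)//.
have F0 n x : `[a, b]%classic x -> (0 <= F n x)%E by rewrite lee_fin sqr_ge0.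
apply: (@le_trans _ _ (limn_einf (fun n => \int[mu]_(x in `[a, b]) F n x)%E)).
  by apply: (@fatou _ _ _ mu `[a, b]%classic _ F).
rewrite limn_einf_lim; apply: lime_le; first exact: is_cvg_einfs.
apply: nearW => n; apply: (@le_trans _ _ (\int[mu]_(x in `[a, b]) F n x)%E); last exact: FB.
by apply: ereal_inf_lbound; exists n => //=.
Qed.

Lemma Int_sqr_ereal f a b (B : R) : locint (fun x => f x ^+ 2) -> Int (fun x => f x ^+ 2) a b <= B ->
  (\int[mu]_(x in `[a, b]) (f x ^+ 2)%:E <= B%:E)%E.
Proof.
move=> lf; rewrite -lee_fin;
rewrite /Int /Rintegral fineK//; exact: integrable_fin_num (locint_int a b lf).
Qed.

Lemma Int_ereal_sqr f a b (B : R) : locint (fun x => f x ^+ 2) ->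
  (\int[mu]_(x in `[a, b]) (f x ^+ 2)%:E <= B%:E)%E -> Int (fun x => f x ^+ 2) a b <= B.
Proof.
move=> lf H; rewrite -lee_fin /Int /Rintegral fineK//.
exact: integrable_fin_num (locint_int a b lf).
Qed.

End Averages.

Opaque Int prim.

(** * Pairs of weak solutions *)

Section Pairs.
Context {R : realType}.
Local Notation mu := (@lebesgue_measure R).
Implicit Types (f g k : R -> R) (w z P Q : R -> R -> R) (a b x y t r h : R).

Lemma contC (c : R) : continuous ((fun=> c) : R -> R).
Proof. by move=> x; exact: cvg_cst. Qed.

Definition tc P := (forall t, locint (P t)) /\
  forall B t (e : R), 0 < e -> exists2 d : R, 0 < d & forall s, `|s - t| < d ->
    Int (fun x => `|P s x - P t x|) (- B) B <= e.

Definition eqc w := forall B t (e : R), 0 < e -> exists2 d : R, 0 < d &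
  forall s, `|s - t| < d -> forall x, - B <= x <= B -> `|w s x - w t x| <= e.

Lemma le_Int_box f x y : locint f -> (forall s, 0 <= f s) ->
  Int f x y <= Int f (- (`|x| + `|y|)) (`|x| + `|y|).
Proof.
move=> lf f0; have [xy|yx] := leP x y; last first.
  by rewrite (Int_ge _ (ltW yx)); exact: Int_ge0.
have hx := ler_norm (- x); rewrite normrN in hx.
have hy := ler_norm y.
have x0 := normr_ge0 x; have y0 := normr_ge0 y.
by apply: le_Int_itv => //; lra.
Qed.

Lemma tc_small P x y t (e : R) : tc P -> 0 < e -> exists2 d : R, 0 < d &
  forall s, `|s - t| < d -> Int (fun u => `|P s u - P t u|) x y <= e.
Proof.
move=> [lP cP] e0; have [d d0 Hd] := cP (`|x| + `|y|) t e e0.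
exists d => // s st; apply: le_trans (Hd s st); apply: le_Int_box => //.
by apply: locint_norm; exact: locintB.
Qed.

Lemma tc_cont P k x y : tc P -> continuous k ->
  continuous (fun t => Int (fun s => k s * P t s) x y).
Proof.
move=> tP ck; have [lP _] := tP; have [M HM] := cont_bounded ck x y.
have M0 : 0 < `|M| + 1 by rewrite ltr_wpDl.
apply: cont_ed => t e e0.
have [d d0 Hd] := tc_small x y t tP (divr_gt0 e0 M0).
exists d => // s st; have {}Hd := Hd s st.
have lk u : locint (fun s => k s * P u s) by exact: locintM.
have lD : locint (fun x => `|P s x - P t x|) by apply: locint_norm; exact: locintB.
rewrite -IntB//; apply: le_trans (Int_norm _ _ (locintB (lk s) (lk t))) _.
apply: (@le_trans _ _ (Int (fun x => (`|M| + 1) * `|P s x - P t x|) x y)).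
  apply: le_Int; [exact: locint_norm (locintB (lk s) (lk t))|exact: locintZ|].
  move=> u uxy; rewrite -mulrBr normrM ler_wpM2r//.
  by apply: le_trans (HM u uxy) _; apply: le_trans (ler_norm _) _; rewrite lerDl.
by rewrite IntZ// mulrC -ler_pdivlMr.
Qed.

Lemma tc_cont1 P x y : tc P -> continuous (fun t => Int (P t) x y).
Proof.
move=> tP; have c1 : continuous ((fun=> 1) : R -> R) by move=> t; exact: cvg_cst.
have := @tc_cont P _ x y tP c1.
rewrite (_ : (fun t => Int (fun s => 1 * P t s) x y) = (fun t => Int (P t) x y))//.
by apply/funext => t; apply: eq_Int => s _; rewrite mul1r.
Qed.

Lemma tc_cont_norm P x y : tc P -> continuous (fun t => Int (fun s => `|P t s|) x y).
Proof.
move=> tP; have [lP _] := tP; apply: cont_ed => t e e0.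
have [d d0 Hd] := tc_small x y t tP e0.
exists d => // s st; apply: le_trans (Hd s st).
have ln u : locint (fun s => `|P u s|) by exact: locint_norm.
have lD : locint (fun x => `|P s x - P t x|) by apply: locint_norm; exact: locintB.
rewrite -IntB//; apply: le_trans (Int_norm _ _ (locintB (ln s) (ln t))) _.
apply: le_Int => //; first by apply: locint_norm; exact: locintB.
by move=> u _; exact: ler_dist_dist.
Qed.

Lemma rep_cont f g : locint g -> (forall x y, x <= y -> f y - f x = Int g x y) -> continuous f.
Proof.
move=> lg fg.
have E y : f y = prim g y + f 0.
  have [y0|y0] := leP 0 y; first by rewrite primE// -fg//; ring.
  have := fg _ _ (ltW y0); have := primB lg (ltW y0); rewrite prim0; lra.
rewrite (_ : f = fun y => prim g y + f 0); last by apply/funext => y; exact: E.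
by apply: contD; [exact: prim_continuous|move=> t; exact: cvg_cst].
Qed.

(* If [z_t = P] in the integrated sense then [(k z)_t = k P]. *)
Lemma time_primitive z P k T1 T2 x y : tc P -> continuous k -> continuous (z T1) ->
  continuous (z T2) -> T1 <= T2 -> x <= y ->
  (forall a b, a <= b -> Int (fun s => z T2 s - z T1 s) a b = Int (fun t => Int (P t) a b) T1 T2) ->
  Int (fun s => k s * (z T2 s - z T1 s)) x y =
  Int (fun t => Int (fun s => k s * P t s) x y) T1 T2.
Proof.
move=> tP ck c1 c2 T12 xy H; have [lP _] := tP.
pose D s := z T2 s - z T1 s.
have cD : continuous D by move=> s; apply: cvgB; [exact: c2|exact: c1].
have lD := locint_cont cD.
have lkD : locint (fun s => k s * D s) by exact: locintM.
have lkP t : locint (fun s => k s * P t s) by exact: locintM.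
have lt g a b : continuous g -> locint (fun t => Int (fun s => g s * P t s) a b).
  by move=> cg; apply: locint_cont; exact: tc_cont.
have ltn a b : locint (fun t => Int (fun s => `|P t s|) a b).
  by apply: locint_cont; exact: tc_cont_norm.
pose f b := Int (fun s => k s * D s) x b - Int (fun t => Int (fun s => k s * P t s) x b) T1 T2.
suff : f y = f x.
  rewrite /f (Int_ge _ (lexx x)) (@eq_Int _ (fun t => Int (fun s => k s * P t s) x x) (fun=> 0)); last first.
    by move=> t _; rewrite Int_ge.
  by rewrite Int_cst// mul0r subrr => /subr0_eq.
pose mm b := Int (fun s => `|D s|) x b + Int (fun t => Int (fun s => `|P t s|) x b) T1 T2.
apply: (eq_local (m := mm) xy) => e e0.
have [d d0 Hd] := cont_unif x y ck e0.
exists d => // p q xp pq qy qp.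
have lnD := locint_norm lD.
have -> : f q - f p = Int (fun s => (k s - k p) * D s) p q -
    Int (fun t => Int (fun s => (k s - k p) * P t s) p q) T1 T2.
  rewrite /f (Int_cat lkD xp pq).
  rewrite (@eq_Int _ (fun t => Int (fun s => k s * P t s) x q)
    (fun t => Int (fun s => k s * P t s) x p + Int (fun s => k s * P t s) p q)); last first.
    by move=> t _; rewrite (Int_cat (lkP t) xp pq).
  rewrite IntD; [|exact: lt|exact: lt].
  have -> : Int (fun s => (k s - k p) * D s) p q = Int (fun s => k s * D s) p q - k p * Int D p q.
    by rewrite -IntZ// -IntB//; [apply: eq_Int => s _; ring|exact: locintZ].
  rewrite (@eq_Int _ (fun t => Int (fun s => (k s - k p) * P t s) p q)
    (fun t => Int (fun s => k s * P t s) p q - k p * Int (P t) p q)); last first.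
    by move=> t _; rewrite -IntZ// -IntB//; [apply: eq_Int => s _; ring|exact: locintZ].
  have lP1 : locint (fun t => Int (P t) p q) by apply: locint_cont; exact: tc_cont1.
  rewrite IntB; [|exact: lt|exact: locintZ].
  rewrite IntZ// -(H p q pq).
  have ar (A B C E F : R) : A + B - (C + E) - (A - C) = B - F - (E - F) by ring.
  exact: ar.
have -> : mm q - mm p = Int (fun s => `|D s|) p q + Int (fun t => Int (fun s => `|P t s|) p q) T1 T2.
  rewrite /mm (Int_cat lnD xp pq).
  rewrite (@eq_Int _ (fun t => Int (fun s => `|P t s|) x q)
    (fun t => Int (fun s => `|P t s|) x p + Int (fun s => `|P t s|) p q)); last first.
    by move=> t _; rewrite (Int_cat (locint_norm (lP t)) xp pq).
  rewrite IntD//.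
  have ar (A B C E : R) : A + B + (C + E) - (A + C) = B + E by ring.
  exact: ar.
have ckp : continuous (fun s => k s - k p) by move=> s; apply: cvgB; [exact: ck|exact: cvg_cst].
have kp s : p <= s <= q -> `|k s - k p| <= e.
  by move=> /andP[ps sq]; apply: Hd; [apply/andP; lra|apply/andP; lra|rewrite ger0_norm; lra].
have bnd g : locint g -> `|Int (fun s => (k s - k p) * g s) p q| <= e * Int (fun s => `|g s|) p q.
  move=> lg; have lkg : locint (fun s => (k s - k p) * g s) by exact: locintM.
  apply: le_trans (Int_norm _ _ lkg) _; rewrite -IntZ; last exact: locint_norm.
  apply: le_Int; [exact: locint_norm|by apply: locintZ; exact: locint_norm|].
  by move=> s spq; rewrite normrM ler_wpM2r//; exact: kp.
apply: le_trans (ler_normB _ _) _; rewrite mulrDr; apply: lerD; first exact: bnd.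
apply: le_trans (Int_norm _ _ (lt _ _ _ ckp)) _; rewrite -IntZ//.
apply: le_Int; [exact: locint_norm (lt _ _ _ ckp)|exact: locintZ|].
by move=> t _; exact: bnd.
Qed.

(* The first order system [w_x = k1 P], [z_x = k2 Q], [z_t = P], [w_t = Q] in
   integrated form. *)
Record wpair (k1 k2 : R -> R) w z P Q : Prop := WPair {
  wp_k1 : continuous k1;
  wp_k2 : continuous k2;
  wp_P : tc P;
  wp_Q : tc Q;
  wp_w : eqc w;
  wp_z : eqc z;
  wp_wx : forall t x y, x <= y -> w t y - w t x = Int (fun s => k1 s * P t s) x y;
  wp_zx : forall t x y, x <= y -> z t y - z t x = Int (fun s => k2 s * Q t s) x y;
  wp_zt : forall T1 T2, 0 <= T1 -> T1 <= T2 -> forall x y, x <= y ->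
     Int (fun s => z T2 s - z T1 s) x y = Int (fun t => Int (P t) x y) T1 T2;
  wp_wt : forall T1 T2, 0 <= T1 -> T1 <= T2 -> forall x y, x <= y ->
     Int (fun s => w T2 s - w T1 s) x y = Int (fun t => Int (Q t) x y) T1 T2 }.

Lemma wpair_sym k1 k2 w z P Q : wpair k1 k2 w z P Q -> wpair k2 k1 z w Q P.
Proof. by case=> *; split. Qed.

Section OnePair.
Variables (k1 k2 : R -> R) (w z P Q : R -> R -> R).
Hypothesis W : wpair k1 k2 w z P Q.

Lemma wp_cont t : continuous (w t).
Proof.
have [lP _] := wp_P W.
apply: (@rep_cont _ (fun s => k1 s * P t s)); last exact: (wp_wx W).
by apply: locintM => //; exact: (wp_k1 W).
Qed.

Lemma wp_tcont x : continuous (fun t => w t x).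
Proof.
apply: cont_ed => t e e0; have [d d0 Hd] := wp_w W `|x| t e0.
exists d => // s st; apply: Hd => //.
by have := ler_norm (- x); have := ler_norm x; rewrite normrN; lra.
Qed.

Definition tprim w t x := Int (fun s => w s x) 0 t.

End OnePair.

Arguments wp_cont {k1 k2 w z P Q} W t.

Lemma tprim_x k1 k2 w z P Q : wpair k1 k2 w z P Q -> forall t x y, 0 <= t -> x <= y ->
  tprim w t y - tprim w t x = Int (fun s => k1 s * (z t s - z 0 s)) x y.
Proof.
move=> W t x y t0 xy; have W' := wpair_sym W.
rewrite (@time_primitive z P k1 0 t x y (wp_P W) (@wp_k1 _ _ _ _ _ _ W) (wp_cont W' 0) (wp_cont W' t) t0 xy (wp_zt W (lexx 0) t0)).
rewrite /tprim -IntB; [|by apply: locint_cont; exact: (wp_tcont W)..].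
by apply: eq_Int => s _; rewrite (wp_wx W).
Qed.

Lemma tprim_cont k1 k2 w z P Q t : wpair k1 k2 w z P Q -> continuous (tprim w t).
Proof.
move=> W; have W' := wpair_sym W; have [t0|t0] := leP 0 t.
  apply: (@rep_cont _ (fun s => k1 s * (z t s - z 0 s))); last by move=> x y xy; exact: (tprim_x W).
  apply: locintM; first exact: (wp_k1 W).
  by apply: locintB; apply: locint_cont; exact: (wp_cont W').
rewrite (_ : tprim w t = fun=> 0); first exact: contC.
by apply/funext => x; rewrite /tprim Int_ge// ltW.
Qed.

Lemma tprim_udat k1 k2 w z P Q a b t : wpair k1 k2 w z P Q -> 0 < t ->
  udat a b (tprim w) t (w t).
Proof.
move=> W t0 e e0; have [d d0 Hd] := wp_w W (`|a| + `|b|) t e0.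
exists (Num.min t d); first by rewrite lt_min t0.
move=> h; rewrite lt_min => /andP[ht hd] x /andP[ax xb].
have lw : locint (fun s => w s x) by apply: locint_cont; exact: (wp_tcont W).
have xB : - (`|a| + `|b|) <= x <= `|a| + `|b|.
  have := ler_norm (- a); have := ler_norm b; rewrite normrN.
  by have := normr_ge0 a; have := normr_ge0 b; lra.
have lc c : locint (fun s => w s x - c) by apply: locintB => //; exact: locint_cst.
rewrite /tprim; have [h0|h0] := leP 0 h.
  have th : t <= t + h by rewrite lerDl.
  rewrite (Int_cat lw (ltW t0) th).
  have -> : Int (fun s => w s x) 0 t + Int (fun s => w s x) t (t + h) - Int (fun s => w s x) 0 t - h * w t x
    = Int (fun s => w s x - w t x) t (t + h).
    by rewrite IntB//; [rewrite Int_cst//; ring|exact: locint_cst].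
  move: hd; rewrite (ger0_norm h0) => hd.
  have -> : e * h = e * (t + h - t) by ring.
  apply: Int_norm_le => // s /andP[ts sh]; apply: Hd => //.
  by rewrite ger0_norm ?subr_ge0//; lra.
move: ht hd; rewrite (ltr0_norm h0) => ht hd.
have th : t + h <= t by lra.
have th0 : 0 <= t + h by lra.
rewrite (Int_cat lw th0 th).
have -> : Int (fun s => w s x) 0 (t + h) - (Int (fun s => w s x) 0 (t + h) + Int (fun s => w s x) (t + h) t) - h * w t x
    = - Int (fun s => w s x - w t x) (t + h) t.
  by rewrite IntB//; [rewrite Int_cst//; ring|exact: locint_cst].
rewrite normrN; have -> : e * - h = e * (t - (t + h)) by ring.
apply: Int_norm_le => // s /andP[ts sh]; apply: Hd => //.
by rewrite ler0_norm ?subr_le0//; lra.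
Qed.

Definition dq h w t x : R := (w (t + h) x - w t x) / h.

Lemma udat_shift a b w t f h : udat a b w (t + h) f -> udat a b (fun t => w (t + h)) t f.
Proof.
move=> H e e0; have [d d0 Hd] := H e e0; exists d => // k kd x xab.
by rewrite (addrAC t k h); exact: Hd.
Qed.

Lemma cst_bnd a b (c : R) : bnd a b (fun=> c).
Proof. by exists `|c| => x _. Qed.

Lemma dq_udat a b w t f g h : udat a b w (t + h) f -> udat a b w t g ->
  udat a b (dq h w) t (fun x => (f x - g x) / h).
Proof.
move=> /udat_shift uf ug.
have := udatZ (cst_bnd a b h^-1) (udatD uf (udatZ (cst_bnd a b (-1)) ug)).
apply: udat_ext => [s x|x]; rewrite ?/dq mulN1r mulrC//.
Qed.

Lemma dq_cont h w t : (forall t, continuous (w t)) -> continuous (dq h w t).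
Proof.
move=> cw; rewrite (_ : dq h w t = fun x => h^-1 * (w (t + h) x + -1 * w t x)).
  by apply: contZ; apply: contD; [|apply: contZ].
by apply/funext => x; rewrite /dq mulN1r mulrC.
Qed.

Definition sqr_bound P a b (B : R) := forall e : R, 0 < e -> exists2 d : R, 0 < d &
  forall t, 0 <= t -> t <= d -> Int (fun x => P t x ^+ 2) a b <= B + e.

Lemma dq_sqr_bound k1 k2 w z P Q a b h t (B : R) : wpair k1 k2 w z P Q -> a <= b ->
  0 < h -> 0 <= t -> (forall s, locint (fun x => P s x ^+ 2)) ->
  (forall s, t <= s <= t + h -> Int (fun x => P s x ^+ 2) a b <= B) ->
  Int (fun x => dq h z t x ^+ 2) a b <= B.
Proof.
move=> W ab h0 t0 lP2 HB; have W' := wpair_sym W.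
have th : t <= t + h by rewrite lerDl ltW.
have cf := @dq_cont h z t (wp_cont W').
set f := dq h z t in cf *.
have [lP _] := wp_P W.
have lf2 := locint_cont (contX2 cf).
have lfP s : locint (fun x => f x * P s x) by exact: locintM.
have lt : locint (fun s => Int (fun x => f x * P s x) a b).
  by apply: locint_cont; apply: tc_cont => //; exact: (wp_P W).
have E : Int (fun x => f x ^+ 2) a b = h^-1 * Int (fun s => Int (fun x => f x * P s x) a b) t (t + h).
  rewrite -(@time_primitive z P f t (t + h) a b (wp_P W) cf (wp_cont W' t) (wp_cont W' _) th ab (wp_zt W t0 th)).
  rewrite -IntZ; last by apply: locintM => //; apply: locintB; apply: locint_cont; exact: (wp_cont W').
  by apply: eq_Int => x _; rewrite expr2 {2}/f /dq; ring.
have : Int (fun s => Int (fun x => f x * P s x) a b) t (t + h) <=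
   Int (fun=> 1 / 2 * Int (fun x => f x ^+ 2) a b + 1 / 2 * B) t (t + h).
  apply: le_Int => //; first exact: locint_cst.
  move=> s sth; apply: le_trans (Int_mul_le _ _ lf2 (lP2 s) (lfP s)) _.
  by rewrite lerD2l ler_pM2l//; exact: HB.
rewrite Int_cst// (_ : t + h - t = h); last by ring.
move: E; set I := Int (fun x => f x ^+ 2) a b; set J := Int _ t (t + h) => E.
have {E} -> : J = h * I by rewrite E mulVKf// gt_eqF.
by rewrite mulrC ler_pM2r//; lra.
Qed.

Lemma dq_weak k1 k2 w z P Q a b t (e : R) : wpair k1 k2 w z P Q -> 0 <= t -> 0 < e ->
  exists2 d : R, 0 < d & forall h, 0 < h -> h < d -> forall x y, a <= x -> x <= y -> y <= b ->
    `|Int (dq h z t) x y - Int (P t) x y| <= e.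
Proof.
move=> W t0 e0; have W' := wpair_sym W; have [lP _] := wp_P W.
have [d d0 Hd] := tc_small a b t (wp_P W) e0.
exists d => // h h0 hd x y ax xy yb.
have th : t <= t + h by rewrite lerDl ltW.
have lt : locint (fun s => Int (P s) x y) by apply: locint_cont; apply: tc_cont1; exact: (wp_P W).
have -> : Int (dq h z t) x y - Int (P t) x y = h^-1 * Int (fun s => Int (P s) x y - Int (P t) x y) t (t + h).
  rewrite IntB//; last exact: locint_cst.
  rewrite Int_cst// -(wp_zt W t0 th xy) mulrBr -IntZ; last first.
    by apply: locintB; apply: locint_cont; exact: (wp_cont W').
  rewrite (@eq_Int _ (dq h z t) (fun s => h^-1 * (z (t + h) s - z t s))); last first.
    by move=> s _; rewrite /dq mulrC.
  by congr (_ - _); field; rewrite gt_eqF.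
rewrite normrM gtr0_norm ?invr_gt0// ler_pdivrMl// (_ : h * e = e * (t + h - t)); last by ring.
apply: Int_norm_le => //; first by apply: locintB => //; exact: locint_cst.
move=> s /andP[ts sh]; rewrite -IntB//.
apply: le_trans (Int_norm _ _ (locintB (lP s) (lP t))) _.
have lD : locint (fun u => `|P s u - P t u|) by apply: locint_norm; exact: locintB.
apply: le_trans (Hd s _); last by rewrite ger0_norm ?subr_ge0//; lra.
exact: le_Int_itv.
Qed.

End Pairs.

Section PairDecay.
Context {R : realType}.
Local Notation mu := (@lebesgue_measure R).
Implicit Types (f g : R -> R) (w z P Q : R -> R -> R) (a b x y t r h : R).

Definition C1_decays (al be : R -> R) (Z0 La C a b : R) := forall V S V' S' : R -> R -> R,
  (forall t, continuous (V t)) -> (forall t, continuous (S t)) ->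
  (forall t, continuous (V' t)) -> (forall t, continuous (S' t)) ->
  (forall t, 0 < t -> forall x y, x <= y -> V t y - V t x = Int (fun s => S' t s / al s) x y) ->
  (forall t, 0 < t -> forall x y, x <= y -> S t y - S t x = Int (fun s => be s * V' t s) x y) ->
  (forall t, 0 < t -> udat a b V t (V' t)) -> (forall t, 0 < t -> udat a b S t (S' t)) ->
  (forall t, 0 < t -> S t b = - (Z0 * V t b)) ->
  (forall t, 0 < t -> S t a = Z0 * V t a) ->
  forall T1 T, 0 < T1 -> T1 <= T ->
    Int (fun x => V T x ^+ 2 + S T x ^+ 2) a b <=
    C * expR (- (La * (T - T1))) * Int (fun x => V T1 x ^+ 2 + S T1 x ^+ 2) a b.

Lemma dq_x (F G : R -> R -> R) (k : R -> R) h : continuous k -> 0 < h -> (forall t, continuous (G t)) ->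
  (forall t, 0 <= t -> forall x y, x <= y -> F t y - F t x = Int (fun s => k s * G t s) x y) ->
  forall t, 0 <= t -> forall x y, x <= y ->
    dq h F t y - dq h F t x = Int (fun s => k s * dq h G t s) x y.
Proof.
move=> ck h0 cG H t t0 x y xy; have th0 : 0 <= t + h by rewrite addr_ge0// ltW.
have lk s : locint (fun u => k u * G s u) by apply: locint_cont; exact: contM.
rewrite (@eq_Int _ _ (fun s => h^-1 * (k s * G (t + h) s - k s * G t s))); last first.
  by move=> s _; rewrite /dq; ring.
rewrite IntZ; last exact: locintB.
by rewrite IntB// -(H _ th0 _ _ xy) -(H _ t0 _ _ xy) /dq; ring.
Qed.

Lemma dq_udat_close a b F t f (e : R) : udat a b F t f -> 0 < e ->
  exists2 d : R, 0 < d & forall k, 0 < k -> k < d -> forall x, a <= x <= b ->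
    `|dq k F t x - f x| <= e.
Proof.
move=> H e0; have [d d0 Hd] := H e e0; exists d => // k k0 kd x xab.
have := Hd k _ x xab; rewrite gtr0_norm// => /(_ kd).
have -> : dq k F t x - f x = (F (t + k) x - F t x - k * f x) / k.
  by rewrite /dq; field; rewrite gt_eqF.
by rewrite normrM normfV (gtr0_norm k0) ler_pdivrMr.
Qed.

Lemma dq_close a b h F (G : R -> R -> R) t (e : R) : 0 < h ->
  (forall x, a <= x <= b -> `|F t x - G t x| <= e) ->
  (forall x, a <= x <= b -> `|F (t + h) x - G (t + h) x| <= e) ->
  forall x, a <= x <= b -> `|dq h F t x - dq h G t x| <= 2 * e / h.
Proof.
move=> h0 H1 H2 x xab.
have -> : dq h F t x - dq h G t x = ((F (t + h) x - G (t + h) x) - (F t x - G t x)) / h.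
  by rewrite /dq; ring.
rewrite normrM normfV (gtr0_norm h0) ler_pM2r ?invr_gt0//.
by apply: le_trans (ler_normB _ _) _; have := H1 x xab; have := H2 x xab; lra.
Qed.

Lemma energy_close k1 k2 w z P Q a b h t (e : R) : wpair k1 k2 w z P Q -> a <= b ->
  0 < h -> 0 < t -> 0 < e -> exists2 d : R, 0 < d & forall k, 0 < k -> k < d ->
  `|Int (fun x => dq h (dq k (tprim w)) t x ^+ 2) a b - Int (fun x => dq h w t x ^+ 2) a b| <= e.
Proof.
move=> W ab h0 t0 e0.
have cw := wp_cont W; have cd := @dq_cont R h w t cw.
have [M HM] := cont_bounded cd a b.
have M0 : 0 <= M by apply: le_trans (HM a _); rewrite // lexx.
pose K := (2 * M + 1) * (b - a) + 1.
have K0 : 0 < K by rewrite ltr_wpDl// mulr_ge0 ?subr_ge0// addr_ge0// mulr_ge0.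
pose e1 := Num.min 1 (e / K).
have e10 : 0 < e1 by rewrite lt_min ltr01 divr_gt0.
have e11 : e1 <= 1 by rewrite ge_min lexx.
have e1K : e1 * K <= e by rewrite -ler_pdivlMr// ge_min lexx orbT.
clearbody e1.
pose e2 := e1 * h / 2.
have e20 : 0 < e2 by rewrite divr_gt0// mulr_gt0.
have th0 : 0 < t + h by rewrite addr_gt0.
have [d1 d10 H1] := dq_udat_close (@tprim_udat _ _ _ _ _ _ _ a b _ W t0) e20.
have [d2 d20 H2] := dq_udat_close (@tprim_udat _ _ _ _ _ _ _ a b _ W th0) e20.
exists (Num.min d1 d2); first by rewrite lt_min d10.
move=> k k0; rewrite lt_min => /andP[kd1 kd2].
have ct s : continuous (dq k (tprim w) s).
  by apply: dq_cont => u; exact: (@tprim_cont _ _ _ _ _ _ _ u W).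
have cl x : a <= x <= b -> `|dq h (dq k (tprim w)) t x - dq h w t x| <= e1.
  move=> xab; have -> : e1 = 2 * e2 / h by rewrite /e2; field; rewrite gt_eqF.
  apply: (dq_close (a := a) (b := b)) => //; [exact: H1|exact: H2].
have := Int_sqr_close ab (@dq_cont R h _ t ct) cd (ltW e10) HM cl.
move=> /le_trans; apply; apply: le_trans e1K; rewrite -mulrA ler_pM2l//.
apply: (@le_trans _ _ ((2 * M + 1) * (b - a))); last by rewrite lerDl.
by apply: ler_wpM2r; [rewrite subr_ge0|rewrite lerD2l].
Qed.

Lemma le_of_close (x y c : R) : 0 <= c -> (forall e : R, 0 < e -> x - 2 * e <= c * (y + 2 * e)) ->
  x <= c * y.
Proof.
move=> c0 H; apply/ler_addgt0Pl => e e0.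
have k0 : 0 < 2 * c + 2 by move: c0; lra.
have := H (e / (2 * c + 2)) (divr_gt0 e0 k0).
have E : e = (2 * c + 2) * (e / (2 * c + 2)) by field; rewrite gt_eqF.
have ar (u : R) : x - 2 * u <= c * (y + 2 * u) -> x <= c * y + (2 * c + 2) * u by lra.
by move=> /ar; rewrite -E [e + _]addrC.
Qed.

Lemma close_arith (K1 K2 I1 I2 J1 J2 L1 L2 c e : R) : 0 <= c -> - (K1 - I1) <= e ->
  - (K2 - I2) <= e -> J1 - L1 <= e -> J2 - L2 <= e -> K1 + K2 <= c * (J1 + J2) ->
  I1 + I2 - 2 * e <= c * (L1 + L2 + 2 * e).
Proof.
move=> c0 h1 h2 h3 h4 hh.
apply: (@le_trans _ _ (K1 + K2)); first lra.
by apply: le_trans hh _; apply: ler_wpM2l => //; lra.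
Qed.

Theorem pair_decay_dq (al be : R -> R) (Z0 La C a b : R) w z P Q :
  (forall x, 0 < al x) -> C1_decays al be Z0 La C a b -> 0 < C -> a <= b ->
  wpair (fun x => (al x)^-1) be w z P Q ->
  (forall t, 0 <= t -> z t b - z 0 b = - (Z0 * (w t b - w 0 b))) ->
  (forall t, 0 <= t -> z t a - z 0 a = Z0 * (w t a - w 0 a)) ->
  forall h T, 0 < h -> h <= T ->
  Int (fun x => dq h w T x ^+ 2) a b + Int (fun x => dq h z T x ^+ 2) a b <=
  C * expR (- (La * (T - h))) *
    (Int (fun x => dq h w h x ^+ 2) a b + Int (fun x => dq h z h x ^+ 2) a b).
Proof.
move=> al0 D C0 ab W zb za h T h0 hT.
have W' := wpair_sym W.
have T0 : 0 < T by exact: lt_le_trans hT.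
have CE : 0 <= C * expR (- (La * (T - h))) by rewrite mulr_ge0 ?expR_ge0// ltW.
apply: (le_of_close CE) => e e0.
have [d1 d10 H1] := energy_close W ab h0 T0 e0.
have [d2 d20 H2] := energy_close W' ab h0 T0 e0.
have [d3 d30 H3] := energy_close W ab h0 h0 e0.
have [d4 d40 H4] := energy_close W' ab h0 h0 e0.
pose k := Num.min (Num.min d1 d2) (Num.min d3 d4) / 2.
have m0 : 0 < Num.min (Num.min d1 d2) (Num.min d3 d4) by rewrite !lt_min d10 d20 d30 d40.
have k0 : 0 < k by rewrite divr_gt0.
have : k < Num.min (Num.min d1 d2) (Num.min d3 d4).
  by rewrite /k ltr_pdivrMr// ltr_pMr// ltr1n.
clearbody k; rewrite !lt_min => /andP[/andP[k1 k2] /andP[k3 k4]].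
have {}H1 := H1 k k0 k1; have {}H2 := H2 k k0 k2.
have {}H3 := H3 k k0 k3; have {}H4 := H4 k k0 k4.
have cw t : continuous (tprim w t) by exact: (@tprim_cont _ _ _ _ _ _ _ t W).
have cz t : continuous (tprim z t) by exact: (@tprim_cont _ _ _ _ _ _ _ t W').
have cV t : continuous (dq h (dq k (tprim w)) t) by exact: (@dq_cont R h _ t (fun u => @dq_cont R k _ u cw)).
have cS t : continuous (dq h (dq k (tprim z)) t) by exact: (@dq_cont R h _ t (fun u => @dq_cont R k _ u cz)).
have cV' t : continuous (dq h (dq k w) t) by exact: (@dq_cont R h _ t (fun u => @dq_cont R k w u (wp_cont W))).
have cS' t : continuous (dq h (dq k z) t) by exact: (@dq_cont R h _ t (fun u => @dq_cont R k z u (wp_cont W'))).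
have gen (k' : R -> R) (F G : R -> R -> R) : continuous k' -> (forall t, continuous (G t)) ->
    (forall t, 0 <= t -> forall x y, x <= y -> F t y - F t x = Int (fun s => k' s * (G t s - G 0 s)) x y) ->
    forall t, 0 < t -> forall x y, x <= y -> dq h (dq k F) t y - dq h (dq k F) t x =
      Int (fun s => k' s * dq h (dq k G) t s) x y.
  move=> ck' cG HF t t0 x y xy.
  have cG0 s : continuous (fun x => G s x - G 0 x) by move=> u; apply: cvgB; exact: cG.
  have c1 s : continuous (dq k (fun s x => G s x - G 0 x) s) by apply: dq_cont.
  rewrite (@dq_x (dq k F) (dq k (fun s x => G s x - G 0 x)) k' h ck' h0 c1 _ t (ltW t0) x y xy).
    by apply: eq_Int => s _; congr (_ * _); rewrite /dq; ring.
  move=> s s0 p q pq.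
  exact: (@dq_x F (fun s x => G s x - G 0 x) k' k ck' k0 cG0 HF s s0 p q pq).
have ud (F G : R -> R -> R) t : 0 < t -> (forall s, 0 < s -> udat a b F s (G s)) ->
    udat a b (dq h (dq k F)) t (dq h (dq k G) t).
  move=> t0 HF; apply: dq_udat; apply: dq_udat; apply: HF; rewrite ?addr_gt0//.
have bd (c x0 : R) : (forall t, 0 <= t -> z t x0 - z 0 x0 = c * (w t x0 - w 0 x0)) ->
    forall t, 0 < t -> dq h (dq k (tprim z)) t x0 = c * dq h (dq k (tprim w)) t x0.
  move=> Hz t t0.
  have lw : locint (fun s => w s x0) by apply: locint_cont; exact: (wp_tcont W).
  have E s : 0 <= s -> tprim z s x0 = c * tprim w s x0 + (z 0 x0 - c * w 0 x0) * s.
    move=> s0; rewrite /tprim.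
    rewrite (@eq_Int _ _ (fun s => c * w s x0 + (z 0 x0 - c * w 0 x0))); last first.
      by move=> u /andP[u0 _]; have := Hz u u0; lra.
    by rewrite IntD; [rewrite IntZ// Int_cst// subr0|exact: locintZ|exact: locint_cst].
  rewrite /dq !E//; [|by rewrite ?addr_ge0// ltW..].
  by field; rewrite !gt_eqF.
have DD := D _ _ _ _ cV cS cV' cS'.
have ck1 := wp_k1 W; have ck2 := wp_k2 W.
have lV2 t : locint (fun x => dq h (dq k (tprim w)) t x ^+ 2) by exact: locint_cont (contX2 (cV t)).
have lS2 t : locint (fun x => dq h (dq k (tprim z)) t x ^+ 2) by exact: locint_cont (contX2 (cS t)).
have : Int (fun x => dq h (dq k (tprim w)) T x ^+ 2) a b + Int (fun x => dq h (dq k (tprim z)) T x ^+ 2) a b <=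
  C * expR (- (La * (T - h))) *
   (Int (fun x => dq h (dq k (tprim w)) h x ^+ 2) a b + Int (fun x => dq h (dq k (tprim z)) h x ^+ 2) a b).
  have X1 t : 0 < t -> forall x y, x <= y -> dq h (dq k (tprim w)) t y - dq h (dq k (tprim w)) t x =
      Int (fun s => dq h (dq k z) t s / al s) x y.
    move=> t0 x y xy.
    rewrite (gen _ _ _ ck1 (wp_cont W') (fun t (p : 0 <= t) x y => @tprim_x _ _ _ _ _ _ _ W t x y p) t t0 x y xy).
    by apply: eq_Int => s _; rewrite mulrC.
  have X2 t : 0 < t -> forall x y, x <= y -> dq h (dq k (tprim z)) t y - dq h (dq k (tprim z)) t x =
      Int (fun s => be s * dq h (dq k w) t s) x y.
    move=> t0 x y xy.
    exact: (gen _ _ _ ck2 (wp_cont W) (fun t (p : 0 <= t) x y => @tprim_x _ _ _ _ _ _ _ W' t x y p) t t0 x y xy).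
  have X3 t : 0 < t -> udat a b (dq h (dq k (tprim w))) t (dq h (dq k w) t).
    by move=> t0; apply: ud => // s s0; exact: (@tprim_udat _ _ _ _ _ _ _ a b _ W s0).
  have X4 t : 0 < t -> udat a b (dq h (dq k (tprim z))) t (dq h (dq k z) t).
    by move=> t0; apply: ud => // s s0; exact: (@tprim_udat _ _ _ _ _ _ _ a b _ W' s0).
  have X5 t : 0 < t -> dq h (dq k (tprim z)) t b = - (Z0 * dq h (dq k (tprim w)) t b).
    by move=> t0; rewrite -mulNr; apply: bd => // s s0; rewrite mulNr; exact: zb.
  have X6 t : 0 < t -> dq h (dq k (tprim z)) t a = Z0 * dq h (dq k (tprim w)) t a.
    by move=> t0; exact: bd.
  have ar (A B A' B' c : R) : A = B -> A' = B' -> A <= c * A' -> B <= c * B' by move=> -> ->.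
  exact: (ar _ _ _ _ _ (IntD a b (lV2 T) (lS2 T)) (IntD a b (lV2 h) (lS2 h)) (DD X1 X2 X3 X4 X5 X6 h T h0 hT)).
move: H1 H2 H3 H4 => /ler_normlP[H1 _] /ler_normlP[H2 _] /ler_normlP[_ H3] /ler_normlP[_ H4] HH.
exact: (close_arith CE H1 H2 H3 H4 HH).
Qed.

Theorem pair_decay (al be : R -> R) (Z0 La C a b b1 BP BQ : R) w z P Q :
  (forall x, 0 < al x) -> C1_decays al be Z0 La C a b -> 0 < C -> 0 < La -> a <= b1 -> b1 < b ->
  wpair (fun x => (al x)^-1) be w z P Q ->
  (forall t, 0 <= t -> z t b - z 0 b = - (Z0 * (w t b - w 0 b))) ->
  (forall t, 0 <= t -> z t a - z 0 a = Z0 * (w t a - w 0 a)) ->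
  (forall t, locint (fun x => P t x ^+ 2)) -> (forall t, locint (fun x => Q t x ^+ 2)) ->
  0 <= BP -> 0 <= BQ -> sqr_bound P a b BP -> sqr_bound Q a b BQ ->
  forall T, 0 <= T ->
  (\int[mu]_(x in `[a, b1]) (P T x ^+ 2)%:E <= ((2 * C + 1) * expR (- (La * T)) * (BP + BQ))%:E)%E /\
  (\int[mu]_(x in `[a, b1]) (Q T x ^+ 2)%:E <= ((2 * C + 1) * expR (- (La * T)) * (BP + BQ))%:E)%E.
Proof.
move=> al0 D C0 La0 ab1 b1b W zb za lP2 lQ2 BP0 BQ0 sP sQ T T0.
have ab : a <= b by rewrite (le_trans ab1)// ltW.
have W' := wpair_sym W.
have [T00|Tn0] := eqVneq T 0.
  rewrite T00 mulr0 oppr0 expR0 mulr1.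
  have bd0 P' B : 0 <= B -> (forall t, locint (fun x => P' t x ^+ 2)) -> B <= BP + BQ ->
    sqr_bound P' a b B ->
    (\int[mu]_(x in `[a, b1]) (P' 0%R x ^+ 2)%:E <= ((2 * C + 1) * (BP + BQ))%:E)%E.
    move=> B0 l2 BB sB; apply: Int_sqr_ereal => //.
    apply: (@le_trans _ _ B); last first.
      by apply: le_trans BB _; rewrite ler_peMl ?addr_ge0// lerDr mulr_ge0// ltW.
    apply/ler_addgt0Pr => e e0; have [d d0 Hd] := sB e e0.
    apply: le_trans (Hd 0 (lexx _) (ltW d0)); apply: le_Int_itv => //; last exact: ltW.
    by move=> s; exact: sqr_ge0.
  split; first by apply: (bd0 _ BP) => //; rewrite lerDl.
  by apply: (bd0 _ BQ) => //; rewrite lerDr.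
have Tp : 0 < T by rewrite lt_neqAle eq_sym Tn0.
pose B := 2 * C * expR (- (La * T)) * (BP + BQ).
have BB0 : 0 <= BP + BQ by rewrite addr_ge0.
have B0 : 0 <= B by rewrite mulr_ge0// mulr_ge0 ?expR_ge0// mulr_ge0// ltW.
have BB : B <= (2 * C + 1) * expR (- (La * T)) * (BP + BQ).
  by apply: ler_wpM2r => //; apply: ler_wpM2r; [exact: expR_ge0|rewrite lerDl].
have key (e : R) : 0 < e -> exists2 h0 : R, 0 < h0 & forall h, 0 < h -> h < h0 ->
   Int (fun x => dq h w T x ^+ 2) a b <= B + e /\ Int (fun x => dq h z T x ^+ 2) a b <= B + e.
  move=> e0; have e1 : 0 < e / (4 * C) by rewrite divr_gt0// mulr_gt0.
  have [d1 d10 H1] := sP _ e1; have [d2 d20 H2] := sQ _ e1.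
  exists (Num.min (Num.min (d1 / 2) (d2 / 2)) (Num.min T (1 / (2 * La)))).
    by rewrite !lt_min !divr_gt0// ?mulr_gt0//= Tp.
  move=> h h0; rewrite !lt_min => /andP[/andP[hd1 hd2] /andP[hT hL]].
  have := pair_decay_dq al0 D C0 ab W zb za h0 (ltW hT).
  have bz : Int (fun x => dq h z h x ^+ 2) a b <= BP + e / (4 * C).
    apply: (dq_sqr_bound W ab h0 (ltW h0) lP2) => s /andP[s1 s2]; apply: H1; lra.
  have bw : Int (fun x => dq h w h x ^+ 2) a b <= BQ + e / (4 * C).
    apply: (dq_sqr_bound W' ab h0 (ltW h0) lQ2) => s /andP[s1 s2]; apply: H2; lra.
  have eL : expR (- (La * (T - h))) <= 2 * expR (- (La * T)).
    have -> : - (La * (T - h)) = - (La * T) + La * h by ring.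
    rewrite expRD mulrC; apply: ler_wpM2r; first exact: expR_ge0.
    have hl : La * h < 1 / 2.
      by move: hL; rewrite ltr_pdivlMr ?mulr_gt0//; lra.
    have := expR_ge1Dx (- (La * h)); have := expRxMexpNx_1 (La * h).
    have := expR_gt0 (La * h); have := expR_gt0 (- (La * h)).
    move: (expR (La * h)) (expR (- (La * h))) => p q q0 p0 pq hq; nra.
  set I1 := Int _ a b; set I2 := Int _ a b; set J1 := Int _ a b; set J2 := Int _ a b => HH.
  have I10 : 0 <= I1 by apply: Int_ge0 => s _; exact: sqr_ge0.
  have I20 : 0 <= I2 by apply: Int_ge0 => s _; exact: sqr_ge0.
  suff : I1 + I2 <= B + e by lra.
  apply: le_trans HH _.
  have h2 : J1 + J2 <= (BP + BQ) + 2 * (e / (4 * C)) by move: bz bw; rewrite -/J1 -/J2; lra.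
  apply: le_trans (ler_wpM2l _ h2) _; first by rewrite mulr_ge0 ?expR_ge0// ltW.
  have hC : C * expR (- (La * (T - h))) <= 2 * C * expR (- (La * T)).
    by rewrite -mulrA mulrCA; apply: ler_wpM2l => //; exact: ltW.
  apply: le_trans (ler_wpM2r _ hC) _.
    by rewrite addr_ge0// mulr_ge0// ltW.
  rewrite mulrDr -/B lerD2l.
  have -> : 2 * C * expR (- (La * T)) * (2 * (e / (4 * C))) = e * expR (- (La * T)) by field; rewrite gt_eqF.
  by rewrite ler_piMr ?(ltW e0)// -expR0 ler_expR oppr_le0 mulr_ge0// ltW.
have [lP _] := wp_P W; have [lQ _] := wp_Q W.
split.
  apply: (@le_trans _ _ B%:E); last by rewrite lee_fin.
  apply: (sqr_lsc ab1 b1b (lP T) B0) => e e0.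
  have [h1 h10 H1] := key e e0.
  have [h2 h20 H2] := dq_weak a b W T0 e0.
  pose h := Num.min h1 h2 / 2.
  have m0 : 0 < Num.min h1 h2 by rewrite lt_min h10.
  have h0 : 0 < h by rewrite divr_gt0.
  have : h < Num.min h1 h2 by rewrite /h ltr_pdivrMr// ltr_pMr// ltr1n.
  rewrite lt_min => /andP[hh1 hh2].
  exists (dq h z T); split.
  - exact: (@dq_cont R h z T (wp_cont W')).
  - by have [] := H1 h h0 hh1.
  - exact: H2.
apply: (@le_trans _ _ B%:E); last by rewrite lee_fin.
apply: (sqr_lsc ab1 b1b (lQ T) B0) => e e0.
have [h1 h10 H1] := key e e0.
have [h2 h20 H2] := dq_weak a b W' T0 e0.
pose h := Num.min h1 h2 / 2.
have m0 : 0 < Num.min h1 h2 by rewrite lt_min h10.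
have h0 : 0 < h by rewrite divr_gt0.
have : h < Num.min h1 h2 by rewrite /h ltr_pdivrMr// ltr_pMr// ltr1n.
rewrite lt_min => /andP[hh1 hh2].
exists (dq h w T); split.
- exact: (@dq_cont R h w T (wp_cont W)).
- by have [] := H1 h h0 hh1.
- exact: H2.
Qed.

End PairDecay.

Section PairLimit.
Context {R : realType}.
Implicit Types (f g : R -> R) (w z P Q : R -> R -> R) (a b x y t r h : R).

Lemma Int_norm_sqr f g a b (M s K : R) : a <= b -> 0 < s -> 0 <= M ->
  locint (fun x => g x * f x) -> locint (fun x => f x ^+ 2) ->
  (forall x, a <= x <= b -> `|g x| <= M) ->
  Int (fun x => f x ^+ 2) a b <= K * s ^+ 2 ->
  Int (fun x => `|g x * f x|) a b <= s * ((M ^+ 2 * (b - a) + K) / 2).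
Proof.
move=> ab s0 M0 lgf lf2 HM HK.
have pw x : a <= x <= b -> `|g x * f x| <= s * M ^+ 2 / 2 + (2 * s)^-1 * f x ^+ 2.
  move=> /HM gM; rewrite normrM -(real_normK (num_real (f x))).
  apply: (@le_trans _ _ (M * `|f x|)); first exact: ler_wpM2r.
  rewrite -subr_ge0; have -> : s * M ^+ 2 / 2 + (2 * s)^-1 * `|f x| ^+ 2 - M * `|f x| =
    (s * M - `|f x|) ^+ 2 / (2 * s) by field; rewrite gt_eqF.
  by rewrite divr_ge0 ?sqr_ge0// mulr_ge0// ltW.
have lc : locint ((fun=> s * M ^+ 2 / 2) : R -> R) by exact: locint_cst.
have lz : locint (fun x => (2 * s)^-1 * f x ^+ 2) by exact: locintZ.
apply: (le_trans (le_Int (locint_norm lgf) (locintD lc lz) pw)).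
rewrite IntD// Int_cst// IntZ//.
have := ler_wpM2l (ltW (_ : 0 < (2 * s)^-1)) HK; rewrite invr_gt0 mulr_gt0// => /(_ isT).
move: (Int _ a b) => I.
have -> : (2 * s)^-1 * (K * s ^+ 2) = s * K / 2 by field; rewrite gt_eqF.
have -> : s * ((M ^+ 2 * (b - a) + K) / 2) = s * M ^+ 2 / 2 * (b - a) + s * K / 2 by ring.
by rewrite lerD2l.
Qed.

Theorem pair_limit (al be : R -> R) (Z0 La C a b m M BP BQ : R) : 0 < Z0 -> 0 < m ->
  (forall x, m <= al x) -> (forall x, 0 <= be x <= M) ->
  C1_decays al be Z0 La C a (b + 1) -> 0 < C -> 0 < La -> a <= b -> 0 <= BP -> 0 <= BQ ->
  exists2 K : R, 0 < K & forall w z P Q (ga gb W : R),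
  wpair (fun x => (al x)^-1) be w z P Q ->
  (forall t x, 0 <= t -> b <= x -> z t x = gb - Z0 * w t x) ->
  (forall t x, 0 <= t -> x <= a -> z t x = ga + Z0 * w t x) ->
  gb - ga = 2 * Z0 * W ->
  (forall t, locint (fun x => P t x ^+ 2)) -> (forall t, locint (fun x => Q t x ^+ 2)) ->
  sqr_bound P a (b + 1) BP -> sqr_bound Q a (b + 1) BQ ->
  forall T, 0 <= T ->
  [/\ Int (fun x => P T x ^+ 2) a b <= K * expR (- (La * T)),
      Int (fun x => Q T x ^+ 2) a b <= K * expR (- (La * T)) &
      forall x, a <= x <= b -> `|w T x - W| <= K * expR (- (La / 2 * T))].
Proof.
move=> Z00 m0 mal bM D C0 La0 ab BP0 BQ0.
have M0 : 0 <= M by have /andP[] := bM 0; exact: le_trans.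
have al0 x : 0 < al x by exact: lt_le_trans (mal x).
pose K1 := (2 * C + 1) * (BP + BQ).
have K10 : 0 <= K1 by rewrite mulr_ge0 ?addr_ge0// mulr_ge0// ltW.
pose A1 := (m^-1 ^+ 2 * (b - a) + K1) / 2.
pose A2 := (M ^+ 2 * (b - a) + K1) / 2.
have ba0 : 0 <= b - a by rewrite subr_ge0.
have A10 : 0 <= A1 by rewrite divr_ge0// addr_ge0// mulr_ge0// sqr_ge0.
have A20 : 0 <= A2 by rewrite divr_ge0// addr_ge0// mulr_ge0// sqr_ge0.
have AZ : 0 <= A2 / (2 * Z0) by rewrite divr_ge0// mulr_ge0// ltW.
exists (K1 + A1 + A2 / (2 * Z0) + 1); first by rewrite ltr_wpDl// !addr_ge0.
move=> w z P Q ga gb W WP zb za gW lP2 lQ2 sP sQ T T0.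
have bb1 : b < b + 1 by rewrite ltrDl.
have bl : b <= b + 1 by exact: ltW.
have [HP HQ] : (\int[lebesgue_measure]_(x in `[a, b]) (P T x ^+ 2)%:E <= ((2 * C + 1) * expR (- (La * T)) * (BP + BQ))%:E)%E /\
  (\int[lebesgue_measure]_(x in `[a, b]) (Q T x ^+ 2)%:E <= ((2 * C + 1) * expR (- (La * T)) * (BP + BQ))%:E)%E.
  apply: (pair_decay al0 D C0 La0 ab bb1 WP _ _ lP2 lQ2 BP0 BQ0 sP sQ T0).
    by move=> t t0; rewrite !zb//; have ar (p q r s : R) : p - q * r - (p - q * s) = - (q * (r - s)) by ring; exact: ar.
  by move=> t t0; rewrite !za//; have ar (p q r s : R) : p + q * r - (p + q * s) = q * (r - s) by ring; exact: ar.
have {}HP := Int_ereal_sqr (lP2 T) HP; have {}HQ := Int_ereal_sqr (lQ2 T) HQ.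
have eK : (2 * C + 1) * expR (- (La * T)) * (BP + BQ) = K1 * expR (- (La * T)) by rewrite /K1; ring.
rewrite eK in HP HQ.
have e0 := expR_ge0 (- (La * T)).
have KK : K1 <= K1 + A1 + A2 / (2 * Z0) + 1 by rewrite -!addrA lerDl !addr_ge0.
split; [exact: le_trans HP (ler_wpM2r e0 KK)|exact: le_trans HQ (ler_wpM2r e0 KK)|].
pose s := expR (- (La / 2 * T)).
have s0 : 0 < s by exact: expR_gt0.
have ss : expR (- (La * T)) = s ^+ 2.
  by rewrite /s -expRM_natl; congr expR; field.
rewrite ss in HP HQ.
have [[lP _] [lQ _]] := (wp_P WP, wp_Q WP).
have ck1 := wp_k1 WP; have ck2 := wp_k2 WP.
have lkP := locintM ck1 (lP T); have lkQ := locintM ck2 (lQ T).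
have mi : 0 <= m^-1 by rewrite invr_ge0 ltW.
have BPm : Int (fun x => `|(al x)^-1 * P T x|) a b <= s * A1.
  apply: (Int_norm_sqr ab s0 mi lkP (lP2 T) _ HP) => x _.
  by rewrite gtr0_norm ?invr_gt0// lef_pV2// posrE.
have BQm : Int (fun x => `|be x * Q T x|) a b <= s * A2.
  apply: (Int_norm_sqr ab s0 M0 lkQ (lQ2 T) _ HQ) => x _.
  by have /andP[b0 bM'] := bM x; rewrite ger0_norm.
have wd x y : a <= x -> x <= y -> y <= b -> `|w T y - w T x| <= s * A1.
  move=> ax xy yb; rewrite (wp_wx WP)//; apply: le_trans (Int_norm _ _ lkP) _.
  by apply: le_trans BPm; apply: le_Int_itv => //; exact: locint_norm.
have zd : `|z T b - z T a| <= s * A2.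
  by rewrite (wp_zx WP)//; apply: le_trans (Int_norm _ _ lkQ) _.
move=> x /andP[ax xb].
have h1 := wd a x (lexx a) ax xb; have h2 := wd x b ax xb (lexx b).
have h3 : `|w T b + w T a - 2 * W| <= s * (A2 / Z0).
  have E : w T b + w T a - 2 * W = - (z T b - z T a) / Z0.
    rewrite (zb _ _ T0 (lexx b)) (za _ _ T0 (lexx a)).
    have -> : gb = ga + 2 * Z0 * W by rewrite -gW addrC subrK.
    by move: (w T b) (w T a) => p q; field; rewrite gt_eqF.
  by rewrite E normrM normrN normfV (gtr0_norm Z00) mulrA ler_pM2r// invr_gt0.
have -> : K1 + A1 + A2 / (2 * Z0) + 1 = K1 + A1 + A2 / Z0 / 2 + 1.
  by congr (_ + _ + _); field; rewrite gt_eqF.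
rewrite -/s; move: (A2 / Z0) h3 K10 A10 s0 => A3 h3.
move: (w T b) (w T a) (w T x) h1 h2 h3 => wb wa wx h1 h2 h3 K10 A10 s0.
have E : wx - W = 2^-1 * (wx - wa) - 2^-1 * (wb - wx) + 2^-1 * (wb + wa - 2 * W) by field.
rewrite E; apply: le_trans (ler_normD _ _) _.
apply: (@le_trans _ _ (s * A1 + s * A3 / 2)).
  apply: lerD; last by rewrite normrM gtr0_norm ?invr_gt0// mulrC ler_pM2r ?invr_gt0.
  apply: le_trans (ler_normB _ _) _; rewrite !normrM gtr0_norm ?invr_gt0//.
  rewrite -mulrDr mulrC ler_pdivrMr//; apply: le_trans (lerD h1 h2) _.
  by rewrite mulr_natr mulr2n.
have -> : (K1 + A1 + A3 / 2 + 1) * s = s * A1 + s * A3 / 2 + (K1 + 1) * s by ring.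
by rewrite lerDl mulr_ge0// ?addr_ge0// ltW.
Qed.

End PairLimit.

(** * From the weak wave equation to its flux potential *)

Section Flux.
Context {R : realType}.
Local Notation mu := (@lebesgue_measure R).
Implicit Types (f g phi : R -> R) (A B z w K : R -> R -> R) (a b x y t s T m : R).

Lemma tcM P (k : R -> R) : tc P -> continuous k -> tc (fun t x => k x * P t x).
Proof.
move=> [lP cP] ck; split=> [t|D t e e0]; first exact: locintM.
have [M HM] := cont_bounded ck (- D) D.
have M0 : 0 < `|M| + 1 by rewrite ltr_wpDl.
have [d d0 Hd] := cP D t _ (divr_gt0 e0 M0).
exists d => // s st; have {}Hd := Hd s st.
have lD : locint (fun x => `|P s x - P t x|) by apply: locint_norm; exact: locintB.
apply: (@le_trans _ _ (Int (fun x => (`|M| + 1) * `|P s x - P t x|) (- D) D)).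
  apply: le_Int; [|exact: locintZ|].
    by apply: locint_norm; apply: locintB; exact: locintM.
  move=> u uxy; rewrite -mulrBr normrM ler_wpM2r//.
  by apply: le_trans (HM u uxy) _; apply: le_trans (ler_norm _) _; rewrite lerDl.
by rewrite IntZ// mulrC -ler_pdivlMr.
Qed.

Lemma small_Int_unif P T x (e : R) : tc P -> 0 < e -> exists2 d : R, 0 < d &
  forall s, 0 <= s <= T -> forall r, 0 <= r -> r < d -> Int (fun u => `|P s u|) x (x + r) <= e.
Proof.
move=> tP e0; have [lP _] := tP.
have e2 : 0 < e / 2 by rewrite divr_gt0.
pose N s t := Int (fun u => `|P s u - P t u|) x (x + 1).
have lB s t : locint (fun u => `|P s u - P t u|) by apply: locint_norm; exact: locintB.
have Nsym s t : N s t = N t s by apply: eq_Int => u _; rewrite distrC.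
have Ntri r s t : N r t <= N r s + N s t.
  by rewrite -IntD//; apply: le_Int => //; [exact: locintD|move=> u _; exact: ler_distD].
have [t|d d0 Hd] := @heine R N 0 T Nsym Ntri _ (e / 2) e2.
  move=> _ e1 e10; have [d d0 Hd] := tc_small x (x + 1) t tP e10.
  by exists d => // s _; exact: Hd.
have step n : exists2 r0 : R, 0 < r0 & forall s, 0 <= s <= T -> s <= n%:R * (d / 2) ->
    forall r, 0 <= r -> r < r0 -> Int (fun u => `|P s u|) x (x + r) <= e.
  elim: n => [|n [r0 r00 IH]].
    have [r0 r00 Hr] := small_Int x (lP 0) e0.
    exists r0 => // s /andP[s0 _]; rewrite mul0r => s0'.
    by rewrite (_ : s = 0)//; apply/eqP; rewrite eq_le s0 s0'.
  have [nT|nT] := leP (n%:R * (d / 2)) T; last first.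
    exists r0 => // s sT _; apply: IH => //; have /andP[_ sT'] := sT.
    exact: le_trans sT' (ltW nT).
  have [r1 r10 Hr] := small_Int x (lP (n%:R * (d / 2))) e2.
  exists (Num.min (Num.min r0 r1) 1); first by rewrite !lt_min r00 r10/=.
  move=> s sT sn r rr; rewrite !lt_min => /andP[/andP[rr0 rr1] rr2].
  have [sn'|sn'] := leP s (n%:R * (d / 2)); first exact: IH.
  have n0 : 0 <= n%:R * (d / 2) by rewrite mulr_ge0// divr_ge0// ltW.
  have HN : N s (n%:R * (d / 2)) <= e / 2.
    apply: Hd => //; first by rewrite n0.
    rewrite gtr0_norm ?subr_gt0// ltrBlDl; apply: le_lt_trans sn _.
    rewrite -[n.+1]addn1 natrD mulrDl mul1r ltrD2l.
    by rewrite ltr_pdivrMr// ltr_pMr// ltr1n.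
  apply: (@le_trans _ _ (Int (fun u => `|P s u - P (n%:R * (d / 2)) u| + `|P (n%:R * (d / 2)) u|) x (x + r))).
    apply: le_Int; [exact: locint_norm|apply: locintD => //; exact: locint_norm|].
    by move=> u _; rewrite -[in leLHS](subrK (P (n%:R * (d / 2)) u) (P s u)) ler_normD.
  rewrite IntD//; last exact: locint_norm.
  rewrite [e](splitr e); apply: lerD; last exact: Hr.
  by apply: le_trans HN; apply: le_Int_itv => //; rewrite ?lerDl// lerD2l ltW.
have d20 : 0 < d / 2 by rewrite divr_gt0.
have [r0 r00 H] := step (Num.Def.archi_bound (T / (d / 2))).
exists r0 => // s /andP[s0 sT]; apply: H; first by rewrite s0.
rewrite -ler_pdivrMr//; apply: le_trans (_ : T / (d / 2) <= _).
  by rewrite ler_pM2r// invr_gt0.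
have [T0|T0] := leP 0 (T / (d / 2)); first by apply: ltW; exact: archi_boundP.
by apply: (le_trans (ltW T0)).
Qed.

Lemma stp_close f x b m : locint f -> 0 < m -> x + m^-1 <= b ->
  `|Int (fun s => stp m x s * f s) x b - Int f x b| <= Int (fun s => `|f s|) x (x + m^-1).
Proof.
move=> lf m0 xb; have mi : 0 < m^-1 by rewrite invr_gt0.
have xm : x <= x + m^-1 by rewrite lerDl ltW.
have ls : locint (fun s => stp m x s * f s) by apply: locintM => //; exact: stp_cont.
have lsf : locint (fun s => stp m x s * f s - f s) by exact: locintB.
rewrite -IntB// (Int_cat lsf xm xb).
rewrite [X in _ + X](@eq_Int _ _ (fun=> 0)); last first.
  by move=> s /andP[s1 _]; rewrite stp_r// mul1r subrr.
rewrite Int_cst// mul0r addr0; apply: le_trans (Int_norm _ _ lsf) _.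
apply: le_Int; [exact: locint_norm|exact: locint_norm|].
move=> s _; rewrite -{2}[f s]mul1r -mulrBl normrM ler_piMl//.
by have /andP[] := stp01 m x s; rewrite ler_norml; lra.
Qed.

Lemma cutoff_close f x y b m : locint f -> 0 < m -> x <= y -> y + m^-1 <= b ->
  `|Int (fun s => cutoff m x y s * f s) x b - Int f x y| <=
  Int (fun s => `|f s|) x (x + m^-1) + Int (fun s => `|f s|) y (y + m^-1).
Proof.
move=> lf m0 xy yb; have mi : 0 < m^-1 by rewrite invr_gt0.
have yb' : y <= b by apply: le_trans yb; rewrite lerDl ltW.
have xb : x + m^-1 <= b by apply: le_trans yb; rewrite lerD2r.
have h1 := stp_close lf m0 xb; have h2 := stp_close lf m0 yb.
have ls u : locint (fun s => stp m u s * f s) by apply: locintM => //; exact: stp_cont.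
have -> : Int (fun s => cutoff m x y s * f s) x b =
    Int (fun s => stp m x s * f s) x b - Int (fun s => stp m y s * f s) y b.
  rewrite (@eq_Int _ _ (fun s => stp m x s * f s - stp m y s * f s)); last first.
    by move=> s _; rewrite /cutoff mulN1r mulrBl.
  rewrite IntB// (Int_cat (ls y) xy yb'); congr (_ - _).
  rewrite (@eq_Int _ _ (fun=> 0)) ?Int_cst// ?mul0r ?add0r//.
  by move=> s /andP[_ sy]; rewrite stp_l// mul0r.
have -> : Int f x y = Int f x b - Int f y b by rewrite (Int_cat lf xy yb') addrK.
have ar (p q r s t u : R) : `|p - r| <= t -> `|q - s| <= u -> `|p - q - (r - s)| <= t + u.
  move=> {}h1 {}h2; have -> : p - q - (r - s) = (p - r) - (q - s) by ring.
  by apply: le_trans (ler_normB _ _) (lerD h1 h2).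
exact: ar h1 h2.
Qed.

Lemma parts phi phi' f x y : locint f -> continuous phi' -> (forall s : R, dat phi s (phi' s)) ->
  x <= y -> Int (fun s => phi s * f s) x y + Int (fun s => phi' s * prim f s) x y =
  phi y * prim f y - phi x * prim f x.
Proof.
move=> lf cp' dp xy.
have cp : continuous phi.
  by apply: cont_ed => t e e0; have [d d0 Hd] := dat_cont (dp t) e0; exists d.
have cf := prim_continuous lf.
have lpf : locint (fun s => phi s * f s) by exact: locintM.
have lpp : locint (fun s => phi' s * prim f s) by apply: locint_cont; exact: contM.
pose F b := phi b * prim f b - Int (fun s => phi s * f s) x b - Int (fun s => phi' s * prim f s) x b.
suff : F y = F x.
  by rewrite /F !(Int_ge _ (lexx x)) !subr0 => /eqP; rewrite !subr_eq => /eqP ->; ring.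
have lf' := locint_norm lf; have lp' := locint_norm (locint_cont cp').
apply: (eq_local (m := fun b => Int (fun s => `|f s|) x b + Int (fun s => `|phi' s|) x b) xy) => e e0.
have [d1 d10 H1] := cont_unif x y cp e0.
have [d2 d20 H2] := cont_unif x y cf e0.
exists (Num.min d1 d2); first by rewrite lt_min d10.
move=> p q xp pq qy; rewrite lt_min => /andP[qp1 qp2].
have E : F q - F p = Int (fun s => (phi q - phi s) * f s) p q + Int (fun s => phi' s * (prim f p - prim f s)) p q.
  have -> : Int (fun s => (phi q - phi s) * f s) p q = phi q * Int f p q - Int (fun s => phi s * f s) p q.
    by rewrite -IntZ// -IntB//; [apply: eq_Int => s _; rewrite mulrBl|exact: locintZ].
  have -> : Int (fun s => phi' s * (prim f p - prim f s)) p q = prim f p * Int phi' p q - Int (fun s => phi' s * prim f s) p q.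
    rewrite -IntZ; last exact: locint_cont.
    rewrite -IntB//; [|by apply: locintZ; exact: locint_cont].
    by apply: eq_Int => s _; rewrite mulrBr [prim f p * _]mulrC.
  rewrite -(primB lf pq) -(prim_unique cp' dp pq) /F (Int_cat lpf xp pq) (Int_cat lpp xp pq).
  have ar (a b c d u v w z : R) : a * b - (u + v) - (w + z) - (c * d - u - w) =
     a * (b - d) - v + (d * (a - c) - z) by ring.
  exact: ar.
rewrite E (Int_cat lf' xp pq) (Int_cat lp' xp pq).
have ar (a b c d : R) : a + b + (c + d) - (a + c) = b + d by ring.
rewrite ar.
have l1 : locint (fun s => (phi q - phi s) * f s).
  by apply: locintM => // s; apply: cvgB; [exact: cvg_cst|exact: cp].
have l2 : locint (fun s => phi' s * (prim f p - prim f s)).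
  apply: locint_cont; apply: contM => // s; apply: cvgB; [exact: cvg_cst|exact: cf].
apply: le_trans (ler_normD _ _) _; rewrite mulrDr; apply: lerD.
  apply: le_trans (Int_norm _ _ l1) _; rewrite -IntZ//; apply: le_Int; [exact: locint_norm|exact: locintZ|].
  move=> s /andP[ps sq]; rewrite normrM ler_wpM2r// H1 ?ger0_norm; try (apply/andP); lra.
apply: le_trans (Int_norm _ _ l2) _; rewrite -IntZ//; apply: le_Int; [exact: locint_norm|exact: locintZ|].
move=> s /andP[ps sq]; rewrite normrM mulrC ler_wpM2r// H2 ?ler0_norm; try (apply/andP); lra.
Qed.

Lemma eqc_rep w K : tc K -> (forall t x y, x <= y -> w t y - w t x = Int (K t) x y) ->
  continuous (fun t => Int (w t) 0 1) -> eqc w.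
Proof.
move=> tK wK cw D t e e0; have [lK _] := tK.
have e2 : 0 < e / 2 by rewrite divr_gt0.
have [d1 d10 H1] := tc_small (- (`|D| + 1)) (`|D| + 1) t tK e2.
have [d2 d20 H2] := cont_unif (t - 1) (t + 1) cw e2.
exists (Num.min d1 (Num.min d2 1)); first by rewrite !lt_min d10 d20/=.
move=> s; rewrite !lt_min => /andP[st1 /andP[st2 st3]] x xD.
have {}H1 := H1 s st1.
have H2' : `|Int (w s) 0 1 - Int (w t) 0 1| <= e / 2.
  apply: (H2 s t) => //; first by move: st3; rewrite ltr_norml; lra.
  by apply/andP; lra.
have cwt u : continuous (w u) by apply: (rep_cont (lK u)) => p q pq; exact: wK.
have lw u := locint_cont (cwt u).
have lKn : locint (fun u => `|K s u - K t u|) by apply: locint_norm; exact: locintB.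
have D0 := normr_ge0 D; have DD := ler_norm D.
pose k y := w s y - w t y.
have lk : locint k by exact: locintB.
have kd y (c : R) : - (`|D| + 1) <= y -> y <= c -> c <= `|D| + 1 -> `|k c - k y| <= e / 2.
  move=> y1 yz c1; have -> : k c - k y = Int (fun u => K s u - K t u) y c.
    by rewrite IntB// -!wK// /k; ring.
  apply: le_trans (Int_norm _ _ (locintB (lK s) (lK t))) _; apply: le_trans H1; exact: le_Int_itv.
have kd' y (c : R) : - (`|D| + 1) <= y <= `|D| + 1 -> - (`|D| + 1) <= c <= `|D| + 1 -> `|k c - k y| <= e / 2.
  move=> /andP[y1 y2] /andP[z1 z2]; have [yz|zy] := leP y c; first exact: kd.
  by rewrite distrC; apply: kd => //; exact: ltW.
rewrite -/(k x); have -> : k x = Int (w s) 0 1 - Int (w t) 0 1 + Int (fun y => k x - k y) 0 1.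
  rewrite IntB//; last exact: locint_cst.
  by rewrite Int_cst// [Int k 0 1]IntB//; ring.
rewrite [e]splitr; apply: le_trans (ler_normD _ _) _; apply: lerD => //.
have -> : e / 2 = e / 2 * (1 - 0) by rewrite subr0 mulr1.
apply: Int_norm_le => //; first by apply: locintB => //; exact: locint_cst.
by move=> y y01; apply: kd'; move: xD y01; lra.
Qed.

End Flux.

Section WeakFlux.
Context {R : realType}.
Local Notation mu := (@lebesgue_measure R).
Implicit Types (f g h phi psi : R -> R) (P Q K : R -> R -> R) (x y t s T m N : R).

Lemma cont_close f t (e : R) : continuous f -> 0 < e -> exists2 d : R, 0 < d &
  forall s, `|s - t| < d -> `|f s - f t| <= e.
Proof.
move=> cf e0; have [d d0 H] := cont_unif (t - 1) (t + 1) cf e0.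
exists (Num.min d 1); first by rewrite lt_min d0/=.
move=> s; rewrite lt_min => /andP[s1 s2]; apply: (H s t) => //; last by apply/andP; lra.
by move: s2; rewrite ltr_norml; lra.
Qed.

Lemma cont_Int0 g : locint g -> continuous (fun T => Int g 0 T).
Proof.
move=> lg.
have E T : Int g 0 T = prim g (Num.max 0 T).
  have [T0|T0] := leP 0 T; first by rewrite primE.
  by rewrite prim0 Int_ge// ltW.
apply: cont_ed => t e e0.
have [d d0 H] := cont_close (Num.max 0 t) (prim_continuous lg) e0.
exists d => // s st; rewrite !E; apply: H; apply: le_lt_trans st.
have := ler_norm (s - t); have := ler_norm (t - s); rewrite (distrC t s) => h1 h2.
by rewrite ler_norml; case: (leP 0 s) => s0; case: (leP 0 t) => t0; apply/andP; split; lra.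
Qed.

Lemma tcD P Q : tc P -> tc Q -> tc (fun t x => P t x + Q t x).
Proof.
move=> [lP cP] [lQ cQ]; split=> [t|D t e e0]; first exact: locintD.
have e2 : 0 < e / 2 by rewrite divr_gt0.
have [d1 d10 H1] := cP D t _ e2; have [d2 d20 H2] := cQ D t _ e2.
exists (Num.min d1 d2); first by rewrite lt_min d10.
move=> s; rewrite lt_min => /andP[s1 s2]; have {}H1 := H1 s s1; have {}H2 := H2 s s2.
have l1 : locint (fun x => `|P s x - P t x|) by apply: locint_norm; exact: locintB.
have l2 : locint (fun x => `|Q s x - Q t x|) by apply: locint_norm; exact: locintB.
have l3 : locint (fun x => `|P s x + Q s x - (P t x + Q t x)|).
  by apply: locint_norm; apply: locintB; exact: locintD.
apply: (le_trans (le_Int l3 (locintD l1 l2) _)).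
  by move=> x _; rewrite opprD addrACA ler_normD.
by rewrite IntD// [e]splitr lerD.
Qed.

Lemma tc_sep (S : R -> R) g : continuous S -> locint g -> tc (fun t x => S t * g x).
Proof.
move=> cS lg; split=> [t|D t e e0]; first exact: locintZ.
have lg' := locint_norm lg.
pose k := Int (fun x => `|g x|) (- D) D + 1.
have k0 : 0 < k by rewrite ltr_wpDl// Int_ge0.
have [d d0 H] := cont_close t cS (divr_gt0 e0 k0).
exists d => // s st; have {}H := H s st.
rewrite (@eq_Int _ _ (fun x => `|S s - S t| * `|g x|)); last first.
  by move=> x _; rewrite -mulrBl normrM.
rewrite IntZ//; apply: (@le_trans _ _ (`|S s - S t| * k)).
  by apply: ler_wpM2l => //; rewrite lerDl.
by rewrite -ler_pdivlMr.
Qed.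

Lemma Int_from0 f h : continuous f -> locint h ->
  (forall s t, 0 < s -> s <= t -> f t - f s = Int h s t) ->
  forall T, 0 <= T -> f T - f 0 = Int h 0 T.
Proof.
move=> cf lh H T T0; have cp := prim_continuous lh.
have E s t : 0 < s -> s <= t -> f t - prim h t = f s - prim h s.
  by move=> s0 st; have := H s t s0 st; rewrite -(primB lh st); lra.
suff : f T - prim h T = f 0 - prim h 0 by rewrite -(primB lh T0); lra.
apply/eqP; rewrite -subr_eq0 -normr_le0; apply/ler_addgt0Pr => e e0; rewrite add0r.
have cD : continuous (fun s => f s - prim h s) by move=> s; apply: cvgB; [exact: cf|exact: cp].
have [d d0 Hd] := cont_close 0 cD e0.
have [T00|T00] := leP T 0.
  by rewrite (_ : T = 0) ?subrr ?normr0 ?(ltW e0)//; apply/eqP; rewrite eq_le T00 T0.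
pose s := Num.min T (d / 2).
have s0 : 0 < s by rewrite lt_min T00 divr_gt0.
rewrite (E s T s0); last by rewrite ge_min lexx.
apply: Hd; rewrite subr0 gtr0_norm//; apply: (@le_lt_trans _ _ (d / 2)).
  by rewrite ge_min lexx orbT.
by rewrite ltr_pdivrMr// ltr_pMr// ltr1n.
Qed.

Definition mean0 f := Int (fun s => dlt 1 0 s * f s) 0 1.

Lemma Int_zero_out f x y (p q : R) : locint f -> x <= p -> p <= q -> q <= y ->
  (forall s, ~ (p < s < q) -> f s = 0) -> Int f x y = Int f p q.
Proof.
move=> lf xp pq qy H; have py : p <= y by exact: le_trans qy.
rewrite (Int_cat lf xp py) (Int_cat lf pq qy).
rewrite (@eq_Int _ f (fun=> 0) x p); last by move=> s /andP[_ sp]; apply: H; apply/negP; rewrite negb_and -!leNgt sp.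
rewrite (@eq_Int _ f (fun=> 0) q y); last by move=> s /andP[sp _]; apply: H; apply/negP; rewrite negb_and -!leNgt sp orbT.
by rewrite !Int_cst// !mul0r addr0 add0r.
Qed.

Lemma bump_out s : ~ (0 < s < 1) -> @bump R s = 0.
Proof. by have [_ _ H _] := @bumpP R; exact: H. Qed.

Lemma dlt10_out s : ~ (0 < s < 1) -> @dlt R 1 0 s = 0.
Proof. by move=> H; rewrite /dlt mulr0 oppr0 addr0 !mul1r bump_out. Qed.

Lemma cutoff_zero m x y s : 0 < m -> x <= y -> ~ (x < s < y + m^-1) -> cutoff m x y s = 0.
Proof.
move=> m0 xy H; rewrite /cutoff mulN1r; have mi : 0 < m^-1 by rewrite invr_gt0.
have [sx|sx] := leP s x; first by rewrite !stp_l ?subrr// (le_trans sx).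
have [sy|sy] := leP (y + m^-1) s; last by case: H; rewrite sx.
by rewrite !stp_r ?subrr// (le_trans _ sy)// lerD2r.
Qed.

Lemma Int_dlt10 N : 1 <= N -> Int (dlt 1 0) (- N) N = 1.
Proof.
move=> N1; have ld := locint_cont (@dlt_cont R 1 0).
rewrite (@Int_zero_out _ _ _ 0 1 ld)//; [|lra|exact: dlt10_out].
by apply: Int_dlt => //; rewrite invr1 add0r.
Qed.

Lemma cutoff_close_box f x y N m : locint f -> 0 < m -> - N <= x -> x <= y -> y + m^-1 <= N ->
  `|Int (fun s => cutoff m x y s * f s) (- N) N - Int f x y| <=
  Int (fun s => `|f s|) x (x + m^-1) + Int (fun s => `|f s|) y (y + m^-1).
Proof.
move=> lf m0 Nx xy yN; have lc : locint (fun s => cutoff m x y s * f s).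
  by apply: locintM => //; exact: smooth_cont (@smooth_cutoff R m x y).
have mi : 0 < m^-1 by rewrite invr_gt0.
have xN : x <= N by apply: le_trans yN; rewrite -[x]addr0 lerD// ltW.
have -> : Int (fun s => cutoff m x y s * f s) (- N) N = Int (fun s => cutoff m x y s * f s) x N.
  rewrite (Int_cat lc Nx xN) [X in X + _](@eq_Int _ _ (fun=> 0)) ?Int_cst// ?mul0r ?add0r//.
  move=> s /andP[_ sx]; rewrite cutoff_zero ?mul0r//; apply/negP.
  by rewrite negb_and -!leNgt sx.
exact: cutoff_close.
Qed.

Lemma box_arith (p q k p0 q0 k0 gx ax e c : R) : `|p - p0| <= 2 * e ->
  `|q - q0| <= 2 * e * c -> `|k - k0| <= 2 * e -> p - k * gx = q - k * ax ->
  `|p0 - q0 - k0 * (gx - ax)| <= e * (2 + 2 * c + 2 * `|gx - ax|).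
Proof.
move=> Hp Hq Hk E.
have -> : p0 - q0 - k0 * (gx - ax) = (q - q0) - (p - p0) + (k - k0) * (gx - ax) by lra.
have -> : e * (2 + 2 * c + 2 * `|gx - ax|) = 2 * e * c + 2 * e + 2 * e * `|gx - ax| by ring.
apply: le_trans (ler_normD _ _) _; apply: lerD; last by rewrite normrM ler_wpM2r.
by apply: le_trans (ler_normB _ _) _; exact: lerD.
Qed.

Section Flux.
Variables (A B : R -> R -> R) (c1 c2 g1 g2 : R -> R).
Hypotheses (tA : tc A) (tB : tc B) (lg1 : locint g1) (lg2 : locint g2).
Hypotheses (cc1 : continuous c1) (cc2 : continuous c2).
Hypotheses (Bneg : forall t, t < 0 -> B t = B 0) (B0 : {ae mu, forall x, B 0 x = 0}).
Hypothesis weak : forall phi N, smooth phi -> (forall x, ~ (- N < x < N) -> phi x = 0) ->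
  weak_on `]0, +oo[ (fun t => Int (fun x => phi x * B t x) (- N) N)
    (fun t => - Int (fun x => derive1 phi x * A t x) (- N) N +
       (c1 t * Int (fun x => phi x * g1 x) (- N) N +
        c2 t * Int (fun x => phi x * g2 x) (- N) N)).

Let S1 T := Int c1 0 T.
Let S2 T := Int c2 0 T.
Let G T x := B T x - (S1 T * g1 x + S2 T * g2 x).

Let lA t : locint (A t). Proof. by have [] := tA. Qed.
Let lB t : locint (B t). Proof. by have [] := tB. Qed.
Let cS1 : continuous S1. Proof. by apply: cont_Int0; exact: locint_cont. Qed.
Let cS2 : continuous S2. Proof. by apply: cont_Int0; exact: locint_cont. Qed.

Let tG : tc G.
Proof.
have t1 := tc_sep cS1 lg1; have t2 := tc_sep cS2 lg2.
have t3 : tc (fun t x => B t x + -1 * (S1 t * g1 x + S2 t * g2 x)).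
  by apply: tcD => //; apply: (tcM (tcD t1 t2)); exact: contC.
rewrite (_ : G = fun t x => B t x + -1 * (S1 t * g1 x + S2 t * g2 x))//.
by apply/funext => t; apply/funext => x; rewrite mulN1r.
Qed.
Let lG t : locint (G t). Proof. by have [] := tG. Qed.

Let weak_time phi N T : smooth phi -> (forall x, ~ (- N < x < N) -> phi x = 0) -> 0 <= T ->
  Int (fun x => phi x * G T x) (- N) N =
  - Int (fun t => Int (fun x => derive1 phi x * A t x) (- N) N) 0 T.
Proof.
move=> sp pN T0; have cp := smooth_cont sp; have cp' := smooth_cont (smooth_derive sp).
set k1 := Int (fun x => phi x * g1 x) (- N) N.
set k2 := Int (fun x => phi x * g2 x) (- N) N.
pose f t := Int (fun x => phi x * B t x) (- N) N.
pose a t := Int (fun x => derive1 phi x * A t x) (- N) N.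
have cf : continuous f by exact: tc_cont.
have ca : continuous a by exact: tc_cont.
have la := locint_cont ca; have lc1 := locint_cont cc1; have lc2 := locint_cont cc2.
have l1 : locint (fun t => k1 * c1 t) by exact: locintZ.
have l2 : locint (fun t => k2 * c2 t) by exact: locintZ.
pose h t := - a t + (k1 * c1 t + k2 * c2 t).
have lh : locint h by apply: locintD; [exact: locintN|exact: locintD].
have ch : continuous h.
  move=> t; apply: cvgD; first by apply: cvgN; exact: ca.
  by apply: cvgD; apply: cvgM; [exact: cvg_cst|exact: cc1|exact: cvg_cst|exact: cc2].
have inc s t : 0 < s -> s <= t -> f t - f s = Int h s t.
  move=> s0 st; have W := weak sp pN.
  have W' : weak_on `]0, +oo[ f h.
    move=> psi tpsi; have := W psi tpsi => ->; congr (- _).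
    by apply: eq_Rintegral => u _; congr (_ * _); rewrite /h (mulrC k1) (mulrC k2).
  have sub : `[s, t + 1]%classic `<=` (`]0, +oo[%classic : set R).
    by move=> u /=; rewrite !in_itv/= andbT => /andP[su _]; exact: lt_le_trans su.
  apply: (weak_Int (b := t + 1) _ (locint_cont cf) lh W' st _ sub) => //.
  - by rewrite ltrDl.
  - exact: Lpt_cont.
  - exact: Lpt_cont.
have := Int_from0 cf lh inc T0.
have -> : f 0 = 0.
  rewrite /f (@Int_ae _ _ (fun=> 0)); [|exact: locintM|exact: locint_cst|]; last first.
    by apply: (aeS B0) => x ->; rewrite mulr0.
  by have [NN|NN] := leP (- N) N; [rewrite Int_cst// mul0r|rewrite Int_ge// ltW].
rewrite subr0 /h IntD; [|exact: locintN|exact: locintD].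
rewrite IntD// IntN// !IntZ// => fT.
have -> : Int (fun x => phi x * G T x) (- N) N = f T - (k1 * S1 T + k2 * S2 T).
  have lp1 : locint (fun x => phi x * g1 x) by exact: locintM.
  have lp2 : locint (fun x => phi x * g2 x) by exact: locintM.
  have lpB : locint (fun x => phi x * B T x) by exact: locintM.
  rewrite (@eq_Int _ _ (fun x => phi x * B T x - (S1 T * (phi x * g1 x) + S2 T * (phi x * g2 x)))); last first.
    by move=> x _; rewrite /G; ring.
  rewrite IntB//; last by apply: locintD; exact: locintZ.
  by rewrite IntD; [|exact: locintZ..]; rewrite !IntZ// -/k1 -/k2 (mulrC k1) (mulrC k2).
by rewrite fT -/(S1 T) -/(S2 T) -/a; ring.
Qed.

Let weak_prim psi N T : smooth psi -> (forall x, ~ (- N < x < N) -> psi x = 0) ->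
  0 <= N -> Int psi (- N) N = 0 -> 0 <= T ->
  Int (fun x => psi x * prim (G T) x) (- N) N =
  Int (fun t => Int (fun x => psi x * A t x) (- N) N) 0 T.
Proof.
move=> sp pN N0 I0 T0; have cp := smooth_cont sp; have lp := locint_cont cp.
have NN : - N <= N by lra.
pose phi x := prim psi x + - prim psi (- N).
have dphi x : dat phi x (psi x).
  have -> : psi x = psi x + 0 by rewrite addr0.
  by apply: datD; [exact: prim_dat|exact: dat_cst].
have sphi : smooth phi by exact: (smooth_prim sp).
have dE : derive1 phi = psi by apply/funext => x; have [] := dat_derive (dphi x).
have pout x : ~ (- N < x < N) -> phi x = 0.
  move=> xN; have [x1|x1] := leP x (- N).
    have := primB lp x1; rewrite (@eq_Int _ psi (fun=> 0)); last first.
      by move=> s /andP[_ sN]; apply: pN; apply/negP; rewrite negb_and -!leNgt sN.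
    by rewrite Int_cst// mul0r /phi; lra.
  have [x2|x2] := leP N x; last by case: xN; rewrite x1.
  rewrite /phi (primB lp (ltW x1)) (Int_cat lp NN x2) I0 add0r.
  rewrite (@eq_Int _ psi (fun=> 0)) ?Int_cst ?mul0r//.
  by move=> s /andP[sN _]; apply: pN; apply/negP; rewrite negb_and -!leNgt sN orbT.
have := weak_time sphi pout T0; rewrite dE => H.
have := parts (lG T) cp dphi NN; rewrite H.
have p1 : phi N = 0 by apply: pout; rewrite ltxx andbF.
have p2 : phi (- N) = 0 by apply: pout; rewrite ltxx.
rewrite p1 p2 !mul0r subr0.
have ar (a b : R) : - a + b = 0 -> b = a by lra.
exact: ar.
Qed.

Let weak_box x y T : x <= y -> 0 <= T ->
  Int (prim (G T)) x y - (y - x) * mean0 (prim (G T)) =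
  Int (fun t => Int (A t) x y) 0 T - (y - x) * Int (fun t => mean0 (A t)) 0 T.
Proof.
move=> xy T0; pose N := `|x| + `|y| + 2.
have x0 := normr_ge0 x; have y0 := normr_ge0 y.
have hx := ler_norm (- x); rewrite normrN in hx; have hy := ler_norm y.
have Nx : - N <= x by rewrite /N; lra.
have yN : y + 1 <= N by rewrite /N; lra.
have N1 : 1 <= N by rewrite /N; lra.
have N0 : 0 <= N by lra.
clearbody N.
have cG := prim_continuous (lG T); have lpG := locint_cont cG.
have cd := @dlt_cont R 1 0.
have lt (k : R -> R) p q : continuous k -> locint (fun t => Int (fun s => k s * A t s) p q).
  by move=> ck; apply: locint_cont; exact: tc_cont.
have lt1 : locint (fun t => Int (A t) x y) by apply: locint_cont; exact: tc_cont1.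
have mean_box f : locint f -> Int (fun s => dlt 1 0 s * f s) (- N) N = mean0 f.
  move=> lf; apply: Int_zero_out; [exact: locintM|lra|exact: ler01|exact: N1|].
  by move=> s /dlt10_out ->; rewrite mul0r.
set p0 := Int (prim (G T)) x y; set q0 := Int _ 0 T.
set gx := mean0 _; set ax := Int _ 0 T.
have ar (a b c d e : R) : a - b - c * (d - e) = 0 -> a - c * d = b - c * e by lra.
suff : p0 - q0 - (y - x) * (gx - ax) = 0 by exact: ar.
apply/eqP; rewrite -normr_le0; apply/ler_addgt0Pr => e' e'0; rewrite add0r.
pose L := 2 + 2 * T + 2 * `|gx - ax|.
have L0 : 0 < L by rewrite /L; have := normr_ge0 (gx - ax); lra.
pose e := e' / L; have e0 : 0 < e by rewrite divr_gt0.
have [d1 d10 H1] := small_Int x lpG e0; have [d2 d20 H2] := small_Int y lpG e0.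
have [d3 d30 H3] := small_Int_unif T x tA e0; have [d4 d40 H4] := small_Int_unif T y tA e0.
pose d := Num.min (Num.min (Num.min d1 d2) (Num.min d3 d4)) (Num.min 1 e).
have d0 : 0 < d by rewrite !lt_min d10 d20 d30 d40 e0 ltr01.
pose r := d / 2; have r0 : 0 < r by rewrite divr_gt0.
have : r < d by rewrite ltr_pdivrMr// ltr_pMr// ltr1n.
rewrite !lt_min => /andP[/andP[/andP[r1 r2] /andP[r3 r4]] /andP[r5 r6]].
pose m := r^-1; have m0 : 0 < m by rewrite invr_gt0.
have mr : m^-1 = r by rewrite invrK.
have yrN : y + m^-1 <= N by rewrite mr; lra.
have cc : continuous (cutoff m x y) by exact: smooth_cont (@smooth_cutoff R m x y).
have lcut := locint_cont cc.
pose kap := Int (cutoff m x y) (- N) N.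
have Hk : `|kap - (y - x)| <= 2 * e.
  have := cutoff_close_box (@locint_cst R 1) m0 Nx xy yrN.
  rewrite Int_cst// mul1r (@eq_Int _ (fun s => cutoff m x y s * 1) (cutoff m x y)); last by move=> s _; rewrite mulr1.
  rewrite -/kap mr => /le_trans; apply.
  rewrite !(@eq_Int _ (fun=> `|1|) (fun=> 1)); try by move=> s _; rewrite normr1.
  by rewrite !Int_cst ?lerDl ?(ltW r0)// !mul1r; lra.
pose psi s := cutoff m x y s + (- kap) * dlt 1 0 s.
have spsi : smooth psi by apply: smoothD; [exact: smooth_cutoff|apply: smoothZ; exact: smooth_dlt].
have pout s : ~ (- N < s < N) -> psi s = 0.
  move=> sN; rewrite /psi cutoff_zero ?dlt10_out ?mulr0 ?addr0// => /andP[s1 s2]; apply: sN; apply/andP; split.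
  - by apply: le_lt_trans s1; lra.
  - by apply: lt_le_trans s2 _; lra.
  - by apply: le_lt_trans s1.
  - by apply: lt_le_trans s2 _.
have I0 : Int psi (- N) N = 0.
  rewrite IntD//; last by apply: locintZ; exact: locint_cont.
  by rewrite IntZ; [rewrite Int_dlt10// mulr1 subrr|exact: locint_cont].
have := weak_prim spsi pout N0 I0 T0.
have split_psi f : locint f -> Int (fun s => psi s * f s) (- N) N =
    Int (fun s => cutoff m x y s * f s) (- N) N - kap * mean0 f.
  move=> lf; have l1 : locint (fun s => cutoff m x y s * f s) by exact: locintM.
  have l2 : locint (fun s => dlt 1 0 s * f s) by exact: locintM.
  rewrite -(mean_box f lf) -IntZ// -IntB//; last exact: locintZ.
  by apply: eq_Int => s _; rewrite /psi; ring.
rewrite split_psi// -/gx.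
rewrite (@eq_Int _ (fun t => Int (fun s => psi s * A t s) (- N) N)
  (fun t => Int (fun s => cutoff m x y s * A t s) (- N) N - kap * mean0 (A t))); last first.
  by move=> t _; rewrite split_psi.
rewrite IntB; [|exact: lt|by apply: locintZ; exact: lt].
rewrite IntZ; last exact: lt.
rewrite -/ax.
have Hp := cutoff_close_box lpG m0 Nx xy yrN.
have Hq : `|Int (fun t => Int (fun s => cutoff m x y s * A t s) (- N) N) 0 T - q0| <= 2 * e * T.
  rewrite /q0 -IntB//; last exact: lt.
  have -> : 2 * e * T = 2 * e * (T - 0) by rewrite subr0.
  apply: Int_norm_le => //; first by apply: locintB => //; exact: lt.
  move=> s sT; apply: le_trans (cutoff_close_box (lA s) m0 Nx xy yrN) _.
  rewrite mr; have h3 := H3 s sT r (ltW r0) r3; have h4 := H4 s sT r (ltW r0) r4.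
  by rewrite mulr_natl mulr2n; exact: lerD h3 h4.
have {}Hp : `|Int (fun s => cutoff m x y s * prim (G T) s) (- N) N - p0| <= 2 * e.
  apply: le_trans Hp _; rewrite mr mulr_natl mulr2n; apply: lerD; [exact: H1 (ltW r0) r1|exact: H2 (ltW r0) r2].
have eL : e' = e * L by rewrite /e mulfVK// gt_eqF.
rewrite eL /L => E; exact: box_arith Hp Hq Hk E.
Qed.

Theorem weak_flux : exists z : R -> R -> R, [/\ eqc z,
  (forall t x y, x <= y -> z t y - z t x = Int (G t) x y),
  (forall T1 T2, 0 <= T1 -> T1 <= T2 -> forall x y, x <= y ->
     Int (fun s => z T2 s - z T1 s) x y = Int (fun t => Int (A t) x y) T1 T2) &
  (forall x, z 0 x = 0)].
Proof.
pose c T := - mean0 (prim (G T)) + Int (fun t => mean0 (A t)) 0 T.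
pose z T x := prim (G T) x + c T.
have zx t x y : x <= y -> z t y - z t x = Int (G t) x y.
  by move=> xy; rewrite -(primB (lG t) xy) /z; ring.
have lpG T := locint_cont (prim_continuous (lG T)).
have zT T x y : 0 <= T -> x <= y -> Int (z T) x y = Int (fun t => Int (A t) x y) 0 T.
  move=> T0 xy; rewrite IntD//; last exact: locint_cst.
  rewrite Int_cst//; have := weak_box xy T0; rewrite /c.
  move: (Int _ 0 T) (Int _ 0 T) (Int _ x y) (mean0 _) => p q r s; lra.
have Gneg t : t < 0 -> G t = G 0.
  move=> t0; apply/funext => x; rewrite /G Bneg// /S1 /S2 !(Int_ge _ (ltW t0)).
  by rewrite !(Int_ge _ (lexx 0)).
have zneg t : t < 0 -> z t = z 0.
  by move=> t0; apply/funext => x; rewrite /z /c Gneg// (Int_ge _ (ltW t0)) (Int_ge _ (lexx 0)).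
have lt1 x y : locint (fun t => Int (A t) x y) by apply: locint_cont; exact: tc_cont1.
have lz T : locint (z T) by apply: locintD => //; exact: locint_cst.
exists z; split => //.
- apply: (eqc_rep tG zx).
  rewrite (_ : (fun t => Int (z t) 0 1) = fun T => Int (fun t => Int (A t) 0 1) 0 T).
    exact: cont_Int0.
  apply/funext => T; have [T0|T0] := leP 0 T; first exact: zT.
  by rewrite zneg// zT// (Int_ge _ (lexx 0)) (Int_ge _ (ltW T0)).
- move=> T1 T2 T10 T12 x y xy; have T20 := le_trans T10 T12.
  rewrite IntB//; rewrite !zT//.
  by rewrite (Int_cat (lt1 x y) T10 T12); ring.
- move=> x; have G0 : {ae mu, forall x, G 0 x = 0}.
    by apply: (aeS B0) => u Bu; rewrite /G Bu /S1 /S2 !(Int_ge _ (lexx 0)); ring.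
  have P0 u : prim (G 0) u = 0.
    have I0 p q : Int (G 0) p q = 0.
      rewrite (@Int_ae _ _ (fun=> 0) _ _ (lG 0) (locint_cst 0) G0).
      by have [pq|pq] := leP p q; [rewrite Int_cst// mul0r|rewrite Int_ge// ltW].
    have [u0|u0] := leP 0 u; first by rewrite primE.
    by have := primB (lG 0) (ltW u0); rewrite prim0 I0; lra.
  rewrite /z /c P0 (Int_ge _ (lexx 0)) addr0 add0r /mean0.
  rewrite (@eq_Int _ _ (fun=> 0)) ?Int_cst ?mul0r ?oppr0//.
  by move=> s _; rewrite P0 mulr0.
Qed.

End Flux.
End WeakFlux.

(** * Extraction of real parts *)

Section Norms.
Context {R : realType}.
Local Notation mu := (@lebesgue_measure R).
Implicit Types (f g : R -> R[i]) (h k : R -> R) (x y t s : R) (b : bool) (D : set R).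

Definition part b f : R -> R := if b then im f else re f.

Lemma normc_sqr (c : R[i]) : Normc.normc c ^+ 2 = complex.Re c ^+ 2 + complex.Im c ^+ 2.
Proof. by case: c => p q /=; rewrite sqr_sqrtr// addr_ge0 ?sqr_ge0. Qed.

Lemma normc_ge0 (c : R[i]) : 0 <= Normc.normc c.
Proof. by case: c => p q /=; exact: sqrtr_ge0. Qed.

Lemma L2norm_int D f :
  L2norm D f = ((\int[mu]_(x in D) (re f x ^+ 2 + im f x ^+ 2)%:E) `^ 2^-1)%E.
Proof.
rewrite /L2norm Lnorm.unlock; congr (_ `^ _)%E; rewrite [RHS]integral_mkcond.
apply: eq_integral => x _; rewrite /patch; case: ifPn => xD.
  rewrite /= ger0_norm ?normc_ge0// powR_mulrn ?normc_ge0// normc_sqr.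
  by [].
by rewrite -[RHS]/(0%E) -[X in `|X%:E|%E]/(0 : R) /= normr0 powR0// pnatr_eq0.
Qed.

Lemma int_sqr_ge0 D f : (0 <= \int[mu]_(x in D) (re f x ^+ 2 + im f x ^+ 2)%:E)%E.
Proof. by apply: integral_ge0 => x _; rewrite lee_fin addr_ge0 ?sqr_ge0. Qed.

Lemma L2norm_sqr D f :
  (L2norm D f ^+ 2 = \int[mu]_(x in D) (re f x ^+ 2 + im f x ^+ 2)%:E)%E.
Proof.
rewrite L2norm_int; have := int_sqr_ge0 D f; move: (integral _ _ _) => z z0.
rewrite expe2 -poweRM//.
case: z z0 => [r|//|//]; rewrite ?lee_fin => r0.
  by rewrite -EFinM poweR_EFin -expr2 -powR_mulrn// -powRrM mulfV ?pnatr_eq0// powRr1.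
by rewrite mulyy poweRyr// invr_eq0 pnatr_eq0.
Qed.

Lemma part_sqr_le b f x : part b f x ^+ 2 <= re f x ^+ 2 + im f x ^+ 2.
Proof. by case: b; rewrite /part ?lerDl ?lerDr sqr_ge0. Qed.

Lemma sqr_meas f : measurable_fun setT (re f) -> measurable_fun setT (im f) ->
  measurable_fun setT (fun x => re f x ^+ 2 + im f x ^+ 2).
Proof. by move=> m1 m2; exact: measurable_funD (measurable_funX _ m1) (measurable_funX _ m2). Qed.

Lemma L2_meas b f D : L2 D f -> measurable_fun D (part b f).
Proof. by case: b => -[]. Qed.

Lemma L2_int b f : L2 setT f ->
  (\int[mu]_(x in setT) (part b f x ^+ 2)%:E < +oo)%E.
Proof.
move=> L; have [m1 m2 foo] := L; have mb := L2_meas b L.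
apply: (@le_lt_trans _ _ (\int[mu]_(x in setT) (re f x ^+ 2 + im f x ^+ 2)%:E)%E).
  apply: ge0_le_integral => //.
  - by move=> x _; rewrite lee_fin sqr_ge0.
  - by apply/measurable_EFinP; exact: measurable_funX.
  - by apply/measurable_EFinP; exact: sqr_meas.
  - by move=> x _; rewrite lee_fin part_sqr_le.
rewrite -L2norm_sqr expe2.
have : (0 <= L2norm setT f)%E by rewrite L2norm_int poweR_ge0.
by move: (L2norm setT f) foo => [r|//|//] _ _; rewrite ltry.
Qed.

Lemma L2_locint_sqr b f : L2 setT f -> locint (fun x => part b f x ^+ 2).
Proof.
move=> L; have mb := L2_meas b L.
have m2 : measurable_fun setT (fun x => part b f x ^+ 2) by exact: measurable_funX.
split=> // x y; apply/integrableP; split.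
  by apply/measurable_EFinP; exact: measurable_funTS.
apply: le_lt_trans (L2_int b L); apply: (@le_trans _ _ (\int[mu]_(x in `[x, y]) (part b f x ^+ 2)%:E)%E).
  by apply: ge0_le_integral => //; [apply/measurable_EFinP; apply: measurableT_comp => //; exact: measurable_funTS
   |apply/measurable_EFinP; exact: measurable_funTS
   |move=> u _; rewrite lee_fin ger0_norm ?sqr_ge0].
apply: ge0_subset_integral => //; first by apply/measurable_EFinP.
by move=> u _; rewrite lee_fin sqr_ge0.
Qed.

Lemma locint_of_sqr h : measurable_fun setT h -> locint (fun x => h x ^+ 2) -> locint h.
Proof.
move=> mh l2; split=> // x y.
have l1 := locintD (@locint_cst R 1) l2.
apply: (le_integrable _ _ _ (locint_int x y l1)) => //.
  by apply/measurable_EFinP; exact: measurable_funTS.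
move=> u _; rewrite /= lee_fin.
rewrite [leRHS]ger0_norm ?addr_ge0 ?sqr_ge0// -(real_normK (num_real (h u))).
by have := sqr_ge0 (`|h u| - 1); have := normr_ge0 (h u); rewrite sqrrB; nra.
Qed.

Lemma L2_locint b f : L2 setT f -> locint (part b f).
Proof. by move=> L; apply: locint_of_sqr; [exact: L2_meas L|exact: L2_locint_sqr]. Qed.

Lemma L2norm_part b f x y s : measurable_fun setT (re f) -> measurable_fun setT (im f) ->
  locint (fun x => part b f x ^+ 2) -> 0 <= s ->
  (L2norm setT f <= s%:E)%E -> Int (fun x => part b f x ^+ 2) x y <= s ^+ 2.
Proof.
move=> m1 m2 l2 s0 fs; apply: Int_ereal_sqr => //.
have N0 : (0 <= L2norm setT f)%E by rewrite L2norm_int poweR_ge0.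
have : (L2norm setT f ^+ 2 <= (s ^+ 2)%:E)%E.
  rewrite expe2 expr2 EFinM; exact: lee_pmul.
rewrite L2norm_sqr; apply: le_trans.
apply: (@le_trans _ _ (\int[mu]_(x in `[x, y]) (re f x ^+ 2 + im f x ^+ 2)%:E)%E).
  apply: ge0_le_integral => //.
  - by move=> u _; rewrite lee_fin sqr_ge0.
  - by apply/measurable_EFinP; apply: measurable_funTS; case: l2.
  - by apply/measurable_EFinP; apply: measurable_funTS; exact: sqr_meas.
  - by move=> u _; rewrite lee_fin part_sqr_le.
apply: ge0_subset_integral => //.
  by apply/measurable_EFinP; exact: sqr_meas.
by move=> u _; rewrite lee_fin addr_ge0 ?sqr_ge0.
Qed.

Lemma L2norm_le D f x y (A s : R) : measurable D -> D `<=` `[x, y] ->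
  locint (fun x => re f x ^+ 2) -> locint (fun x => im f x ^+ 2) ->
  Int (fun x => re f x ^+ 2) x y <= A -> Int (fun x => im f x ^+ 2) x y <= A ->
  0 <= s -> 2 * A <= s ^+ 2 -> (L2norm D f <= s%:E)%E.
Proof.
move=> mD sD l1 l2 h1 h2 s0 As.
have l3 := locintD l1 l2.
have I0 : (\int[mu]_(x in D) (re f x ^+ 2 + im f x ^+ 2)%:E <= (s ^+ 2)%:E)%E.
  apply: (@le_trans _ _ (\int[mu]_(x in `[x, y]) (re f x ^+ 2 + im f x ^+ 2)%:E)%E).
    apply: ge0_subset_integral => //.
      by apply/measurable_EFinP; apply: measurable_funTS; case: l3.
    by move=> u _; rewrite lee_fin addr_ge0 ?sqr_ge0.
  have fin : (\int[mu]_(x in `[x, y]) (re f x ^+ 2 + im f x ^+ 2)%:E)%E \is a fin_num.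
    exact: integrable_fin_num (locint_int x y l3).
  rewrite -[leLHS]fineK// lee_fin.
  apply: le_trans As; have := IntD x y l1 l2; rewrite {1}IntE /Rintegral => ->.
  by have := lerD h1 h2; rewrite mulr_natl mulr2n.
rewrite L2norm_int; have -> : s%:E = ((s ^+ 2)%:E `^ 2^-1)%E.
  by rewrite poweR_EFin -powR_mulrn// -powRrM mulfV ?pnatr_eq0// powRr1.
by apply: gt0_ler_poweR => //; rewrite ?in_itv/= ?int_sqr_ge0 ?lee_fin ?sqr_ge0// ?leey// invr_ge0.
Qed.

End Norms.

Local Open Scope complex_scope.

Section Extract.
Context {R : realType}.
Local Notation mu := (@lebesgue_measure R).
Implicit Types (f g F : R -> R[i]) (h k phi : R -> R) (P Q : R -> R -> R) (u ut w : R -> R -> R[i])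
  (x y t s T N : R) (b : bool) (D : set R).

(* [part b f] and [copart b f] are the real and imaginary parts of [f] or, for
   [b = true], of [- 'i * f]. *)
Definition copart b f : R -> R := fun x => if b then - re f x else im f x.

Lemma partB b f g x : part b (fun x => f x - g x) x = part b f x - part b g x.
Proof. by case: b; rewrite /part /re /im; case: (f x) => p q; case: (g x). Qed.

Lemma partBE b f g : part b (fun x => f x - g x) = fun x => part b f x - part b g x.
Proof. by apply/funext => x; exact: partB. Qed.

Lemma partZ b k f x : part b (fun x => (k x)%:C * f x) x = k x * part b f x.
Proof. by case: b; rewrite /part /re /im; case: (f x) => p q /=; rewrite mul0r ?subr0 ?addr0. Qed.

Lemma locint_sqrB h k : locint h -> locint k -> locint (fun x => h x ^+ 2) ->
  locint (fun x => k x ^+ 2) -> locint (fun x => (h x - k x) ^+ 2).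
Proof.
move=> [mh _] [mk _] lh2 lk2; have l2 := locintD (locintZ 2 lh2) (locintZ 2 lk2).
have ms : measurable_fun setT (fun x => (h x - k x) ^+ 2).
  by apply: measurable_funX; exact: measurable_funB.
split=> // x y; apply: (le_integrable _ _ _ (locint_int x y l2)) => //.
  by apply/measurable_EFinP; exact: measurable_funTS.
move=> u _; rewrite /= lee_fin (ger0_norm (sqr_ge0 _)).
have := sqr_ge0 (h u + k u); have := sqr_ge0 (h u); have := sqr_ge0 (k u).
by move: (h u) (k u) => p q p0 q0 pq; rewrite ger0_norm; lra.
Qed.

Definition tc2 P := [/\ forall t, locint (P t), forall t, locint (fun x => P t x ^+ 2) &
  forall B t (e : R), 0 < e -> exists2 d : R, 0 < d & forall s, `|s - t| < d ->
    Int (fun x => (P s x - P t x) ^+ 2) (- B) B <= e].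

Lemma tc2_tc P : tc2 P -> tc P.
Proof.
move=> [lP lP2 cP]; split=> // B t e e0.
have lD s : locint (fun x => P s x - P t x) by exact: locintB.
have [B0|B0] := leP B 0.
  by exists 1 => // s _; rewrite Int_ge ?(ltW e0)//; lra.
have BB : - B <= B by lra.
have e20 : 0 < e ^+ 2 / (2 * B) by rewrite divr_gt0 ?exprn_gt0// mulr_gt0.
have [d d0 Hd] := cP B t _ e20.
exists d => // s st; have {}Hd := Hd s st.
have lD2 : locint (fun x => (P s x - P t x) ^+ 2) by exact: locint_sqrB.
have ln := locint_norm (lD s).
have ln2 : locint (fun x => `|P s x - P t x| ^+ 2).
  rewrite (_ : (fun x => _) = (fun x => (P s x - P t x) ^+ 2))//.
  by apply/funext => x; rewrite real_normK// num_real.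
have := Int_sqr_le ln ln2 BB.
rewrite (@eq_Int _ (fun x => `|P s x - P t x| ^+ 2) (fun x => (P s x - P t x) ^+ 2)); last first.
  by move=> x _; rewrite real_normK// num_real.
move=> H; have I0 : 0 <= Int (fun x => `|P s x - P t x|) (- B) B by exact: Int_ge0.
rewrite -(@ler_pXn2r _ 2)// ?nnegrE ?(ltW e0)//; apply: le_trans H _.
have B2 : 0 < B - - B by lra.
by rewrite mulrC -ler_pdivlMr// (_ : B - - B = 2 * B)//; ring.
Qed.

Lemma tc2_bound P a (c : R) : a <= c -> tc2 P ->
  sqr_bound P a c (2 * Int (fun x => P 0 x ^+ 2) a c).
Proof.
move=> ac [lP lP2 cP] e e0; have e2 : 0 < e / 2 by rewrite divr_gt0.
have [d d0 Hd] := cP (`|a| + `|c|) 0 _ e2.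
exists (d / 2); first by rewrite divr_gt0.
move=> t t0 td; have td' : `|t - 0| < d.
  by rewrite subr0 ger0_norm//; apply: le_lt_trans td _; rewrite ltr_pdivrMr// ltr_pMr// ltr1n.
have lD2 : locint (fun x => (P t x - P 0 x) ^+ 2) by exact: locint_sqrB.
have {}Hd := Hd t td'.
have {}Hd := le_trans (le_Int_box a c lD2 (fun x => sqr_ge0 _)) Hd.
apply: (@le_trans _ _ (Int (fun x => 2 * P 0 x ^+ 2 + 2 * (P t x - P 0 x) ^+ 2) a c)).
  apply: le_Int => //; first by apply: locintD; exact: locintZ.
  by move=> x _; have := sqr_ge0 (P t x - 2 * P 0 x); move: (P t x) (P 0 x) => p q; lra.
rewrite IntD; [|exact: locintZ|exact: locintZ].
by rewrite !IntZ// lerD2l; move: Hd; rewrite ler_pdivlMr// mulrC.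
Qed.

Lemma tc2D P Q : tc2 P -> tc2 Q -> tc2 (fun t x => P t x - Q t x).
Proof.
move=> [lP lP2 cP] [lQ lQ2 cQ]; split=> [t|t|B t e e0]; first exact: locintB.
  exact: locint_sqrB.
have e4 : 0 < e / 4 by rewrite divr_gt0.
have [d1 d10 H1] := cP B t _ e4; have [d2 d20 H2] := cQ B t _ e4.
exists (Num.min d1 d2); first by rewrite lt_min d10.
move=> s; rewrite lt_min => /andP[s1 s2]; have {}H1 := H1 s s1; have {}H2 := H2 s s2.
have l1 : locint (fun x => (P s x - P t x) ^+ 2) by exact: locint_sqrB.
have l2 : locint (fun x => (Q s x - Q t x) ^+ 2) by exact: locint_sqrB.
have l3 : locint (fun x => (P s x - Q s x - (P t x - Q t x)) ^+ 2).
  by apply: locint_sqrB; [exact: locintB|exact: locintB|exact: locint_sqrB|exact: locint_sqrB].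
apply: (le_trans (le_Int l3 (locintD (locintZ 2 l1) (locintZ 2 l2)) _)).
  move=> x _; have := sqr_ge0 ((P s x - P t x) + (Q s x - Q t x)).
  by move: (P s x) (P t x) (Q s x) (Q t x) => p q p' q'; lra.
rewrite IntD; [|exact: locintZ|exact: locintZ].
by rewrite !IntZ//; move: H1 H2; move: (Int _ _ _) (Int _ _ _) => p q; lra.
Qed.

Lemma tc2M P k : continuous k -> (exists M : R, forall x, `|k x| <= M) -> tc2 P ->
  tc2 (fun t x => k x * P t x).
Proof.
move=> ck [M kM] [lP lP2 cP]; have M0 : 0 <= M by apply: le_trans (kM 0).
have ck2 := contX2 ck.
have E (p q : R) : (p * q) ^+ 2 = p ^+ 2 * q ^+ 2 by rewrite exprMn.
have lk (f : R -> R) : locint (fun x => f x ^+ 2) -> locint (fun x => (k x * f x) ^+ 2).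
  move=> lf; rewrite (_ : (fun x => _) = (fun x => k x ^+ 2 * f x ^+ 2)); first exact: locintM.
  by apply/funext => x; exact: E.
split=> [t|t|B t e e0]; [exact: locintM|exact: lk|].
have M1 : 0 < M ^+ 2 + 1 by rewrite ltr_wpDl// sqr_ge0.
have [d d0 Hd] := cP B t _ (divr_gt0 e0 M1).
exists d => // s st; have {}Hd := Hd s st.
have lD2 : locint (fun x => (P s x - P t x) ^+ 2) by exact: locint_sqrB.
apply: (@le_trans _ _ (Int (fun x => (M ^+ 2 + 1) * (P s x - P t x) ^+ 2) (- B) B)).
  apply: le_Int; [|exact: locintZ|].
    by apply: locint_sqrB; [exact: locintM|exact: locintM|exact: lk|exact: lk].
  move=> x _; rewrite -mulrBr E ler_wpM2r ?sqr_ge0//.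
  apply: (@le_trans _ _ (M ^+ 2)); last by rewrite lerDl.
  rewrite -(real_normK (num_real (k x))); exact: lerXn2r.
by rewrite IntZ// mulrC -ler_pdivlMr.
Qed.

(* Functions of the time [t >= 0] are extended to all [t] by their value at [0]. *)
Definition clamp t : R := Num.max 0 t.

Lemma clamp_ge0 t : 0 <= clamp t.
Proof. by rewrite le_max lexx. Qed.

Lemma clampE t : 0 <= t -> clamp t = t.
Proof. by move=> t0; rewrite /clamp max_r. Qed.

Lemma clamp_neg t : t < 0 -> clamp t = clamp 0.
Proof. by move=> t0; rewrite /clamp max_l ?(ltW t0)// maxxx. Qed.

Lemma clamp_dist s t : `|clamp s - clamp t| <= `|s - t|.
Proof.
have := ler_norm (s - t); have := ler_norm (t - s); rewrite (distrC t s) /clamp => h1 h2.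
by rewrite ler_norml; case: (leP 0 s) => s0; case: (leP 0 t) => t0; apply/andP; split; lra.
Qed.

Lemma within_ed (h : R -> \bar R) t (e : R) :
  h s @[s --> within `[0, +oo[ (nbhs t)] --> 0%E -> 0 < e ->
  exists2 d : R, 0 < d & forall s, 0 <= s -> `|s - t| < d -> (h s < e%:E)%E.
Proof.
move=> H e0; have FF : Filter (within (`[0, +oo[%classic : set R) (nbhs t)) by exact: within_filter.
have := cvge0_lt FF H e0.
rewrite near_withinE => /nbhs_ballP[d /= d0 Hd].
exists d => // s s0 st; apply: Hd; last by rewrite /= in_itv/= s0.
by rewrite /ball/= distrC.
Qed.

Lemma within_d_ed (h : R -> \bar R) t (e : R) :
  h s @[s --> within `[0, +oo[ (dnbhs t)] --> 0%E -> 0 < e ->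
  exists2 d : R, 0 < d & forall s, 0 <= s -> s != t -> `|s - t| < d -> (h s < e%:E)%E.
Proof.
move=> H e0; have FF : Filter (within (`[0, +oo[%classic : set R) (dnbhs t)) by exact: within_filter.
have := cvge0_lt FF H e0.
rewrite near_withinE near_withinE => /nbhs_ballP[d /= d0 Hd].
exists d => // s s0 snt st; apply: Hd => //; last by rewrite /= in_itv/= s0.
by rewrite /ball/= distrC.
Qed.

Lemma L2_measB f g : L2 setT f -> L2 setT g ->
  measurable_fun setT (re (fun x => f x - g x)) /\ measurable_fun setT (im (fun x => f x - g x)).
Proof.
move=> [m1 m2 _] [m3 m4 _]; have E1 := partBE false f g; have E2 := partBE true f g.
rewrite /part in E1 E2; rewrite E1 E2; split; exact: measurable_funB.
Qed.

Lemma L2_tc2 b w : continuous_in_L2 w -> tc2 (fun t => part b (w (clamp t))).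
Proof.
move=> [Lw Hw]; split=> [t|t|B t e e0].
- by apply: L2_locint; apply: Lw; exact: clamp_ge0.
- by apply: L2_locint_sqr; apply: Lw; exact: clamp_ge0.
have e'0 : 0 < Num.sqrt e by rewrite sqrtr_gt0.
have [d d0 Hd] := within_ed (Hw _ (clamp_ge0 t)) e'0.
exists d => // s st.
have {}Hd := ltW (Hd _ (clamp_ge0 s) (le_lt_trans (clamp_dist s t) st)).
have L1 := Lw _ (clamp_ge0 s); have L2 := Lw _ (clamp_ge0 t).
have [m1 m2] := L2_measB L1 L2.
have l2 : locint (fun x => part b (fun x => w (clamp s) x - w (clamp t) x) x ^+ 2).
  rewrite partBE; apply: locint_sqrB; by [exact: L2_locint|exact: L2_locint_sqr].
have := L2norm_part (- B) B m1 m2 l2 (ltW e'0) Hd.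
by rewrite partBE sqr_sqrtr// ltW.
Qed.

Lemma wderiv_spec D f : has_wderiv D f -> is_wderiv D f (wderiv D f).
Proof. by case=> g Hg; rewrite /wderiv; exact: (xgetPex (P := [set g | is_wderiv D f g]) (cst 0) (ex_intro _ g Hg)). Qed.

Lemma is_wderiv_part b D f g : is_wderiv D f g -> is_wderivR D (part b f) (part b g).
Proof. by case: b => -[]. Qed.

Lemma wderivR_B h k h' k' : is_wderivR setT h h' -> is_wderivR setT k k' ->
  is_wderivR setT (fun x => h x - k x) (fun x => h' x - k' x).
Proof.
move=> [l1 l2 H1] [l3 l4 H2]; split.
- by apply: locint_locally; apply: locintB; exact: locally_locint.
- by apply: locint_locally; apply: locintB; exact: locally_locint.
move=> phi tp; have [_ i1] := weak_integrable l1 tp; have [i2 _] := weak_integrable l2 tp.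
have [_ i3] := weak_integrable l3 tp; have [i4 _] := weak_integrable l4 tp.
under eq_Rintegral do rewrite mulrBl.
rewrite RintegralB// H1// H2//.
under [X in _ = - X]eq_Rintegral do rewrite mulrBl.
by rewrite RintegralB// opprB addrC opprK.
Qed.

Lemma L2norm_ge0 D f : (0 <= L2norm D f)%E.
Proof. by rewrite L2norm_int poweR_ge0. Qed.

Lemma H1norm_lt D f (e : R) : (H1norm D f < e%:E)%E ->
  has_wderiv D f /\ (L2norm D (wderiv D f) <= e%:E)%E.
Proof.
rewrite /H1norm !L2norm_sqr; case: ifPn => [/asboolP hf|_ //]; move=> H; split => //.
apply: le_trans (ltW H); rewrite [leLHS]L2norm_int.
apply: gt0_ler_poweR; rewrite ?in_itv/= ?leey ?andbT ?invr_ge0//.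
- exact: int_sqr_ge0.
- by rewrite adde_ge0// int_sqr_ge0.
by rewrite leeDr// int_sqr_ge0.
Qed.

Lemma H1_tc2 b w : continuous_in_H1 w ->
  tc2 (fun t => part b (wderiv setT (w (clamp t)))).
Proof.
move=> [Lw Hw]; have LH t : L2 setT (wderiv setT (w (clamp t))).
  by have [] := Lw _ (clamp_ge0 t).
have hw t : is_wderivR setT (part b (w (clamp t))) (part b (wderiv setT (w (clamp t)))).
  by apply: is_wderiv_part; apply: wderiv_spec; have [] := Lw _ (clamp_ge0 t).
split=> [t|t|B t e e0]; [exact: L2_locint|exact: L2_locint_sqr|].
have e'0 : 0 < Num.sqrt e by rewrite sqrtr_gt0.
have [d d0 Hd] := within_ed (Hw _ (clamp_ge0 t)) e'0.
exists d => // s st.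
have [hd {}Hd] := H1norm_lt (Hd _ (clamp_ge0 s) (le_lt_trans (clamp_dist s t) st)).
set f := fun x => w (clamp s) x - w (clamp t) x in hd Hd.
have sp b' : {ae mu, forall x, part b' (wderiv setT f) x =
    part b' (wderiv setT (w (clamp s))) x - part b' (wderiv setT (w (clamp t))) x}.
  have h1 := is_wderiv_part b' (wderiv_spec hd).
  have hw' r : is_wderivR setT (part b' (w (clamp r))) (part b' (wderiv setT (w (clamp r)))).
    by apply: is_wderiv_part; apply: wderiv_spec; have [] := Lw _ (clamp_ge0 r).
  have h2 := wderivR_B (hw' s) (hw' t); rewrite -partBE in h2.
  by apply: (aeS (wderivR_unique h1 h2)) => x; exact.
have mm b' : measurable_fun setT (part b' (wderiv setT f)).
  by have [_ /locally_locint[]] := is_wderiv_part b' (wderiv_spec hd).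
have l2 : locint (fun x => (part b (wderiv setT (w (clamp s))) x - part b (wderiv setT (w (clamp t))) x) ^+ 2).
  by apply: locint_sqrB; by [exact: L2_locint|exact: L2_locint_sqr].
have aeE : {ae mu, forall x, (part b (wderiv setT f) x) ^+ 2 =
    (part b (wderiv setT (w (clamp s))) x - part b (wderiv setT (w (clamp t))) x) ^+ 2}.
  by apply: (aeS (sp b)) => x ->.
have ms : measurable_fun setT (fun x => part b (wderiv setT f) x ^+ 2) by exact: measurable_funX.
have l3 : locint (fun x => part b (wderiv setT f) x ^+ 2).
  exact: (locint_ae ms l2 aeE).
have := L2norm_part (- B) B (mm false) (mm true) l3 (ltW e'0) Hd.
by rewrite sqr_sqrtr ?(ltW e0)// (Int_ae _ _ l3 l2 aeE).
Qed.

End Extract.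

Section Wave.
Context {R : realType}.
Local Notation mu := (@lebesgue_measure R).
Implicit Types (f g F : R -> R[i]) (h k phi : R -> R) (u ut : R -> R -> R[i])
  (W z p v : R -> R -> R) (x y t s T N : R) (b : bool) (D : set R).

Lemma dat_increment h k s t : continuous k -> (forall r : R, 0 < r -> dat h r (k r)) -> 0 < s -> s <= t ->
  h t - h s = Int k s t.
Proof.
move=> ck dh s0 st; have lk := locint_cont ck.
have d1 r : 0 < r -> dat (fun r => h r + -1 * prim k r) r (k r + -1 * k r).
  by move=> r0; apply: datD; [exact: dh|apply: datZ; exact: prim_dat].
have d2 r : 0 < r -> dat (fun r => -1 * (h r + -1 * prim k r)) r (-1 * (k r + -1 * k r)).
  by move=> r0; apply: datZ; exact: d1.
have E1 r : 0 < r -> k r + -1 * k r <= 0 by move=> _; rewrite mulN1r subrr.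
have E2 r : 0 < r -> -1 * (k r + -1 * k r) <= 0 by move=> _; move: (k r) => c; lra.
have h1 := dat_le0_decr s0 st d1 E1; have h2 := dat_le0_decr s0 st d2 E2.
rewrite -(primB lk st); move: h1 h2; move: (prim k t) (prim k s) => p q; lra.
Qed.

Lemma C1_dat b u ut x y t : C1_in_L2 u ut -> x <= y -> 0 < t ->
  dat (fun s => Int (part b (u (clamp s))) x y) t (Int (part b (ut (clamp t))) x y).
Proof.
move=> [[Lu _] [Lv _] H] xy t0 e e0.
have yx0 : 0 <= y - x by rewrite subr_ge0.
have yx1 : 0 < y - x + 1 by rewrite ltr_wpDl.
pose e' := e / (y - x + 1); have e'0 : 0 < e' by rewrite divr_gt0.
have [d d0 Hd] := within_d_ed (H t (ltW t0)) e'0.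
exists (Num.min d t); first by rewrite lt_min d0.
move=> r; rewrite lt_min => /andP[rd rt].
have [->|r0] := eqVneq r 0; first by rewrite addr0 subrr mul0r subrr normr0 mulr0.
have tr0 : 0 <= t + r by have := ler_norm (- r); rewrite normrN; lra.
rewrite !clampE ?(ltW t0)//.
have trt : t + r != t by rewrite -subr_eq0 (_ : t + r - t = r)//; ring.
have := Hd (t + r) tr0 trt; rewrite (_ : t + r - t = r); last by ring.
move=> /(_ rd) /ltW; set q := fun x0 => _ => Hq.
have Lu1 := Lu _ tr0; have Lu2 := Lu _ (ltW t0); have Lv1 := Lv _ (ltW t0).
have Eq b' : part b' q = fun x => r^-1 * (part b' (u (t + r)) x - part b' (u t) x) - part b' (ut t) x.
  apply/funext => s; rewrite /q partB; congr (_ - _).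
  rewrite (partZ b' (fun=> r^-1) (fun x => u (t + r) x - u t x)); congr (_ * _).
  exact: partB.
have l1 b' : locint (part b' (u (t + r))) by exact: L2_locint.
have l2 b' : locint (part b' (u t)) by exact: L2_locint.
have l3 b' : locint (part b' (ut t)) by exact: L2_locint.
have lq b' : locint (part b' q).
  by rewrite Eq; apply: locintB => //; apply: locintZ; exact: locintB.
have lq2 : locint (fun x => part b q x ^+ 2).
  rewrite Eq; apply: locint_sqrB => //; [by apply: locintZ; exact: locintB| |exact: L2_locint_sqr].
  have l4 : locint (fun x => (part b (u (t + r)) x - part b (u t) x) ^+ 2).
    by apply: locint_sqrB => //; exact: L2_locint_sqr.
  rewrite (_ : (fun x => _) = (fun x => r^-1 ^+ 2 * (part b (u (t + r)) x - part b (u t) x) ^+ 2)).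
    exact: locintZ.
  by apply/funext => s; rewrite exprMn.
have B := L2norm_part x y (proj1 (lq false)) (proj1 (lq true)) lq2 (ltW e'0) Hq.
have HI : `|Int (part b q) x y| <= e.
  rewrite -(@ler_pXn2r _ 2)// ?nnegrE ?(ltW e0)// real_normK ?num_real//.
  apply: le_trans (Int_sqr_le (lq b) lq2 xy) _.
  apply: le_trans (ler_wpM2l yx0 B) _.
  have -> : e = e' * (y - x + 1) by rewrite /e' mulfVK// gt_eqF.
  move: (y - x) yx0 => c c0; have := sqr_ge0 e' => ee.
  have cc : c <= (c + 1) ^+ 2 by move: c0; clear; nra.
  by rewrite (mulrC c) [leRHS]exprMn; exact: ler_wpM2l.
have EI : Int (part b q) x y = r^-1 * (Int (part b (u (t + r))) x y - Int (part b (u t)) x y) - Int (part b (ut t)) x y.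
  rewrite Eq IntB//; last by apply: locintZ; exact: locintB.
  by rewrite IntZ; [rewrite IntB|exact: locintB].
rewrite EI in HI.
have -> : forall A B C : R, A - B - r * C = r * (r^-1 * (A - B) - C) by move=> *; field.
by rewrite normrM mulrC ler_wpM2r.
Qed.

Definition rho_cos (om : R) t := Int (fun s => cos (om * s)) 0 t.
Definition rho_sin (om : R) t := Int (fun s => sin (om * s)) 0 t.

(* [W] is the continuous representative of a real wave with data
   [cos(om t) f1 + sin(om t) f2], and [z] its flux potential: [z_t = al W_x]. *)
Record rwave (al be f1 f2 : R -> R) (om : R) W z p v : Prop := RWave {
  rw_p : tc2 p;
  rw_v : tc2 v;
  rw_W : eqc W;
  rw_z : eqc z;
  rw_Wx : forall t x y, x <= y -> W t y - W t x = Int (p t) x y;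
  rw_zx : forall t x y, x <= y -> z t y - z t x =
    Int (fun s => be s * v t s - (rho_cos om t * (be s * f1 s) + rho_sin om t * (be s * f2 s))) x y;
  rw_Wt : forall T1 T2, 0 <= T1 -> T1 <= T2 -> forall x y, x <= y ->
     Int (fun s => W T2 s - W T1 s) x y = Int (fun t => Int (v t) x y) T1 T2;
  rw_zt : forall T1 T2, 0 <= T1 -> T1 <= T2 -> forall x y, x <= y ->
     Int (fun s => z T2 s - z T1 s) x y = Int (fun t => Int (fun s => al s * p t s) x y) T1 T2;
  rw_W0 : forall x, W 0 x = 0;
  rw_z0 : forall x, z 0 x = 0;
  rw_p0 : {ae mu, forall x, p 0 x = 0};
  rw_v0 : {ae mu, forall x, v 0 x = 0} }.

Lemma part_ae0 b f : {ae mu, forall x, f x = 0} -> {ae mu, forall x, part b f x = 0}.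
Proof. by move=> H; apply: (aeS H) => x; rewrite /part /re /im; case: b => ->. Qed.

Lemma wderivR_zero h k : is_wderivR setT h k -> {ae mu, forall x, h x = 0} ->
  {ae mu, forall x, k x = 0}.
Proof.
move=> hk h0; have [l1 l2 H] := hk.
have hz : is_wderivR setT h (fun=> 0).
  split => // [|phi tp]; first by apply: locint_locally; exact: locint_cst.
  have [_ i1] := weak_integrable l1 tp.
  rewrite [RHS](_ : _ = 0); last first.
    by under eq_Rintegral do rewrite mul0r; rewrite /Rintegral integral0 oppr0.
  rewrite /Rintegral (_ : integral _ _ _ = 0%E)//.
  rewrite -(@integral0 _ _ R mu setT); apply: ae_eq_integral => //.
    by case/integrableP: i1.
  by apply: (aeS h0) => x -> _; rewrite mul0r.
by apply: (aeS (wderivR_unique hk hz)) => x; exact.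
Qed.

Lemma supp_int (alpha al : R -> R) phi h N : measurable_fun setT alpha -> continuous al ->
  {ae mu, forall x, alpha x = al x} -> locint h -> continuous phi ->
  (forall x, ~ (- N < x < N) -> phi x = 0) ->
  \int[mu]_(x in setT) (alpha x * phi x * h x) = Int (fun x => phi x * (al x * h x)) (- N) N.
Proof.
move=> ma ca aE [mh lh] cp pN.
rewrite (@integral_supp _ setT _ (- N) N) => //; last first.
  move=> x xN; rewrite pN ?mulr0 ?mul0r// => /andP[h1 h2].
  by apply: xN; rewrite (ltW h1) (ltW h2).
apply: Int_ae_meas.
- apply: measurable_funM => //; apply: measurable_funM => //.
  exact: continuous_measurable_fun.
- have [] // : locint (fun x => phi x * (al x * h x)) by do 2 apply: locintM => //.
- by apply: (aeS aE) => x -> _; ring.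
Qed.

Lemma derive1_out phi N : (forall x, ~ (- N < x < N) -> phi x = 0) -> smooth phi ->
  forall x, ~ (- N < x < N) -> derive1 phi x = 0.
Proof.
move=> pN sp x xN; have cp' := smooth_cont (smooth_derive sp).
have Hout y : ~ (- N <= y <= N) -> derive1 phi y = 0.
  move=> yN; apply: (derive1_supp (K := `[- N, N]%classic)) => //; first exact: segment_compact.
  move=> u uN; apply: pN => /andP[h1 h2]; apply: uN.
  by rewrite /= in_itv/= (ltW h1) (ltW h2).
apply/eqP; rewrite -normr_le0; apply/ler_addgt0Pr => e e0; rewrite add0r.
have [d d0 Hd] := cont_close x cp' e0.
have dd : d / 2 < d by rewrite ltr_pdivrMr// ltr_pMr// ltr1n.
have d20 : 0 < d / 2 by rewrite divr_gt0.
have [x1|x1] := leP x (- N).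
  have := Hd (x - d / 2); rewrite Hout; last by move/andP; lra.
  by rewrite sub0r normrN; apply; rewrite ltr_norml; apply/andP; lra.
have x2 : N <= x by rewrite leNgt; apply/negP => x2; apply: xN; rewrite x1 x2.
have := Hd (x + d / 2); rewrite Hout; last by move/andP; lra.
by rewrite sub0r normrN; apply; rewrite ltr_norml; apply/andP; lra.
Qed.

Lemma cosl_cont (om : R) : continuous (fun s : R => cos (om * s)).
Proof.
move=> t; apply: (@continuous_comp _ _ _ (fun s => om * s) (@cos R)); last exact: continuous_cos.
by apply: cvgM; [exact: cvg_cst|exact: cvg_id].
Qed.

Lemma sinl_cont (om : R) : continuous (fun s : R => sin (om * s)).
Proof.
move=> t; apply: (@continuous_comp _ _ _ (fun s => om * s) (@sin R)); last exact: continuous_sin.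
by apply: cvgM; [exact: cvg_cst|exact: cvg_id].
Qed.

Lemma part_cint b (G : R -> R -> R[i]) t :
  part b (fun t => cintegral setT (G t)) t = \int[mu]_(x in setT) part b (G t) x.
Proof. by case: b. Qed.

Lemma part_cis b (z : R -> R[i]) (c : R[i]) (om t : R) :
  part b (fun t => - z t + cis (- (om * t)) * c) t =
  - part b z t + (cos (om * t) * part b (fun=> c) t + sin (om * t) * copart b (fun=> c) t).
Proof.
by rewrite /part /copart; case: b; rewrite /re /im; case: (z t) => p q; case: c => r s /=;
  rewrite cosN sinN; ring.
Qed.

Lemma copart_locint b F : L2 setT F -> locint (copart b F).
Proof.
move=> LF; case: b; [apply: locintN; exact: (L2_locint false LF)|exact: (L2_locint true LF)].
Qed.

Lemma copart_int b F phi (be : R -> R) (c : R[i]) N t : continuous be -> continuous phi ->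
  (forall b, locint (part b F)) ->
  (forall b, part b (fun=> c) t = Int (fun x => phi x * (be x * part b F x)) (- N) N) ->
  copart b (fun=> c) t = Int (fun x => phi x * (be x * copart b F x)) (- N) N.
Proof.
move=> cb cp lF H; case: b; last exact: (H true).
transitivity (- part false (fun=> c) t) => //; rewrite (H false) -IntN; last by do 2 apply: locintM => //; exact: (lF false).
by apply: eq_Int => x _; rewrite /part !mulrN.
Qed.

Lemma incr_arith (a c d e a' c' a0 : R) : a' = a -> c' = c -> a - a0 = d + e -> c - a0 = d ->
  a' - c' = e.
Proof. lra. Qed.

Theorem wave_extract (alpha beta al be : R -> R) (om : R) F u ut b :
  measurable_fun setT alpha -> measurable_fun setT beta ->
  continuous al -> continuous be -> {ae mu, forall x, alpha x = al x} ->
  {ae mu, forall x, beta x = be x} -> L2 setT F ->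
  wave_solution alpha beta om F u ut ->
  exists W z, rwave al be (part b F) (copart b F) om W z
     (fun t => part b (wderiv setT (u (clamp t)))) (fun t => part b (ut (clamp t))) /\
     forall t, {ae mu, forall x, W t x = part b (u (clamp t)) x}.
Proof.
move=> ma mb ca cb aE bE LF [H1u C1u u0 v0 weak].
set p := fun t => part b (wderiv setT (u (clamp t))).
set v := fun t => part b (ut (clamp t)).
have [Lu Lv _] := C1u.
have tp : tc2 p := H1_tc2 b H1u.
have tv : tc2 v := L2_tc2 b Lv.
have tu : tc2 (fun t => part b (u (clamp t))) := L2_tc2 b Lu.
have tcp := tc2_tc tp; have tcv := tc2_tc tv; have tcu := tc2_tc tu.
have wd t : is_wderivR setT (part b (u (clamp t))) (p t).
  by apply: is_wderiv_part; apply: wderiv_spec; have [] := (proj1 H1u) _ (clamp_ge0 t).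
have [c Hc] := choice (fun t => wderivR_rep (wd t)).
pose W t x := c t + prim (p t) x.
have lp t : locint (p t) by have [] := tp.
have lv t : locint (v t) by have [] := tv.
have Wx t x y : x <= y -> W t y - W t x = Int (p t) x y.
  by move=> xy; rewrite -(primB (lp t) xy) /W; ring.
have Wc t : continuous (W t) by apply: (rep_cont (lp t)) => x y; exact: Wx.
have Wae t : {ae mu, forall x, W t x = part b (u (clamp t)) x} by apply: (aeS (Hc t)) => x ->.
have lu t : locint (part b (u (clamp t))) by have [] := tu.
have WI t x y : Int (W t) x y = Int (part b (u (clamp t))) x y.
  by apply: Int_ae => //; exact: locint_cont.
have c0 : clamp (0 : R) = 0 by rewrite clampE.
have pu0 : {ae mu, forall x, part b (u (clamp 0)) x = 0} by rewrite c0; exact: part_ae0.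
have pv0 : {ae mu, forall x, v 0 x = 0} by rewrite /v c0; exact: part_ae0.
have lF b' : locint (part b' F) by exact: L2_locint.
have lcF : locint (copart b F) by exact: copart_locint.
have lg1 := locintM cb (lF b); have lg2 := locintM cb lcF.
have tA := tcM tcp ca; have tB := tcM tcv cb.
have Bneg t : t < 0 -> (fun x => be x * v t x) = (fun x => be x * v 0 x).
  by move=> t0; rewrite /v (clamp_neg t0).
have B0 : {ae mu, forall x, be x * v 0 x = 0} by apply: (aeS pv0) => x ->; rewrite mulr0.
have weak' phi N : smooth phi -> (forall x, ~ (- N < x < N) -> phi x = 0) ->
  weak_on `]0, +oo[ (fun t => Int (fun x => phi x * (be x * v t x)) (- N) N)
    (fun t => - Int (fun x => derive1 phi x * (al x * p t x)) (- N) N +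
       (cos (om * t) * Int (fun x => phi x * (be x * part b F x)) (- N) N +
        sin (om * t) * Int (fun x => phi x * (be x * copart b F x)) (- N) N)).
  move=> sp pN; have cp := smooth_cont sp; have cp' := smooth_cont (smooth_derive sp).
  have p'N := derive1_out pN sp.
  have tphi : test_function setT phi.
    apply: (@test_itv _ _ _ (- N) N) => // x xN; apply: pN => /andP[h1 h2].
    by apply: xN; rewrite (ltW h1) (ltW h2).
  have [_ _ HH] := is_wderiv_part b (weak phi tphi).
  move=> psi tpsi; have := HH psi tpsi.
  have E1 t : 0 < t -> part b (fun t => cintegral setT (fun x => (beta x * phi x)%:C * ut t x)) t =
      Int (fun x => phi x * (be x * v t x)) (- N) N.
    move=> t0; rewrite part_cint.
    rewrite -(supp_int mb cb bE (lv t) cp pN) /v clampE ?(ltW t0)//.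
    by apply: eq_Rintegral => x _; rewrite (partZ b (fun x => beta x * phi x) (ut t)).
  have I2 t : 0 < t -> part b (fun t => cintegral setT (fun x => (alpha x * derive1 phi x)%:C * wderiv setT (u t) x)) t =
      Int (fun x => derive1 phi x * (al x * p t x)) (- N) N.
    move=> t0; rewrite part_cint.
    rewrite -(supp_int ma ca aE (lp t) cp' p'N) /p clampE ?(ltW t0)//.
    by apply: eq_Rintegral => x _; rewrite (partZ b (fun x => alpha x * derive1 phi x) (wderiv setT (u t))).
  have E2 t : 0 < t -> part b (fun t => - cintegral setT (fun x => (alpha x * derive1 phi x)%:C * wderiv setT (u t) x) +
             cis (- (om * t)) * cintegral setT (fun x => (beta x * phi x)%:C * F x)) t =
      - Int (fun x => derive1 phi x * (al x * p t x)) (- N) N +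
       (cos (om * t) * Int (fun x => phi x * (be x * part b F x)) (- N) N +
        sin (om * t) * Int (fun x => phi x * (be x * copart b F x)) (- N) N).
    move=> t0; rewrite -(I2 t t0).
    have KE b' : part b' (fun=> cintegral setT (fun x => (beta x * phi x)%:C * F x)) t =
        Int (fun x => phi x * (be x * part b' F x)) (- N) N.
      rewrite part_cint -(supp_int mb cb bE (lF b') cp pN).
      by apply: eq_Rintegral => x _; rewrite (partZ b' (fun x => beta x * phi x) F).
    rewrite part_cis -(KE b); congr (_ + (_ + _ * _)).
    exact: (@copart_int b F phi be _ N t cb cp lF KE).
  rewrite (@eq_Rintegral _ _ _ mu _ (fun t => Int (fun x => phi x * (be x * v t x)) (- N) N * derive1 psi t)); last first.
    by move=> t; rewrite inE/= in_itv/= andbT => t0; rewrite E1.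
  move=> ->; congr (- _); apply: eq_Rintegral => t.
  by rewrite inE/= in_itv/= andbT => t0; rewrite E2.
have cc := @cosl_cont om; have cs := @sinl_cont om.
have [z [ez zx zt z0]] := weak_flux tA tB lg1 lg2 cc cs Bneg B0 weak'.
have Wt T1 T2 : 0 <= T1 -> T1 <= T2 -> forall x y, x <= y ->
     Int (fun s => W T2 s - W T1 s) x y = Int (fun t => Int (v t) x y) T1 T2.
  move=> T10 T12 x y xy; have T20 := le_trans T10 T12.
  have cI := @tc_cont1 _ _ x y tcv; have lI := locint_cont cI.
  have H T : 0 <= T -> Int (part b (u (clamp T))) x y - Int (part b (u (clamp 0))) x y = Int (fun t => Int (v t) x y) 0 T.
    have cf := @tc_cont1 _ _ x y tcu.
    apply: (Int_from0 cf lI) => s t s0 st.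
    have dd r : 0 < r -> dat (fun s => Int (part b (u (clamp s))) x y) r (Int (v r) x y).
      by move=> r0; exact: (C1_dat b C1u xy r0).
    exact: (dat_increment cI dd s0 st).
  rewrite IntB; [|exact: locint_cont|exact: locint_cont].
  exact: (incr_arith (WI T2 x y) (WI T1 x y) (etrans (H _ T20) (Int_cat lI T10 T12)) (H _ T10)).
exists W, z; split; last by [].
split => //.
- apply: (eqc_rep tcp Wx).
  rewrite (_ : (fun t => Int (W t) 0 1) = fun t => Int (part b (u (clamp t))) 0 1).
    exact: (@tc_cont1 _ _ 0 1 tcu).
  by apply/funext => t; exact: WI.
- move=> x; have : W 0 = fun=> 0.
    apply: ae_cont_eq => //; first exact: contC.
    by apply: (aeS (ae_and (Wae 0) pu0)) => s [-> ->].
  by move=> ->.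
- exact: (wderivR_zero (wd 0) pu0).
Qed.

End Wave.

(** * The Helmholtz equation *)

Section Helmholtz.
Context {R : realType}.
Local Notation mu := (@lebesgue_measure R).
Implicit Types (f g F U : R -> R[i]) (h k phi : R -> R) (x y t s T N : R) (b : bool) (D : set R).

Lemma dat_opp h x (l : R) : dat h (- x) l -> dat (fun y => h (- y)) x (- l).
Proof.
move=> dh; have := @dat_comp R h (fun y => -1 * y + 0) x l (-1).
rewrite mulrN1 addr0 mulN1r => /(_ dh (dat_aff _ _ _)).
by apply: (@dat_near _ _ _ _ _ 1) => // y _; rewrite mulN1r addr0.
Qed.

Lemma dat_const h (c : R) : (forall x, c < x -> dat h x 0) ->
  forall x y, c < x -> x <= y -> h y = h x.
Proof.
move=> dh x y cx xy.
have d1 r : 0 < r -> dat (fun s => h (s + c)) r 0.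
  move=> r0; have := @dat_comp R h (fun s => 1 * s + c) r 0 1.
  rewrite mulr1 mul1r => /(_ (dh _ _) (dat_aff _ _ _)) H.
  by apply: (@dat_near _ _ _ _ _ 1 _ _ (H _)) => // [s _|]; rewrite ?mul1r// ltrDr.
have d2 r : 0 < r -> dat (fun s => -1 * h (s + c)) r (-1 * 0) by move=> r0; apply: datZ; exact: d1.
have cx' : 0 < x - c by rewrite subr_gt0.
have xy' : x - c <= y - c by rewrite lerD2r.
have := dat_le0_decr cx' xy' d1 (fun _ _ => lexx 0).
have := dat_le0_decr cx' xy' d2; rewrite mulr0 => /(_ (fun _ _ => lexx 0)).
by rewrite !subrK !mulN1r lerN2 => h1 h2; apply/eqP; rewrite eq_le h1 h2.
Qed.

Lemma outgoing_helmholtz (V1 V2 S1 S2 : R -> R) (A0 B0 om c : R) : 0 < A0 -> 0 < B0 -> 0 < om ->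
  (forall x, c < x -> dat V1 x (S1 x / A0)) -> (forall x, c < x -> dat V2 x (S2 x / A0)) ->
  (forall x, c < x -> dat S1 x (- (om ^+ 2 * B0 * V1 x))) ->
  (forall x, c < x -> dat S2 x (- (om ^+ 2 * B0 * V2 x))) ->
  (forall e : R, 0 < e -> exists X : R, forall x, X < x ->
     (S1 x / A0 + om * Num.sqrt (B0 / A0) * V2 x) ^+ 2 +
     (S2 x / A0 - om * Num.sqrt (B0 / A0) * V1 x) ^+ 2 <= e) ->
  forall x, c < x -> S1 x = - (om * Num.sqrt (A0 * B0) * V2 x) /\
     S2 x = om * Num.sqrt (A0 * B0) * V1 x.
Proof.
move=> A00 B00 om0 dV1 dV2 dS1 dS2 rad x cx.
set k := om * Num.sqrt (B0 / A0) in rad.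
have k2 : k ^+ 2 = om ^+ 2 * B0 / A0.
  by rewrite /k exprMn sqr_sqrtr ?divr_ge0 ?(ltW A00) ?(ltW B00)// mulrA.
have kZ : A0 * k = om * Num.sqrt (A0 * B0).
  rewrite /k mulrCA; congr (_ * _).
  have -> : A0 * B0 = A0 ^+ 2 * (B0 / A0) by field; rewrite gt_eqF.
  by rewrite (sqrtrM _ (sqr_ge0 A0)) (@sqrtr_sqr R A0) gtr0_norm.
pose d1 x := A0^-1 * S1 x + k * V2 x.
pose d2 x := A0^-1 * S2 x + (- k) * V1 x.
pose E x := d1 x * d1 x + d2 x * d2 x.
have dE y : c < y -> dat E y 0.
  move=> cy.
  have h1 := datD (datZ A0^-1 (dS1 y cy)) (datZ k (dV2 y cy)).
  have h2 := datD (datZ A0^-1 (dS2 y cy)) (datZ (- k) (dV1 y cy)).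
  have := datD (datM h1 h1) (datM h2 h2).
  rewrite -/(d1 _) -/(d2 _).
  set l := (X in dat _ _ X -> _); have -> : l = 0; last by [].
  rewrite /l.
  have -> : A0^-1 * - (om ^+ 2 * B0 * V1 y) = - (k ^+ 2 * V1 y) by rewrite k2; ring.
  have -> : A0^-1 * - (om ^+ 2 * B0 * V2 y) = - (k ^+ 2 * V2 y) by rewrite k2; ring.
  rewrite /d1 /d2; ring.
have E0 : E x = 0.
  apply/eqP; rewrite eq_le; apply/andP; split; last by rewrite addr_ge0// -expr2 sqr_ge0.
  apply/ler_addgt0Pr => e e0; rewrite add0r.
  have [X HX] := rad e e0.
  pose y := Num.max x (X + 1).
  have xy : x <= y by rewrite le_max lexx.
  have Xy : X < y by rewrite lt_max ltrDl ltr01 orbT.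
  rewrite -(dat_const dE cx xy); apply: le_trans (HX y Xy).
  by rewrite /E /d1 /d2 !expr2 ![A0^-1 * _]mulrC !mulNr.
have := E0; rewrite /E -!expr2 => /eqP; rewrite paddr_eq0 ?sqr_ge0// !sqrf_eq0.
move=> /andP[/eqP p1 /eqP p2]; rewrite -kZ.
have e1 : A0^-1 * S1 x = - (k * V2 x) by apply/eqP; rewrite -addr_eq0; apply/eqP.
have e2 : A0^-1 * S2 x = k * V1 x by move: p2; rewrite /d2 mulNr => /eqP; rewrite subr_eq0 => /eqP.
split.
  by rewrite -(mulVKf (lt0r_neq0 A00) (S1 x)) e1; ring.
by rewrite -(mulVKf (lt0r_neq0 A00) (S2 x)) e2; ring.
Qed.

Record rhelm (al be f1 f2 : R -> R) (om a b Z0 : R) (U1 U2 S1 S2 : R -> R) : Prop := RHelm {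
  rh_U1 : forall x y, x <= y -> U1 y - U1 x = Int (fun s => S1 s / al s) x y;
  rh_U2 : forall x y, x <= y -> U2 y - U2 x = Int (fun s => S2 s / al s) x y;
  rh_S1 : forall x y, x <= y -> S1 y - S1 x = Int (fun s => - (be s * (om ^+ 2 * U1 s + f1 s))) x y;
  rh_S2 : forall x y, x <= y -> S2 y - S2 x = Int (fun s => - (be s * (om ^+ 2 * U2 s + f2 s))) x y;
  rh_cS1 : continuous S1;
  rh_cS2 : continuous S2;
  rh_r1 : forall x, b <= x -> S1 x = - (om * Z0 * U2 x);
  rh_r2 : forall x, b <= x -> S2 x = om * Z0 * U1 x;
  rh_l1 : forall x, x <= a -> S1 x = om * Z0 * U2 x;
  rh_l2 : forall x, x <= a -> S2 x = - (om * Z0 * U1 x) }.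

Lemma rhelm_cont (al be f1 f2 U1 U2 S1 S2 : R -> R) (om a b Z0 : R) : continuous al -> (forall x : R, 0 < al x) ->
  rhelm al be f1 f2 om a b Z0 U1 U2 S1 S2 -> continuous U1 /\ continuous U2.
Proof.
move=> ca a0 H; have cV := contV ca a0; split.
  by apply: (rep_cont (locint_cont (contM (rh_cS1 H) cV))) => x y xy; exact: (rh_U1 H).
by apply: (rep_cont (locint_cont (contM (rh_cS2 H) cV))) => x y xy; exact: (rh_U2 H).
Qed.


Lemma ae_dat_eq h k x (l : R) : {ae mu, forall y, h y = k y} -> continuous k -> dat h x l -> h x = k x.
Proof.
move=> hk ck dh; apply/eqP; rewrite -subr_eq0 -normr_le0; apply/ler_addgt0Pr => e e0; rewrite add0r.
have e2 : 0 < e / 2 by rewrite divr_gt0.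
have [d1 d10 H1] := dat_cont dh e2; have [d2 d20 H2] := cont_close x ck e2.
have xd : x < x + Num.min d1 d2 by rewrite ltrDl lt_min d10.
have [y /andP[xy yd] E] := ae_ex hk xd.
have : y - x < Num.min d1 d2 by rewrite ltrBlDl.
have yx : `|y - x| = y - x by rewrite gtr0_norm// subr_gt0.
rewrite lt_min -yx => /andP[/H1 h1 /H2 h2].
have -> : h x - k x = (k y - k x) - (h y - h x) by rewrite E; ring.
by apply: le_trans (ler_normB _ _) _; rewrite [e]splitr; exact: lerD.
Qed.

Lemma eq_edge h k x : continuous h -> continuous k ->
  (forall e : R, 0 < e -> exists2 y, `|y - x| < e & h y = k y) -> h x = k x.
Proof.
move=> ch ck H; apply/eqP; rewrite -subr_eq0 -normr_le0; apply/ler_addgt0Pr => e e0; rewrite add0r.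
have e2 : 0 < e / 2 by rewrite divr_gt0.
have [d1 d10 H1] := cont_close x ch e2; have [d2 d20 H2] := cont_close x ck e2.
have [|y yx E] := H (Num.min d1 d2); first by rewrite lt_min d10.
move: yx; rewrite lt_min => /andP[/H1 h1 /H2 h2].
have -> : h x - k x = (k y - k x) - (h y - h x) by rewrite E; ring.
by apply: le_trans (ler_normB _ _) _; rewrite [e]splitr; exact: lerD.
Qed.

Lemma defect_norm (k x : R) (V : R -> R[i]) :
  Normc.normc (radiation_defect k V x) ^+ 2 =
  (Num.sg x * derive1 (re V) x + k * im V x) ^+ 2 + (Num.sg x * derive1 (im V) x - k * re V x) ^+ 2.
Proof.
rewrite normc_sqr /radiation_defect /cderiv /im /re.
by case: (V x) => p q /=; congr (_ ^+ 2 + _ ^+ 2); ring.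
Qed.

Theorem helmholtz_extract (alpha beta al be : R -> R) (A0 B0 a b om : R) F U :
  measurable_fun setT alpha -> measurable_fun setT beta ->
  continuous al -> continuous be -> (forall x, 0 < al x) -> (forall x, 0 < be x) ->
  {ae mu, forall x, alpha x = al x} -> {ae mu, forall x, beta x = be x} ->
  (forall x, ~ (a < x < b) -> al x = A0) -> (forall x, ~ (a < x < b) -> be x = B0) ->
  L2 setT F -> {ae mu, forall x, ~ (a < x < b) -> F x = 0} -> 0 < om -> a < b ->
  helmholtz_solution alpha beta A0 B0 `]a, b[ om F U ->
  exists V S : bool -> R -> R,
    (forall b', {ae mu, forall x, part b' U x = V b' x}) /\
    (forall b', {ae mu, forall x, al x * part b' (wderiv setT U) x = S b' x}) /\
    rhelm al be (part false F) (part true F) om a b (Num.sqrt (A0 * B0))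
      (V false) (V true) (S false) (S true).
Proof.
move=> ma mb ca cb a0 b0 aE bE alo beo LF F0 om0 ab [[_ hU _ _ _] hflux heq [Vr [UVr dVr rp rn]]].
have A00 : 0 < A0 by rewrite -(alo a)// ltxx.
have B00 : 0 < B0 by rewrite -(beo a)// ltxx.
pose DU := wderiv setT U; pose fl := flux_wderiv alpha U.
have w1 b' := is_wderiv_part b' (wderiv_spec hU).
have w2 b' := is_wderiv_part b' (wderiv_spec hflux).
have [c1 Hc1] := choice (fun b' => wderivR_rep (w1 b')).
have [c2 Hc2] := choice (fun b' => wderivR_rep (w2 b')).
pose V b' x := c1 b' + prim (part b' DU) x.
pose S b' x := c2 b' + prim (part b' fl) x.
have lDU b' : locint (part b' DU) by have [_ /locally_locint] := w1 b'.
have lU b' : locint (part b' U) by have [/locally_locint] := w1 b'.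
have lfl b' : locint (part b' fl) by have [_ /locally_locint] := w2 b'.
have VU b' : {ae mu, forall x, part b' U x = V b' x} by exact: Hc1.
have SU b' : {ae mu, forall x, al x * part b' DU x = S b' x}.
  by apply: (aeS (ae_and aE (Hc2 b'))) => x [<- e]; rewrite /S -e (partZ b' alpha).
have cV b' : continuous (V b').
  by apply: (rep_cont (lDU b')) => x y xy; rewrite -(primB (lDU b') xy) /V; ring.
have cS b' : continuous (S b').
  by apply: (rep_cont (lfl b')) => x y xy; rewrite -(primB (lfl b') xy) /S; ring.
have cal := contV ca a0.
have cSa b' : continuous (fun s => S b' s / al s) by exact: (contM (cS b') cal).
have HV b' x y : x <= y -> V b' y - V b' x = Int (fun s => S b' s / al s) x y.
  move=> xy; transitivity (Int (part b' DU) x y); first by rewrite -(primB (lDU b') xy) /V; ring.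
  apply: Int_ae => //; first exact: locint_cont.
  by apply: (aeS (SU b')) => s <-; rewrite mulrC mulKf// gt_eqF.
have lF b' : locint (part b' F) by exact: L2_locint.
have lK b' : locint (fun s => - (be s * (om ^+ 2 * V b' s + part b' F s))).
  apply: locintN; apply: locintM => //; apply: locintD => //; apply: locintZ.
  exact: locint_cont.
have HS b' x y : x <= y -> S b' y - S b' x = Int (fun s => - (be s * (om ^+ 2 * V b' s + part b' F s))) x y.
  move=> xy; transitivity (Int (part b' fl) x y); first by rewrite -(primB (lfl b') xy) /S; ring.
  apply: Int_ae => //.
  apply: (aeS (ae_and (ae_and heq bE) (VU b'))) => s [[Hs bs] <-].
  have bs0 : be s != 0 by rewrite gt_eqF.
  have : part b' F s = - om ^+ 2 * part b' U s - (be s)^-1 * part b' fl s.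
    by rewrite -bs; case: (b'); rewrite /part /re /im -Hs -/fl; case: (U s) => p q; case: (fl s) => p' q' /=; ring.
  by move=> ->; field.
have dV b' x : dat (V b') x (S b' x / al x) by exact: (Int_dat (cSa b') (HV b')).
pose K b' s := - (om ^+ 2 * B0 * V b' s).
have cK b' : continuous (K b').
  by move=> s; apply: cvgN; apply: cvgM; [exact: cvg_cst|exact: cV].
have HSo b' x y : x <= y -> (forall s, x <= s <= y -> ~ (a < s < b)) ->
    S b' y - S b' x = prim (K b') y - prim (K b') x.
  move=> xy out; rewrite (HS _ _ _ xy) (primB (locint_cont (cK b')) xy).
  apply: Int_ae_meas; [by have [] := lK b'|exact: continuous_measurable_fun|].
  apply: (aeS F0) => s Fs sxy; have so := out s sxy.
  have : part b' F s = 0 by case: (b'); rewrite /part /re /im Fs.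
  by move=> ->; rewrite /K (beo s so); ring.
have outb s : b <= s -> ~ (a < s < b) by move=> bs /andP[_]; rewrite ltNge bs.
have outa s : s <= a -> ~ (a < s < b) by move=> sa /andP[+ _]; rewrite ltNge sa.
have dSr b' x : b < x -> dat (S b') x (- (om ^+ 2 * B0 * V b' x)).
  move=> bx; have := datD (prim_dat (cK b') x) (dat_cst (S b' b - prim (K b') b) x).
  rewrite addr0; apply: (@dat_near _ _ _ _ _ (x - b)); first by rewrite subr_gt0.
  move=> y; rewrite ltr_norml => /andP[y1 y2].
  have by' : b <= y by lra.
  by have := HSo b' b y by' (fun s sby => outb s (proj1 (andP sby))); lra.
have dSl b' x : x < a -> dat (S b') x (- (om ^+ 2 * B0 * V b' x)).
  move=> xa; have := datD (prim_dat (cK b') x) (dat_cst (S b' a - prim (K b') a) x).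
  rewrite addr0; apply: (@dat_near _ _ _ _ _ (a - x)); first by rewrite subr_gt0.
  move=> y; rewrite ltr_norml => /andP[y1 y2].
  have ya : y <= a by lra.
  by have := HSo b' y a ya (fun s sya => outa s (proj2 (andP sya))); lra.
have clo x : x < a \/ b < x -> ~ closure (`]a, b[%classic : set R) x.
  move=> xo cx; have : (`[a, b]%classic : set R) x.
    have cl : closed (`[a, b]%classic : set R) by exact: itv_closed.
    rewrite ((closure_id _).1 cl).
    apply: (closure_subset _ cx) => y /=; rewrite !in_itv/= => /andP[h1 h2].
    by rewrite (ltW h1) (ltW h2).
  by rewrite /= in_itv/= => /andP[h1 h2]; case: xo; lra.
have dVrE b' x : x < a \/ b < x -> part b' Vr x = V b' x /\ derive1 (part b' Vr) x = S b' x / al x.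
  move=> xo; have aeV : {ae mu, forall y, part b' Vr y = V b' y}.
    by apply: (aeS (ae_and UVr (VU b'))) => y [h1 <-]; case: (b'); rewrite /part /re /im h1.
  have dP y : y < a \/ b < y -> dat (part b' Vr) y (derive1 (part b' Vr) y).
    by move=> /clo /dVr[h1 h2]; apply: derive_dat; rewrite /part; case: (b').
  have eqP' y : y < a \/ b < y -> part b' Vr y = V b' y.
    by move=> yo; exact: (ae_dat_eq aeV (cV b') (dP y yo)).
  split; first exact: eqP'.
  have [r r0 Hr] : exists2 r : R, 0 < r & forall y, `|y - x| < r -> y < a \/ b < y.
    case: xo => xo.
      by exists (a - x); rewrite ?subr_gt0// => y; rewrite ltr_norml => /andP[_ h]; left; lra.
    by exists (x - b); rewrite ?subr_gt0// => y; rewrite ltr_norml => /andP[h _]; right; lra.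
  have := @dat_near _ _ (part b' Vr) x _ r r0 _ (dV b' x).
  by move=> /(_ (fun y yr => esym (eqP' y (Hr y yr)))) /dat_derive[].
exists V, S; split; first exact: VU.
split; first exact: SU.
set k := om * Num.sqrt (B0 / A0) in rp rn.
have radp (e : R) : 0 < e -> exists X : R, forall x, X < x ->
     (S false x / A0 + k * V true x) ^+ 2 + (S true x / A0 - k * V false x) ^+ 2 <= e.
  move=> e0; have e'0 : 0 < Num.sqrt e by rewrite sqrtr_gt0.
  move/cvgrPdist_le: rp => /(_ _ e'0)[X [_ HX]].
  exists (Num.max X (Num.max 0 b)) => x; rewrite !gt_max => /and3P[Xx x0 bx].
  have := HX x Xx; rewrite sub0r normrN ger0_norm ?normc_ge0// => H.
  have xo : x < a \/ b < x by right.
  have := lerXn2r 2 (normc_ge0 _) (ltW e'0) H.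
  rewrite defect_norm sqr_sqrtr ?(ltW e0)//.
  have [E1 E2] := dVrE false x xo; have [E3 E4] := dVrE true x xo.
  rewrite /part in E1 E2 E3 E4; rewrite E1 E2 E3 E4 gtr0_sg// !mul1r alo//.
  by move=> /andP[_]; rewrite ltNge (ltW bx).
have radn (e : R) : 0 < e -> exists X : R, forall x, X < x ->
     (- S false (- x) / A0 + k * V true (- x)) ^+ 2 + (- S true (- x) / A0 - k * V false (- x)) ^+ 2 <= e.
  move=> e0; have e'0 : 0 < Num.sqrt e by rewrite sqrtr_gt0.
  move/cvgrPdist_le: rn => /(_ _ e'0)[X [_ HX]].
  exists (Num.max (- X) (Num.max 0 (- a))) => y; rewrite !gt_max => /and3P[Xx x0 bx].
  have Xy : - y < X by rewrite ltrNl.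
  have := HX (- y) Xy; rewrite sub0r normrN ger0_norm ?normc_ge0// => H.
  have xo : - y < a \/ b < - y by left; rewrite ltrNl.
  have := lerXn2r 2 (normc_ge0 _) (ltW e'0) H.
  rewrite defect_norm sqr_sqrtr ?(ltW e0)//.
  have [E1 E2] := dVrE false (- y) xo; have [E3 E4] := dVrE true (- y) xo.
  rewrite /part in E1 E2 E3 E4; rewrite E1 E2 E3 E4 ltr0_sg ?oppr_lt0// !mulN1r alo ?mulNr//.
  by move=> /andP[h1 _]; move: bx; rewrite ltrNl => bx; move: (lt_trans h1 bx); rewrite ltxx.
have aR x : b < x -> al x = A0 by move=> bx; apply: alo => /andP[_]; rewrite ltNge (ltW bx).
have aL x : x < a -> al x = A0 by move=> xa; apply: alo => /andP[+ _]; rewrite ltNge (ltW xa).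
have dVr' b' x : b < x -> dat (V b') x (S b' x / A0) by move=> bx; rewrite -(aR x bx).
have outR := outgoing_helmholtz A00 B00 om0 (dVr' false) (dVr' true) (dSr false) (dSr true) radp.
have na x : - a < x -> - x < a by rewrite ltrNl.
have dVl b' x : - a < x -> dat (fun y => V b' (- y)) x (- S b' (- x) / A0).
  by move=> /na xa; rewrite mulNr -(aL _ xa); exact: dat_opp.
have dSl' b' x : - a < x -> dat (fun y => - S b' (- y)) x (- (om ^+ 2 * B0 * V b' (- x))).
  move=> /na xa; have := datZ (-1) (dat_opp (dSl b' _ xa)); rewrite mulN1r opprK.
  by apply: (@dat_near _ _ _ _ _ 1) => // y _; rewrite mulN1r.
have outL := outgoing_helmholtz A00 B00 om0 (dVl false) (dVl true) (dSl' false) (dSl' true) radn.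
have d2 (e : R) : 0 < e -> 0 < e / 2 /\ e / 2 < e.
  by move=> e0; rewrite divr_gt0// ltr_pdivrMr// ltr_pMr// ltr1n.
have closR (f g : R -> R) : continuous f -> continuous g -> (forall x, b < x -> f x = g x) -> forall x, b <= x -> f x = g x.
  move=> cf cg H x; rewrite le_eqVlt => /orP[/eqP <-|]; last exact: H.
  apply: eq_edge => // e /d2[e1 e2]; exists (b + e / 2); first by rewrite addrAC subrr add0r gtr0_norm.
  by apply: H; rewrite ltrDl.
have closL (f g : R -> R) : continuous f -> continuous g -> (forall x, x < a -> f x = g x) -> forall x, x <= a -> f x = g x.
  move=> cf cg H x; rewrite le_eqVlt => /orP[/eqP ->|]; last exact: H.
  apply: eq_edge => // e /d2[e1 e2]; exists (a - e / 2); first by rewrite addrAC subrr add0r normrN gtr0_norm.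
  by apply: H; rewrite ltrBlDr ltrDl.
have cm (c : R) b' : continuous (fun x => c * V b' x) by move=> s; apply: cvgM; [exact: cvg_cst|exact: cV].
have cmN (c : R) b' : continuous (fun x => - (c * V b' x)) by move=> s; apply: cvgN; exact: cm.
have pa x : x < a -> - a < - x by rewrite ltrN2.
have r1 := closR _ _ (cS false) (@cmN _ true) (fun s bs => proj1 (outR s bs)).
have r2 := closR _ _ (cS true) (@cm _ false) (fun s bs => proj2 (outR s bs)).
have l1 : forall x, x <= a -> S false x = om * Num.sqrt (A0 * B0) * V true x.
  apply: (closL _ _ (cS false) (@cm _ true)) => s /pa sa; have [+ _] := outL _ sa.
  by rewrite opprK => /oppr_inj.
have l2 : forall x, x <= a -> S true x = - (om * Num.sqrt (A0 * B0) * V false x).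
  apply: (closL _ _ (cS true) (@cmN _ false)) => s /pa sa; have [_ +] := outL _ sa.
  by rewrite opprK => <-; rewrite opprK.
exact: (RHelm (HV false) (HV true) (HS false) (HS true) (cS false) (cS true) r1 r2 l1 l2).
Qed.

End Helmholtz.

(** * Outgoing waves *)

Section Transport.
Context {R : realType}.
Local Notation mu := (@lebesgue_measure R).
Implicit Types (f g h : R -> R) (l w z p v : R -> R -> R) (x y t s T : R) (D : R -> Prop).

Lemma dat_zero_itv f s t : s <= t -> (forall r : R, s <= r <= t -> dat f r 0) -> f t = f s.
Proof.
rewrite le_eqVlt => /orP[/eqP ->//|st] H.
have [r||c _] := @MVT R f (fun=> 0) s t st.
- rewrite in_itv/= => /andP[sr rt]; apply/is_derive_dat; apply: H.
  by rewrite (ltW sr) (ltW rt).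
- apply: continuous_in_subspaceT => r; rewrite inE/= in_itv/= => rst.
  have [dr _] := dat_derive (H r rst).
  exact/differentiable_continuous/derivable1_diffP.
- by rewrite mul0r => /eqP; rewrite subr_eq0 => /eqP.
Qed.

Lemma prim_close f x y (c e : R) : locint f -> (forall s, `|s - x| <= `|y - x| -> `|f s - c| <= e) ->
  `|prim f y - prim f x - (y - x) * c| <= e * `|y - x|.
Proof.
move=> lf H; have lc : locint (fun s => f s - c) by apply: locintB => //; exact: locint_cst.
have [xy|yx] := leP x y.
  have E : prim f y - prim f x - (y - x) * c = Int (fun s => f s - c) x y.
    by rewrite (primB lf xy) IntB//; [rewrite Int_cst// mulrC|exact: locint_cst].
  rewrite E [`|y - x|]ger0_norm ?subr_ge0//; apply: Int_norm_le => // s /andP[xs sy].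
  by apply: H; rewrite !ger0_norm ?subr_ge0//; lra.
have {}yx := ltW yx.
have E : prim f y - prim f x - (y - x) * c = - Int (fun s => f s - c) y x.
  have := primB lf yx; rewrite IntB//; last exact: locint_cst.
  by rewrite Int_cst// => <-; ring.
rewrite E normrN [`|y - x|]ler0_norm ?subr_le0// opprB; apply: Int_norm_le => // s /andP[xs sy].
by apply: H; rewrite !ler0_norm ?subr_le0//; lra.
Qed.

Lemma Int_zero_pt f t : continuous f -> (forall s, t <= s -> Int f t s = 0) -> f t = 0.
Proof.
move=> cf H; apply/eqP; rewrite -normr_le0; apply/ler_addgt0Pr => e e0; rewrite add0r.
have [d d0 Hd] := cont_close t cf e0.
have [r r0 rd] : exists2 r : R, 0 < r & r < d.
  by exists (d / 2); rewrite ?divr_gt0// ltr_pdivrMr// ltr_pMr// ltr1n.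
have td : t <= t + r by rewrite lerDl ltW.
have lf := locint_cont cf.
have := @prim_close f t (t + r) (f t) e lf _.
rewrite (primB lf td) (H _ td) sub0r normrN (_ : t + r - t = r); last by ring.
rewrite normrM mulrC ler_pM2r ?normr_gt0 ?gt_eqF//; apply=> s sd; apply: Hd.
by apply: le_lt_trans sd _; rewrite gtr0_norm.
Qed.

Lemma eqcD w z (c : R) : eqc w -> eqc z -> eqc (fun t x => z t x + c * w t x).
Proof.
move=> ew ez B t e e0; have c0 : 0 < `|c| + 1 by rewrite ltr_wpDl.
have e2 : 0 < e / 2 by rewrite divr_gt0.
have e3 : 0 < e / 2 / (`|c| + 1) by rewrite divr_gt0.
have [d1 d10 H1] := ew B t _ e3; have [d2 d20 H2] := ez B t _ e2.
exists (Num.min d1 d2); first by rewrite lt_min d10.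
move=> s; rewrite lt_min => /andP[s1 s2] x xB; have h1 := H1 s s1 x xB; have h2 := H2 s s2 x xB.
have -> : z s x + c * w s x - (z t x + c * w t x) = (z s x - z t x) + c * (w s x - w t x) by ring.
apply: le_trans (ler_normD _ _) _; rewrite [e]splitr; apply: lerD => //.
rewrite normrM; apply: (@le_trans _ _ ((`|c| + 1) * `|w s x - w t x|)).
  by apply: ler_wpM2r => //; rewrite lerDl.
by rewrite mulrC -ler_pdivlMr.
Qed.

Lemma eqc_tcont w x : eqc w -> continuous (fun t => w t x).
Proof.
move=> ew; apply: cont_ed => t e e0; have [d d0 Hd] := ew `|x| t e e0.
exists d => // s st; apply: Hd => //.
by have := ler_norm (- x); have := ler_norm x; rewrite normrN; lra.
Qed.

Lemma char_arith (a b d h k c : R) :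
  c * a - c * d = c * (a - b - h * k) + (c * (b - d) - - (c * h) * k).
Proof. ring. Qed.

(* [M t x = c int_0^t l(s, x) ds] satisfies [M_x = l] and [M_t = c l], hence is
   constant along the characteristics [x + c t = cst]. *)
Lemma transport l D (c : R) : eqc l -> (forall t, continuous (l t)) -> (forall x, l 0 x = 0) ->
  c != 0 ->
  (forall x, D x -> exists2 d : R, 0 < d & forall s, - d <= s -> D (x + c * s)) ->
  (forall t, 0 <= t -> forall x y, D x -> D y ->
     prim (l t) y - prim (l t) x = c * (Int (fun s => l s y) 0 t - Int (fun s => l s x) 0 t)) ->
  forall t x, 0 <= t -> D x -> l t x = 0.
Proof.
move=> el cl l0 c0 HD H; have ct x := @eqc_tcont _ x el.
have lt x := locint_cont (ct x).
pose M t x := c * prim (fun s => l s x) t.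
have ME t x : 0 <= t -> M t x = c * Int (fun s => l s x) 0 t by move=> t0; rewrite /M primE.
have cc : 0 < `|c| by rewrite normr_gt0.
have M0 t x : 0 < t -> D x -> M t x = 0.
  move=> t0 Dx; have [d d0 HdD] := HD x Dx.
  pose psi s := M s (x + c * (t - s)).
  have Dpsi s : s <= t + d -> D (x + c * (t - s)) by move=> sd; apply: HdD; lra.
  have dpsi s : 0 < s < t + d -> dat psi s 0.
    move=> /andP[s0 std] e e0.
    set y := x + c * (t - s).
    have e1 : 0 < e / (4 * `|c|) by rewrite divr_gt0// mulr_gt0.
    have [d1 d10 H1] := el (`|y| + `|c|) s _ e1.
    have [d2 d20 H2] := cont_close y (cl s) e1.
    pose r := Num.min (Num.min d1 (d2 / `|c|)) (Num.min (Num.min 1 s) (t + d - s)).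
    exists r; first by rewrite !lt_min d10 divr_gt0// ltr01 s0 subr_gt0.
    move=> h; rewrite !lt_min => /andP[/andP[h1 h2] /andP[/andP[h3 h4] h5]].
    rewrite mulr0 subr0.
    have hn := ler_norm h; have hn' := ler_norm (- h); rewrite normrN in hn'.
    have sh0 : 0 <= s + h by lra.
    set y' := x + c * (t - (s + h)).
    have yy : y' - y = - (c * h) by rewrite /y /y'; ring.
    have Dy : D y by apply: Dpsi; exact: ltW.
    have Dy' : D y' by apply: Dpsi; lra.
    have y'B : - (`|y| + `|c|) <= y' <= `|y| + `|c|.
      have : `|y'| <= `|y| + `|c|.
        have -> : y' = y - c * h by rewrite -[y'](subrK y) yy addrC.
        apply: le_trans (ler_normB _ _) _; rewrite lerD2l normrM -[leRHS]mulr1.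
        by apply: ler_wpM2l => //; exact: ltW.
      by rewrite ler_norml.
    have near2 u : `|u - y| <= `|c * h| -> `|l s u - l s y| <= e / (4 * `|c|).
      move=> uy; apply: H2; apply: le_lt_trans uy _.
      by rewrite normrM mulrC -ltr_pdivlMr.
    have near1 u : `|u - s| <= `|h| -> `|l u y' - l s y| <= e / (2 * `|c|).
      move=> us; have -> : l u y' - l s y = (l u y' - l s y') + (l s y' - l s y) by ring.
      apply: le_trans (ler_normD _ _) _.
      have -> : e / (2 * `|c|) = e / (4 * `|c|) + e / (4 * `|c|) by field; rewrite gt_eqF.
      apply: lerD; last by apply: near2; rewrite yy normrN.
      by apply: H1 => //; exact: le_lt_trans h1.
    have c1 := @prim_close (fun u => l u y') s (s + h) (l s y) (e / (2 * `|c|)) (lt y').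
    have c2 := @prim_close (l s) y y' (l s y) (e / (4 * `|c|)) (locint_cont (cl s)).
    move: c1 c2; rewrite (_ : s + h - s = h); last by ring.
    rewrite yy normrN => /(_ near1) c1 /(_ near2) c2.
    have E : psi (s + h) - psi s = c * (prim (fun u => l u y') (s + h) - prim (fun u => l u y') s - h * l s y)
        + (prim (l s) y' - prim (l s) y - - (c * h) * l s y).
      rewrite (H s (ltW s0) _ _ Dy Dy') /psi -/y -/y' ![M s _]ME ?(ltW s0)// /M.
      rewrite [prim _ s]primE ?(ltW s0)//.
      exact: char_arith.
    rewrite E; apply: le_trans (ler_normD _ _) _.
    have -> : e * `|h| = `|c| * (e / (2 * `|c|) * `|h|) + e / (2 * `|c|) * (`|c| * `|h|).
      by field; rewrite gt_eqF.
    apply: lerD; first by rewrite normrM; apply: ler_wpM2l.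
    rewrite -normrM; apply: le_trans c2 _; apply: ler_wpM2r => //.
    apply: ler_wpM2l; first exact: ltW.
    by rewrite lef_pV2 ?posrE ?mulr_gt0// ler_pM2r// ler_nat.
  have small (e : R) : 0 < e -> exists2 r : R, 0 < r & forall s, 0 < s -> s < r -> `|psi s| <= e.
    move=> e0; pose B := `|x| + `|c| * t.
    have [r1 r10 H1] := el B 0 1 ltr01.
    exists (Num.min (Num.min r1 t) (e / `|c|)); first by rewrite !lt_min r10 t0 divr_gt0.
    move=> s s0; rewrite !lt_min => /andP[/andP[sr st] se].
    rewrite /psi ME ?(ltW s0)// normrM.
    set y := x + c * (t - s).
    have yB : - B <= y <= B.
      rewrite -ler_norml; apply: le_trans (ler_normD _ _) _; rewrite lerD2l normrM.
      by apply: ler_wpM2l => //; rewrite ger0_norm ?subr_ge0; [lra|exact: ltW].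
    apply: (@le_trans _ _ (`|c| * (1 * (s - 0)))); last first.
      by rewrite mul1r subr0 mulrC -ler_pdivlMr// ltW.
    apply: ler_wpM2l => //; apply: Int_norm_le => //; first exact: ltW.
    move=> u /andP[u0 us]; have := H1 u; rewrite subr0 ger0_norm// => /(_ (le_lt_trans us sr) y yB).
    by rewrite l0 subr0.
  have -> : M t x = psi t by rewrite /psi subrr mulr0 addr0.
  apply/eqP; rewrite -normr_le0; apply/ler_addgt0Pr => e e0; rewrite add0r.
  have [r r0 Hr] := small e e0.
  pose s := Num.min r t / 2.
  have rt0 : 0 < Num.min r t by rewrite lt_min r0.
  have s0 : 0 < s by rewrite divr_gt0.
  have : s < Num.min r t by rewrite ltr_pdivrMr// ltr_pMr// ltr1n.
  rewrite lt_min => /andP[sr st].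
  rewrite (@dat_zero_itv psi s t (ltW st)); first exact: Hr.
  by move=> u /andP[su ut]; apply: dpsi; apply/andP; split; lra.
have key x t : 0 <= t -> D x -> l t x = 0.
  move=> t0 Dx; apply: (@Int_zero_pt (fun s => l s x)) => // s ts.
  have I0 u : 0 <= u -> Int (fun s => l s x) 0 u = 0.
    rewrite le_eqVlt => /orP[/eqP <-|u0]; first by rewrite Int_ge.
    by have := M0 u x u0 Dx; rewrite ME ?(ltW u0)// => /eqP; rewrite mulf_eq0 (negbTE c0) => /eqP.
  have := Int_cat (lt x) t0 ts; rewrite !I0// ?(le_trans t0 ts)//.
  by rewrite add0r => <-.
by move=> t x; exact: key.
Qed.

End Transport.

Section Assemble.
Context {R : realType}.
Local Notation mu := (@lebesgue_measure R).
Variables (al be f1 f2 : R -> R) (om a b A0 B0 m M : R).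
Hypotheses (cal : continuous al) (cbe : continuous be) (m0 : 0 < m).
Hypotheses (al_lo : forall x, m <= al x) (be_lo : forall x, m <= be x).
Hypotheses (al_up : forall x, al x <= M) (be_up : forall x, be x <= M).
Hypotheses (al_out : forall x, ~ (a < x < b) -> al x = A0).
Hypotheses (be_out : forall x, ~ (a < x < b) -> be x = B0).
Hypotheses (lf1 : locint f1) (lf2 : locint f2).
Hypotheses (f1_out : {ae mu, forall x, ~ (a < x < b) -> f1 x = 0}).
Hypotheses (f2_out : {ae mu, forall x, ~ (a < x < b) -> f2 x = 0}).
Hypotheses (ab : a < b) (om0 : 0 < om).
Local Notation Z0 := (Num.sqrt (A0 * B0)).
Implicit Types (W z p v : R -> R -> R) (U S : R -> R) (x y t s T : R).

Let A00 : 0 < A0. Proof. by rewrite -(al_out (x := a)) ?ltxx//; exact: lt_le_trans (al_lo a). Qed.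
Let B00 : 0 < B0. Proof. by rewrite -(be_out (x := a)) ?ltxx//; exact: lt_le_trans (be_lo a). Qed.
Let Z00 : 0 < Z0. Proof. by rewrite sqrtr_gt0 mulr_gt0. Qed.
Let Z02 : Z0 ^+ 2 = A0 * B0. Proof. by rewrite sqr_sqrtr// mulr_ge0 ?ltW. Qed.
Let lg1 : locint (fun x => be x * f1 x). Proof. exact: locintM. Qed.
Let lg2 : locint (fun x => be x * f2 x). Proof. exact: locintM. Qed.

Lemma outgoing_arith (A Z k sg w w' z z' : R) : A = Z ^+ 2 * k -> sg ^+ 2 = 1 ->
  A * (w - w') + sg * Z * (k * (z - z')) =
  sg * (Z * k) * ((z + sg * Z * w) - (z' + sg * Z * w')).
Proof.
move=> -> sg2; have -> : Z ^+ 2 * k = sg ^+ 2 * (Z ^+ 2 * k) by rewrite sg2 mul1r.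
ring.
Qed.

Lemma wave_transport W z p v (D : R -> Prop) (sg : R) : rwave al be f1 f2 om W z p v ->
  sg ^+ 2 = 1 ->
  (forall x y s, D x -> D y -> x <= s <= y -> ~ (a < s < b)) ->
  (forall x, D x -> exists2 d : R, 0 < d & forall s, - d <= s -> D (x + sg * s)) ->
  forall t x, 0 <= t -> D x -> z t x + sg * Z0 * W t x = 0.
Proof.
move=> H sg2 Dout Dch.
have tcp := tc2_tc (rw_p H); have tcv := tc2_tc (rw_v H).
have [lp _] := tcp; have [lv _] := tcv.
pose l t x := z t x + sg * Z0 * W t x.
have el : eqc l by apply: eqcD; [exact: (rw_W H)|exact: (rw_z H)].
have cW t : continuous (W t) by apply: (rep_cont (lp t)) => x y xy; exact: (rw_Wx H).
have lzx t : locint (fun s => be s * v t s - (rho_cos om t * (be s * f1 s) + rho_sin om t * (be s * f2 s))).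
  by apply: locintB; [exact: locintM|apply: locintD; exact: locintZ].
have cz t : continuous (z t) by apply: (rep_cont (lzx t)) => x y xy; exact: (rw_zx H).
have lW t := locint_cont (cW t); have lz t := locint_cont (cz t).
have cl t : continuous (l t) by move=> x; apply: cvgD; [exact: cz|apply: cvgM; [exact: cvg_cst|exact: cW]].
have l0 x : l 0 x = 0 by rewrite /l (rw_W0 H) (rw_z0 H) mulr0 addr0.
have sg0 : sg != 0 by apply/eqP => E; move: sg2; rewrite E expr0n/= => /eqP; rewrite eq_sym oner_eq0.
pose c := sg * (Z0 / B0).
have c0 : c != 0 by rewrite mulf_neq0// mulf_neq0 ?invr_eq0 ?gt_eqF.
have czt x := @eqc_tcont _ _ x (rw_z H); have cWt x := @eqc_tcont _ _ x (rw_W H).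
have lzt x := locint_cont (czt x); have lWt x := locint_cont (cWt x).
have clt x := @eqc_tcont _ _ x el.
have llt x := locint_cont (clt x).
have zv t x y : x <= y -> D x -> D y -> z t y - z t x = B0 * Int (v t) x y.
  move=> xy Dx Dy; rewrite (rw_zx H t xy) -IntZ//.
  apply: Int_ae_meas; [by have [] := lzx t|by have [] := locintZ B0 (lv t)|].
  apply: (aeS (ae_and f1_out f2_out)) => s [h1 h2] sxy.
  have so := Dout x y s Dx Dy sxy.
  by rewrite (h1 so) (h2 so) (be_out so) !mulr0 addr0 subr0.
have Ap t x y : x <= y -> D x -> D y -> Int (fun s => al s * p t s) x y = A0 * (W t y - W t x).
  move=> xy Dx Dy; rewrite (rw_Wx H t xy) -IntZ//; apply: eq_Int => s sxy.
  by rewrite (al_out (Dout x y s Dx Dy sxy)).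
have main t x y : 0 <= t -> x <= y -> D x -> D y ->
    Int (l t) x y = c * (Int (fun s => l s y) 0 t - Int (fun s => l s x) 0 t).
  move=> t0 xy Dx Dy.
  have e1 : Int (z t) x y = Int (fun s => A0 * (W s y - W s x)) 0 t.
    have -> : Int (z t) x y = Int (fun s => z t s - z 0 s) x y.
      by apply: eq_Int => s _; rewrite (rw_z0 H) subr0.
    rewrite (rw_zt H (lexx 0) t0 xy); apply: eq_Int => s _; exact: Ap.
  have e2 : Int (W t) x y = Int (fun s => B0^-1 * (z s y - z s x)) 0 t.
    have -> : Int (W t) x y = Int (fun s => W t s - W 0 s) x y.
      by apply: eq_Int => s _; rewrite (rw_W0 H) subr0.
    rewrite (rw_Wt H (lexx 0) t0 xy); apply: eq_Int => s _.
    by rewrite (zv s x y xy Dx Dy) mulKf// gt_eqF.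
  rewrite IntD//; last exact: locintZ.
  rewrite IntZ// e1 e2 -!IntZ; try (by apply: locintZ; exact: locintB); try exact: locintB.
  rewrite -IntB// -[RHS]IntZ; last exact: locintB.
  rewrite -IntD; [|by apply: locintZ; exact: locintB|by do 2 apply: locintZ; exact: locintB].
  apply: eq_Int => s _; rewrite /l /c; apply: (outgoing_arith _ _ _ _ _ sg2).
  by rewrite Z02 mulfK// gt_eqF.
have Dch' x : D x -> exists2 d : R, 0 < d & forall s, - d <= s -> D (x + c * s).
  move=> Dx; have [d d0 Hd] := Dch x Dx.
  have k0 : 0 < Z0 / B0 by rewrite divr_gt0.
  exists (d / (Z0 / B0)); first by rewrite divr_gt0.
  move=> s sd; rewrite /c -mulrA; apply: Hd.
  by move: sd; rewrite -mulNr ler_pdivrMr// mulrC.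
apply: (@transport _ l D c el cl l0 c0 Dch') => t t0 x y Dx Dy.
have lm := locint_cont (cl t).
have [xy|yx] := leP x y; first by rewrite (primB lm xy) main.
by have := primB lm (ltW yx); rewrite (main t y x t0 (ltW yx) Dy Dx); lra.
Qed.

Lemma wave_outgoing W z p v : rwave al be f1 f2 om W z p v ->
  (forall t x, 0 <= t -> b <= x -> z t x = - (Z0 * W t x)) /\
  (forall t x, 0 <= t -> x <= a -> z t x = Z0 * W t x).
Proof.
move=> H; have [lp _] := tc2_tc (rw_p H); have [lv _] := tc2_tc (rw_v H).
have cW t : continuous (W t) by apply: (rep_cont (lp t)) => x y xy; exact: (rw_Wx H).
have lzx t : locint (fun s => be s * v t s - (rho_cos om t * (be s * f1 s) + rho_sin om t * (be s * f2 s))).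
  by apply: locintB; [exact: locintM|apply: locintD; exact: locintZ].
have cz t : continuous (z t) by apply: (rep_cont (lzx t)) => x y xy; exact: (rw_zx H).
have cZ t (c : R) : continuous (fun x => c * W t x).
  by move=> x; apply: cvgM; [exact: cvg_cst|exact: cW].
have h2 (e : R) : 0 < e -> 0 < e / 2 /\ e / 2 < e.
  by move=> e0; rewrite divr_gt0// ltr_pdivrMr// ltr_pMr// ltr1n.
have R1 t x : 0 <= t -> b < x -> z t x = (- Z0) * W t x.
  move=> t0 bx.
  have := @wave_transport W z p v (fun x => b < x) 1 H (expr1n _ 2) _ _ t x t0 bx.
  rewrite mul1r mulNr => E; apply/eqP; rewrite -addr_eq0; apply/eqP; apply: E.
    by move=> x1 y1 s b1 _ /andP[xs _] /andP[_]; rewrite ltNge (ltW (lt_le_trans b1 xs)).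
  move=> x1 b1; exists ((x1 - b) / 2); first by rewrite divr_gt0// subr_gt0.
  by move=> s sd; rewrite mul1r; lra.
have L1 t x : 0 <= t -> x < a -> z t x = Z0 * W t x.
  move=> t0 xa.
  have := @wave_transport W z p v (fun x => x < a) (-1) H _ _ _ t x t0 xa.
  rewrite mulN1r mulNr => E; apply/eqP; rewrite -subr_eq0; apply/eqP; apply: E.
  - by rewrite sqrrN expr1n.
  - by move=> x1 y1 s _ y1a /andP[_ sy] /andP[+ _]; rewrite ltNge (ltW (le_lt_trans sy y1a)).
  - move=> x1 xa1; exists ((a - x1) / 2); first by rewrite divr_gt0// subr_gt0.
    by move=> s sd; rewrite mulN1r; lra.
split=> t x t0.
  rewrite -mulNr le_eqVlt => /orP[/eqP <-|bx]; last exact: R1.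
  apply: (eq_edge (cz t) (cZ t _)) => e /h2[e1 e2]; exists (b + e / 2).
    by rewrite addrAC subrr add0r gtr0_norm.
  by apply: R1 => //; rewrite ltrDl.
rewrite le_eqVlt => /orP[/eqP ->|xa]; last exact: L1.
apply: (eq_edge (cz t) (cZ t _)) => e /h2[e1 e2]; exists (a - e / 2).
  by rewrite addrAC subrr add0r normrN gtr0_norm.
by apply: L1 => //; rewrite ltrBlDr ltrDl.
Qed.

End Assemble.

(** * The difference to the time-harmonic solution *)

Section TimeFactors.
Context {R : realType}.
Implicit Types (f g h : R -> R) (P : R -> R -> R) (x y t s T : R).

Lemma tc2_sep (S : R -> R) g : continuous S -> locint g -> locint (fun x => g x ^+ 2) ->
  tc2 (fun t x => S t * g x).
Proof.
move=> cS lg lg2; have E (c : R) : locint (fun x => (c * g x) ^+ 2).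
  rewrite (_ : (fun x => _) = (fun x => c ^+ 2 * g x ^+ 2)); first exact: locintZ.
  by apply/funext => x; rewrite exprMn.
split=> [t|t|D t e e0]; [exact: locintZ|exact: E|].
pose k := Int (fun x => g x ^+ 2) (- D) D + 1.
have k0 : 0 < k by rewrite ltr_wpDl// Int_ge0// => s _; exact: sqr_ge0.
have r0 : 0 < Num.sqrt (e / k) by rewrite sqrtr_gt0 divr_gt0.
have [d d0 H] := cont_close t cS r0.
exists d => // s st; have {}H := H s st.
rewrite (@eq_Int _ _ (fun x => (S s - S t) ^+ 2 * g x ^+ 2)); last first.
  by move=> x _; rewrite -mulrBl exprMn.
rewrite IntZ//; apply: (@le_trans _ _ ((S s - S t) ^+ 2 * k)).
  by apply: ler_wpM2l; [exact: sqr_ge0|rewrite lerDl].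
rewrite -ler_pdivlMr// -(real_normK (num_real (S s - S t))).
have := lerXn2r 2 (normr_ge0 _) (ltW r0) H; rewrite sqr_sqrtr//.
by rewrite divr_ge0// ltW.
Qed.

Lemma clamp_cont : continuous (@clamp R).
Proof.
apply: cont_ed => t e e0; exists e => // s st.
exact: le_trans (clamp_dist s t) (ltW st).
Qed.

Definition ccos (om t : R) : R := cos (om * clamp t).
Definition csin (om t : R) : R := sin (om * clamp t).

Lemma ccos_cont om : continuous (ccos om).
Proof. by move=> t; apply: (@continuous_comp _ _ _ (@clamp R) (fun s => cos (om * s))); [exact: clamp_cont|exact: cosl_cont]. Qed.

Lemma csin_cont om : continuous (csin om).
Proof. by move=> t; apply: (@continuous_comp _ _ _ (@clamp R) (fun s => sin (om * s))); [exact: clamp_cont|exact: sinl_cont]. Qed.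

Lemma dat_sin (om x : R) : dat (fun s => sin (om * s)) x (om * cos (om * x)).
Proof.
have ds : dat sin (om * x + 0) (cos (om * x + 0)).
  by apply/is_derive_dat; exact: is_derive_sin.
have := @dat_comp _ _ (fun y => om * y + 0) _ _ _ ds (dat_aff om 0 x); rewrite addr0 [cos _ * _]mulrC.
by apply: (@dat_near _ _ _ _ _ 1) => // y _; rewrite addr0.
Qed.

Lemma dat_cos (om x : R) : dat (fun s => cos (om * s)) x (- (om * sin (om * x))).
Proof.
have ds : dat cos (om * x + 0) (- sin (om * x + 0)).
  by apply/is_derive_dat; exact: is_derive_cos.
have := @dat_comp _ _ (fun y => om * y + 0) _ _ _ ds (dat_aff om 0 x); rewrite addr0 mulNr [sin _ * _]mulrC.
by apply: (@dat_near _ _ _ _ _ 1) => // y _; rewrite addr0.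
Qed.

Lemma Int_ccos om T1 T2 : 0 <= T1 -> T1 <= T2 ->
  om * Int (ccos om) T1 T2 = csin om T2 - csin om T1.
Proof.
move=> T10 T12; have T20 := le_trans T10 T12.
rewrite /csin !clampE// (@eq_Int _ (ccos om) (fun s => cos (om * s))); last first.
  by move=> s /andP[s1 _]; rewrite /ccos clampE// (le_trans T10).
have lc := locint_cont (@cosl_cont R om).
rewrite -IntZ//; symmetry; apply: (@prim_unique _ (fun s => sin (om * s)) (fun s => om * cos (om * s))) => //.
  by move=> s; apply: cvgM; [exact: cvg_cst|exact: cosl_cont].
exact: dat_sin.
Qed.

Lemma Int_csin om T1 T2 : 0 <= T1 -> T1 <= T2 ->
  om * Int (csin om) T1 T2 = ccos om T1 - ccos om T2.
Proof.
move=> T10 T12; have T20 := le_trans T10 T12.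
rewrite /ccos !clampE// (@eq_Int _ (csin om) (fun s => sin (om * s))); last first.
  by move=> s /andP[s1 _]; rewrite /csin clampE// (le_trans T10).
have lc := locint_cont (@sinl_cont R om).
have H : cos (om * T2) - cos (om * T1) = Int (fun s => - (om * sin (om * s))) T1 T2.
  apply: (@prim_unique _ (fun s => cos (om * s)) (fun s => - (om * sin (om * s)))) => //.
    by move=> s; apply: cvgN; apply: cvgM; [exact: cvg_cst|exact: sinl_cont].
  exact: dat_cos.
by rewrite -opprB H -IntZ// -IntN; [apply: eq_Int => s _; rewrite opprK|apply: locintN; exact: locintZ].
Qed.

Lemma rho_cosE om t : 0 < om -> om * rho_cos om t = csin om t.
Proof.
move=> om0; have [t0|t0] := leP 0 t; last first.
  by rewrite /rho_cos (Int_ge _ (ltW t0)) mulr0 /csin clamp_neg// clampE// mulr0 sin0.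
have := Int_ccos om (lexx 0) t0; rewrite [csin om 0]/csin clampE// mulr0 sin0 subr0 => <-.
by congr (_ * _); apply: eq_Int => s /andP[s0 _]; rewrite /ccos clampE.
Qed.

Lemma rho_sinE om t : 0 < om -> om * rho_sin om t = 1 - ccos om t.
Proof.
move=> om0; have [t0|t0] := leP 0 t; last first.
  by rewrite /rho_sin (Int_ge _ (ltW t0)) mulr0 /ccos clamp_neg// clampE// mulr0 cos0 subrr.
have := Int_csin om (lexx 0) t0; rewrite [ccos om 0]/ccos clampE// mulr0 cos0 => <-.
by congr (_ * _); apply: eq_Int => s /andP[s0 _]; rewrite /csin clampE.
Qed.

Definition sep2 (c s : R -> R) g1 g2 t x : R := c t * g1 x + s t * g2 x.

Lemma Int_sep2 (c s : R -> R) g1 g2 t x y : locint g1 -> locint g2 ->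
  Int (sep2 c s g1 g2 t) x y = c t * Int g1 x y + s t * Int g2 x y.
Proof. by move=> l1 l2; rewrite IntD; [rewrite !IntZ|exact: locintZ|exact: locintZ]. Qed.

Lemma sep2_cont (c s g1 g2 : R -> R) t : continuous g1 -> continuous g2 -> continuous (sep2 c s g1 g2 t).
Proof.
by move=> c1 c2 x; apply: cvgD; apply: cvgM; [exact: cvg_cst|exact: c1|exact: cvg_cst|exact: c2].
Qed.

Lemma sep2_tc2 (c s : R -> R) g1 g2 : continuous c -> continuous s -> continuous g1 -> continuous g2 ->
  tc2 (sep2 c s g1 g2).
Proof.
move=> cc cs c1 c2.
have t1 := tc2_sep cc (locint_cont c1) (locint_cont (contX2 c1)).
have csN : continuous (fun t => - s t) by move=> t; apply: cvgN; exact: cs.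
have t2 := tc2_sep csN (locint_cont c2) (locint_cont (contX2 c2)).
have := tc2D t1 t2; rewrite (_ : (fun t x => _) = sep2 c s g1 g2)//.
by apply/funext => t; apply/funext => x; rewrite /sep2 mulNr opprK.
Qed.

Lemma sep2_eqc (c s : R -> R) g1 g2 : continuous c -> continuous s -> continuous g1 -> continuous g2 ->
  eqc (sep2 c s g1 g2).
Proof.
move=> cc cs c1 c2 B t e e0.
have [M1 HM1] := cont_bounded c1 (- B) B; have [M2 HM2] := cont_bounded c2 (- B) B.
have k1 : 0 < `|M1| + 1 by rewrite ltr_wpDl.
have k2 : 0 < `|M2| + 1 by rewrite ltr_wpDl.
have e2 : 0 < e / 2 by rewrite divr_gt0.
have [d1 d10 H1] := cont_close t cc (divr_gt0 e2 k1).
have [d2 d20 H2] := cont_close t cs (divr_gt0 e2 k2).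
exists (Num.min d1 d2); first by rewrite lt_min d10.
move=> r; rewrite lt_min => /andP[/H1 h1 /H2 h2] x xB.
have -> : sep2 c s g1 g2 r x - sep2 c s g1 g2 t x = (c r - c t) * g1 x + (s r - s t) * g2 x.
  by rewrite /sep2; ring.
have st (q q' g Mg : R) : `|q| <= e / 2 / (`|Mg| + 1) -> `|g| <= Mg -> `|q * g| <= e / 2.
  move=> hq hg; have kg : 0 < `|Mg| + 1 by rewrite ltr_wpDl.
  rewrite normrM; apply: (@le_trans _ _ (e / 2 / (`|Mg| + 1) * (`|Mg| + 1))); last first.
    by rewrite mulfVK// gt_eqF.
  apply: ler_pM => //; apply: le_trans hg _; apply: le_trans (ler_norm _) _.
  by rewrite lerDl.
apply: le_trans (ler_normD _ _) _; rewrite [e]splitr; apply: lerD.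
  exact: (st _ 0 _ _ h1 (HM1 x xB)).
exact: (st _ 0 _ _ h2 (HM2 x xB)).
Qed.

Lemma sep2_time (c s c' s' : R -> R) g1 g2 T1 T2 x y (p : R) : locint g1 -> locint g2 ->
  continuous c' -> continuous s' ->
  p * Int c' T1 T2 = c T2 - c T1 -> p * Int s' T1 T2 = s T2 - s T1 ->
  Int (fun r => sep2 c s g1 g2 T2 r - sep2 c s g1 g2 T1 r) x y =
  Int (fun t => Int (fun r => p * sep2 c' s' g1 g2 t r) x y) T1 T2.
Proof.
move=> l1 l2 cc cs hc hs.
have l3 : locint (sep2 c' s' g1 g2 0) by apply: locintD; exact: locintZ.
rewrite (@eq_Int _ (fun t => Int _ x y) (fun t => p * Int g1 x y * c' t + p * Int g2 x y * s' t)); last first.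
  move=> t _; rewrite IntZ; last by apply: locintD; exact: locintZ.
  by rewrite Int_sep2//; ring.
rewrite [RHS]IntD; [|by apply: locintZ; exact: locint_cont|by apply: locintZ; exact: locint_cont].
rewrite !IntZ; [|exact: locint_cont|exact: locint_cont].
rewrite IntB; [|by apply: locintD; exact: locintZ|by apply: locintD; exact: locintZ].
rewrite !Int_sep2//.
have ar (a1 a2 I1 I2 C S cc1 cc2 ss1 ss2 : R) : p * C = cc2 - cc1 -> p * S = ss2 - ss1 ->
  cc2 * I1 + ss2 * I2 - (cc1 * I1 + ss1 * I2) = p * I1 * C + p * I2 * S.
  move=> e1 e2; have -> : p * I1 * C = I1 * (p * C) by ring.
  have -> : p * I2 * S = I2 * (p * S) by ring.
  rewrite e1 e2; ring.
exact: (ar 0 0).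
Qed.

End TimeFactors.

Section RealLimit.
Context {R : realType}.
Local Notation mu := (@lebesgue_measure R).
Variables (al be f1 f2 : R -> R) (om a b A0 B0 m M : R).
Hypotheses (cal : continuous al) (cbe : continuous be) (m0 : 0 < m).
Hypotheses (al_lo : forall x, m <= al x) (be_lo : forall x, m <= be x).
Hypotheses (al_up : forall x, al x <= M) (be_up : forall x, be x <= M).
Hypotheses (al_out : forall x, ~ (a < x < b) -> al x = A0).
Hypotheses (be_out : forall x, ~ (a < x < b) -> be x = B0).
Hypotheses (lf1 : locint f1) (lf2 : locint f2).
Hypotheses (f1_out : {ae mu, forall x, ~ (a < x < b) -> f1 x = 0}).
Hypotheses (f2_out : {ae mu, forall x, ~ (a < x < b) -> f2 x = 0}).
Hypotheses (ab : a < b) (om0 : 0 < om).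
Local Notation Z0 := (Num.sqrt (A0 * B0)).
Variables (U1 U2 S1 S2 : R -> R).
Hypothesis HH : rhelm al be f1 f2 om a b Z0 U1 U2 S1 S2.
Implicit Types (W z p v : R -> R -> R) (x y t s T : R).

Let A00 : 0 < A0. Proof. by rewrite -(al_out (x := a)) ?ltxx//; exact: lt_le_trans (al_lo a). Qed.
Let B00 : 0 < B0. Proof. by rewrite -(be_out (x := a)) ?ltxx//; exact: lt_le_trans (be_lo a). Qed.
Let Z00 : 0 < Z0. Proof. by rewrite sqrtr_gt0 mulr_gt0. Qed.
Let al0 x : 0 < al x. Proof. exact: lt_le_trans (al_lo x). Qed.
Let be0 x : 0 < be x. Proof. exact: lt_le_trans (be_lo x). Qed.
Let lg1 : locint (fun x => be x * f1 x). Proof. exact: locintM. Qed.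
Let lg2 : locint (fun x => be x * f2 x). Proof. exact: locintM. Qed.
Let cV : continuous (fun x => (al x)^-1). Proof. exact: contV. Qed.
Let cU1 : continuous U1. Proof. by have [] := rhelm_cont cal al0 HH. Qed.
Let cU2 : continuous U2. Proof. by have [] := rhelm_cont cal al0 HH. Qed.
Let cS1 : continuous S1. Proof. exact: (rh_cS1 HH). Qed.
Let cS2 : continuous S2. Proof. exact: (rh_cS2 HH). Qed.
Let cc := @ccos_cont R om.
Let cs := @csin_cont R om.
Let ccN : continuous (fun t => - ccos om t). Proof. by move=> t; apply: cvgN; exact: cc. Qed.
Let csN : continuous (fun t => - csin om t). Proof. by move=> t; apply: cvgN; exact: cs. Qed.

Definition harm t x := sep2 (ccos om) (csin om) U1 U2 t x.
Definition harm_t t x := om * sep2 (fun t => - csin om t) (ccos om) U1 U2 t x.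
Definition harm_flux t x := sep2 (ccos om) (csin om) S1 S2 t x.
Definition harm_pot t x := om^-1 * sep2 (csin om) (fun t => - ccos om t) S1 S2 t x.

Definition errP p t x := al x * p t x - harm_flux t x.
Definition errQ v t x := v t x - harm_t t x.
Definition errW W t x := W t x + -1 * harm t x.
Definition errZ z t x := z t x + -1 * harm_pot t x + om^-1 * prim (fun x => be x * f2 x) x.

Let sqM : exists M' : R, forall x, `|al x| <= M'.
Proof. by exists M => x; rewrite gtr0_norm. Qed.

Lemma errP_tc2 p : tc2 p -> tc2 (errP p).
Proof. by move=> tp; apply: (tc2D (tc2M cal sqM tp)); exact: sep2_tc2. Qed.

Lemma errQ_tc2 v : tc2 v -> tc2 (errQ v).
Proof.
move=> tv; apply: (tc2D tv); apply: (@tc2M _ _ (fun=> om)) => //.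
- exact: contC.
- by exists om => _; rewrite gtr0_norm.
- exact: sep2_tc2.
Qed.

Lemma harm_x t x y : x <= y -> harm t y - harm t x = Int (fun s => (al s)^-1 * harm_flux t s) x y.
Proof.
move=> xy; rewrite (@eq_Int _ _ (sep2 (ccos om) (csin om) (fun s => S1 s / al s) (fun s => S2 s / al s) t)); last first.
  by move=> s _; rewrite /harm_flux /sep2; ring.
rewrite Int_sep2; [|by apply: locint_cont; exact: contM|by apply: locint_cont; exact: contM].
by rewrite -(rh_U1 HH xy) -(rh_U2 HH xy) /harm /sep2; ring.
Qed.

Let K1 s := be s * (om ^+ 2 * U1 s + f1 s).
Let K2 s := be s * (om ^+ 2 * U2 s + f2 s).
Let lK1 : locint K1.
Proof. by apply: locintM => //; apply: locintD => //; apply: locintZ; exact: locint_cont. Qed.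
Let lK2 : locint K2.
Proof. by apply: locintM => //; apply: locintD => //; apply: locintZ; exact: locint_cont. Qed.

Lemma harm_pot_x t x y : x <= y -> harm_pot t y - harm_pot t x =
  Int (fun s => be s * harm_t t s - om^-1 * (csin om t * (be s * f1 s) - ccos om t * (be s * f2 s))) x y.
Proof.
move=> xy; transitivity (Int (fun s => om^-1 * (ccos om t * K2 s + - csin om t * K1 s)) x y).
  rewrite IntZ; last by apply: locintD; exact: locintZ.
  rewrite IntD; [|exact: locintZ..]; rewrite !IntZ//.
  have : S1 y - S1 x = - Int K1 x y by rewrite (rh_S1 HH xy) IntN.
  have : S2 y - S2 x = - Int K2 x y by rewrite (rh_S2 HH xy) IntN.
  rewrite /harm_pot /sep2; move: (Int K1 x y) (Int K2 x y) => I1 I2 e2 e1.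
  have -> : I1 = S1 x - S1 y by lra.
  have -> : I2 = S2 x - S2 y by lra.
  ring.
by apply: eq_Int => s _; rewrite /K1 /K2 /harm_t /sep2; field; rewrite gt_eqF.
Qed.

Lemma eqcDcst z (g : R -> R) : eqc z -> eqc (fun t x => z t x + g x).
Proof.
move=> ez B t e e0; have [d d0 Hd] := ez B t e e0.
exists d => // s st x xB; have -> : z s x + g x - (z t x + g x) = z s x - z t x by ring.
exact: Hd.
Qed.

Lemma err_wpair W z p v : rwave al be f1 f2 om W z p v ->
  wpair (fun x => (al x)^-1) be (errW W) (errZ z) (errP p) (errQ v).
Proof.
move=> H; have tp := rw_p H; have tv := rw_v H.
have tP := errP_tc2 tp; have tQ := errQ_tc2 tv.
have [lp _] := tc2_tc tp; have [lv _] := tc2_tc tv.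
have [lP _ _] := tP; have [lQ _ _] := tQ.
have cW t : continuous (W t) by apply: (rep_cont (lp t)) => x y xy; exact: (rw_Wx H).
have lzx t : locint (fun s => be s * v t s - (rho_cos om t * (be s * f1 s) + rho_sin om t * (be s * f2 s))).
  by apply: locintB; [exact: locintM|apply: locintD; exact: locintZ].
have cz t : continuous (z t) by apply: (rep_cont (lzx t)) => x y xy; exact: (rw_zx H).
have lW t := locint_cont (cW t); have lz t := locint_cont (cz t).
have ch t : continuous (harm t) by exact: sep2_cont.
have chf t : continuous (harm_flux t) by exact: sep2_cont.
have chp t : continuous (harm_pot t).
  by move=> x; apply: cvgM; [exact: cvg_cst|exact: (@sep2_cont _ (csin om) (fun t => - ccos om t) S1 S2 t cS1 cS2)].
have cht t : continuous (harm_t t).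
  by move=> x; apply: cvgM; [exact: cvg_cst|exact: (@sep2_cont _ (fun t => - csin om t) (ccos om) U1 U2 t cU1 cU2)].
have lh t := locint_cont (ch t); have lhf t := locint_cont (chf t).
have lhp t := locint_cont (chp t); have lht t := locint_cont (cht t).
have lap t : locint (fun x => al x * p t x) by exact: locintM.
have tcap := tcM (tc2_tc tp) cal.
have tchf : tc harm_flux := tc2_tc (sep2_tc2 cc cs cS1 cS2).
have tcht : tc harm_t.
  by apply: (@tcM _ _ (fun=> om)); [exact: (tc2_tc (sep2_tc2 csN cc cU1 cU2))|exact: contC].
split.
- exact: cV.
- exact: cbe.
- exact: tc2_tc.
- exact: tc2_tc.
- by apply: eqcD; [exact: sep2_eqc|exact: (rw_W H)].
- apply: eqcDcst; apply: eqcD; last exact: (rw_z H).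
  have E : eqc (fun t x => 0 + om^-1 * sep2 (csin om) (fun t => - ccos om t) S1 S2 t x).
    apply: eqcD; first exact: sep2_eqc.
    by move=> B t e e0; exists 1 => // s _ x _; rewrite subrr normr0 ltW.
  rewrite (_ : harm_pot = fun t x => 0 + om^-1 * sep2 (csin om) (fun t => - ccos om t) S1 S2 t x)//.
  by apply/funext => t; apply/funext => x; rewrite add0r.
- move=> t x y xy; rewrite (@eq_Int _ _ (fun s => p t s - (al s)^-1 * harm_flux t s)); last first.
    by move=> s _; rewrite /errP mulrBr mulKf// gt_eqF.
  rewrite IntB//; last by apply: locint_cont; exact: contM.
  by rewrite -(rw_Wx H t xy) -(harm_x t xy) /errW; ring.
- move=> t x y xy.
  have l1 : locint (fun s => be s * harm_t t s - om^-1 * (csin om t * (be s * f1 s) - ccos om t * (be s * f2 s))).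
    apply: locintB; first by apply: locint_cont; exact: contM.
    by apply: locintZ; apply: locintB; exact: locintZ.
  transitivity ((z t y - z t x) - (harm_pot t y - harm_pot t x) + om^-1 * (prim (fun x => be x * f2 x) y - prim (fun x => be x * f2 x) x)).
    by rewrite /errZ; ring.
  rewrite (primB lg2 xy) (rw_zx H t xy) (harm_pot_x t xy) -IntZ//.
  rewrite -IntB// -IntD; [|exact: locintB|exact: locintZ].
  apply: eq_Int => s _; rewrite /errQ.
  have rc := rho_cosE t om0; have rs := rho_sinE t om0.
  have -> : rho_cos om t = om^-1 * csin om t by rewrite -rc mulKf// gt_eqF.
  have -> : rho_sin om t = om^-1 * (1 - ccos om t) by rewrite -rs mulKf// gt_eqF.
  ring.
- move=> T1 T2 T10 T12 x y xy.
  rewrite (@eq_Int _ _ (fun s => (z T2 s - z T1 s) - (harm_pot T2 s - harm_pot T1 s))); last first.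
    by move=> s _; rewrite /errZ; ring.
  rewrite IntB; [|exact: locintB|exact: locintB].
  rewrite (rw_zt H T10 T12 xy).
  have E : Int (fun s => harm_pot T2 s - harm_pot T1 s) x y = Int (fun t => Int (harm_flux t) x y) T1 T2.
    have := @sep2_time R (csin om) (fun t => - ccos om t) (ccos om) (csin om) S1 S2 T1 T2 x y om
      (locint_cont cS1) (locint_cont cS2) cc cs (Int_ccos om T10 T12).
    rewrite (Int_csin om T10 T12) opprK [- _ + _]addrC => /(_ erefl) E.
    rewrite (@eq_Int _ _ (fun s => om^-1 * (sep2 (csin om) (fun t => - ccos om t) S1 S2 T2 s - sep2 (csin om) (fun t => - ccos om t) S1 S2 T1 s))); last first.
      by move=> s _; rewrite /harm_pot mulrBr.
    rewrite IntZ; last first.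
      by apply: locintB; apply: locint_cont; exact: sep2_cont.
    rewrite E -IntZ; last first.
      apply: locint_cont; apply: (@tc_cont _ (sep2 (ccos om) (csin om) S1 S2) (fun=> om)); [exact: tchf|exact: contC].
    apply: eq_Int => t _; rewrite IntZ; last exact: lhf.
    by rewrite mulKf// gt_eqF.
  rewrite E -IntB; [|by apply: locint_cont; exact: tc_cont1|by apply: locint_cont; exact: tc_cont1].
  by apply: eq_Int => t _; rewrite -IntB.
- move=> T1 T2 T10 T12 x y xy.
  rewrite (@eq_Int _ _ (fun s => (W T2 s - W T1 s) - (harm T2 s - harm T1 s))); last first.
    by move=> s _; rewrite /errW; ring.
  rewrite IntB; [|exact: locintB|exact: locintB].
  rewrite (rw_Wt H T10 T12 xy).
  have E : Int (fun s => harm T2 s - harm T1 s) x y = Int (fun t => Int (harm_t t) x y) T1 T2.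
    apply: (@sep2_time R (ccos om) (csin om) (fun t => - csin om t) (ccos om) U1 U2 T1 T2 x y om
      (locint_cont cU1) (locint_cont cU2) csN cc _ (Int_ccos om T10 T12)).
    by rewrite IntN ?mulrN ?(Int_csin om T10 T12) ?opprB//; exact: locint_cont.
  rewrite E -IntB; [|by apply: locint_cont; exact: (@tc_cont1 _ _ x y (tc2_tc tv))|by apply: locint_cont; exact: tc_cont1].
  by apply: eq_Int => t _; rewrite -(IntB _ _ (lv t) (lht t)).
Qed.

Definition limit_value : R := Int (fun x => be x * f2 x) a b / (2 * (om * Z0)).

Lemma prim_f2_out x y : (forall s, x <= s <= y -> ~ (a < s < b)) -> x <= y ->
  prim (fun x => be x * f2 x) y = prim (fun x => be x * f2 x) x.
Proof.
move=> out xy; have := primB lg2 xy; have [mf _] := lg2; have [m0' _] := @locint_cst R 0.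
rewrite (Int_ae_meas mf m0'); first by rewrite Int_cst// mul0r => /eqP; rewrite subr_eq0 => /eqP.
by apply: (aeS f2_out) => s Hs sxy; rewrite Hs ?mulr0//; exact: out.
Qed.

Let ccos0 : ccos om 0 = 1. Proof. by rewrite /ccos clampE// mulr0 cos0. Qed.
Let csin0 : csin om 0 = 0. Proof. by rewrite /csin clampE// mulr0 sin0. Qed.

Theorem real_limit (La C a' b' : R) : a' <= a -> b <= b' ->
  C1_decays al be Z0 La C a' (b' + 1) -> 0 < C -> 0 < La ->
  exists2 K : R, 0 < K & forall W z p v, rwave al be f1 f2 om W z p v ->
  forall T, 0 <= T ->
  [/\ Int (fun x => errP p T x ^+ 2) a' b' <= K * expR (- (La * T)),
      Int (fun x => errQ v T x ^+ 2) a' b' <= K * expR (- (La * T)) &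
      forall x, a' <= x <= b' -> `|errW W T x - limit_value| <= K * expR (- (La / 2 * T))].
Proof.
move=> aa bb D C0 La0; have ab' : a' <= b' := le_trans aa (le_trans (ltW ab) bb).
have ab1 : a' <= b' + 1 by apply: le_trans ab' _; rewrite lerDl.
pose BP := 2 * Int (fun x => S1 x ^+ 2) a' (b' + 1).
pose BQ := 2 * Int (fun x => (om * U2 x) ^+ 2) a' (b' + 1).
have BP0 : 0 <= BP by rewrite mulr_ge0// Int_ge0// => s _; exact: sqr_ge0.
have BQ0 : 0 <= BQ by rewrite mulr_ge0// Int_ge0// => s _; exact: sqr_ge0.
have be_M x : 0 <= be x <= M by rewrite (ltW (be0 x)) be_up.
have [K K0 HK] := pair_limit Z00 m0 al_lo be_M D C0 La0 ab' BP0 BQ0.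
exists K => // W z p v H T T0.
have WP := err_wpair H; have [zR zL] := wave_outgoing cbe m0 al_lo be_lo al_out be_out lf1 lf2 f1_out f2_out H.
have [lP lP2 _] := errP_tc2 (rw_p H); have [lQ lQ2 _] := errQ_tc2 (rw_v H).
pose g := prim (fun x => be x * f2 x).
have outb s : b <= s -> ~ (a < s < b) by move=> bs /andP[_]; rewrite ltNge bs.
have outa s : s <= a -> ~ (a < s < b) by move=> sa /andP[+ _]; rewrite ltNge sa.
have omn : om != 0 by rewrite gt_eqF.
apply: (HK _ _ _ _ (om^-1 * g a) (om^-1 * g b) limit_value WP) => //.
- move=> t x t0 bx; have {}bx : b <= x by exact: le_trans bx.
  rewrite /errZ -/g (_ : g x = g b); last first.
    by apply: prim_f2_out => // s /andP[bs _]; exact: outb.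
  rewrite (zR t x t0 bx) /errW /harm_pot /harm /sep2 (rh_r1 HH bx) (rh_r2 HH bx).
  by move: (W t x) (U1 x) (U2 x) (ccos om t) (csin om t) (g b) => w u1 u2 c s gb; field.
- move=> t x t0 xa; have {}xa : x <= a by exact: le_trans aa.
  rewrite /errZ -/g (_ : g x = g a); last first.
    by symmetry; apply: prim_f2_out => // s /andP[_ sa]; exact: outa.
  rewrite (zL t x t0 xa) /errW /harm_pot /harm /sep2 (rh_l1 HH xa) (rh_l2 HH xa).
  by move: (W t x) (U1 x) (U2 x) (ccos om t) (csin om t) (g a) => w u1 u2 c s ga; field.
- rewrite -mulrBr /g (primB lg2 (ltW ab)) /limit_value.
  by field; rewrite omn gt_eqF.
- have := tc2_bound ab1 (errP_tc2 (rw_p H)).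
  rewrite (_ : Int _ a' (b' + 1) = Int (fun x => S1 x ^+ 2) a' (b' + 1))//.
  apply: Int_ae; [exact: lP2|exact: locint_cont (contX2 cS1)|].
  apply: (aeS (rw_p0 H)) => x p0; rewrite /errP /harm_flux /sep2 p0 ccos0 csin0.
  by rewrite mulr0 mul1r mul0r addr0 sub0r sqrrN.
- have := tc2_bound ab1 (errQ_tc2 (rw_v H)).
  rewrite (_ : Int _ a' (b' + 1) = Int (fun x => (om * U2 x) ^+ 2) a' (b' + 1))//.
  apply: Int_ae; [exact: lQ2| |].
    by apply: locint_cont; apply: contX2; exact: contZ.
  apply: (aeS (rw_v0 H)) => x v0; rewrite /errQ /harm_t /sep2 v0 ccos0 csin0.
  by rewrite oppr0 mul0r mul1r !add0r sqrrN.
Qed.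

End RealLimit.

(** * Conclusion *)

Section Glue.
Context {R : realType}.
Local Notation mu := (@lebesgue_measure R).
Implicit Types (f g F U : R -> R[i]) (h k phi : R -> R) (x y t s : R) (b : bool) (D : set R).

Lemma Int_ae_bound h x y (M : R) : locint h -> x <= y -> {ae mu, forall s, `|h s| <= M} ->
  `|Int h x y| <= M * (y - x).
Proof.
move=> lh xy hM; apply: le_trans (Int_norm _ _ lh) _; have ln := locint_norm lh.
have lm : locint (fun s => Num.min `|h s| M).
  apply: (locint_ae (g := fun s => `|h s|)) => //; last by apply: (aeS hM) => s /min_idPl.
  by have [mh _] := ln; apply: measurable_minr => //; exact: measurable_cst.
rewrite (Int_ae x y ln lm); last by apply: (aeS hM) => s /min_idPl ->.
rewrite -(@Int_cst _ M x y xy); apply: le_Int => //; first exact: locint_cst.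
by move=> s _; rewrite ge_min lexx orbT.
Qed.

Lemma Lfun_oo_bound h : h \in Lfun mu +oo%E ->
  measurable_fun setT h /\ exists2 M : R, 0 <= M & {ae mu, forall x, `|h x| <= M}.
Proof.
rewrite inE => /andP[mh fh]; split; first by move: mh; rewrite inE.
move: fh; rewrite inE /finite_norm Lnorm.unlock.
rewrite /=; case: ifPn => [_ foo|]; last first.
  have m1 : (0 < mu `[0%R, 1%R])%E by rewrite lebesgue_measure_itv/= lte_fin ltr01 oppr0 adde0 lte01.
  have m2 : (0 < mu [set: R])%E by apply: (lt_le_trans m1); apply: le_measure; rewrite ?inE.
  by move=> /negP[]; exact: m2.
have [M HM] := @ess_sup_inf.ess_supr_bounded _ _ _ mu (fun x => `|h x|) foo.
exists `|M| => //; apply: (aeS HM) => x /le_trans; apply; exact: ler_norm.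
Qed.

Lemma wderivR_ae h h' k : is_wderivR setT h k -> measurable_fun setT h' ->
  {ae mu, forall x, h' x = h x} -> is_wderivR setT h' k.
Proof.
move=> [l1 l2 H] mh' E; have lh := locally_locint l1.
have lh' := locint_ae mh' lh E.
split => // [|phi tp]; first exact: locint_locally.
rewrite -(H phi tp); have [_ i1] := weak_integrable l1 tp.
have [_ i2] := weak_integrable (locint_locally lh') tp.
congr fine; apply: ae_eq_integral => //; [by case/integrableP: i2|by case/integrableP: i1|].
by apply: (aeS E) => x -> _.
Qed.

Lemma test_supp D phi : test_function D phi -> exists2 N : R, 0 <= N &
  smooth phi /\ forall x, ~ (- N < x < N) -> phi x = 0.
Proof.
move=> [sp [K [cK _ pK]]]; have [M [_ HM]] := compact_bounded cK.
exists (`|M| + 2); first by rewrite addr_ge0.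
split=> // x xN; apply: pK => Kx; apply: xN.
have := HM (`|M| + 1) _ x Kx; rewrite /= => H.
have {}H : `|x| <= `|M| + 1 by apply: H; apply: le_lt_trans (ler_norm _) _; rewrite ltrDl.
by rewrite -ltr_norml; apply: le_lt_trans H _; rewrite ltrD2l ltr1n.
Qed.

Lemma rep_wderivR h k : locint k -> (forall x y, x <= y -> h y - h x = Int k x y) ->
  is_wderivR setT h k.
Proof.
move=> lk hk; have ch := rep_cont lk hk.
split; [by apply: locint_locally; exact: locint_cont|exact: locint_locally|].
move=> phi tp; have [N N0 [sp pN]] := test_supp tp.
have cp := smooth_cont sp; have cp' := smooth_cont (smooth_derive sp).
have p'N := derive1_out pN sp.
have NN : - N <= N by lra.
have out (g1 g2 : R -> R) : (forall x, ~ (- N < x < N) -> g2 x = 0) ->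
    \int[mu]_(x in setT) (g1 x * g2 x) = Int (fun x => g1 x * g2 x) (- N) N.
  move=> g0; apply: integral_supp => // x xN; rewrite g0 ?mulr0// => /andP[h1 h2].
  by apply: xN; rewrite (ltW h1) (ltW h2).
rewrite (out h (derive1 phi) p'N) (out k phi pN).
have lp := parts lk cp' (smooth_dat sp) NN.
have p1 : phi N = 0 by apply: pN; rewrite ltxx andbF.
have p2 : phi (- N) = 0 by apply: pN; rewrite ltxx.
have l1 : locint (fun s => phi s * k s) by exact: locintM.
have l2 : locint (fun s => derive1 phi s * prim k s).
  by apply: locint_cont; apply: contM => //; exact: prim_continuous.
have E x : h x = prim k x + h 0.
  have [x0|x0] := leP 0 x; first by rewrite (primE _ x0) -hk//; ring.
  by have := hk _ _ (ltW x0); have := primB lk (ltW x0); rewrite prim0; lra.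
rewrite p1 p2 !mul0r subrr in lp.
have d0 : Int (derive1 phi) (- N) N = 0.
  by rewrite -(prim_unique cp' (smooth_dat sp) NN) p1 p2 subrr.
have -> : Int (fun x => k x * phi x) (- N) N = Int (fun s => phi s * k s) (- N) N.
  by apply: eq_Int => s _; rewrite mulrC.
have -> : Int (fun x => h x * derive1 phi x) (- N) N = Int (fun s => derive1 phi s * prim k s) (- N) N.
  rewrite (@eq_Int _ _ (fun s => derive1 phi s * prim k s + h 0 * derive1 phi s)).
    by rewrite IntD// ?IntZ ?d0 ?mulr0 ?addr0//; [exact: locint_cont|apply: locintZ; exact: locint_cont].
  by move=> s _; rewrite E; ring.
by apply/eqP; rewrite -addr_eq0 addrC lp.
Qed.

Lemma L2norm_ae D f g : measurable D -> (forall b, measurable_fun D (part b f)) ->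
  (forall b, measurable_fun D (part b g)) ->
  (forall b, {ae mu, forall x, D x -> part b f x = part b g x}) -> L2norm D f = L2norm D g.
Proof.
move=> mD mf mg E; rewrite !L2norm_int; congr (_ `^ _)%E; apply: ae_eq_integral => //.
- apply/measurable_EFinP; exact: measurable_funD (measurable_funX _ (mf false)) (measurable_funX _ (mf true)).
- apply/measurable_EFinP; exact: measurable_funD (measurable_funX _ (mg false)) (measurable_funX _ (mg true)).
- apply: (aeS (ae_and (E false) (E true))) => x [e1 e2] Dx; congr (_%:E).
  by have := e1 Dx; have := e2 Dx; rewrite /part => -> ->.
Qed.

Lemma H1norm_le D f (s1 s2 : R) : has_wderiv D f -> 0 <= s1 -> 0 <= s2 ->
  (L2norm D f <= s1%:E)%E -> (L2norm D (wderiv D f) <= s2%:E)%E -> (H1norm D f <= (s1 + s2)%:E)%E.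
Proof.
move=> hf s10 s20 h1 h2; rewrite /H1norm (asboolT hf).
have -> : (s1 + s2)%:E = (((s1 + s2) ^+ 2)%:E `^ 2^-1)%E.
  by rewrite poweR_EFin -powR_mulrn ?addr_ge0// -powRrM mulfV ?pnatr_eq0// powRr1// addr_ge0.
have sq (g : R -> R[i]) (r : R) : 0 <= r -> (L2norm D g <= r%:E)%E -> (L2norm D g ^+ 2 <= (r ^+ 2)%:E)%E.
  by move=> r0 H; rewrite expe2 expr2 EFinM; apply: lee_pmul => //; exact: L2norm_ge0.
have H : (L2norm D f ^+ 2 + L2norm D (wderiv D f) ^+ 2 <= ((s1 + s2) ^+ 2)%:E)%E.
  apply: le_trans (leeD (sq _ _ s10 h1) (sq _ _ s20 h2)) _.
  by rewrite -EFinD lee_fin; have := mulr_ge0 s10 s20; nra.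
have N0 : (0 <= L2norm D f ^+ 2 + L2norm D (wderiv D f) ^+ 2)%E.
  by rewrite !L2norm_sqr adde_ge0// int_sqr_ge0.
move: N0 H; move: (L2norm D f ^+ 2 + L2norm D (wderiv D f) ^+ 2)%E => z z0 zs.
apply: gt0_ler_poweR => //; rewrite ?invr_ge0// in_itv/= leey andbT//.
by rewrite lee_fin sqr_ge0.
Qed.

Lemma esupport_ae F (a c : R) : esupport F `<=` `]a, c[ ->
  {ae mu, forall x, ~ (a < x < c) -> F x = 0}.
Proof.
move=> sF; pose D := ~` esupport F.
have Dloc x : D x -> exists2 V : set R, nbhs x V & mu.-negligible (V `&` [set y | F y != 0]).
  by rewrite /D /esupport /= => /existsNP[V] /not_implyP[nV] /contrapT H; exists V.
have oD : open D.
  rewrite openE => x /Dloc[V nV H]; rewrite /interior.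
  apply: filterS (nbhs_interior nV) => y yV; rewrite /D /esupport /= => /(_ V).
  by apply => //; exact: nbhs_interior.
have := @ae_local R D (fun x => F x = 0) oD _.
move=> H; suff : {ae mu, forall x, D x -> F x = 0}.
  move=> {}H; apply: (aeS H) => x Dx xo; apply: Dx => /sF.
  by rewrite /= in_itv/=.
apply: H => x /Dloc[V /nbhs_ballP[e /= e0 eV] H]; exists e; split=> // r s r1 rx xs s1.
apply: negligibleS H => y /= /not_implyP[/andP[ry ys] Fy]; split; last exact/eqP.
by apply: eV; rewrite /ball/= ltr_norml; apply/andP; lra.
Qed.

Lemma rhelm_rot (al be f1 f2 : R -> R) (om a c Z0 : R) (U1 U2 S1 S2 : R -> R) :
  locint (fun s => be s * (om ^+ 2 * U1 s + f1 s)) ->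
  rhelm al be f1 f2 om a c Z0 U1 U2 S1 S2 -> locint (fun s => S1 s / al s) ->
  rhelm al be f2 (fun x => - f1 x) om a c Z0 U2 (fun x => - U1 x) S2 (fun x => - S1 x).
Proof.
move=> lK H lS; split.
- exact: (rh_U2 H).
- move=> x y xy; have := rh_U1 H xy.
  rewrite (@eq_Int _ (fun s => - S1 s / al s) (fun s => - (S1 s / al s))); last by move=> s _; rewrite mulNr.
  by rewrite IntN//; lra.
- exact: (rh_S2 H).
- move=> x y xy; have := rh_S1 H xy; rewrite IntN//.
  rewrite (@eq_Int _ _ (fun s => be s * (om ^+ 2 * U1 s + f1 s))); last by move=> s _; ring.
  lra.
- exact: (rh_cS2 H).
- by move=> x; apply: cvgN; exact: (rh_cS1 H).
- by move=> x cx; rewrite (rh_r2 H cx); ring.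
- by move=> x cx; rewrite (rh_r1 H cx); ring.
- by move=> x cx; rewrite (rh_l2 H cx); ring.
- by move=> x cx; rewrite (rh_l1 H cx); ring.
Qed.

End Glue.

Section Glue2.
Context {R : realType}.
Local Notation mu := (@lebesgue_measure R).
Implicit Types (f g F U : R -> R[i]) (h k phi : R -> R) (x y t s : R) (b : bool) (D : set R).

Lemma ae_le_cont h (c : R) : continuous h -> {ae mu, forall x, h x <= c} -> forall x, h x <= c.
Proof.
move=> ch H x; apply/ler_addgt0Pr => e e0; have [d d0 Hd] := cont_close x ch e0.
have xd : x < x + d by rewrite ltrDl.
have [y /andP[xy yd] hy] := ae_ex H xd.
have : `|h y - h x| <= e by apply: Hd; rewrite gtr0_norm ?subr_gt0//; lra.
by rewrite ler_norml => /andP[h1 _]; lra.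
Qed.

Lemma ae_ge_cont h (c : R) : continuous h -> {ae mu, forall x, c <= h x} -> forall x, c <= h x.
Proof.
move=> ch H x; rewrite -lerN2; apply: (@ae_le_cont (fun x => - h x)).
  by move=> y; apply: cvgN; exact: ch.
by apply: (aeS H) => y; rewrite lerN2.
Qed.

Lemma ae_eq_out h (a c A : R) : continuous h -> a < c ->
  {ae mu, forall x, ~ (a < x < c) -> h x = A} -> forall x, ~ (a < x < c) -> h x = A.
Proof.
move=> ch ac H x xo; apply/eqP; rewrite -subr_eq0 -normr_le0; apply/ler_addgt0Pr => e e0; rewrite add0r.
have [d d0 Hd] := cont_close x ch e0.
have [xa|xa] := leP x a.
  have xd : x - d < x by rewrite ltrBlDr ltrDl.
  have [y /andP[y1 y2] hy] := ae_ex H xd.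
  rewrite -(hy _); first rewrite distrC; first by apply: Hd; rewrite ltr0_norm ?subr_lt0//; lra.
  by move=> /andP[]; lra.
have cx : c <= x by rewrite leNgt; apply/negP => xc; apply: xo; rewrite xa.
have xd : x < x + d by rewrite ltrDl.
have [y /andP[y1 y2] hy] := ae_ex H xd.
rewrite -(hy _); first rewrite distrC; first by apply: Hd; rewrite gtr0_norm ?subr_gt0//; lra.
by move=> /andP[]; lra.
Qed.

Lemma W1oo_rep h : W1oo h -> measurable_fun setT h /\ exists g : R -> R,
  [/\ continuous g, {ae mu, forall x, h x = g x},
   exists2 L : R, 0 <= L & forall x y, x <= y -> `|g y - g x| <= L * (y - x) &
   exists M : R, forall x, g x <= M].
Proof.
move=> [/Lfun_oo_bound[mh [M M0 HM]] [k hk /Lfun_oo_bound[mk [L L0 HL]]]]; split=> //.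
have [c Hc] := wderivR_rep hk; have [_ /locally_locint lk _] := hk.
pose g x := c + prim k x.
have gk x y : x <= y -> g y - g x = Int k x y by move=> xy; rewrite -(primB lk xy) /g; ring.
have cg := rep_cont lk gk.
exists g; split=> //.
- by exists L => // x y xy; rewrite gk//; exact: Int_ae_bound.
- exists M; apply: ae_le_cont => //; apply: (aeS (ae_and HM Hc)) => x [h1 h2].
  by rewrite /g -h2; apply: le_trans h1; exact: ler_norm.
Qed.

Lemma exp_small (r K : R) : 0 < r -> 0 <= K -> forall e : R, 0 < e ->
  exists2 T : R, 0 <= T & K * expR (- (r * T)) <= e.
Proof.
move=> r0 K0 e e0; pose T := K / e / r.
have T0 : 0 <= T by rewrite !divr_ge0// ltW.
exists T => //; have rT : r * T = K / e by rewrite /T mulrC divfK// gt_eqF.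
have q0 : 0 <= K / e by rewrite divr_ge0// ltW.
rewrite rT expRN ler_pdivrMr ?expR_gt0//.
apply: (@le_trans _ _ (e * (1 + K / e))); last by apply: ler_wpM2l; [exact: ltW|exact: expR_ge1Dx].
have -> : e * (1 + K / e) = e + K by field; rewrite gt_eqF.
by rewrite lerDr ltW.
Qed.

Lemma harm_zero (om A B K r : R) : 0 < om -> 0 < r -> 0 <= K ->
  (forall T, 0 <= T -> `|cos (om * T) * A + sin (om * T) * B| <= K * expR (- (r * T))) ->
  A = 0 /\ B = 0.
Proof.
move=> om0 r0 K0 H.
have S0 : A ^+ 2 + B ^+ 2 = 0.
  apply/eqP; rewrite eq_le; apply/andP; split; last by rewrite addr_ge0// sqr_ge0.
  apply/ler_addgt0Pr => e e0; rewrite add0r.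
  have e'0 : 0 < Num.sqrt (e / 2) by rewrite sqrtr_gt0 divr_gt0.
  have [T T0 HT] := exp_small r0 K0 e'0.
  pose T' := T + pi / 2 / om.
  have TT : T <= T' by rewrite lerDl !divr_ge0 ?pi_ge0// ltW.
  have E : om * T' = om * T + pi / 2 by rewrite /T'; field; rewrite gt_eqF.
  have h1 := le_trans (H T T0) HT.
  have h2 : `|cos (om * T') * A + sin (om * T') * B| <= Num.sqrt (e / 2).
    apply: le_trans (H T' (le_trans T0 TT)) _; apply: le_trans HT; apply: ler_wpM2l => //.
    by rewrite ler_expR lerN2 ler_wpM2l// ltW.
  rewrite E cosDpihalf sinDpihalf in h2.
  have sq (q : R) : `|q| <= Num.sqrt (e / 2) -> q ^+ 2 <= e / 2.
    move=> hq; rewrite -(real_normK (num_real q)).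
    have := lerXn2r 2 (normr_ge0 q) (ltW e'0) hq; rewrite sqr_sqrtr//.
    by rewrite divr_ge0// ltW.
  have := lerD (sq _ h1) (sq _ h2); rewrite -splitr.
  have := cos2Dsin2 (om * T); move: (cos (om * T)) (sin (om * T)) => c s cs1.
  congr (_ <= _).
  have -> : (c * A + s * B) ^+ 2 + (- s * A + c * B) ^+ 2 = (c ^+ 2 + s ^+ 2) * (A ^+ 2 + B ^+ 2) by ring.
  by rewrite cs1 mul1r.
by move/eqP: S0; rewrite paddr_eq0 ?sqr_ge0// !sqrf_eq0 => /andP[/eqP ? /eqP ?].
Qed.

Definition co b (V : bool -> R -> R) : R -> R := fun x => if b then - V false x else V true x.

Lemma helm_part b (al be : R -> R) (om a c Z0 : R) F (V S : bool -> R -> R) :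
  continuous al -> continuous be -> (forall x, 0 < al x) -> L2 setT F ->
  rhelm al be (part false F) (part true F) om a c Z0 (V false) (V true) (S false) (S true) ->
  rhelm al be (part b F) (copart b F) om a c Z0 (V b) (co b V) (S b) (co b S).
Proof.
move=> ca cb a0 LF H; case: b; last exact: H.
have [c1 c2] := rhelm_cont ca a0 H.
apply: rhelm_rot => //.
  apply: locintM => //; apply: locintD; last exact: (L2_locint false LF).
  by apply: locintZ; exact: locint_cont.
by apply: locint_cont; apply: contM; [exact: (rh_cS1 H)|exact: contV].
Qed.

Lemma sqr_pad (c e : R) : 0 <= c -> 2 * (c * e ^+ 2) <= ((2 * c + 1) * e) ^+ 2.
Proof.
move=> c0; rewrite exprMn mulrA; apply: ler_wpM2r; first exact: sqr_ge0.
by nra.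
Qed.

Lemma norms_from_parts D (a c A1 A2 A3 s1 s2 s3 : R) (X1 X2 g : R -> R[i]) : open D -> D `<=` `[a, c] ->
  (forall b, is_wderivR setT (part b X1) (part b g)) ->
  (forall b, locint (fun x => part b X1 x ^+ 2)) -> (forall b, locint (fun x => part b g x ^+ 2)) ->
  (forall b, locint (fun x => part b X2 x ^+ 2)) ->
  (forall b, Int (fun x => part b X1 x ^+ 2) a c <= A1) ->
  (forall b, Int (fun x => part b g x ^+ 2) a c <= A2) ->
  (forall b, Int (fun x => part b X2 x ^+ 2) a c <= A3) ->
  0 <= s1 -> 0 <= s2 -> 0 <= s3 -> 2 * A1 <= s1 ^+ 2 -> 2 * A2 <= s2 ^+ 2 -> 2 * A3 <= s3 ^+ 2 ->
  (H1norm D X1 + L2norm D X2 <= (s1 + s2 + s3)%:E)%E.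
Proof.
move=> oD sD wd l1 lg l2 h1 hg h2 s10 s20 s30 e1 e2 e3.
have mD : measurable D by exact: open_measurable.
have wdD b : is_wderivR D (part b X1) (part b g) by exact: wderivR_sub.
have hw : has_wderiv D X1 by exists g; split; [exact: (wdD false)|exact: (wdD true)].
have ws := wderiv_spec hw.
have n1 := L2norm_le mD sD (l1 false) (l1 true) (h1 false) (h1 true) s10 e1.
have n2 := L2norm_le mD sD (lg false) (lg true) (hg false) (hg true) s20 e2.
have n3 := L2norm_le mD sD (l2 false) (l2 true) (h2 false) (h2 true) s30 e3.
have E : L2norm D (wderiv D X1) = L2norm D g.
  apply: L2norm_ae => // b.
  - by have [_ []] := is_wderiv_part b ws.
  - by have [_ []] := wdD b.
  - exact: (wderivR_unique (is_wderiv_part b ws) (wdD b)).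
rewrite EFinD; apply: leeD => //; apply: H1norm_le => //.
by rewrite E.
Qed.

End Glue2.

Section Final.
Context {R : realType}.
Local Notation mu := (@lebesgue_measure R).
Implicit Types (f g U : R -> R[i]) (h k phi : R -> R) (u ut : R -> R -> R[i])
  (V S : bool -> R -> R) (x y t s T : R) (b : bool) (D : set R).
Variables (alpha beta al be : R -> R) (a c a0 c0 A0 B0 m M om La : R) (F : R -> R[i]).
Hypotheses (ma : measurable_fun setT alpha) (mb : measurable_fun setT beta).
Hypotheses (cal : continuous al) (cbe : continuous be) (m0 : 0 < m).
Hypotheses (aE : {ae mu, forall x, alpha x = al x}) (bE : {ae mu, forall x, beta x = be x}).
Hypotheses (al_lo : forall x, m <= al x) (be_lo : forall x, m <= be x).
Hypotheses (al_up : forall x, al x <= M) (be_up : forall x, be x <= M).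
Hypotheses (al_out : forall x, ~ (a < x < c) -> al x = A0).
Hypotheses (be_out : forall x, ~ (a < x < c) -> be x = B0).
Hypotheses (LF : L2 setT F) (F_out : {ae mu, forall x, ~ (a < x < c) -> F x = 0}).
Hypotheses (ac : a < c) (om0 : 0 < om) (La0 : 0 < La).
Local Notation Z0 := (Num.sqrt (A0 * B0)).
Hypothesis decays : forall a1 c1, a1 <= a0 -> c0 <= c1 ->
  exists2 C : R, 0 < C & C1_decays al be Z0 La C a1 c1.

Let al_gt0 x : 0 < al x. Proof. exact: lt_le_trans (al_lo x). Qed.
Let be_gt0 x : 0 < be x. Proof. exact: lt_le_trans (be_lo x). Qed.

Let f1_out b : {ae mu, forall x, ~ (a < x < c) -> part b F x = 0}.
Proof. by apply: (aeS F_out) => x H xo; case: b; rewrite /part /re /im H. Qed.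

Let f2_out b : {ae mu, forall x, ~ (a < x < c) -> copart b F x = 0}.
Proof. by apply: (aeS F_out) => x H xo; case: b; rewrite /copart /re /im H//= oppr0. Qed.

Let lf1 b : locint (part b F). Proof. exact: L2_locint. Qed.
Let lf2 b : locint (copart b F). Proof. exact: copart_locint. Qed.

Definition helm_data V S := rhelm al be (part false F) (part true F) om a c Z0
  (V false) (V true) (S false) (S true).

Lemma helm_limit V S b a' c' : helm_data V S -> a' <= a -> a' <= a0 -> c <= c' -> c0 <= c' ->
  exists2 K : R, 0 < K & forall W z p v, rwave al be (part b F) (copart b F) om W z p v ->
  forall T, 0 <= T ->
  [/\ Int (fun x => errP al om (S b) (co b S) p T x ^+ 2) a' c' <= K * expR (- (La * T)),
      Int (fun x => errQ om (V b) (co b V) v T x ^+ 2) a' c' <= K * expR (- (La * T)) &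
      forall x, a' <= x <= c' ->
      `|errW om (V b) (co b V) W T x - limit_value be (copart b F) om a c A0 B0|
        <= K * expR (- (La / 2 * T))].
Proof.
move=> H aa aa0 cc cc0; have Hb := helm_part b cal cbe al_gt0 LF H.
have [C C0 D] := @decays a' (c' + 1) aa0 (le_trans cc0 (ltW (ltr_pwDr ltr01 (lexx c')))).
exact: (real_limit cal cbe m0 al_lo be_lo al_up be_up al_out be_out (lf1 b) (lf2 b)
  (f1_out b) (f2_out b) ac om0 Hb aa cc D C0 La0).
Qed.

Lemma helm_unique V S V' S' u ut : helm_data V S -> helm_data V' S' ->
  wave_solution alpha beta om F u ut -> forall b, V b = V' b /\ S b = S' b.
Proof.
move=> H H' Hw.
have EV b : V b = V' b.
  apply/funext => x.
  pose a' := Num.min (Num.min a a0) x; pose c' := Num.max (Num.max c c0) x.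
  have a1 : a' <= a by rewrite !ge_min lexx.
  have a2 : a' <= a0 by rewrite !ge_min lexx !orbT.
  have a3 : a' <= x by rewrite ge_min lexx orbT.
  have c1 : c <= c' by rewrite !le_max lexx.
  have c2 : c0 <= c' by rewrite !le_max lexx !orbT.
  have c3 : x <= c' by rewrite le_max lexx orbT.
  have [K K0 HK] := helm_limit b H a1 a2 c1 c2.
  have [K' K'0 HK'] := helm_limit b H' a1 a2 c1 c2.
  have [W [z [rw _]]] := wave_extract b ma mb cal cbe aE bE LF Hw.
  have La2 : 0 < La / 2 by rewrite divr_gt0.
  have [] := @harm_zero R om (V b x - V' b x) (co b V x - co b V' x) (K + K') (La / 2) om0 La2 _ _.
  - by rewrite addr_ge0 ?ltW.
  - move=> T T0; have [_ _ h1] := HK _ _ _ _ rw T T0; have [_ _ h2] := HK' _ _ _ _ rw T T0.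
    have xx : a' <= x <= c' by rewrite a3.
    have := h1 x xx; have := h2 x xx; rewrite /errW /harm /sep2 /ccos /csin clampE//.
    move: (W T x) (limit_value _ _ _ _ _ _ _) (expR _) (cos _) (sin _) (V b x) (V' b x) (co b V x) (co b V' x).
    move=> w l e co si p p' q q' h3 h4; rewrite mulrDl.
    have -> : co * (p - p') + si * (q - q') =
      (w + -1 * (co * p' + si * q') - l) - (w + -1 * (co * p + si * q) - l) by ring.
    by apply: le_trans (ler_normB _ _) _; rewrite addrC; exact: lerD.
  by move=> /eqP; rewrite subr_eq0 => /eqP.
move=> b; split=> //; apply/funext => x.
have cV := contV cal al_gt0.
have dV (V1 S1 : R -> R) : continuous S1 -> (forall x y, x <= y -> V1 y - V1 x = Int (fun s => S1 s / al s) x y) ->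
    derive1 V1 x = S1 x / al x.
  by move=> cS HV; have [] := dat_derive (Int_dat (contM cS cV) HV x).
have Hb := helm_part b cal cbe al_gt0 LF H; have Hb' := helm_part b cal cbe al_gt0 LF H'.
have := dV _ _ (rh_cS1 Hb) (rh_U1 Hb); have := dV _ _ (rh_cS1 Hb') (rh_U1 Hb').
by rewrite EV => -> /(mulIf (invr_neq0 (lt0r_neq0 (al_gt0 x)))).
Qed.

Lemma limit_valueE b x : part b (fun=> Uinfty A0 B0 om `]a, c[ beta F) x =
  limit_value be (copart b F) om a c A0 B0.
Proof.
have A00 : 0 < A0 by rewrite -(al_out (x := a)) ?ltxx.
have B00 : 0 < B0 by rewrite -(be_out (x := a)) ?ltxx.
have Z00 : 0 < Z0 by rewrite sqrtr_gt0 mulr_gt0.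
pose I b := Int (fun x => be x * part b F x) a c.
have IE b' : \int[mu]_(x in `]a, c[) part b' (fun x => F x * (beta x)%:C) x = I b'.
  have mF : measurable_fun setT (part b' F) by exact: L2_meas LF.
  have lI : locint (fun x => beta x * part b' F x).
    apply: (locint_ae (g := fun x => be x * part b' F x)).
    - exact: measurable_funM.
    - exact: locintM.
    - by apply: (aeS bE) => y ->.
  transitivity (Int (fun x => beta x * part b' F x) a c); last first.
    apply: Int_ae => //; first exact: locintM.
    by apply: (aeS bE) => y ->.
  rewrite (@eq_Rintegral _ _ _ mu _ (fun x => beta x * part b' F x)); last first.
    move=> y _; rewrite -(partZ b' beta F); congr (part b' _ y).
    by apply/funext => z; rewrite mulrC.
  exact: Int_oo.
have inv : (2 * 'i%C * (om * Z0)%:C)^-1 = - 'i%C * ((2 * (om * Z0))^-1)%:C :> R[i].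
  apply: mulr1_eq; apply/eqP; rewrite eq_complex; apply/andP.
  by split; apply/eqP => /=; field; rewrite !gt_eqF.
rewrite /Uinfty inv /limit_value /cintegral.
have If : \int[mu]_(x in `]a, c[) re (fun x => F x * (beta x)%:C) x = I false := IE false.
have It : \int[mu]_(x in `]a, c[) im (fun x => F x * (beta x)%:C) x = I true := IE true.
rewrite If It; case: (b); rewrite /part /re /im /= /I /part.
  have -> : Int (fun x => be x * copart true F x) a c = - I false.
    rewrite /I -IntN; last exact: locintM.
    by apply: eq_Int => y _; rewrite mulrN.
  rewrite /I /part; field; by rewrite !gt_eqF.
by field; rewrite !gt_eqF.
Qed.

Lemma part_err b f U (th : R) (k : R[i]) x :
  part b (fun x => f x - cis (- th) * U x - k) x =
  part b f x + -1 * (cos th * part b U x + sin th * copart b U x) - part b (fun=> k) x.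
Proof.
rewrite /part /copart; case: b; rewrite /re /im; case: (f x) => p q; case: (U x) => p' q'; case: k => r r' /=;
  rewrite cosN sinN; ring.
Qed.

Lemma part_err_t b f U (w th : R) x :
  part b (fun x => f x + 'i%C * w%:C * cis (- th) * U x) x =
  part b f x - w * (- sin th * part b U x + cos th * copart b U x).
Proof.
rewrite /part /copart; case: b; rewrite /re /im; case: (f x) => p q; case: (U x) => p' q' /=;
  rewrite cosN sinN; ring.
Qed.

Theorem norm_limit V0 S0 D a' c' : helm_data V0 S0 -> a' <= a -> a' <= a0 -> c <= c' -> c0 <= c' ->
  open D -> D `<=` `[a', c'] ->
  exists2 C : R, 0 < C & forall U V S u ut, helm_data V S ->
    (forall b, measurable_fun setT (part b U)) ->
    (forall b, {ae mu, forall x, part b U x = V b x}) ->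
    wave_solution alpha beta om F u ut -> forall t, 0 <= t ->
    (H1norm D (fun x => (u t x - cis (- (om * t)) * U x - Uinfty A0 B0 om `]a, c[ beta F)%R)
     + L2norm D (fun x => (ut t x + 'i%C * om%:C * cis (- (om * t)) * U x)%R)
     <= (C * expR (- (La / 2 * t)))%:E)%E.
Proof.
move=> H0 aa aa0 cc cc0 oD sD.
have [K1 K10 HK1] := helm_limit false H0 aa aa0 cc cc0.
have [K2 K20 HK2] := helm_limit true H0 aa aa0 cc cc0.
have ac' : a' <= c' by apply: le_trans aa (le_trans (ltW ac) cc).
pose K := K1 + K2; have K0 : 0 <= K by rewrite addr_ge0 ?ltW.
have K1K : K1 <= K by rewrite lerDl ltW.
have K2K : K2 <= K by rewrite lerDr ltW.
have HK b W z p v : rwave al be (part b F) (copart b F) om W z p v -> forall T, 0 <= T ->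
  [/\ Int (fun x => errP al om (S0 b) (co b S0) p T x ^+ 2) a' c' <= K * expR (- (La * T)),
      Int (fun x => errQ om (V0 b) (co b V0) v T x ^+ 2) a' c' <= K * expR (- (La * T)) &
      forall x, a' <= x <= c' ->
      `|errW om (V0 b) (co b V0) W T x - limit_value be (copart b F) om a c A0 B0|
        <= K * expR (- (La / 2 * T))].
  move=> rw T T0; have e1 := expR_ge0 (- (La * T)); have e2 := expR_ge0 (- (La / 2 * T)).
  case: b rw => rw.
    have [h1 h2 h3] := HK2 _ _ _ _ rw T T0.
    split; [exact: le_trans h1 (ler_wpM2r e1 K2K)|exact: le_trans h2 (ler_wpM2r e1 K2K)|].
    by move=> x xx; exact: le_trans (h3 x xx) (ler_wpM2r e2 K2K).
  have [h1 h2 h3] := HK1 _ _ _ _ rw T T0.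
  split; [exact: le_trans h1 (ler_wpM2r e1 K1K)|exact: le_trans h2 (ler_wpM2r e1 K1K)|].
  by move=> x xx; exact: le_trans (h3 x xx) (ler_wpM2r e2 K1K).
pose k1 := K ^+ 2 * (c' - a'); pose k2 := m^-1 ^+ 2 * K.
have k10 : 0 <= k1 by rewrite mulr_ge0 ?sqr_ge0// subr_ge0.
have k20 : 0 <= k2 by rewrite mulr_ge0 ?sqr_ge0.
exists ((2 * k1 + 1) + (2 * k2 + 1) + (2 * K + 1)).
  have q1 (q : R) : 0 <= q -> 0 < 2 * q + 1 by move=> q0; rewrite ltr_wpDl// mulr_ge0.
  by apply: addr_gt0; [apply: addr_gt0|]; exact: q1.
move=> U V S u ut H mU UV Hw t t0.
have [EV ES] : (forall b, V b = V0 b) /\ (forall b, S b = S0 b).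
  by split=> b; have [] := helm_unique H H0 Hw b.
pose p b t := part b (wderiv setT (u (clamp t))).
pose v b t := part b (ut (clamp t)).
have WE b : exists W, (exists z, rwave al be (part b F) (copart b F) om W z (p b) (v b)) /\
     forall t, {ae mu, forall x, W t x = part b (u (clamp t)) x}.
  by have [W [z [rw Wu]]] := wave_extract b ma mb cal cbe aE bE LF Hw; exists W; split=> //; exists z.
have [W HW] := choice WE.
pose e := expR (- (La / 2 * t)); have e0 : 0 <= e by exact: expR_ge0.
have e2 : expR (- (La * t)) = e ^+ 2 by rewrite /e -expRM_natl; congr expR; field.
pose lim b := limit_value be (copart b F) om a c A0 B0.
pose h b x := errW om (V0 b) (co b V0) (W b) t x - lim b.
pose P b := errP al om (S0 b) (co b S0) (p b) t.
pose Q b := errQ om (V0 b) (co b V0) (v b) t.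
have est b : [/\ Int (fun x => P b x ^+ 2) a' c' <= K * e ^+ 2,
    Int (fun x => Q b x ^+ 2) a' c' <= K * e ^+ 2 & forall x, a' <= x <= c' -> `|h b x| <= K * e].
  by have [[z rw] _] := HW b; have := HK b _ _ _ _ rw t t0; rewrite e2.
have wp b : exists z, wpair (fun x => (al x)^-1) be (errW om (V0 b) (co b V0) (W b)) z
    (errP al om (S0 b) (co b S0) (p b)) (errQ om (V0 b) (co b V0) (v b)).
  have [[z rw] _] := HW b; have Hb := helm_part b cal cbe al_gt0 LF H0.
  by have WP := err_wpair cal cbe m0 al_lo al_up (lf1 b) (lf2 b) om0 Hb rw; eexists; exact: WP.
have [lP lP2] : (forall b, locint (P b)) /\ (forall b, locint (fun x => P b x ^+ 2)).
  have X b : tc2 (errP al om (S0 b) (co b S0) (p b)).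
    have [[z rw] _] := HW b; have Hb := helm_part b cal cbe al_gt0 LF H0.
    exact: (errP_tc2 cal m0 al_lo al_up Hb (rw_p rw)).
  by split=> b; have [h1 h2 _] := X b; first [exact: h1|exact: h2].
have [lQ lQ2] : (forall b, locint (Q b)) /\ (forall b, locint (fun x => Q b x ^+ 2)).
  have X b : tc2 (errQ om (V0 b) (co b V0) (v b)).
    have [[z rw] _] := HW b; have Hb := helm_part b cal cbe al_gt0 LF H0.
    exact: (errQ_tc2 cal m0 al_lo om0 Hb (rw_v rw)).
  by split=> b; have [h1 h2 _] := X b; first [exact: h1|exact: h2].
have cV := contV cal al_gt0.
pose k b x := (al x)^-1 * P b x.
have lk b : locint (k b) by exact: locintM.
have hk b x y : x <= y -> h b y - h b x = Int (k b) x y.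
  by move=> xy; have [z WP] := wp b; rewrite -(wp_wx WP t xy) /h; ring.
have ch b : continuous (h b) := rep_cont (lk b) (hk b).
set X1 := fun x => _ - _ - _; set X2 := fun x => _ + _.
have UC b : {ae mu, forall x, copart b U x = co b V0 x}.
  by case: b; [apply: (aeS (UV false)) => x E|apply: (aeS (UV true)) => x E];
    rewrite /copart /co -EV -E.
have uW b : {ae mu, forall x, W b t x = part b (u t) x}.
  by have [_ /(_ t)] := HW b; rewrite clampE.
have X1E b : {ae mu, forall x, part b X1 x = h b x}.
  apply: (aeS (ae_and (ae_and (UV b) (UC b)) (uW b))) => x [[h1 h2] h3].
  rewrite /X1 part_err limit_valueE h1 h2 -h3 EV /h /errW /harm /sep2 /ccos /csin clampE//.
have X2E b : {ae mu, forall x, part b X2 x = Q b x}.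
  apply: (aeS (ae_and (UV b) (UC b))) => x [h1 h2].
  by rewrite /X2 part_err_t h1 h2 EV /Q /errQ /harm_t /sep2 /ccos /csin /v clampE.
have mC b : measurable_fun setT (copart b U).
  by case: b; [apply: measurableT_comp => //; exact: (mU false)|exact: (mU true)].
have mu1 b : measurable_fun setT (part b (u t)).
  by have [[Lu _] _ _ _ _] := Hw; have [Lt _ _] := Lu t t0; exact: (L2_meas b Lt).
have mu2 b : measurable_fun setT (part b (ut t)).
  by have [_ [_ [Lv _] _] _ _ _] := Hw; exact: (L2_meas b (Lv t t0)).
have ms b (c1 c2 : R) : measurable_fun setT (fun x => c1 * part b U x + c2 * copart b U x).
  by apply: measurable_funD; apply: measurable_funM => //; exact: measurable_cst.
have mX1 b : measurable_fun setT (part b X1).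
  rewrite (_ : part b X1 = fun x => part b (u t) x + -1 * (cos (om * t) * part b U x + sin (om * t) * copart b U x) - lim b).
    apply: measurable_funB; last exact: measurable_cst.
    by apply: measurable_funD => //; apply: measurable_funM => //; exact: measurable_cst.
  by apply/funext => x; rewrite /X1 part_err limit_valueE.
have mX2 b : measurable_fun setT (part b X2).
  rewrite (_ : part b X2 = fun x => part b (ut t) x - om * (- sin (om * t) * part b U x + cos (om * t) * copart b U x)).
    by apply: measurable_funB => //; apply: measurable_funM => //; exact: measurable_cst.
  by apply/funext => x; rewrite /X2 part_err_t.
have sqE (f1 f2 : R -> R) : {ae mu, forall x, f1 x = f2 x} -> {ae mu, forall x, f1 x ^+ 2 = f2 x ^+ 2}.
  by move=> E; apply: (aeS E) => x ->.
have lh2 b := locint_cont (contX2 (ch b)).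
have l1 b : locint (fun x => part b X1 x ^+ 2).
  by apply: (locint_ae _ (lh2 b) (sqE _ _ (X1E b))); exact: measurable_funX.
have l2 b : locint (fun x => part b X2 x ^+ 2).
  by apply: (locint_ae _ (lQ2 b) (sqE _ _ (X2E b))); exact: measurable_funX.
pose g x := k false x +i* k true x.
have gE b : part b g = k b by case: b.
have k2E b x : k b x ^+ 2 = (al x)^-1 ^+ 2 * P b x ^+ 2 by rewrite /k exprMn.
have lk2 b : locint (fun x => k b x ^+ 2).
  rewrite (_ : (fun x => _) = fun x => (al x)^-1 ^+ 2 * P b x ^+ 2); first exact: locintM (contX2 cV) (lP2 b).
  by apply/funext => x; exact: k2E.
rewrite (_ : _ * e = (2 * k1 + 1) * e + (2 * k2 + 1) * e + (2 * K + 1) * e); last by ring.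
have pp (q : R) : 0 <= q -> 0 <= (2 * q + 1) * e by move=> q0; rewrite mulr_ge0// addr_ge0// mulr_ge0.
apply: (@norms_from_parts _ _ _ _ (k1 * e ^+ 2) (k2 * e ^+ 2) (K * e ^+ 2) _ _ _ X1 X2 g oD sD).
- move=> b; rewrite gE; exact: (wderivR_ae (rep_wderivR (lk b) (hk b)) (mX1 b) (X1E b)).
- exact: l1.
- by move=> b; rewrite gE.
- exact: l2.
- move=> b; rewrite (Int_ae _ _ (l1 b) (lh2 b) (sqE _ _ (X1E b))).
  have [_ _ hb] := est b.
  have -> : k1 * e ^+ 2 = (K * e) ^+ 2 * (c' - a') by rewrite /k1; ring.
  rewrite -Int_cst//; apply: le_Int => //; first exact: locint_cst.
  move=> x xx; rewrite -(real_normK (num_real (h b x))).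
  by apply: lerXn2r; rewrite ?nnegrE ?mulr_ge0//; exact: hb.
- move=> b; rewrite gE; have [hb _ _] := est b.
  apply: (@le_trans _ _ (Int (fun x => m^-1 ^+ 2 * P b x ^+ 2) a' c')).
    apply: le_Int; [exact: lk2|exact: locintZ|].
    move=> x _; rewrite k2E; apply: ler_wpM2r; first exact: sqr_ge0.
    have mi : 0 <= m^-1 by rewrite invr_ge0 ltW.
    by apply: lerXn2r; rewrite ?nnegrE// ?lef_pV2 ?posrE ?invr_ge0// ltW.
  by rewrite IntZ// /k2 -mulrA; apply: ler_wpM2l; [exact: sqr_ge0|].
- by move=> b; rewrite (Int_ae _ _ (l2 b) (lQ2 b) (sqE _ _ (X2E b))); have [_] := est b.
- exact: pp.
- exact: pp.
- exact: pp.
- exact: sqr_pad.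
- exact: sqr_pad.
- exact: sqr_pad.
Qed.

End Final.

Lemma medium_rep {R : realType} (alpha beta al be : R -> R) (amin bmin A0 B0 a c : R) :
  a < c -> continuous al -> continuous be ->
  {ae @lebesgue_measure R, forall x, alpha x = al x} ->
  {ae @lebesgue_measure R, forall x, beta x = be x} ->
  medium alpha beta amin bmin A0 B0 `]a, c[ ->
  [/\ 0 < amin, 0 < bmin, forall x, amin <= al x, forall x, bmin <= be x &
   (forall x, ~ (a < x < c) -> al x = A0) /\ (forall x, ~ (a < x < c) -> be x = B0)].
Proof.
move=> ac ca cb aE bE [[m1 m2 _ _] h1 h2 h3].
have o x : ~ (a < x < c) -> alpha x = A0 /\ beta x = B0.
  by move=> xo; apply: h3; rewrite /= in_itv.
split=> //.
- by apply: ae_ge_cont => //; apply: (aeS aE) => x <-.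
- by apply: ae_ge_cont => //; apply: (aeS bE) => x <-.
- split; apply: ae_eq_out => //.
    by apply: (aeS aE) => x <- /o[].
  by apply: (aeS bE) => x <- /o[].
Qed.

Theorem theorem1p5 (R : realType) (alpha beta : R -> R)
    (halpha : W1oo alpha) (hbeta : W1oo beta) :
  exists2 Lambda : R, 0 < Lambda &
  forall (alpha_min beta_min alpha0 beta0 a b : R),
    a < b ->
    let Omega_in : set R := `]a, b[%classic in
    medium alpha beta alpha_min beta_min alpha0 beta0 Omega_in ->
  forall (omega : R) (F : R -> R[i]),
    0 < omega -> L2 setT F -> esupport F `<=` Omega_in ->
  forall Omega : set R,
    Omega !=set0 -> open Omega -> connected Omega -> bounded_set Omega ->
  exists2 C : R, 0 < C &
  forall (U : R -> R[i]) (u ut : R -> R -> R[i]),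
    helmholtz_solution alpha beta alpha0 beta0 Omega_in omega F U ->
    wave_solution alpha beta omega F u ut ->
  forall t : R, 0 <= t ->
    (H1norm Omega (fun x => (u t x - cis (- (omega * t)) * U x
                             - Uinfty alpha0 beta0 omega Omega_in beta F)%R)
     + L2norm Omega (fun x => (ut t x
                               + 'i%C * omega%:C * cis (- (omega * t)) * U x)%R)
     <= (C * expR (- (Lambda * t)))%:E)%E.
Proof.
have [ma [al [cal aE [La1 La10 alip] [Ma alM]]]] := W1oo_rep halpha.
have [mb [be [cbe bE [Lb1 Lb10 blip] [Mb beM]]]] := W1oo_rep hbeta.
pose is_medium (q : R * R * R * R * (R * R)) := q.2.1 < q.2.2 /\
  medium alpha beta q.1.1.1.1 q.1.1.1.2 q.1.1.2 q.1.2 `]q.2.1, q.2.2[.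
have [[[[[[amin bmin] A0] B0] [a0 c0]] /= [ac0 med0]]|no] := pselect (exists q, is_medium q); last first.
  exists 1 => // am bm A0 B0 a b ab Om med; exfalso; apply: no.
  by exists (am, bm, A0, B0, (a, b)); split; [exact: ab|exact: med].
have [amin0 bmin0 al_lo0 be_lo0 [al_out0 be_out0]] := medium_rep ac0 cal cbe aE bE med0.
pose m := Num.min amin bmin; pose M := Num.max 1 (Num.max Ma Mb); pose Lp := Num.max La1 Lb1.
have m0 : 0 < m by rewrite lt_min amin0.
have al_lo x : m <= al x by apply: le_trans (al_lo0 x); rewrite ge_min lexx.
have be_lo x : m <= be x by apply: le_trans (be_lo0 x); rewrite ge_min lexx orbT.
have al_up x : al x <= M by apply: le_trans (alM x) _; rewrite !le_max lexx orbT.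
have be_up x : be x <= M by apply: le_trans (beM x) _; rewrite !le_max lexx !orbT.
have M1 : 1 <= M by rewrite le_max lexx.
have Lp0 : 0 <= Lp by rewrite le_max La10.
have alip' x y : x <= y -> `|al y - al x| <= Lp * (y - x).
  move=> xy; apply: le_trans (alip x y xy) _; apply: ler_wpM2r; first by rewrite subr_ge0.
  by rewrite le_max lexx.
have blip' x y : x <= y -> `|be y - be x| <= Lp * (y - x).
  move=> xy; apply: le_trans (blip x y xy) _; apply: ler_wpM2r; first by rewrite subr_ge0.
  by rewrite le_max lexx orbT.
pose La := decay_rate m M Lp a0 c0.
have La0 : 0 < La by exact: decay_rate_gt0.
have decays a1 c1 : a1 <= a0 -> c0 <= c1 ->
    exists2 C : R, 0 < C & C1_decays al be (Num.sqrt (A0 * B0)) La C a1 c1.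
  exact: (decay_C1 m0 M1 Lp0 (ltW ac0) cal cbe al_lo be_lo al_up be_up alip' blip' al_out0 be_out0).
exists (La / 2); first by rewrite divr_gt0.
move=> am bm A1 B1 a c ac med om F om0 LF sF D _ oD _ bD.
have [_ _ _ _ [al_out be_out]] := medium_rep ac cal cbe aE bE med.
have far x : c <= x -> ~ (a < x < c) by move=> cx /andP[_]; rewrite ltNge cx.
have far0 x : c0 <= x -> ~ (a0 < x < c0) by move=> cx /andP[_]; rewrite ltNge cx.
have cm1 : c <= Num.max c c0 by rewrite le_max lexx.
have cm2 : c0 <= Num.max c c0 by rewrite le_max lexx orbT.
have EA : A0 = A1 by rewrite -(al_out _ (far _ cm1)) (al_out0 _ (far0 _ cm2)).
have EB : B0 = B1 by rewrite -(be_out _ (far _ cm1)) (be_out0 _ (far0 _ cm2)).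
rewrite EA EB in decays.
have F_out := esupport_ae sF.
have [N [_ HN]] := bD.
have {}HN x : D x -> - (`|N| + 1) <= x <= `|N| + 1.
  move=> Dx; rewrite -ler_norml; apply: (HN (`|N| + 1)) => //.
  by apply: le_lt_trans (ler_norm _) _; rewrite ltrDl.
pose a' := Num.min (Num.min a a0) (- (`|N| + 1)); pose c' := Num.max (Num.max c c0) (`|N| + 1).
have a1 : a' <= a by rewrite !ge_min lexx.
have a2 : a' <= a0 by rewrite !ge_min lexx !orbT.
have a3 : a' <= - (`|N| + 1) by rewrite ge_min lexx orbT.
have c1 : c <= c' by rewrite !le_max lexx.
have c2 : c0 <= c' by rewrite !le_max lexx !orbT.
have c3 : `|N| + 1 <= c' by rewrite le_max lexx orbT.
have sD : D `<=` `[a', c'].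
  move=> x /HN /andP[h1 h2]; rewrite /= in_itv/=.
  by rewrite (le_trans a3 h1) (le_trans h2 c3).
have al_gt0 x : 0 < al x by exact: lt_le_trans (al_lo x).
have be_gt0 x : 0 < be x by exact: lt_le_trans (be_lo x).
have extract U : helmholtz_solution alpha beta A1 B1 `]a, c[ om F U ->
    exists V S, (forall b', {ae @lebesgue_measure R, forall x, part b' U x = V b' x}) /\
      helm_data al be a c A1 B1 om F V S.
  move=> HU.
  have [V [S [h1 [_ h2]]]] := helmholtz_extract ma mb cal cbe al_gt0 be_gt0 aE bE al_out be_out LF F_out om0 ac HU.
  by exists V, S.
have [[U0 HU0]|no] := pselect (exists U0, helmholtz_solution alpha beta A1 B1 `]a, c[ om F U0); last first.
  by exists 1 => // U u ut HU; exfalso; apply: no; exists U.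
have [V0 [S0 [_ H0]]] := extract U0 HU0.
have [C C0 HC] := norm_limit ma mb cal cbe m0 aE bE al_lo be_lo al_up be_up al_out be_out LF F_out
  ac om0 La0 decays H0 a1 a2 c1 c2 oD sD.
exists C => // U u ut HU Hw t t0.
have [V [S [UV H]]] := extract U HU.
apply: (HC U V S u ut H _ UV Hw t t0) => b.
have [[_ hU _ _ _] _ _ _] := HU.
by have [/locally_locint[]] := is_wderiv_part b (wderiv_spec hU).
Qed.
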